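(* Let $p\ge 2$ be an integer and let $\alpha>0$, $\beta>0$ be real numbers. If $$\tfrac12(e^{\beta}-1)(p-1)p\,\alpha<1,\qquad(\ast)$$ then the map $T:\Pr[-1,1]\to\Pr[-1,1]$ defined in the context has a unique fixed point $\zeta$, $T(\zeta)=\zeta$. If both $(\ast)$ and $$\min(4\beta,1)\,(p-1)p\,\alpha<1$$ hold, then, with $\zeta$ this unique fixed point, $$\lim_{N\to\infty}F_N=\mathcal{P}(\zeta),$$ where $F_N$ is the free energy of the random $p$-sat model and $\mathcal{P}$ is the replica symmetric functional, both defined in the context.
   Context: Let $(J_i)_{1\le i\le p}$ be independent random signs, $\mathbb{P}(J_i=\pm1)=1/2$, and define the random function on $[-1,1]^p$ $$\theta(\sigma_1,\ldots,\sigma_p)=\log\Bigl(1+(e^{-\beta}-1)\prod_{1\le i\le p}\frac{1+J_i\sigma_i}{2}\Bigr).$$ On $\{-1,1\}^p$ it coincides with $-\beta\prod_{1\le i\le p}\frac{1+J_i\sigma_i}{2}$. Let $(\theta_k)_{k\ge1}$ be independent copies of $\theta$ (defined with independent copies of $(J_i)_{i\le p}$). The Hamiltonian $H_N$ on $\Sigma_N=\{-1,1\}^N$ is given by $$-H_N(\sigma)=\sum_{k\le \pi(\alpha N)}\theta_k(\sigma_{i_{1,k}},\ldots,\sigma_{i_{p,k}}),$$ where $\pi(\alpha N)$ is a Poisson random variable with mean $\alpha N$, the indices $(i_{j,k})_{j,k\ge1}$ are i.i.d. uniform on $\{1,\ldots,N\}$, and $\pi(\alpha N)$, $(i_{j,k})$,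 $(\theta_k)$ are independent of each other. The free energy is $$F_N=\frac1N\,\mathbb{E}\log\sum_{\sigma\in\Sigma_N}\exp(-H_N(\sigma)).$$ $\Pr[-1,1]$ denotes the set of (Borel) probability measures on $[-1,1]$, and $\mathrm{Av}$ denotes the uniform average over $\varepsilon\in\{-1,1\}$. For $\zeta\in\Pr[-1,1]$, let $(z_i)_{i\ge1}$ and $(z_{i,j})_{i,j\ge1}$ be i.i.d. random variables with distribution $\zeta$, and set $$\mathcal{P}(\zeta)=\log2+\mathbb{E}\log \mathrm{Av}\exp\sum_{k\le\pi(\alpha p)}\theta_k(z_{1,k},\ldots,z_{p-1,k},\varepsilon)-(p-1)\alpha\,\mathbb{E}\,\theta(z_1,\ldots,z_p),$$ where $\pi(\alpha p)$ is a Poisson random variable with mean $\alpha p$ independent of everything else; the $z$'s are independent of the functions $\theta,\theta_k$. For $r\ge1$ define the random function $T_r:[-1,1]^{(p-1)r}\to[-1,1]$ by $$T_r\bigl((\sigma_{j,k})_{j\le p-1,k\le r}\bigr)=\frac{\mathrm{Av}\,\varepsilon\exp A(\varepsilon)}{\mathrm{Av}\exp A(\varepsilon)},\qquad A(\varepsilon)=\sum_{k\le r}\theta_k(\sigma_{1,k},\ldots,\sigma_{p-1,k},\varepsilon),$$ and set $T_0=0$. For $\zeta\in\Pr[-1,1]$ and $(z_{j,k})_{j\le p-1,k\ge1}$ i.i.d. with distribution $\zeta$ (independent of $(\theta_k)$), $T(\zeta)$ is the distribution $$T(\zeta)=\mathcal{L}\Bigl(T_{\pi(\alpha p)}\bigl((z_{j,k})_{j\le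 p-1,k\le\pi(\alpha p)}\bigr)\Bigr)=\sum_{r\ge0}\frac{(\alpha p)^r}{r!}e^{-\alpha p}\,\mathcal{L}\Bigl(T_r\bigl((z_{j,k})_{j\le p-1,k\le r}\bigr)\Bigr),$$ where $\mathcal{L}(X)$ denotes the law of $X$ (with respect to all the randomness, including that of the $\theta_k$), and $\pi(\alpha p)$ is Poisson with mean $\alpha p$, independent of everything else. *)

(* Defs.v *)
From HB Require Import structures.
From mathcomp Require Import all_boot all_order all_algebra.
From mathcomp Require Import all_classical all_reals all_analysis.
From mathcomp Require Import measurable_realfun giry.

Set Implicit Arguments.
Unset Strict Implicit.
Unset Printing Implicit Defensive.

Import Order.TTheory GRing.Theory Num.Theory.
Import numFieldNormedType.Exports.

Local Open Scope classical_set_scope.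
Local Open Scope ring_scope.

(* The families of independent variables of the model are realised on canonical
   product spaces:
   - i.i.d. uniform variables with values in a finite type A, indexed by a
     finite type I, are the coordinates of a uniform element of {ffun I -> A};
     an expectation over them is the plain average [avg];
   - i.i.d. variables with law mu are the coordinates under the power [iid mu n];
   - expectation over independent blocks is iterated integration, the Poisson
     number of clauses being integrated last. *)

Definition avg (R : realType) (A : finType) (f : A -> R) : R :=
  (#|A|%:R)^-1 * \sum_(a : A) f a.

(* The second argument of the library's poisson_prob is a dummy. *)
Definition poisson (R : realType) (rate : R) : probability nat R :=
  poisson_prob rate 0%N.

Section prod_probability.
Context d1 d2 (T1 : measurableType d1) (T2 : measurableType d2) (R : realType).
Variables (P1 : probability T1 R) (P2 : probability T2 R).

Definition prod_prob : set (T1 * T2) -> \bar R := (P1 \x P2)%E.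

HB.instance Definition _ := Measure.on prod_prob.

Let prod_prob_setT : prod_prob setT = 1%E.
Proof.
rewrite /prod_prob -setXTT [LHS]product_measure1E//.
rewrite -[RHS]mule1.
congr (_ * _)%E; [exact: (probability_setT P1)|exact: (probability_setT P2)].
Qed.

HB.instance Definition _ :=
  Measure_isProbability.Build _ _ _ prod_prob prod_prob_setT.

End prod_probability.

Section cons_tuple.
Context d (T : measurableType d) (n : nat).

Definition cons_pair (x : T * n.-tuple T) : n.+1.-tuple T :=
  [the n.+1.-tuple T of x.1 :: x.2].

Let measurable_cons_pair : measurable_fun [set: T * n.-tuple T] cons_pair.
Proof. exact: measurable_cons. Qed.

HB.instance Definition _ :=
  isMeasurableFun.Build _ _ _ _ cons_pair measurable_cons_pair.

End cons_tuple.

Fixpoint iid d (T : measurableType d) (R : realType) (mu : probability T R)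
    (n : nat) : probability (n.-tuple T) R :=
  match n return probability (n.-tuple T) R with
  | 0%N => \d_([tuple])
  | n'.+1 => distribution (prod_prob mu (iid mu n')) (@cons_pair _ T n')
  end.

Section psat.
Context (R : realType).
Variables (alpha beta : R) (p : nat).

Definition spin (b : bool) : R := if b then 1 else -1.

(* Outside [-1, 1]^p the argument of ln may be nonpositive; this is irrelevant,
   as the points at which theta is evaluated almost surely lie in [-1, 1]^p. *)
Definition theta (J : {ffun 'I_p -> bool}) (s : 'I_p -> R) : R :=
  ln (1 + (expR (- beta) - 1) * \prod_(i < p) ((1 + spin (J i) * s i) / 2)).

Section Hamiltonian.
Variables (N r : nat).

(* The value of -H_N given that the Poisson variable equals r, with idx k j the
   index i_{j,k}. *)
Definition minus_H (J : {ffun 'I_r -> {ffun 'I_p -> bool}})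
    (idx : {ffun 'I_r -> {ffun 'I_p -> 'I_N}}) (sigma : {ffun 'I_N -> bool}) : R :=
  \sum_(k < r) theta (J k) (fun j => spin (sigma (idx k j))).

Definition partition_function (J : {ffun 'I_r -> {ffun 'I_p -> bool}})
    (idx : {ffun 'I_r -> {ffun 'I_p -> 'I_N}}) : R :=
  \sum_(sigma : {ffun 'I_N -> bool}) expR (minus_H J idx sigma).

End Hamiltonian.

Definition free_energy (N : nat) : R :=
  N%:R^-1 * \int[poisson (alpha * N%:R)]_r
    avg (fun J : {ffun 'I_r -> {ffun 'I_p -> bool}} =>
    avg (fun idx : {ffun 'I_r -> {ffun 'I_p -> 'I_N}} =>
      ln (partition_function J idx))).

(* The k-th entry of z is (z_{1,k}, ..., z_{p-1,k}), the first p-1 arguments of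
   theta_k; the last argument is eps. *)
Definition cavity_field (r : nat) (J : {ffun 'I_r -> {ffun 'I_p -> bool}})
    (z : r.-tuple (p.-1.-tuple R)) (eps : R) : R :=
  \sum_(k < r) theta (J k) (fun i => nth 0 (rcons (tnth z k) eps) i).

(* For r = 0 this is 0, in accordance with the convention T_0 = 0. *)
Definition T_fun (r : nat) (J : {ffun 'I_r -> {ffun 'I_p -> bool}})
    (z : r.-tuple (p.-1.-tuple R)) : R :=
  avg (fun eps : bool => spin eps * expR (cavity_field J z (spin eps))) /
  avg (fun eps : bool => expR (cavity_field J z (spin eps))).

Definition law_T_fun (zeta : probability R R) (r : nat) (A : set R) : \bar R :=
  ((#|{ffun 'I_r -> {ffun 'I_p -> bool}}|%:R)^-1%:E *
   \sum_(J : {ffun 'I_r -> {ffun 'I_p -> bool}})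
     iid (iid zeta p.-1) r (T_fun J @^-1` A))%E.

Definition law_T (zeta : probability R R) (A : set R) : \bar R :=
  (\int[poisson (alpha * p%:R)]_r law_T_fun zeta r A)%E.

Definition RS_functional (zeta : probability R R) : R :=
  ln 2
  + \int[poisson (alpha * p%:R)]_r
      avg (fun J : {ffun 'I_r -> {ffun 'I_p -> bool}} =>
        \int[iid (iid zeta p.-1) r]_z
          ln (avg (fun eps : bool => expR (cavity_field J z (spin eps)))))
  - p.-1%:R * alpha *
      avg (fun J : {ffun 'I_p -> bool} => \int[iid zeta p]_z theta J (tnth z)).

End psat.

(* Pr[-1,1], as the Borel probability measures on the line carried by [-1,1].
   A measure of the library is a function on all sets, meaningful on the
   measurable ones only: equality of measures is measure_eq. *)
Record Pr11 (R : realType) := MkPr11 {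
  Pr11_prob :> probability R R ;
  Pr11_carried : Pr11_prob `[-1, 1]%classic = 1%E }.

Section law_T_is_probability.
Context (R : realType).
Variables (alpha beta : R) (p : nat).

Lemma measurable_theta_rcons (J : {ffun 'I_p -> bool}) (eps : R) :
  measurable_fun [set: p.-1.-tuple R]
    (fun z : p.-1.-tuple R => theta beta J (fun i => nth 0 (rcons z eps) i)).
Proof.
apply: measurableT_comp; first exact: measurable_ln.
apply: measurable_funD => //; apply: measurable_funM => //.
apply: measurable_prod => i _.
apply: measurable_funM => //; apply: measurable_funD => //.
apply: measurable_funM => //.
under eq_fun do rewrite nth_rcons size_tuple.
have [ip|_] := ltnP i p.-1; last exact: measurable_cst.
have -> : (fun x : p.-1.-tuple R => nth 0 x i) =
          (fun x => tnth x (Ordinal ip)).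
  by apply/funext => x; rewrite (tnth_nth 0).
exact: measurable_tnth.
Qed.

Lemma measurable_cavity_field r (J : {ffun 'I_r -> {ffun 'I_p -> bool}})
    (eps : R) :
  measurable_fun setT (fun z => cavity_field beta J z eps).
Proof.
apply: measurable_sum => k.
apply: (measurableT_comp (measurable_theta_rcons (J k) eps)).
exact: measurable_tnth.
Qed.

Lemma avg_bool (f : bool -> R) : avg f = 2^-1 * (f true + f false).
Proof. by rewrite /avg card_bool big_bool. Qed.

Lemma measurable_T_fun r (J : {ffun 'I_r -> {ffun 'I_p -> bool}}) :
  measurable_fun setT (T_fun beta J).
Proof.
have mE (b : bool) :
    measurable_fun setT (fun z => expR (cavity_field beta J z (spin R b))).
  by apply: measurableT_comp => //; exact: measurable_cavity_field.
rewrite /T_fun; under eq_fun do rewrite !avg_bool.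
have -> : (fun z => 2^-1 * (spin R true * expR (cavity_field beta J z (spin R true)) +
    spin R false * expR (cavity_field beta J z (spin R false))) /
  (2^-1 * (expR (cavity_field beta J z (spin R true)) +
           expR (cavity_field beta J z (spin R false))))) =
  (fun z => 2^-1 * (spin R true * expR (cavity_field beta J z (spin R true)) +
    spin R false * expR (cavity_field beta J z (spin R false))) *
  expR (- ln (2^-1 * (expR (cavity_field beta J z (spin R true)) +
           expR (cavity_field beta J z (spin R false)))))).
  apply/funext => z; rewrite expRN lnK// posrE mulr_gt0 ?invr_gt0//.
  by rewrite addr_gt0 ?expR_gt0.
apply: measurable_funM.
  by apply: measurable_funM => //; apply: measurable_funD; apply: measurable_funM.
apply: measurableT_comp => //; apply: measurableT_comp => //.
apply: measurableT_comp; first exact: measurable_ln.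
by apply: measurable_funM => //; apply: measurable_funD.
Qed.

Lemma T_fun_itv r (J : {ffun 'I_r -> {ffun 'I_p -> bool}}) z :
  -1 <= T_fun beta J z <= 1.
Proof.
rewrite /T_fun !avg_bool /spin.
have a0 := expR_gt0 (cavity_field beta J z 1).
have b0 := expR_gt0 (cavity_field beta J z (-1)).
set a := expR _ in a0 *; set b := expR _ in b0 *.
have ab0 : 0 < 2^-1 * (a + b) by rewrite mulr_gt0 ?invr_gt0// addr_gt0.
rewrite ler_pdivlMr// ler_pdivrMr// mulN1r mul1r -mulrN !ler_pM2l ?invr_gt0//.
rewrite mul1r mulN1r opprD; apply/andP; split.
- by rewrite lerD2r ltW// (lt_trans _ a0)// oppr_lt0.
- by rewrite ler_pM2l ?invr_gt0// lerD2l ltW// (lt_trans _ b0)// oppr_lt0.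
Qed.

Variable zeta : probability R R.
Local Open Scope ereal_scope.

Let law_T_fun_ge0 r A : 0 <= law_T_fun beta p zeta r A.
Proof. by rewrite mule_ge0 ?lee_fin ?invr_ge0// sume_ge0. Qed.

Let law_T_fun_setT r (A : set R) :
  (forall J z, A (@T_fun R beta p r J z)) -> law_T_fun beta p zeta r A = 1.
Proof.
move=> AT; rewrite /law_T_fun (eq_bigr (fun _ => 1)); last first.
  move=> J _; rewrite (_ : _ @^-1` A = setT) ?probability_setT//.
  by apply/seteqP; split => // z _; exact: AT.
rewrite sumEFin sumr_const -EFinM mulVf// pnatr_eq0 -lt0n.
by apply/card_gt0P; exists [ffun=> [ffun=> true]].
Qed.

Let law_T_fun_sigma_additive r : semi_sigma_additive (law_T_fun beta p zeta r).
Proof.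
move=> F mF tF mUF; rewrite /law_T_fun.
rewrite (_ : (fun n => _) = (fun n => (#|{ffun 'I_r -> {ffun 'I_p -> bool}}|%:R^-1)%:E *
   \sum_(J : {ffun 'I_r -> {ffun 'I_p -> bool}})
   \sum_(0 <= i < n) iid (iid zeta p.-1) r (T_fun beta J @^-1` F i))); last first.
  apply/funext => n; rewrite -ge0_sume_distrr; last by move=> i _; exact: sume_ge0.
  by rewrite exchange_big.
apply: cvgeZl => //; apply: cvg_nnesum => [J _|J _].
  by apply: nearW => n; exact: sume_ge0.
rewrite preimage_bigcup.
have mTF i : measurable (T_fun beta J @^-1` F i).
  by rewrite -[X in measurable X]setTI; exact: measurable_T_fun.
apply: measure_semi_sigma_additive => //.
- apply/trivIsetP => i j _ _ ij; rewrite -preimage_setI.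
  by move/trivIsetP : tF => ->//; rewrite preimage_set0.
- by apply: bigcup_measurable => i _.
Qed.

Let law_T0 : law_T alpha beta p zeta set0 = 0.
Proof.
apply: integral0_eq => r _; rewrite /law_T_fun big1 ?mule0// => J _.
by rewrite preimage_set0 measure0.
Qed.

Let law_T_ge0 A : 0 <= law_T alpha beta p zeta A.
Proof. exact: integral_ge0. Qed.

Let law_T_sigma_additive : semi_sigma_additive (law_T alpha beta p zeta).
Proof.
move=> F mF tF mUF.
have -> : law_T alpha beta p zeta (\bigcup_n F n) =
    \sum_(0 <= i <oo) law_T alpha beta p zeta (F i).
  rewrite /law_T -integral_nneseries//.
  apply: eq_integral => r _; apply/esym/cvg_lim => //.
  exact: law_T_fun_sigma_additive.
by apply: is_cvg_nneseries => i _ _; exact: law_T_ge0.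
Qed.

HB.instance Definition _ := isMeasure.Build _ _ _ (law_T alpha beta p zeta)
  law_T0 law_T_ge0 law_T_sigma_additive.

Let law_T_carried (A : set R) :
  (forall r J z, A (@T_fun R beta p r J z)) -> law_T alpha beta p zeta A = 1.
Proof.
move=> AT; rewrite /law_T (eq_integral (cst 1)); last first.
  by move=> r _; exact: law_T_fun_setT.
rewrite integral_cst// mul1e.
exact: (probability_setT (poisson (alpha * p%:R))).
Qed.

Let law_T_setT : law_T alpha beta p zeta setT = 1.
Proof. exact: law_T_carried. Qed.

HB.instance Definition _ :=
  Measure_isProbability.Build _ _ _ (law_T alpha beta p zeta) law_T_setT.

Lemma law_T_itv : law_T alpha beta p zeta `[(-1)%R, 1%R]%classic = 1.
Proof.
by apply: law_T_carried => r J z; rewrite /= in_itv/=; exact: T_fun_itv.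
Qed.

End law_T_is_probability.

Definition T_map (R : realType) (alpha beta : R) (p : nat) (zeta : Pr11 R) :
  Pr11 R := MkPr11 (law_T_itv alpha beta p zeta).

(* Main.v *)
(* Everything is reduced to Lipschitz test functions. On them, T contracts the
   expectation of a measure by the factor (e^beta - 1) (p - 1) p alpha / 2, since
   each of the (p - 1) p alpha cavity inputs enters the output with Lipschitz
   constant (e^beta - 1) / 2. Hence the iterates of T converge; the limiting
   functional is the integral against a measure, whose distribution function is
   read off the ramps approximating the indicators of half-lines.

   In the finite system the clauses form a Poisson process, so Mecke's formula,
   superposition and thinning are available. The influence of one spin on another
   is bounded by a sum over clause-avoiding walks, in which a clause costs a factor
   min(4 beta, 1). Under the second condition the mean total influence is bounded
   uniformly in N, so that finitely many spins decouple up to O(1/N), and the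
   magnetization of a site is a function of the magnetizations of the other sites
   of its clauses in the system without them. Iterating this L times shows that
   the magnetizations behave as independent samples of the fixed point, up to
   O(contraction^L) + O_L(1/N).

   Finally N F_N is a sum of increments. Adding a site with its clauses contributes
   log 2 plus the logarithm of a Gibbs average that converges to the first term of
   the functional; it requires thinning the old clauses by a rate which tends to
   alpha (p - 1), and this contributes the second term. Cesaro's theorem concludes. *)

From HB Require Import structures.
Require Import Defs.
From mathcomp Require Import all_boot all_order all_algebra.
From mathcomp Require Import all_classical all_reals all_analysis.
From mathcomp Require Import measurable_realfun giry.
From mathcomp Require Import ring lra.

Set Implicit Arguments.
Unset Strict Implicit.
Unset Printing Implicit Defensive.

Import Order.TTheory GRing.Theory Num.Theory.
Import numFieldNormedType.Exports.

Local Open Scope classical_set_scope.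
Local Open Scope ring_scope.

(** * Exponential series and Poisson processes *)

(** No common probability space carries the clause systems and the laws on [-1, 1]. Clause systems
    are lists over a finite type and Poisson expectations are absolutely convergent series, so
    Mecke's formula and superposition are identities between sums; a law enters only through its
    values on Lipschitz functions, and integrals are translated separately. The obstacle is that the
    recursion does not close on single sites: a magnetization has several inputs, and removing the
    clauses of a site disturbs the whole field. Hence the induction hypothesis [claim] is about one
    sample inside a test function of the entire field, with two errors: [A] is contracted at each
    step, while [B] may grow with the number of steps but is divided by N. Origin of the constants:
    each factor (1 + J y)/2 gives 1/2; e^beta - 1 is the variation 1 - e^(-beta) of a clause weight
    over its least value; and a clause affects only one of the two cavity weights, its last factor
    vanishing for the other spin. The influence walks are cut at a depth n with kappa^n <= 1/N, so
    that the cut costs no more than the other errors. *)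

Section exponential_series.
Context {R : realType}.
Implicit Types a b : nat -> R.

(** A Poisson expectation is [expR (- lam)] times such a sum, the powers of the rate being absorbed
    into the sequence. *)
Definition xser a : nat -> R := series (fun r => a r / r`!%:R).
Definition xsum a : R := limn (xser a).
(** The exponent [r.+1] lets the single constant [K] dominate [a 0] too, so that the class is closed
    under sums and products with no multiplicative constant to carry along. *)
Definition gbnd a := exists K : R, forall r, `|a r| <= K ^+ r.+1.

Lemma gbnd_ge0 a : gbnd a -> exists2 K : R, 0 <= K & forall r, `|a r| <= K ^+ r.+1.
Proof. by case=> K aK; exists K => //; rewrite (le_trans _ (aK 0%N)). Qed.

Lemma gbndD a b : gbnd a -> gbnd b -> gbnd (fun r => a r + b r).
Proof.
move=> /gbnd_ge0[K K0 aK] /gbnd_ge0[L L0 bL]; exists (K + L) => r.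
rewrite (le_trans (ler_normD _ _))// (le_trans (lerD (aK r) (bL r)))//.
elim: r => [|r ih]; first by rewrite !expr1.
rewrite [in leRHS]exprS (le_trans _ (ler_wpM2l _ ih)) ?addr_ge0//.
rewrite exprS [L ^+ r.+2]exprS mulrDr !mulrDl.
by rewrite addrACA lerD// ?lerDl ?lerDr mulr_ge0 ?exprn_ge0.
Qed.

Lemma gbndM a b : gbnd a -> gbnd b -> gbnd (fun r => a r * b r).
Proof.
move=> [K aK] [L bL]; exists (K * L) => r.
by rewrite normrM exprMn ler_pM.
Qed.

Lemma gbnd_cst (k : R) : gbnd (fun=> k).
Proof.
exists (1 + `|k|) => r; rewrite exprS (@le_trans _ _ (1 + `|k|)) ?lerDr//.
by rewrite ler_peMr ?addr_ge0// exprn_ege1// lerDl.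
Qed.

Lemma gbnd_pow (k : R) : gbnd (fun r => k ^+ r).
Proof.
exists (1 + `|k|) => r; rewrite normrX (@le_trans _ _ ((1 + `|k|) ^+ r))//.
  by rewrite lerXn2r ?nnegrE ?addr_ge0// lerDr.
by apply: ler_weXn2l; rewrite ?lerDl.
Qed.

Lemma gbnd_nat : gbnd (fun r => r%:R).
Proof.
exists 2 => r; rewrite normr_nat -natrX ler_nat.
by rewrite (@leq_trans (2 ^ r))// ?leq_exp2l// ltnW// ltn_expl.
Qed.

Lemma gbndZ k a : gbnd a -> gbnd (fun r => k * a r).
Proof. by move=> aK; apply: gbndM aK; exact: gbnd_cst. Qed.

Lemma gbndN a : gbnd a -> gbnd (fun r => - a r).
Proof. by case=> K aK; exists K => r; rewrite normrN. Qed.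

Lemma gbnd_norm a : gbnd a -> gbnd (fun r => `|a r|).
Proof. by case=> K aK; exists K => r; rewrite normr_id. Qed.

Lemma gbnd_le a b : (forall r, `|a r| <= b r) -> gbnd b -> gbnd a.
Proof.
by move=> ab [K bK]; exists K => r; rewrite (le_trans (ab r))// (le_trans (ler_norm _)).
Qed.

Lemma gbnd_shift a : gbnd a -> gbnd (fun r => a r.+1).
Proof.
move=> [K aK]; exists (Num.max 1 K ^+ 2) => r; rewrite (le_trans (aK r.+1))//.
have K0 : 0 <= K by rewrite (le_trans _ (aK 0%N)).
rewrite -exprM (@le_trans _ _ (Num.max 1 K ^+ r.+2))//.
  by rewrite lerXn2r ?nnegrE ?le_max ?lexx ?orbT ?ler01.
by rewrite ler_weXn2l ?le_max ?lexx// mul2n -addnn addSn !ltnS addnS ltnS leq_addr.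
Qed.

Lemma gbnd_sum (I : Type) (s : seq I) (P : pred I) (a : I -> nat -> R) :
  (forall i, gbnd (a i)) -> gbnd (fun r => \sum_(i <- s | P i) a i r).
Proof.
move=> ga; elim: s => [|i s ih].
  by under eq_fun do rewrite big_nil; exact: gbnd_cst.
under eq_fun do rewrite big_cons; case: (P i) => //; exact: gbndD.
Qed.

Lemma is_cvg_xser a : gbnd a -> cvgn (xser a).
Proof.
move=> /gbnd_ge0[K K0 aK]; apply: normed_cvg.
apply: (@series_le_cvg _ _ (fun r => K * exp_coeff K r)) => [r|r|r|] /=.
- exact: normr_ge0.
- by rewrite mulr_ge0// exp_coeff_ge0.
- rewrite normrM normfV (ger0_norm (ler0n _ _)) /exp_coeff/= mulrA -exprS.
  by rewrite ler_pM2r// invr_gt0 ltr0n fact_gt0.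
- by apply: is_cvg_seriesZ; exact: is_cvg_series_exp_coeff.
Qed.

Lemma eq_xsum a b : a =1 b -> xsum a = xsum b.
Proof. by move=> /funext ->. Qed.

Lemma xsumZ k a : gbnd a -> xsum (fun r => k * a r) = k * xsum a.
Proof.
move=> /is_cvg_xser ca; rewrite /xsum -[RHS]lim_seriesZ//; congr (limn (series _)).
by apply/funext => r; rewrite /= -mulrA.
Qed.

Lemma xsumD a b : gbnd a -> gbnd b -> xsum (fun r => a r + b r) = xsum a + xsum b.
Proof.
move=> /is_cvg_xser ca /is_cvg_xser cb; rewrite /xsum -lim_seriesD//.
by congr (limn (series _)); apply/funext => r /=; rewrite mulrDl.
Qed.

Lemma xsumN a : gbnd a -> xsum (fun r => - a r) = - xsum a.
Proof.
by move=> ga; rewrite -mulN1r -xsumZ//; apply: eq_xsum => r; rewrite mulN1r.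
Qed.

Lemma le_xsum a b : gbnd a -> gbnd b -> (forall r, a r <= b r) -> xsum a <= xsum b.
Proof.
move=> /is_cvg_xser ca /is_cvg_xser cb ab; apply: lim_series_le => // r.
by rewrite ler_pM2r// invr_gt0 ltr0n fact_gt0.
Qed.

Lemma xsum_expR (k : R) : xsum (fun r => k ^+ r) = expR k.
Proof. by []. Qed.

Lemma xsum0 : xsum (fun=> 0) = 0.
Proof.
rewrite -[RHS](mul0r (xsum (fun=> 0))) -xsumZ; last exact: gbnd_cst.
by apply: eq_xsum => r; rewrite mulr0.
Qed.

Lemma xsum_norm a : gbnd a -> `|xsum a| <= xsum (fun r => `|a r|).
Proof.
move=> ga; have gn := gbnd_norm ga; rewrite ler_norml -xsumN//; apply/andP; split.
  by apply: le_xsum => // [|r]; [exact: gbndN|rewrite lerNl -normrN ler_norm].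
by apply: le_xsum => // r; exact: ler_norm.
Qed.

Lemma xsum_sum (I : Type) (s : seq I) (P : pred I) (f : I -> nat -> R) :
  (forall i, gbnd (f i)) ->
  xsum (fun r => \sum_(i <- s | P i) f i r) = \sum_(i <- s | P i) xsum (f i).
Proof.
move=> gf; elim: s => [|i s ih].
  by under eq_xsum do rewrite big_nil; rewrite xsum0 big_nil.
under eq_xsum do rewrite big_cons; rewrite big_cons; case: (P i) => //.
by rewrite xsumD ?ih//; exact: gbnd_sum.
Qed.

(* The factor [r] cancels in [r / r!], which turns removals into insertions. *)
Lemma xsum_shift a : gbnd a -> xsum (fun r => r%:R * a r.-1) = xsum a.
Proof.
move=> ga; rewrite /xsum; apply/esym.
have ga' : gbnd (fun r => r%:R * a r.-1).
  apply: gbndM; first exact: gbnd_nat.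
  have [K K0 aK] := gbnd_ge0 ga; exists (1 + K) => r.
  rewrite (le_trans (aK _))// (@le_trans _ _ ((1 + K) ^+ r.-1.+1))//.
    by rewrite lerXn2r ?nnegrE ?addr_ge0// lerDr.
  by apply: ler_weXn2l; rewrite ?lerDl// ltnS leq_pred.
suff <- : (fun n => xser (fun r => r%:R * a r.-1) n.+1) = xser a.
  by apply/cvg_lim => //; rewrite cvg_shiftS; exact: is_cvg_xser.
apply/funext => n.
rewrite /xser /series/= big_nat_recl// mul0r mul0r add0r; apply: eq_bigr => r _ /=.
by rewrite factS natrM invfM mulrACA divff ?mul1r.
Qed.

Lemma xser_le_xsum a n : gbnd a -> (forall r, 0 <= a r) -> xser a n <= xsum a.
Proof.
move=> ga a0; apply: nondecreasing_cvgn_le; last exact: is_cvg_xser.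
apply/nondecreasing_seqP => m; rewrite /xser /series/= big_nat_recr//= lerDl.
by rewrite divr_ge0.
Qed.

Lemma xserE a n : xser a n = \sum_(i < n) a i / i`!%:R.
Proof. by rewrite /xser /series/= big_mkord. Qed.

(** Both [B * K ^+ r - a r] and [B * K ^+ r + a r] are nonnegative, so their partial sums lie below
    their full sums. *)
Lemma xsum_tail a (B K : R) n : 0 <= K -> (forall r, `|a r| <= B * K ^+ r) ->
  `|xsum a - xser a n| <= B * (expR K - xser (fun r => K ^+ r) n).
Proof.
move=> K0 aK.
have gK : gbnd (fun r => B * K ^+ r) by apply: gbndZ; exact: gbnd_pow.
have ga : gbnd a by exact: gbnd_le gK.
have key c : gbnd c -> (forall r, `|c r| <= B * K ^+ r) ->
    xsum c - xser c n <= B * (expR K - xser (fun r => K ^+ r) n).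
  move=> gc cK.
  have := @xser_le_xsum (fun r => B * K ^+ r - c r) n.
  rewrite xsumD//; last exact: gbndN.
  rewrite xsumN// xsumZ; last exact: gbnd_pow.
  rewrite xsum_expR (_ : xser _ n = B * xser (fun r => K ^+ r) n - xser c n); last first.
    rewrite !xserE mulr_sumr -sumrB; apply: eq_bigr => i _.
    by rewrite mulrBl mulrA.
  move=> h; rewrite mulrBr.
  have {}h := h (gbndD gK (gbndN gc)) _.
  have : B * xser (fun r => K ^+ r) n - xser c n <= B * expR K - xsum c.
    by apply: h => r; rewrite subr_ge0 (le_trans (ler_norm _)).
  by lra.
rewrite ler_norml key// andbT.
have := key (fun r => - a r) (gbndN ga).
rewrite xsumN// (_ : xser _ n = - xser a n); last first.
  by rewrite !xserE -sumrN; apply: eq_bigr => i _; rewrite mulNr.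
have h r : `|- a r| <= B * K ^+ r by rewrite normrN.
by move=> /(_ h); lra.
Qed.

Definition gbnd2 (b : nat -> nat -> R) :=
  exists K : R, forall i j, `|b i j| <= K ^+ (i + j).+1.

Lemma gbnd2_ge1 (b : nat -> nat -> R) : gbnd2 b -> exists2 K : R, 1 <= K &
  forall i j, `|b i j| <= K * K ^+ i * K ^+ j.
Proof.
move=> [K bK]; have K0 : 0 <= K by rewrite (le_trans _ (bK 0%N 0%N)).
exists (1 + K); first by rewrite lerDl.
move=> i j; rewrite -exprS -exprD addSn (le_trans (bK i j))//.
by rewrite lerXn2r ?nnegrE ?addr_ge0// lerDr.
Qed.

Definition sqsum (b : nat -> nat -> R) n :=
  \sum_(i < n) \sum_(j < n) b i j / (i`!%:R * j`!%:R).

Lemma gbnd2_xsum (b : nat -> nat -> R) : gbnd2 b -> gbnd (fun i => xsum (b i)) /\ forall i, gbnd (b i).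
Proof.
move=> /gbnd2_ge1[K K1 bK]; have K0 : 0 <= K by exact: le_trans K1.
have gi i : gbnd (b i).
  by apply: gbnd_le (bK i) _; apply: gbndZ; exact: gbnd_pow.
split=> //; apply: (@gbnd_le _ (fun i => expR K * (K * K ^+ i))).
  move=> i; rewrite (le_trans (xsum_norm _))// -xsum_expR mulrC -xsumZ.
    apply: le_xsum; [exact: gbnd_norm|apply: gbndZ; exact: gbnd_pow|exact: bK].
  exact: gbnd_pow.
by do 2!apply: gbndZ; exact: gbnd_pow.
Qed.

(** Every row of the square has a truncation error dominated by the same exponential tail, by
    [xsum_tail]. Square partial sums are symmetric in the two indices, hence this limit also yields
    the exchange of the two sums. *)
Lemma sqsum_cvg (b : nat -> nat -> R) : gbnd2 b -> sqsum b n @[n --> \oo] --> xsum (fun i => xsum (b i)).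
Proof.
move=> gb; have [gx gi] := gbnd2_xsum gb.
have [K K1 bK] := gbnd2_ge1 gb; have K0 : 0 <= K by exact: le_trans K1.
have cE := is_cvg_xser (gbnd_pow K).
apply: (@squeeze_cvgr _ _ _ _ (fun n => xser (fun i => xsum (b i)) n -
    K * expR K * (expR K - xser (fun r => K ^+ r) n))
  (fun n => xser (fun i => xsum (b i)) n +
    K * expR K * (expR K - xser (fun r => K ^+ r) n))); last 2 first.
- rewrite -[X in _ --> X]subr0; apply: cvgB; first exact: is_cvg_xser.
  rewrite -(mulr0 (K * expR K)) -(subrr (expR K)).
  by apply: cvgM; [exact: cvg_cst|apply: cvgB => //; exact: cvg_cst].
- rewrite -[X in _ --> X]addr0; apply: cvgD; first exact: is_cvg_xser.
  rewrite -(mulr0 (K * expR K)) -(subrr (expR K)).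
  by apply: cvgM; [exact: cvg_cst|apply: cvgB => //; exact: cvg_cst].
apply: nearW => n; rewrite -ler_distlC /sqsum xserE.
rewrite -sumrB (le_trans (ler_norm_sum _ _ _))//.
apply: (@le_trans _ _ (\sum_(i < n) (K ^+ i / i`!%:R) *
    (K * (expR K - xser (fun r => K ^+ r) n)))).
  apply: ler_sum => i _.
  rewrite (_ : _ - _ = (xsum (b i) - xser (b i) n) / i`!%:R); last first.
    rewrite mulrBl; congr (_ - _); rewrite xserE mulr_suml; apply: eq_bigr => j _.
    by rewrite invfM mulrA mulrAC.
  rewrite normrM normfV (ger0_norm (ler0n _ _)) mulrAC ler_pM2r ?invr_gt0 ?ltr0n ?fact_gt0//.
  by rewrite mulrA; apply: xsum_tail => // r; rewrite [K ^+ i * K]mulrC bK.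
rewrite -mulr_suml mulrCA mulrA ler_wpM2r//.
  by rewrite subr_ge0 -xsum_expR xser_le_xsum//; [exact: gbnd_pow|move=> r; exact: exprn_ge0].
rewrite ler_wpM2l// -(xserE (fun r => K ^+ r)) -xsum_expR xser_le_xsum//; first exact: gbnd_pow.
by move=> r; exact: exprn_ge0.
Qed.

Lemma xsum_swap (b : nat -> nat -> R) : gbnd2 b -> xsum (fun i => xsum (b i)) = xsum (fun j => xsum (b^~ j)).
Proof.
move=> gb; have /cvg_lim <- // := sqsum_cvg gb.
have gb' : gbnd2 (fun j => b^~ j).
  by case: gb => K bK; exists K => i j; rewrite addnC.
have /cvg_lim <- // := sqsum_cvg gb'.
congr (limn _); apply/funext => n; rewrite /sqsum exchange_big/=.
by apply: eq_bigr => i _; apply: eq_bigr => j _; rewrite [i`!%:R * _]mulrC.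
Qed.
End exponential_series.

(** * Binomial convolution of double exponential series *)

Section cauchy_product.
Context {R : realType}.
Implicit Types b : nat -> nat -> R.

Definition cauchy b r : R := \sum_(i < r.+1) 'C(r, i)%:R * b i (r - i)%N.

Lemma xser_cauchy b n : xser (cauchy b) n =
  \sum_(i < n) \sum_(j < n | (i + j < n)%N) b i j / (i`!%:R * j`!%:R).
Proof.
rewrite xserE; apply/esym.
transitivity (\sum_(i < n) \sum_(j < n) \sum_(r < n)
    (if (i + j)%N == r then b i j / (i`!%:R * j`!%:R) else 0)).
  apply: eq_bigr => i _; rewrite big_mkcond; apply: eq_bigr => j _ /=.
  rewrite -big_mkcond/=; case: ifPn => [ij|ij].
    by rewrite (big_pred1 (Ordinal ij))// => r; rewrite /= -val_eqE eq_sym.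
  by rewrite big1// => r /eqP ijr; rewrite ijr ltn_ord in ij.
under eq_bigr do rewrite exchange_big/=.
rewrite exchange_big/=; apply: eq_bigr => r _.
rewrite /cauchy mulr_suml (big_ord_widen n (fun i => 'C(r, i)%:R * b i (r - i)%N / r`!%:R))//.
rewrite [RHS]big_mkcond; apply: eq_bigr => i _ /=; rewrite -big_mkcond/= ltnS.
case: ifPn => [ir|ri]; last first.
  by rewrite big1// => j /eqP ijr; rewrite -ijr leq_addr in ri.
have rin : (r - i < n)%N by rewrite (leq_ltn_trans (leq_subr _ _)).
rewrite (big_pred1 (Ordinal rin)); last first.
  by move=> j; rewrite /= -val_eqE/= -[RHS](eqn_add2l i) subnKC.
have fu k : (k`!%:R : R) \is a GRing.unit by rewrite unitfE pnatr_eq0 -lt0n fact_gt0.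
rewrite /= mulrAC mulrC; congr (_ * _).
apply/(mulIr (fu r)); rewrite mulrVK ?unitfE ?pnatr_eq0 -?lt0n ?fact_gt0//.
rewrite -(bin_fact ir) natrM -natrM mulrCA mulVf ?mulr1// natrM.
Qed.

Lemma gbnd_cauchy b : gbnd2 b -> gbnd (cauchy b).
Proof.
move=> /gbnd2_ge1[K K1 bK]; have K0 : 0 <= K by exact: le_trans K1.
apply: (@gbnd_le _ _ (fun r => K * (K + K) ^+ r)); last by apply: gbndZ; exact: gbnd_pow.
move=> r; rewrite exprDn mulr_sumr (le_trans (ler_norm_sum _ _ _))//.
apply: ler_sum => -[i]/= ir _; rewrite -[in leRHS]mulr_natl normrM normr_nat [leRHS]mulrCA ler_wpM2l//.
by rewrite (le_trans (bK _ _))// mulrA mulrAC.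
Qed.

(** The square minus the triangle is the sum over i, j < n with i + j >= n, to which domination
    applies term by term. *)
Lemma sqsum_cauchy_dist b b' n : (forall i j, `|b i j| <= b' i j) ->
  `|sqsum b n - xser (cauchy b) n| <= sqsum b' n - xser (cauchy b') n.
Proof.
have E c : sqsum c n - xser (cauchy c) n =
  \sum_(i < n) \sum_(j < n | ~~ (i + j < n)%N) c i j / (i`!%:R * j`!%:R).
  rewrite xser_cauchy /sqsum -sumrB; apply: eq_bigr => i _.
  by rewrite (bigID (fun j : 'I_n => (i + j < n)%N))/= addrAC subrr add0r.
move=> bb'; rewrite !E (le_trans (ler_norm_sum _ _ _))//; apply: ler_sum => i _.
rewrite (le_trans (ler_norm_sum _ _ _))//; apply: ler_sum => j _.
by rewrite normrM normfV (@ger0_norm _ (i`!%:R * j`!%:R)) ?mulr_ge0// ler_wpM2r// invr_ge0 mulr_ge0.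
Qed.

(** For the majorant K K^i K^j the identity is the binomial theorem together with e^K e^K = e^(2K);
    so its square and triangular sums merge in the limit, and by domination so do those of [b]. *)
Lemma xsum_cauchy b : gbnd2 b -> xsum (cauchy b) = xsum (fun i => xsum (b i)).
Proof.
move=> gb; have [K K1 bK] := gbnd2_ge1 gb; have K0 : 0 <= K by exact: le_trans K1.
pose b' i j := K * K ^+ i * K ^+ j.
have gb' : gbnd2 b'.
  exists K => i j; rewrite /b' ger0_norm ?mulr_ge0 ?exprn_ge0//.
  by rewrite -exprS -exprD addSn.
have cb' : sqsum b' n - xser (cauchy b') n @[n --> \oo] --> (0 : R).
  have <- : xsum (fun i => xsum (b' i)) - xsum (cauchy b') = 0.
    apply/eqP; rewrite subr_eq0; apply/eqP.
    transitivity (xsum (fun i => (K * expR K) * K ^+ i)).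
      apply: eq_xsum => i; rewrite /b' xsumZ; last exact: gbnd_pow.
      by rewrite xsum_expR mulrAC.
    rewrite xsumZ; last exact: gbnd_pow.
    rewrite xsum_expR -mulrA -expRD -xsum_expR -xsumZ; last exact: gbnd_pow.
    apply: eq_xsum => r; rewrite exprDn mulr_sumr; apply: eq_bigr => -[i]/= ir _.
    rewrite /b' -[in LHS]mulr_natl [LHS]mulrCA; congr (_ * _).
    by rewrite [in LHS](mulrC (K ^+ (r - i))) mulrA.
  by apply: cvgB; [exact: sqsum_cvg|apply: is_cvg_xser; exact: gbnd_cauchy].
have cs : sqsum b n - xser (cauchy b) n @[n --> \oo] --> (0 : R).
  apply/norm_cvg0P; apply: (squeeze_cvgr _ (cvg_cst 0) cb').
  by apply: nearW => n; rewrite normr_ge0/= sqsum_cauchy_dist.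
apply/eqP; rewrite eq_sym -subr_eq0; apply/eqP.
have h : sqsum b n - xser (cauchy b) n @[n --> \oo] -->
    xsum (fun i => xsum (b i)) - xsum (cauchy b).
  by apply: cvgB; [exact: sqsum_cvg|apply: is_cvg_xser; exact: gbnd_cauchy].
exact: (cvg_unique _ h cs).
Qed.
End cauchy_product.

(** * Iterated sums over lists, and the removal of one entry *)

Section iterated_operators.
Context {R : realType}.

(** One combinator serves for weighted sums, uniform averages and expectations on Lipschitz
    functions; the first entry of the list is bound outermost. *)
Fixpoint It (Y : Type) (op : (Y -> R) -> R) n (F : seq Y -> R) : R :=
  if n is n'.+1 then op (fun y => It op n' (fun l => F (y :: l))) else F [::].

Definition wsum (C : finType) (nu : C -> R) (phi : C -> R) : R :=
  \sum_c nu c * phi c.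

Definition mass (C : finType) (nu : C -> R) : R := \sum_c nu c.

(* Sums [H x l'] over the ways of extracting one entry [x] from [l], [l'] being
   the rest. *)
Fixpoint RS (T : Type) (H : T -> seq T -> R) (l : seq T) : R :=
  if l is x :: l' then H x l' + RS (fun y s => H y (x :: s)) l' else 0.

Definition perm_inv (C : eqType) (T : Type) (F : seq C -> T) :=
  forall l l', perm_eq l l' -> F l = F l'.

Lemma eq_It (Y : Type) (op1 op2 : (Y -> R) -> R) n (F G : seq Y -> R) :
  (forall phi, op1 phi = op2 phi) -> (forall l, size l = n -> F l = G l) ->
  It op1 n F = It op2 n G.
Proof.
move=> op12; elim: n F G => [|n ih] F G FG /=; first exact: FG.
rewrite op12; congr (op2 _); apply/funext => y; apply: ih => l ln.
by rewrite FG//= ln.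
Qed.

Lemma It_map (Y Z : Type) (g : Z -> Y) (op : (Y -> R) -> R) (op' : (Z -> R) -> R) n
    (F : seq Y -> R) : (forall phi, op phi = op' (phi \o g)) ->
  It op n F = It op' n (F \o map g).
Proof.
move=> opg; elim: n F => [//|n ih] F /=.
by rewrite opg; congr (op' _); apply/funext => y /=; rewrite ih.
Qed.

Lemma It_add (Y : Type) (op : (Y -> R) -> R) n m (F : seq Y -> R) :
  It op (n + m) F = It op n (fun l => It op m (fun l' => F (l ++ l'))).
Proof. by elim: n F => [//|n ih] F /=; congr op; apply/funext => y; rewrite ih. Qed.

Section wsum.
Variables (C : finType) (nu : C -> R).
Local Notation psum := (It (wsum nu)).

Lemma psumD n F G : psum n (fun l => F l + G l) = psum n F + psum n G.
Proof.
elim: n F G => [//|n ih] F G /=; rewrite /wsum -big_split/=.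
by apply: eq_bigr => c _; rewrite ih mulrDr.
Qed.

Lemma psumZ n k F : psum n (fun l => k * F l) = k * psum n F.
Proof.
elim: n F => [//|n ih] F /=; rewrite /wsum mulr_sumr.
by apply: eq_bigr => c _; rewrite ih mulrCA.
Qed.

Lemma psum_sum (I : Type) (s : seq I) (P : pred I) n (F : I -> seq C -> R) :
  psum n (fun l => \sum_(i <- s | P i) F i l) = \sum_(i <- s | P i) psum n (F i).
Proof.
elim: n F => [//|n ih] F /=; rewrite /wsum.
rewrite /= in ih *; under [LHS]eq_bigr => c _ do rewrite (ih (fun i l => F i (c :: l))) mulr_sumr.
by rewrite exchange_big.
Qed.

Lemma psum_cst n k : psum n (fun=> k) = mass nu ^+ n * k.
Proof.
elim: n => [|n ih] /=; first by rewrite mul1r.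
by rewrite /wsum; under eq_bigr do rewrite ih; rewrite -mulr_suml exprS mulrA.
Qed.

Lemma psum_xsum n (G : seq C -> nat -> R) : (forall l, gbnd (G l)) ->
  psum n (fun l => xsum (G l)) = xsum (fun j => psum n (fun l => G l j)) /\
  gbnd (fun j => psum n (fun l => G l j)).
Proof.
elim: n G => [|n ih] G gG /=; first by split => //; exact: gG.
rewrite /wsum.
have gn c : gbnd (fun j => psum n (fun l => G (c :: l) j)).
  by have [] := ih _ (fun l => gG (c :: l)).
have gn' c : gbnd (fun j => nu c * psum n (fun l => G (c :: l) j)) by exact: gbndZ.
split; last by apply: gbnd_sum.
rewrite xsum_sum//; apply: eq_bigr => c _.
by rewrite (ih _ (fun l => gG (c :: l))).1 xsumZ.
Qed.

Hypothesis nu0 : forall c, 0 <= nu c.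

Lemma mass_ge0 : 0 <= mass nu. Proof. exact: sumr_ge0. Qed.

Lemma le_psum n F G : (forall l, size l = n -> F l <= G l) -> psum n F <= psum n G.
Proof.
elim: n F G => [|n ih] F G FG /=; first exact: FG.
apply: ler_sum => c _; apply: ler_wpM2l => //; apply: ih => l ln.
by apply: FG; rewrite /= ln.
Qed.

Lemma psum_norm n F : `|psum n F| <= psum n (fun l => `|F l|).
Proof.
elim: n F => [//|n ih] F /=; rewrite (le_trans (ler_norm_sum _ _ _))//.
by apply: ler_sum => c _; rewrite normrM ger0_norm// ler_wpM2l.
Qed.

Lemma psum_bound n F B : (forall l, size l = n -> `|F l| <= B) ->
  `|psum n F| <= mass nu ^+ n * B.
Proof. by move=> FB; rewrite (le_trans (psum_norm _ _))// -psum_cst; exact: le_psum. Qed.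

(** Mecke's formula at fixed size: all entries have the same weights, so each of the [n] removals
    contributes the same. *)
Lemma psum_RS n H : psum n (RS H) = n%:R * wsum nu (fun c => psum n.-1 (H c)).
Proof.
elim: n H => [|n ih] H /=; first by rewrite mul0r.
transitivity (wsum nu (fun c => psum n (H c)) + n%:R * wsum nu (fun c => psum n (H c))).
  rewrite {1}/wsum; under eq_bigr do rewrite psumD ih mulrDr.
  rewrite big_split/=; congr (_ + _).
  case: n {ih} => [|n]; first by rewrite mul0r big1// => c _; rewrite mul0r mulr0.
  under eq_bigr do rewrite mulrCA; rewrite -mulr_sumr; congr (_ * _).
  rewrite [RHS]/wsum /=; under [LHS]eq_bigr do rewrite /wsum mulr_sumr.
  rewrite exchange_big/=; apply: eq_bigr => c _; rewrite [in RHS]/wsum mulr_sumr.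
  by apply: eq_bigr => d _; rewrite mulrCA.
by rewrite -natr1 mulrDl mul1r addrC.
Qed.

End wsum.

Lemma psum_swap (C D : finType) (nu : C -> R) (mu : D -> R) n m (F : seq C -> seq D -> R) :
  It (wsum nu) n (fun l => It (wsum mu) m (F l)) =
  It (wsum mu) m (fun l' => It (wsum nu) n (F^~ l')).
Proof.
elim: n F => [//|n ih] F /=; rewrite {1}/wsum [in RHS]/wsum psum_sum.
by apply: eq_bigr => c _; rewrite psumZ ih.
Qed.

Lemma pascal_sum (A : nat -> nat -> R) r :
  \sum_(i < r.+1) 'C(r, i)%:R * (A i.+1 (r - i)%N + A i (r - i).+1) =
  \sum_(i < r.+2) 'C(r.+1, i)%:R * A i (r.+1 - i)%N.
Proof.
rewrite [RHS]big_ord_recl/= bin0 mul1r.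
under [in RHS]eq_bigr do rewrite /= binS natrD mulrDl subSS.
under eq_bigr do rewrite mulrDr.
rewrite !big_split/= addrC [RHS]addrA; congr (_ + _).
rewrite big_ord_recl/= bin0 mul1r subn0; congr (_ + _).
rewrite [RHS]big_ord_recr/= bin_small// mul0r addr0.
by apply: eq_bigr => i _; rewrite /bump/= add1n subnSK.
Qed.

(** Each entry is attributed to [nu] or to [mu]; since [F] ignores the order, those attributed to
    [nu] may be listed first, and the binomial coefficient counts the attributions. *)
Lemma psum_add (C : finType) (nu mu : C -> R) r (F : seq C -> R) : perm_inv F ->
  It (wsum (fun c => nu c + mu c)) r F =
  cauchy (fun i j => It (wsum nu) i (fun l => It (wsum mu) j (fun l' => F (l ++ l')))) r.
Proof.
elim: r F => [|r ih] F pF; first by rewrite /cauchy/= big_ord_recr/= big_ord0 add0r bin0 mul1r.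
pose A i j := It (wsum nu) i (fun l => It (wsum mu) j (fun l' => F (l ++ l'))).
rewrite /cauchy -[RHS](pascal_sum A)/=.
transitivity (\sum_c (nu c + mu c) *
  It (wsum (fun c => nu c + mu c)) r (fun l => F (c :: l))) => //.
have pFc c : perm_inv (fun l => F (c :: l)).
  by move=> l l' ll'; apply: pF; rewrite perm_cons.
under [LHS]eq_bigr do rewrite ih// mulrDl /cauchy.
rewrite big_split/= {}/A.
under [in RHS]eq_bigr do rewrite mulrDr.
rewrite [RHS]big_split/=; congr (_ + _).
  under eq_bigr do rewrite mulr_sumr; rewrite exchange_big; apply: eq_bigr => i _ /=.
  by rewrite /wsum mulr_sumr; apply: eq_bigr => c _; rewrite mulrCA.
under eq_bigr do rewrite mulr_sumr; rewrite exchange_big; apply: eq_bigr => i _ /=.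
under eq_bigr do rewrite mulrCA; rewrite -mulr_sumr; congr (_ * _).
rewrite psum_sum; apply: eq_bigr => c _; rewrite psumZ; congr (_ * _).
apply: eq_It => // l _; apply: eq_It => // l' _; apply: pF.
by rewrite perm_sym -cat1s perm_catCA.
Qed.

Lemma RS_cat (T : Type) (H : T -> seq T -> R) s1 s2 :
  RS H (s1 ++ s2) = RS (fun y l => H y (l ++ s2)) s1 + RS (fun y l => H y (s1 ++ l)) s2.
Proof.
elim: s1 H => [|x s1 ih] H /=; first by rewrite add0r.
by rewrite ih addrA.
Qed.

Lemma RS_map (T U : Type) (f : U -> T) (H : T -> seq T -> R) s :
  RS H (map f s) = RS (fun y l => H (f y) (map f l)) s.
Proof. by elim: s H => [//|x s ih] H /=; rewrite ih. Qed.

Lemma eq_RS (T : Type) (H H' : T -> seq T -> R) s :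
  (forall x l, (size l).+1 = size s -> H x l = H' x l) -> RS H s = RS H' s.
Proof.
elim: s H H' => [//|x s ih] H H' HH' /=; rewrite HH'//; congr (_ + _).
by apply: ih => y l ls; rewrite HH'//= ls.
Qed.

Lemma le_RS (T : Type) (H H' : T -> seq T -> R) s :
  (forall x l, (size l).+1 = size s -> H x l <= H' x l) -> RS H s <= RS H' s.
Proof.
elim: s H H' => [//|x s ih] H H' HH' /=; apply: lerD; first exact: HH'.
by apply: ih => y l ls; rewrite HH'//= ls.
Qed.

Lemma RS_cst (T : Type) (k : R) (s : seq T) : RS (fun _ _ => k) s = (size s)%:R * k.
Proof.
by elim: s => [|x s ih] /=; [rewrite mul0r|rewrite ih -natr1 mulrDl mul1r addrC].
Qed.

Lemma RS_norm (T : Type) (H : T -> seq T -> R) s :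
  `|RS H s| <= RS (fun x l => `|H x l|) s.
Proof.
elim: s H => [|x s ih] H /=; first by rewrite normr0.
by rewrite (le_trans (ler_normD _ _))// lerD2l.
Qed.

Lemma RS_ge0 (T : Type) (H : T -> seq T -> R) s : (forall x l, 0 <= H x l) -> 0 <= RS H s.
Proof.
by elim: s H => [//|x s ih] H H0 /=; rewrite addr_ge0// ih.
Qed.

Lemma RS_perm (C : eqType) (H : C -> seq C -> R) :
  (forall x, perm_inv (H x)) -> perm_inv (RS H).
Proof.
move=> pH l l' ll'; symmetry.
pose P s := forall H, (forall x, perm_inv (H x)) -> RS H s = RS H l.
suff : P l' by apply.
(* It suffices to exchange two blocks, over which [RS_cat] splits the sum. *)
apply: (catCA_perm_ind (P := P) _ ll') => // s1 s2 s3 Ps {}H {}pH.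
rewrite -(Ps _ pH) !RS_cat addrCA [RHS]addrCA; rewrite addrCA.
congr (_ + (_ + _)); apply: eq_RS => x s _; apply: pH.
- by rewrite perm_sym perm_catCA.
- by rewrite perm_catCA.
- by rewrite perm_catCA.
Qed.

End iterated_operators.

(** * Poisson processes on finite sets: Mecke's formula, exchange, superposition, images *)

Section poisson_process.
Context {R : realType}.

(* Expectation of [F] over a Poisson process of intensity [nu], listed in
   random order. *)
Definition PP (C : finType) (nu : C -> R) (F : seq C -> R) : R :=
  expR (- mass nu) * xsum (fun r => It (wsum nu) r F).

(* Growth at most exponential in the size, so that all Poisson series converge
   absolutely. *)
Definition gr (C : Type) (F : seq C -> R) :=
  exists K : R, forall l, `|F l| <= K ^+ (size l).+1.

Definition gr2 (C D : Type) (F : seq C -> seq D -> R) :=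
  exists K : R, forall l l', `|F l l'| <= K ^+ (size l + size l').+1.

Lemma gr2_ge1 (C D : Type) (F : seq C -> seq D -> R) : gr2 F ->
  exists2 K : R, 1 <= K & forall l l', `|F l l'| <= K ^+ (size l + size l').+1.
Proof.
move=> [K FK]; have K0 : 0 <= K by rewrite (le_trans _ (FK [::] [::])).
exists (1 + K) => [|l l']; first by rewrite lerDl.
by rewrite (le_trans (FK l l'))// lerXn2r ?nnegrE ?addr_ge0// lerDr.
Qed.

Lemma gr_size (C : Type) (F : seq C -> R) (a : nat -> R) :
  gbnd a -> (forall l, `|F l| <= a (size l)) -> gr F.
Proof.
move=> [K aK] Fa; exists K => l.
by rewrite (le_trans (Fa l))// (le_trans (ler_norm _)).
Qed.

Lemma gr2_size (C D : Type) (F : seq C -> seq D -> R) (a : nat -> R) :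
  gbnd a -> (forall l l', `|F l l'| <= a (size l + size l')%N) -> gr2 F.
Proof.
move=> [K aK] Fa; exists K => l l'.
by rewrite (le_trans (Fa l l'))// (le_trans (ler_norm _)).
Qed.

Lemma gr_bounded (C : Type) (F : seq C -> R) (k : R) : (forall l, `|F l| <= k) -> gr F.
Proof. by move=> Fk; apply: (@gr_size _ _ (fun=> k)) => //; exact: gbnd_cst. Qed.

Lemma gr2_bounded (C D : Type) (F : seq C -> seq D -> R) (k : R) :
  (forall l l', `|F l l'| <= k) -> gr2 F.
Proof. by move=> Fk; apply: (@gr2_size _ _ _ (fun=> k)) => //; exact: gbnd_cst. Qed.

Lemma gr_lift (C : Type) (F : seq C -> R) : gr F ->
  exists2 a, gbnd a & forall l, `|F l| <= a (size l).
Proof.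
move=> [K FK]; exists (fun n => K ^+ n.+1) => //.
by apply: gbnd_shift; exact: gbnd_pow.
Qed.

Lemma grD (C : Type) (F G : seq C -> R) : gr F -> gr G -> gr (fun l => F l + G l).
Proof.
move=> /gr_lift[a ga Fa] /gr_lift[b gb Gb]; apply: (gr_size (gbndD ga gb)) => l.
by rewrite (le_trans (ler_normD _ _))// lerD.
Qed.

Lemma grZ (C : Type) (F : seq C -> R) k : gr F -> gr (fun l => k * F l).
Proof.
move=> /gr_lift[a ga Fa]; apply: (gr_size (gbndZ `|k| ga)) => l.
by rewrite normrM ler_wpM2l.
Qed.

Lemma grN (C : Type) (F : seq C -> R) : gr F -> gr (fun l => - F l).
Proof. by move=> [K FK]; exists K => l; rewrite normrN. Qed.

Lemma gr_norm (C : Type) (F : seq C -> R) : gr F -> gr (fun l => `|F l|).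
Proof. by move=> [K FK]; exists K => l; rewrite normr_id. Qed.

Lemma gr_le (C : Type) (F G : seq C -> R) : (forall l, `|F l| <= G l) -> gr G -> gr F.
Proof.
by move=> FG [K GK]; exists K => l; rewrite (le_trans (FG l))// (le_trans (ler_norm _)).
Qed.

Lemma gr_sum (C I : Type) (s : seq I) (P : pred I) (F : I -> seq C -> R) :
  (forall i, gr (F i)) -> gr (fun l => \sum_(i <- s | P i) F i l).
Proof.
move=> gF; elim: s => [|i s ih].
  by under eq_fun do rewrite big_nil; apply: (@gr_bounded _ _ 0) => l; rewrite normr0.
under eq_fun do rewrite big_cons; case: (P i) => //; exact: grD.
Qed.

Lemma gr2_l (C D : Type) (F : seq C -> seq D -> R) l : gr2 F -> gr (F l).
Proof.
move=> /gr2_ge1[K K1 FK]; have K0 : 0 <= K by exact: le_trans K1.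
apply: (@gr_size _ _ (fun n => K ^+ (size l) * K ^+ n.+1)).
  by apply: gbndZ; apply: gbnd_shift; exact: gbnd_pow.
by move=> l'; rewrite (le_trans (FK _ _))// -exprD addnS.
Qed.

Lemma gr2_sym (C D : Type) (F : seq C -> seq D -> R) : gr2 F -> gr2 (fun l l' => F l' l).
Proof. by move=> [K FK]; exists K => l l'; rewrite addnC. Qed.

Lemma gr2_cat (C : Type) (F : seq C -> R) : gr F -> gr2 (fun l l' => F (l ++ l')).
Proof. by move=> [K FK]; exists K => l l'; rewrite (le_trans (FK _))// size_cat. Qed.

Section one.
Variables (C : finType) (nu : C -> R).
Hypothesis nu0 : forall c, 0 <= nu c.

Lemma gr_psum (F : seq C -> R) : gr F -> gbnd (fun r => It (wsum nu) r F).
Proof.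
move=> [K FK]; apply: (@gbnd_le _ _ (fun r => mass nu ^+ r * K ^+ r.+1)).
  by move=> r; apply: psum_bound => // l lr; rewrite -lr.
by apply: gbndM; [exact: gbnd_pow|apply: gbnd_shift; exact: gbnd_pow].
Qed.

Lemma eq_PP (F G : seq C -> R) : F =1 G -> PP nu F = PP nu G.
Proof. by move=> /funext ->. Qed.

Lemma PPD (F G : seq C -> R) : gr F -> gr G ->
  PP nu (fun l => F l + G l) = PP nu F + PP nu G.
Proof.
move=> gF gG; rewrite /PP -mulrDr -xsumD; [|exact: gr_psum..].
by congr (_ * _); apply: eq_xsum => r; rewrite psumD.
Qed.

Lemma PPZ (F : seq C -> R) k : gr F -> PP nu (fun l => k * F l) = k * PP nu F.
Proof.
move=> gF; rewrite /PP [RHS]mulrCA -[in RHS]xsumZ; last exact: gr_psum.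
by congr (_ * _); apply: eq_xsum => r; rewrite psumZ.
Qed.

Lemma PPN (F : seq C -> R) : gr F -> PP nu (fun l => - F l) = - PP nu F.
Proof.
by move=> gF; rewrite -mulN1r -PPZ//; apply: eq_PP => l; rewrite mulN1r.
Qed.

Lemma PPB (F G : seq C -> R) : gr F -> gr G ->
  PP nu (fun l => F l - G l) = PP nu F - PP nu G.
Proof. by move=> gF gG; rewrite PPD ?PPN//; exact: grN. Qed.

Lemma PP_sum (I : Type) (s : seq I) (P : pred I) (F : I -> seq C -> R) :
  (forall i, gr (F i)) ->
  PP nu (fun l => \sum_(i <- s | P i) F i l) = \sum_(i <- s | P i) PP nu (F i).
Proof.
move=> gF; rewrite /PP -mulr_sumr -xsum_sum; last by move=> i; exact: gr_psum.
by congr (_ * _); apply: eq_xsum => r; rewrite psum_sum.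
Qed.

Lemma PP_cst k : PP nu (fun=> k) = k.
Proof.
rewrite /PP; under eq_xsum do rewrite psum_cst mulrC.
rewrite xsumZ; last exact: gbnd_pow.
by rewrite xsum_expR mulrCA -expRD addNr expR0 mulr1.
Qed.

Lemma le_PP (F G : seq C -> R) : gr F -> gr G -> (forall l, F l <= G l) ->
  PP nu F <= PP nu G.
Proof.
move=> gF gG FG; rewrite ler_wpM2l ?expR_ge0// le_xsum//; [exact: gr_psum..|].
by move=> r; exact: le_psum.
Qed.

Lemma PP_norm (F : seq C -> R) : gr F -> `|PP nu F| <= PP nu (fun l => `|F l|).
Proof.
move=> gF; have gN := gr_norm gF; rewrite ler_norml -PPN//; apply/andP; split.
  by apply: le_PP => // [|l]; [exact: grN|rewrite lerNl -normrN ler_norm].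
by apply: le_PP => // l; exact: ler_norm.
Qed.

Lemma PP_ge0 (F : seq C -> R) : gr F -> (forall l, 0 <= F l) -> 0 <= PP nu F.
Proof.
move=> gF F0; rewrite -(PP_cst 0); apply: le_PP => //.
by apply: (@gr_bounded _ _ 0) => l; rewrite normr0.
Qed.

Lemma PP_dist (F G H : seq C -> R) : gr F -> gr G -> gr H ->
  (forall l, `|F l - G l| <= H l) -> `|PP nu F - PP nu G| <= PP nu H.
Proof.
move=> gF gG gH FGH; rewrite -PPB// (le_trans (PP_norm _))//.
  exact: (grD gF (grN gG)).
by apply: le_PP => //; apply: gr_norm; exact: (grD gF (grN gG)).
Qed.

Lemma PP_bounded (F : seq C -> R) k : (forall l, `|F l| <= k) -> `|PP nu F| <= k.
Proof.
move=> Fk; have gF := gr_bounded Fk; rewrite -[leRHS]PP_cst.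
rewrite (le_trans (PP_norm gF))// le_PP//; first exact: gr_norm.
by apply: (@gr_bounded _ _ `|k|).
Qed.

(* Mecke's formula *)
Lemma PP_RS (H : C -> seq C -> R) : (forall c, gr (H c)) ->
  PP nu (RS H) = \sum_c nu c * PP nu (H c).
Proof.
move=> gH; rewrite /PP.
transitivity (expR (- mass nu) * xsum (fun r => wsum nu (fun c => It (wsum nu) r (H c)))).
  congr (_ * _); rewrite -[RHS]xsum_shift.
    by apply: eq_xsum => r; rewrite psum_RS.
  by apply: gbnd_sum => c; apply: gbndZ; exact: gr_psum.
rewrite /wsum xsum_sum; last by move=> c; apply: gbndZ; exact: gr_psum.
rewrite mulr_sumr; apply: eq_bigr => c _; rewrite xsumZ; last exact: gr_psum.
by rewrite mulrCA.
Qed.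

Lemma PP_size : PP nu (fun l => (size l)%:R) = mass nu.
Proof.
transitivity (PP nu (RS (fun _ _ => 1))).
  by apply: eq_PP => l; rewrite RS_cst mulr1.
rewrite PP_RS => [|c]; last by apply: (@gr_bounded _ _ 1) => l; rewrite normr1.
by apply: eq_bigr => c _; rewrite PP_cst mulr1.
Qed.

End one.

Lemma gr_RS (C : finType) (H : C -> seq C -> R) : (forall c, gr (H c)) -> gr (RS H).
Proof.
move=> gH.
have [a ga aH] : exists2 a, gbnd a & forall c l, `|H c l| <= a (size l).
  have /choice[a aP] : forall c, exists a : nat -> R, gbnd a /\ forall l, `|H c l| <= a (size l).
    by move=> c; have [a ga Ha] := gr_lift (gH c); exists a.
  exists (fun n => \sum_c a c n); first by apply: gbnd_sum => c; exact: (aP c).1.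
  move=> c l; rewrite (bigD1 c)//= (le_trans ((aP c).2 l))// lerDl sumr_ge0// => d _.
  by rewrite (le_trans _ ((aP d).2 l)).
apply: (@gr_size _ _ (fun r => r%:R * a r.-1)).
  case: (gbnd_shift (@gbnd_nat R)) => K Kn; case: ga => L aL.
  have K0 : 0 <= K by rewrite (le_trans _ (Kn 0%N)).
  have L0 : 0 <= L by rewrite (le_trans _ (aL 0%N)).
  apply: (@gbnd_le _ _ (fun r => K ^+ r.+1 * (1 + L) ^+ r.+1)); last first.
    by apply: gbndM; apply: gbnd_shift; exact: gbnd_pow.
  move=> r; rewrite normrM normr_nat ler_pM//.
    by rewrite (le_trans _ (Kn r))// normr_nat ler_nat.
  rewrite (le_trans (aL _))// (@le_trans _ _ ((1 + L) ^+ r.-1.+1))//.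
    by rewrite lerXn2r ?nnegrE ?addr_ge0// lerDr.
  by apply: ler_weXn2l; rewrite ?lerDl// ltnS leq_pred.
move=> l; rewrite (le_trans (RS_norm _ _))// -RS_cst; apply: le_RS => c s sl.
by rewrite (le_trans (aH _ _))// -sl.
Qed.

Section two.
Variables (C D : finType) (nu : C -> R) (mu : D -> R).
Hypotheses (nu0 : forall c, 0 <= nu c) (mu0 : forall c, 0 <= mu c).

Lemma gr2_PP (F : seq C -> seq D -> R) : gr2 F -> gr (fun l => PP mu (F l)).
Proof.
move=> gF; have [K K1 FK] := gr2_ge1 gF; have K0 : 0 <= K by exact: le_trans K1.
have gp : gr (fun l : seq D => K ^+ size l).
  apply: (@gr_size _ _ (fun r => K ^+ r)); first exact: gbnd_pow.
  by move=> l; rewrite ger0_norm// exprn_ge0.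
apply: (@gr_size _ _ (fun r => PP mu (fun l => K ^+ size l) * K ^+ r.+1)).
  by apply: gbndZ; apply: gbnd_shift; exact: gbnd_pow.
move=> l; have gFl := gr2_l l gF.
rewrite (le_trans (PP_norm mu0 gFl))// mulrC -(PPZ mu0 _ gp) le_PP//.
- exact: gr_norm.
- exact: grZ.
- by move=> l'; rewrite (le_trans (FK l l'))// -exprD addSn.
Qed.

Lemma gbnd2_psum (F : seq C -> seq D -> R) : gr2 F ->
  gbnd2 (fun i j => It (wsum nu) i (fun l => It (wsum mu) j (F l))).
Proof.
move=> gF; have [K K1 FK] := gr2_ge1 gF; have K0 : 0 <= K by exact: le_trans K1.
have n0 := mass_ge0 nu0; have m0 := mass_ge0 mu0.
pose M := (1 + mass nu + mass mu) * K; exists M => i j.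
have M1 : 1 <= 1 + mass nu + mass mu by rewrite -addrA lerDl addr_ge0.
apply: (@le_trans _ _ (mass nu ^+ i * (mass mu ^+ j * K ^+ (i + j).+1))).
  apply: psum_bound => // l li; apply: psum_bound => // l' lj.
  by rewrite -li -lj.
rewrite mulrA [leRHS]exprMn ler_pM ?mulr_ge0 ?exprn_ge0//.
apply: (@le_trans _ _ ((1 + mass nu + mass mu) ^+ i * (1 + mass nu + mass mu) ^+ j)).
  rewrite ler_pM ?exprn_ge0// lerXn2r// ?nnegrE ?addr_ge0//.
    by rewrite addrAC lerDr addr_ge0.
  by rewrite lerDr addr_ge0.
by rewrite -exprD ler_weXn2l.
Qed.

Lemma PP_PP (F : seq C -> seq D -> R) : gr2 F ->
  PP nu (fun l => PP mu (F l)) = expR (- (mass nu + mass mu)) *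
    xsum (fun i => xsum (fun j => It (wsum nu) i (fun l => It (wsum mu) j (F l)))).
Proof.
move=> gF; have gl l := gr_psum mu0 (gr2_l l gF).
rewrite /PP opprD expRD -mulrA; congr (_ * _).
under eq_xsum => i do rewrite psumZ (psum_xsum nu i gl).1.
by rewrite xsumZ//; exact: (gbnd2_xsum (gbnd2_psum gF)).1.
Qed.

End two.

Lemma PP_swap (C D : finType) (nu : C -> R) (mu : D -> R) (F : seq C -> seq D -> R) :
  (forall c, 0 <= nu c) -> (forall c, 0 <= mu c) -> gr2 F ->
  PP nu (fun l => PP mu (F l)) = PP mu (fun l' => PP nu (F^~ l')).
Proof.
move=> nu0 mu0 gF; rewrite !PP_PP//; last exact: gr2_sym.
rewrite addrC; congr (_ * _); rewrite xsum_swap; last exact: gbnd2_psum.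
by do 2!apply: eq_xsum => ?; rewrite psum_swap.
Qed.

(** Superposition of independent processes: on the right the entries of [nu] come first, on the left
    the two kinds are mixed, hence the invariance required of [F]. *)
Lemma PP_add (C : finType) (nu mu : C -> R) (F : seq C -> R) :
  (forall c, 0 <= nu c) -> (forall c, 0 <= mu c) -> perm_inv F -> gr F ->
  PP (fun c => nu c + mu c) F = PP nu (fun l => PP mu (fun l' => F (l ++ l'))).
Proof.
move=> nu0 mu0 pF gF; rewrite PP_PP//; last exact: gr2_cat.
rewrite /PP {1}/mass big_split/=; congr (_ * _).
by rewrite -xsum_cauchy; [apply: eq_xsum => r; exact: psum_add|
  apply: gbnd2_psum => //; exact: gr2_cat].
Qed.

Lemma PP_map (C D : finType) (f : C -> D) (nu : C -> R) (F : seq D -> R) :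
  PP nu (F \o map f) = PP (fun d => \sum_(c | f c == d) nu c) F.
Proof.
rewrite /PP; congr (expR (- _) * _).
  rewrite /mass (partition_big f predT)//=.
apply: eq_xsum => r; apply/esym; apply: It_map => phi.
rewrite /wsum (partition_big f predT)//=; apply: eq_bigr => d _.
by rewrite mulr_suml; apply: eq_bigr => c /eqP ->.
Qed.

(** The equality of the image intensities is tested against functions, because the common image,
    later a set of weight functions, need not be a finite type. *)
Lemma PP_ext (C D : finType) (T : Type) (nu : C -> R) (mu : D -> R) (f : C -> T) (g : D -> T)
    (F : seq T -> R) :
  (forall phi, wsum nu (phi \o f) = wsum mu (phi \o g)) ->
  PP nu (F \o map f) = PP mu (F \o map g).
Proof.
move=> h; rewrite /PP; congr (expR (- _) * _).
  by have := h (fun=> 1); rewrite /wsum /=; under eq_bigr do rewrite mulr1;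
     under [in RHS]eq_bigr do rewrite mulr1.
apply: eq_xsum => r.
pose op phi : R := wsum nu (phi \o f).
by rewrite -(@It_map _ _ _ f op)// -(@It_map _ _ _ g op).
Qed.
End poisson_process.

(** * Decay of influence in a Gibbs measure *)

Section gibbs_averages.
Context {R : realType} {V : finType}.
Local Notation conf := {ffun V -> bool}.
Implicit Types (W f B w : conf -> R) (S : {set V}) (s t : conf).

Definition gavg W f : R := (\sum_s W s * f s) / \sum_s W s.

Definition upd S t s : conf := [ffun u => if u \in S then t u else s u].

Definition dep (S : {pred V}) f := forall s t, {in S, s =1 t} -> f s = f t.

(** Exchanging the [S]-coordinates of two configurations is an involution on pairs. *)
Lemma sum_upd S (h : conf -> R) :
  \sum_t \sum_s h (upd S t s) = #|{: conf}|%:R * \sum_s h s.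
Proof.
rewrite pair_big/=.
pose phi (ts : conf * conf) := (upd S ts.2 ts.1, upd S ts.1 ts.2).
have phiK : involutive phi.
  move=> [t s]; rewrite /phi/=; congr (_, _); apply/ffunP => u; rewrite !ffunE;
    by case: (u \in S).
rewrite (reindex_inj (inv_inj phiK))/=.
transitivity (\sum_(ts : conf * conf) h ts.2).
  apply: eq_bigr => -[t s] _ /=; congr h; apply/ffunP => u; rewrite !ffunE.
  by case: ifP => // ->.
rewrite -(pair_big predT predT (fun _ s => h s))/= sumr_const.
by rewrite -[LHS]mulr_natl.
Qed.

Section positive_weight.
Variable W : conf -> R.
Hypothesis W0 : forall s, 0 < W s.

Lemma sumW_gt0 : 0 < \sum_s W s.
Proof. by rewrite (bigD1 [ffun=> true])//= ltr_pwDl// sumr_ge0// => s _; exact: ltW. Qed.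

Lemma eq_gavg f g : f =1 g -> gavg W f = gavg W g.
Proof. by move=> /funext ->. Qed.

Lemma gavgD f g : gavg W (fun s => f s + g s) = gavg W f + gavg W g.
Proof.
rewrite /gavg -mulrDl -big_split/=; congr (_ / _).
by apply: eq_bigr => s _; rewrite mulrDr.
Qed.

Lemma gavgZ k f : gavg W (fun s => k * f s) = k * gavg W f.
Proof.
rewrite /gavg mulrA mulr_sumr; congr (_ / _).
by apply: eq_bigr => s _; rewrite mulrCA.
Qed.

Lemma gavg_cst k : gavg W (fun=> k) = k.
Proof. by rewrite /gavg -mulr_suml mulrAC divff ?mul1r// gt_eqF// sumW_gt0. Qed.

Lemma le_gavg f g : (forall s, f s <= g s) -> gavg W f <= gavg W g.
Proof.
move=> fg; apply: ler_wpM2r; first by rewrite invr_ge0 ltW// sumW_gt0.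
by apply: ler_sum => s _; rewrite ler_pM2l.
Qed.

Lemma gavg_norm f : `|gavg W f| <= gavg W (fun s => `|f s|).
Proof.
rewrite normrM normfV (gtr0_norm sumW_gt0).
apply: ler_wpM2r; first by rewrite invr_ge0 ltW// sumW_gt0.
rewrite (le_trans (ler_norm_sum _ _ _))//; apply: ler_sum => s _.
by rewrite normrM (gtr0_norm (W0 s)).
Qed.

Lemma gavg_bounded f k : (forall s, `|f s| <= k) -> `|gavg W f| <= k.
Proof.
by move=> fk; rewrite (le_trans (gavg_norm f))// -[leRHS]gavg_cst le_gavg.
Qed.

Lemma gavg_gt0 f : (forall s, 0 < f s) -> 0 < gavg W f.
Proof.
move=> f0; rewrite divr_gt0 ?sumW_gt0// (bigD1 [ffun=> true])//= ltr_pwDl ?mulr_gt0//.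
by rewrite sumr_ge0// => s _; rewrite ltW ?mulr_gt0.
Qed.

(** The Gibbs average given that the spins in [S] equal those of [t]. The sums still run over full
    configurations, whose own spins in [S] only contribute a common factor to numerator and
    denominator. *)
Definition condavg S t f := gavg (W \o upd S t) (f \o upd S t).

(** Tower property: the configuration is resampled off [S], and [B], which sees [S] only, factors
    out. *)
Lemma sum_condavg S B f : dep (mem S) B ->
  #|{: conf}|%:R * \sum_s W s * B s * f s =
  \sum_t B t * (\sum_s W (upd S t s)) * condavg S t f.
Proof.
move=> dB; rewrite -(sum_upd S); apply: eq_bigr => t _.
have Z0 : \sum_s W (upd S t s) != 0.
  by rewrite gt_eqF// (bigD1 [ffun=> true])//= ltr_pwDl// sumr_ge0// => s _; exact: ltW.
rewrite /condavg /gavg/= -mulrA [X in _ = _ * X]mulrCA divff// mulr1 mulr_sumr.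
apply: eq_bigr => s _; rewrite (dB (upd S t s) t); first by rewrite -mulrA mulrCA.
by move=> u uS; rewrite ffunE uS.
Qed.

Lemma card_conf_gt0 : (0 : R) < #|{: conf}|%:R.
Proof. by rewrite ltr0n; apply/card_gt0P; exists [ffun=> true]. Qed.

(* Centering [B] lets the conditional average be measured from the middle of
   its range: this is where the factor 1/2 comes from. *)
Lemma cov_centered S B f (D : R) : dep (mem S) B -> \sum_s W s * B s = 0 ->
  (forall t t', `|condavg S t f - condavg S t' f| <= D) ->
  `|\sum_s W s * B s * f s| <= D / 2 * \sum_s W s * `|B s|.
Proof.
move=> dB B0 fD; pose Z t := \sum_s W (upd S t s).
have Z0 t : 0 <= Z t by apply: sumr_ge0 => s _; exact: ltW.
have [t0 t0P] : exists t0, forall t, condavg S t0 f <= condavg S t f.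
  case: (@arg_minP _ _ _ [ffun=> true] predT (fun t => condavg S t f)) => // t0 _ h.
  by exists t0 => t; exact: h.
have absB : #|{: conf}|%:R * (\sum_s W s * `|B s|) = \sum_t `|B t| * Z t.
  have dB' : dep (mem S) (fun s => `|B s|) by move=> s t /dB ->.
  have := sum_condavg (fun=> 1) dB'.
  under eq_bigr do rewrite mulr1; move=> ->; apply: eq_bigr => t _.
  rewrite (_ : condavg _ _ _ = 1) ?mulr1// /condavg /gavg/=.
  under eq_bigr do rewrite mulr1; rewrite divff// gt_eqF//.
  by rewrite (bigD1 [ffun=> true])//= ltr_pwDl// sumr_ge0// => s _; exact: ltW.
have cB : \sum_t B t * Z t = 0.
  have := sum_condavg (fun=> 1) dB.
  under eq_bigr do rewrite mulr1; rewrite B0 mulr0 => /esym.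
  move=> h; rewrite -[RHS]h; apply: eq_bigr => t _.
  rewrite (_ : condavg _ _ _ = 1) ?mulr1// /condavg /gavg/=.
  under eq_bigr do rewrite mulr1; rewrite divff// gt_eqF//.
  by rewrite (bigD1 [ffun=> true])//= ltr_pwDl// sumr_ge0// => s _; exact: ltW.
rewrite -(ler_pM2l card_conf_gt0) mulrCA absB.
rewrite -[X in X * `|_|](ger0_norm (ltW card_conf_gt0)) -normrM (sum_condavg f dB).
have -> : \sum_t B t * (\sum_s W (upd S t s)) * condavg S t f =
    \sum_t B t * Z t * (condavg S t f - condavg S t0 f).
  under [RHS]eq_bigr do rewrite mulrBr; rewrite sumrB -[X in _ - X]mulr_suml cB.
  by rewrite mul0r subr0.
have g0 t : 0 <= condavg S t f - condavg S t0 f <= D.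
  by rewrite subr_ge0 t0P (le_trans (ler_norm _) (fD _ _)).
have D0 : 0 <= D by have /andP[/le_trans] := g0 t0; exact.
(* [B] is centered, so its positive and negative parts each carry half of the mass of its absolute
   value; the positive part gives the upper bound, the negative one the lower bound. *)
have half : D / 2 * (\sum_t `|B t| * Z t) =
    \sum_t (`|B t| + B t) / 2 * Z t * D.
  transitivity (D / 2 * (\sum_t `|B t| * Z t) + D / 2 * \sum_t B t * Z t).
    by rewrite cB mulr0 addr0.
  by rewrite !mulr_sumr -big_split/=; apply: eq_bigr => t _; field.
have half' : D / 2 * (\sum_t `|B t| * Z t) =
    \sum_t (`|B t| - B t) / 2 * Z t * D.
  transitivity (D / 2 * (\sum_t `|B t| * Z t) - D / 2 * \sum_t B t * Z t).
    by rewrite cB mulr0 subr0.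
  by rewrite !mulr_sumr -sumrB/=; apply: eq_bigr => t _; field.
rewrite ler_norml; apply/andP; split.
  rewrite half' -sumrN; apply: ler_sum => t _; have /andP[g1 g2] := g0 t.
  have b0 : 0 <= `|B t| - B t by rewrite subr_ge0 ler_norm.
  rewrite -subr_ge0; set g := _ - condavg S t0 f in g1 g2 *.
  rewrite (_ : _ - _ = Z t * ((`|B t| - B t) / 2 * (D - g) + (`|B t| + B t) / 2 * g)); last by field.
  rewrite mulr_ge0// addr_ge0// mulr_ge0 ?subr_ge0// divr_ge0//.
  by have := ler_norm (- B t); rewrite normrN; lra.
rewrite half; apply: ler_sum => t _; have /andP[g1 g2] := g0 t.
rewrite -subr_ge0; set g := _ - condavg S t0 f in g1 g2 *.
rewrite (_ : _ - _ = Z t * ((`|B t| + B t) / 2 * (D - g) + (`|B t| - B t) / 2 * g)); last by field.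
rewrite mulr_ge0// addr_ge0// mulr_ge0 ?subr_ge0 ?ler_norm// divr_ge0 ?subr_ge0 ?ler_norm//.
by have := ler_norm (- B t); rewrite normrN; lra.
Qed.

(** Centering [B] at most doubles the mean of its absolute value, which absorbs the factor 1/2 of
    [cov_centered]. *)
Lemma cov_bound S B f (D : R) : dep (mem S) B ->
  (forall t t', `|condavg S t f - condavg S t' f| <= D) ->
  `|gavg W (fun s => B s * (f s - gavg W f))| <= D * gavg W (fun s => `|B s|).
Proof.
move=> dB fD.
have Z0 := sumW_gt0; have Zn0 : \sum_s W s != 0 by rewrite gt_eqF.
pose b := gavg W B.
have dB' : dep (mem S) (fun s => B s - b) by move=> s t /dB ->.
have D0 : 0 <= D by rewrite (le_trans _ (fD [ffun=> true] [ffun=> true])).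
have cB : \sum_s W s * (B s - b) = 0.
  under eq_bigr do rewrite mulrBr; rewrite sumrB -[X in _ - X]mulr_suml.
  by rewrite /b /gavg mulrC mulfVK// subrr.
have := cov_centered dB' cB fD.
rewrite /gavg normrM normfV (gtr0_norm Z0) mulrA ler_pdivrMr// mulfVK//.
have -> : \sum_s W s * (B s * (f s - (\sum_s0 W s0 * f s0) / \sum_s0 W s0)) =
          \sum_s W s * (B s - b) * f s.
  have -> : \sum_s W s * (B s - b) * f s =
      (\sum_s W s * B s * f s) - b * (\sum_s W s * f s).
    by rewrite mulr_sumr -sumrB; apply: eq_bigr => s _; ring.
  have -> : b * (\sum_s W s * f s) = (\sum_s W s * B s) * gavg W f.
    by rewrite /b /gavg; field.
  by rewrite [X in _ - X]mulr_suml -sumrB; apply: eq_bigr => s _; rewrite /gavg; ring.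
move=> /le_trans; apply; rewrite -mulrA ler_wpM2l//.
rewrite mulrC ler_pdivrMr// mulr_natr mulr2n.
apply: (@le_trans _ _ (\sum_s (W s * `|B s| + W s * `|b|))).
  by apply: ler_sum => s _; rewrite -mulrDr ler_pM2l// ler_normB.
rewrite big_split/= lerD2l -mulr_suml /b.
rewrite (le_trans (ler_wpM2l (ltW Z0) (gavg_norm B)))// /gavg mulrC mulfVK//.
Qed.

End positive_weight.

(* For [beta <= 1/4] both densities lie between [exp (- beta)] and [exp beta];
   otherwise the total variation distance is at most 1. *)
Lemma gavg_reweight (beta : R) W w w' f S (D : R) : 0 < beta ->
  (forall s, 0 < W s) -> (forall s, 0 < w s) -> (forall s, 0 < w' s) ->
  (forall s t, w s <= expR beta * w t) -> (forall s t, w' s <= expR beta * w' t) ->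
  dep (mem S) w -> dep (mem S) w' ->
  (forall t t', `|condavg W S t f - condavg W S t' f| <= D) ->
  `|gavg (fun s => w s * W s) f - gavg (fun s => w' s * W s) f| <= Num.min (4 * beta) 1 * D.
Proof.
move=> b0 W0 w0 w'0 rw rw' dw dw' fD.
have D0 : 0 <= D by rewrite (le_trans _ (fD [ffun=> true] [ffun=> true])).
pose a := \sum_s w s * W s; pose a' := \sum_s w' s * W s.
have a0 : 0 < a by apply: sumW_gt0 => s; rewrite mulr_gt0.
have a'0 : 0 < a' by apply: sumW_gt0 => s; rewrite mulr_gt0.
pose B s := w s / a - w' s / a'.
have dB : dep (mem S) B by move=> s t st; rewrite /B (dw _ _ st) (dw' _ _ st).
have cB : \sum_s W s * B s = 0.
  rewrite /B; under eq_bigr do rewrite mulrBr !mulrA.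
  rewrite sumrB -!mulr_suml.
  under eq_bigr do rewrite mulrC; rewrite -/a divff ?gt_eqF//.
  by under eq_bigr do rewrite mulrC; rewrite -/a' divff ?gt_eqF// subrr.
have -> : gavg (fun s => w s * W s) f - gavg (fun s => w' s * W s) f =
    \sum_s W s * B s * f s.
  rewrite /gavg -/a -/a' !mulr_suml -sumrB; apply: eq_bigr => s _.
  by rewrite /B; ring.
suff h : \sum_s W s * `|B s| <= 2 * Num.min (4 * beta) 1.
  rewrite (le_trans (cov_centered W0 dB cB fD))//.
  rewrite (le_trans (ler_wpM2l _ h)) ?divr_ge0//.
  by rewrite mulrA mulfVK// mulrC.
have le2 : \sum_s W s * `|B s| <= 2.
  apply: (@le_trans _ _ (\sum_s (W s * (w s / a) + W s * (w' s / a')))).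
    apply: ler_sum => s _; rewrite -mulrDr ler_pM2l//.
    by rewrite (le_trans (ler_normB _ _))// !gtr0_norm ?divr_gt0.
  have E (v : conf -> R) c : c = \sum_s v s * W s -> 0 < c -> \sum_s W s * (v s / c) = 1.
    move=> cE c0; transitivity ((\sum_s v s * W s) / c).
      by rewrite mulr_suml; apply: eq_bigr => s _; ring.
    by rewrite -cE divff// gt_eqF.
  by rewrite big_split/= (E w a)// (E w' a')//; lra.
have [b4|b4] := leP (4 * beta) 1; last by rewrite mulr1.
(* Together these give e^beta - e^(-beta) <= 3 beta, within the 8 beta allowed. *)
have [e1 e2] : expR beta <= 1 + 2 * beta /\ 1 - beta <= expR (- beta).
  have h := expR_ge1Dx (- beta); split => //.
  rewrite -[expR beta]invrK -expRN -[leLHS]mul1r ler_pdivrMr ?expR_gt0//.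
  by nra.
pose Z := \sum_s W s; have Z0 : 0 < Z by exact: sumW_gt0.
have bnd (v : conf -> R) : (forall s, 0 < v s) -> (forall s t, v s <= expR beta * v t) ->
    forall s, expR (- beta) / Z <= v s / (\sum_s v s * W s) <= expR beta / Z.
  move=> v0 rv s; have c0 : 0 < \sum_s v s * W s.
    by apply: sumW_gt0 => t; rewrite mulr_gt0.
  rewrite ler_pdivlMr// mulrAC ler_pdivrMr// [leLHS]mulr_sumr /Z mulr_sumr.
  rewrite ler_pdivrMr// mulrAC ler_pdivlMr// !mulr_sumr; apply/andP; split.
    apply: ler_sum => t _; rewrite mulrA ler_pM2r// expRN mulrC ler_pdivrMr ?expR_gt0//.
    by rewrite mulrC.
  by apply: ler_sum => t _; rewrite mulrA ler_pM2r.
apply: (@le_trans _ _ (\sum_s W s * ((expR beta - expR (- beta)) / Z))).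
  apply: ler_sum => s _; rewrite ler_pM2l// ler_norml mulrBl.
  have := bnd w w0 rw s; have := bnd w' w'0 rw' s; rewrite -/a -/a' -/(B s) /B.
  by move=> /andP[? ?] /andP[? ?]; apply/andP; split; lra.
rewrite -mulr_suml -/Z mulrC mulfVK ?gt_eqF//.
by lra.
Qed.

End gibbs_averages.

(** * Influence of one spin on another, clause by clause *)

Section influence.
Context {R : realType} {V : finType} {p : nat}.
Variable beta : R.
Local Notation conf := {ffun V -> bool}.
Local Notation hedge := {ffun 'I_p -> V}.
Local Notation cb := (Num.min (4 * beta) 1).

(** The weight is any function of the spins of the hyperedge with ratio at most e^beta, not just a
    clause weight: this class is stable under freezing spins ([pin]) and contains the constant 1,
    while the hyperedges, hence [infl], stay unchanged. *)
Record factor := Factor {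
  fedge : hedge ;
  fwt : conf -> R ;
  fwt_gt0 : forall s, 0 < fwt s ;
  fwt_ratio : forall s t, fwt s <= expR beta * fwt t ;
  fwt_dep : dep (mem (codom fedge)) fwt }.

Definition fprod (L : seq factor) (s : conf) : R := \prod_(x <- L) fwt x s.

Lemma fprod_gt0 L s : 0 < fprod L s.
Proof. by rewrite /fprod prodr_gt0// => x _; exact: fwt_gt0. Qed.

(* Weighted count, truncated at depth [n], of the clause-avoiding walks from [i]
   to [t]. *)
Fixpoint infl n (l : seq hedge) (i t : V) : R :=
  if n is n'.+1 then
    if i == t then 1 else
    Num.min 1 (RS (fun (e : hedge) l' => cb * \sum_(a < p) \sum_(b < p | b != a)
                                 (e a == i)%:R * infl n' l' (e b) t) l)
  else 1.

Hypothesis beta0 : 0 < beta.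

Lemma cb_ge0 : 0 <= cb.
Proof. by rewrite le_min ler01 mulr_ge0// ltW. Qed.

Lemma infl_itv n l i t : 0 <= infl n l i t <= 1.
Proof.
elim: n l i => [|n ih] l i /=; first by rewrite ler01 lexx.
case: ifP => _; first by rewrite ler01 lexx.
rewrite ge_min lexx andbT le_min ler01 RS_ge0// => e s.
rewrite mulr_ge0 ?cb_ge0// sumr_ge0// => a _; rewrite sumr_ge0// => b _.
by rewrite mulr_ge0//; have /andP[] := ih s (e b).
Qed.

Lemma infl_ge0 n l i t : 0 <= infl n l i t.
Proof. by have /andP[] := infl_itv n l i t. Qed.

Lemma infl_le1 n l i t : infl n l i t <= 1.
Proof. by have /andP[] := infl_itv n l i t. Qed.

Lemma infl_perm n i t : perm_inv (fun l => infl n l i t).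
Proof.
elim: n i => [//|n ih] i l l' ll' /=; case: ifP => // _; congr Num.min.
apply: RS_perm ll' => e s s' ss'; congr (_ * _); apply: eq_bigr => a _.
by apply: eq_bigr => b _; rewrite (ih _ _ _ ss').
Qed.

Lemma pin_dep (S : {set V}) (t : conf) (f : factor) : dep (mem (codom (fedge f))) (fwt f \o upd S t).
Proof.
move=> s s' ss' /=; apply: fwt_dep => u uf; rewrite !ffunE.
by case: ifP => // _; exact: ss'.
Qed.

Definition pin (S : {set V}) (t : conf) (f : factor) : factor :=
  @Factor (fedge f) (fwt f \o upd S t) (fun s => fwt_gt0 f (upd S t s))
    (fun s s' => fwt_ratio f (upd S t s) (upd S t s')) (@pin_dep S t f).

Lemma fprod_pin (S : {set V}) (t : conf) L : fprod (map (pin S t) L) = fprod L \o upd S t.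
Proof. by apply/funext => s; rewrite /fprod big_map. Qed.

Lemma fedge_pin (S : {set V}) (t : conf) L : map fedge (map (pin S t) L) = map fedge L.
Proof. by rewrite -map_comp. Qed.

Implicit Types (S : {set V}) (f : conf -> R) (s : conf) (t u i : V).

(** The factor 2 is the trivial bound for functions between -1 and 1, so that depth 0 costs
    nothing. *)
Definition influence_bound n := forall L i t f, dep (pred1 t) f ->
  (forall s, `|f s| <= 1) -> forall s s',
  `|condavg (fprod L) [set i] s f - condavg (fprod L) [set i] s' f|
    <= 2 * infl n (map fedge L) i t.

Section step.
Variable n : nat.
Hypothesis infln : influence_bound n.

(** Only the spin of [u] differs; the other spins of [S] are frozen by [pin], which keeps the
    hyperedges, and the hypothesis at depth [n] applies to the pinned factors with the single site
    [u]. *)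
Lemma condavg_step L S t f u s s' : dep (pred1 t) f -> (forall s, `|f s| <= 1) ->
  (forall v, v \in S -> v != u -> s v = s' v) ->
  `|condavg (fprod L) S s f - condavg (fprod L) S s' f| <= 2 * infl n (map fedge L) u t.
Proof.
move=> df f1 ss'; have [uS|uS] := boolP (u \in S); last first.
  suff E : upd S s = upd S s' by rewrite /condavg E subrr normr0 mulr_ge0 ?infl_ge0.
  apply/funext => r; apply/ffunP => v; rewrite !ffunE; case: ifPn => // vS.
  by apply: ss' => //; apply: contraNneq uS => <-.
have E (r : conf) : (forall v, v \in S -> v != u -> r v = s v) ->
    upd (S :\ u) s \o upd [set u] r = upd S r.
  move=> rs; apply/funext => q; apply/ffunP => v; rewrite /= !ffunE finset.in_set1 finset.in_setD1.
  have [->|vu] := eqVneq v u; first by rewrite uS.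
  by case: (boolP (v \in S)) => vS //=; rewrite rs.
pose L' := map (pin (S :\ u) s) L.
have df' : dep (pred1 t) (f \o upd (S :\ u) s).
  move=> q q' qq' /=; apply: df => v vt; rewrite !ffunE; case: ifP => // _.
  exact: qq'.
have := infln L' u df' (fun r => f1 _) s s'.
have C (r : conf) : (forall v, v \in S -> v != u -> r v = s v) ->
    condavg (fprod L') [set u] r (f \o upd (S :\ u) s) = condavg (fprod L) S r f.
  by move=> rs; rewrite /condavg -(E r rs) /L' fprod_pin.
rewrite /L' fedge_pin -/L' !C// => v vS vu.
by rewrite ss'.
Qed.

Lemma condavg_osc L S t f s s' (q : seq V) : dep (pred1 t) f -> (forall s, `|f s| <= 1) ->
  (forall v, v \in S -> v \notin q -> s v = s' v) ->
  `|condavg (fprod L) S s f - condavg (fprod L) S s' f|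
    <= 2 * \sum_(u <- q) infl n (map fedge L) u t.
Proof.
move=> df f1; elim: q s => [|u q ih] s ss'.
  rewrite big_nil mulr0 /condavg (_ : upd S s = upd S s') ?subrr ?normr0//.
  apply/funext => r; apply/ffunP => v; rewrite !ffunE; case: ifPn => // vS.
  by apply: ss'.
pose s'' := upd [set u] s' s.
rewrite big_cons mulrDr (le_trans (ler_distD (condavg (fprod L) S s'' f) _ _))// lerD//.
  apply: condavg_step => // v vS vu; rewrite /s'' ffunE finset.in_set1.
  by rewrite (negbTE vu).
apply: ih => v vS vq; rewrite /s'' ffunE finset.in_set1; case: ifPn => // vu.
by apply: ss' => //; rewrite in_cons negb_or vu.
Qed.

Lemma condavg_osc_seq L (q : seq V) t f : dep (pred1 t) f -> (forall s, `|f s| <= 1) ->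
  forall s s', `|condavg (fprod L) [set:: q] s f - condavg (fprod L) [set:: q] s' f|
    <= 2 * \sum_(u <- q) infl n (map fedge L) u t.
Proof.
move=> df f1 s s'; apply: condavg_osc => // v; rewrite inE => vq.
by rewrite vq.
Qed.

Section switching.
Variable dq : hedge -> seq V.

(** A replacement of one factor by another on the same hyperedge; [dq] lists the sites through which
    an active replacement is felt. *)
Record switch := Switch {
  sw1 : factor ; sw2 : factor ; sw_on : bool ;
  sw_edge : fedge sw1 = fedge sw2 ;
  sw_off : ~~ sw_on -> fwt sw1 = fwt sw2 ;
  sw_dep1 : sw_on -> dep (mem (dq (fedge sw1))) (fwt sw1) ;
  sw_dep2 : sw_on -> dep (mem (dq (fedge sw1))) (fwt sw2) }.

(** Telescoping: factors before [x] are already replaced, those after it are not. The weight of the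
    other factors is common, and [gavg_reweight] converts the change at [x] into the oscillation of
    their average when the sites in [dq] are frozen. The hyperedge of [x] is absent from that
    average: this is where the walks become clause-avoiding. *)
Lemma gavg_switch (X : seq switch) t f : dep (pred1 t) f -> (forall s, `|f s| <= 1) ->
  `|gavg (fprod (map sw1 X)) f - gavg (fprod (map sw2 X)) f| <=
  RS (fun x l' => if sw_on x then cb * (2 * \sum_(u <- dq (fedge (sw1 x)))
        infl n (map (fedge \o sw1) l') u t) else 0) X.
Proof.
move=> df f1.
suff h P : `|gavg (fprod (map sw2 P ++ map sw1 X)) f -
             gavg (fprod (map sw2 P ++ map sw2 X)) f| <=
    RS (fun x l' => if sw_on x then cb * (2 * \sum_(u <- dq (fedge (sw1 x)))
        infl n (map (fedge \o sw1) (P ++ l')) u t) else 0) X by exact: (h [::]).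
elim: X P => [|x X ih] P /=; first by rewrite subrr normr0.
have /= ihP := ih (rcons P x).
rewrite (le_trans (ler_distD (gavg (fprod (map sw2 P ++ sw2 x :: map sw1 X)) f) _ _))//.
apply: lerD; last first.
  rewrite -!cat_rcons -map_rcons (le_trans ihP)//; apply: le_RS => y l _.
  by rewrite cat_rcons.
pose L := map sw2 P ++ map sw1 X.
have E y : fprod (map sw2 P ++ y :: map sw1 X) = (fun s => fwt y s * fprod L s).
  apply/funext => s; rewrite /fprod /L !big_cat big_cons/=.
  by rewrite mulrCA.
rewrite !E; case: ifPn => [on|off]; last first.
  by rewrite (sw_off off) subrr normr0.
have dS (w : conf -> R) : dep (mem (dq (fedge (sw1 x)))) w ->
    dep (mem [set:: dq (fedge (sw1 x))]) w.
  by move=> dw s s' ss'; apply: dw => u uq; apply: ss'; rewrite inE.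
apply: (gavg_reweight beta0 (S := [set:: dq (fedge (sw1 x))])).
- exact: fprod_gt0.
- exact: fwt_gt0.
- exact: fwt_gt0.
- exact: fwt_ratio.
- exact: fwt_ratio.
- exact/dS/sw_dep1.
- exact/dS/sw_dep2.
move=> s s'; rewrite (le_trans (condavg_osc_seq L _ df f1 s s'))//.
rewrite (_ : map fedge L = map (fedge \o sw1) (P ++ X))// /L !map_cat -!map_comp.
by congr (_ ++ _); apply: eq_map => y /=; rewrite sw_edge.
Qed.

End switching.
End step.

Lemma RSZ (T : Type) (k : R) (H : T -> seq T -> R) (s : seq T) :
  RS (fun x l => k * H x l) s = k * RS H s.
Proof. by elim: s H => [|x s ih] H /=; rewrite ?mulr0// ih mulrDr. Qed.

(* A spin acts on the rest of the system only through the clauses containing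
   it; switching these clauses one at a time gives the recursion of [infl]. *)
Lemma influence_boundP n : influence_bound n.
Proof.
elim: n => [|n ih] L i t f df f1 s s'.
  rewrite /= mulr1 (le_trans (ler_normB _ _))// -[leRHS]addr0.
  have b r : `|condavg (fprod L) [set i] r f| <= 1.
    by apply: gavg_bounded => q //=; exact: fprod_gt0.
  by have := b s; have := b s'; lra.
have b r : `|condavg (fprod L) [set i] r f| <= 1.
  by apply: gavg_bounded => q //=; exact: fprod_gt0.
rewrite /=; case: ifPn => [_|it].
  by rewrite (le_trans (ler_normB _ _))//; have := b s; have := b s'; lra.
rewrite minr_pMr// le_min; apply/andP; split.
  by rewrite (le_trans (ler_normB _ _))//; have := b s; have := b s'; lra.
(* Once [i] is frozen, a factor depends only on the other sites of its hyperedge. *)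
pose dq (e : hedge) := [seq u <- codom e | u != i].
have off (x : factor) : ~~ (i \in codom (fedge x)) ->
    fwt x \o upd [set i] s = fwt x \o upd [set i] s'.
  move=> ix; apply/funext => q /=; apply: fwt_dep => u ux; rewrite !ffunE finset.in_set1.
  by case: eqVneq => // ui; rewrite ui (negbTE ix) in ux.
have dp (x : factor) r : i \in codom (fedge x) ->
    dep (mem (dq (fedge x))) (fwt x \o upd [set i] r).
  move=> ix q q' qq' /=; apply: fwt_dep => u ux; rewrite !ffunE finset.in_set1.
  by case: ifPn => // ui; apply: qq'; rewrite mem_filter ui.
pose sw x := @Switch dq (pin [set i] s x) (pin [set i] s' x) (i \in codom (fedge x))
  erefl (off x) (dp x s) (dp x s').
have E r : condavg (fprod L) [set i] r f = gavg (fprod (map (pin [set i] r) L)) f.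
  rewrite /condavg fprod_pin; congr gavg; apply/funext => q; apply: df => u.
  by rewrite inE => /eqP ->; rewrite ffunE finset.in_set1 eq_sym (negbTE it).
have := gavg_switch ih (map sw L) df f1.
rewrite -!map_comp !E => /le_trans; apply.
rewrite RS_map RS_map -RSZ; apply: le_RS => x l _ /=.
case: ifPn => [ix|_]; last first.
  rewrite !mulr_ge0 ?cb_ge0// sumr_ge0// => a _; rewrite sumr_ge0// => c _.
  by rewrite mulr_ge0 ?infl_ge0.
rewrite mulrCA ler_wpM2l// ler_wpM2l ?cb_ge0// -map_comp.
rewrite [X in infl n X](_ : _ = map fedge l); last exact: eq_map.
(* One position [a0] of [i] is enough: the other positions only add nonnegative terms to the sum in
   [infl]. *)
move/codomP : (ix) => [a0 ia0].
rewrite (bigD1 a0)//= ler_wpDr//.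
  rewrite sumr_ge0// => a _; rewrite sumr_ge0// => c _.
  by rewrite mulr_ge0 ?infl_ge0.
rewrite /dq big_filter big_map big_enum_cond/= big_mkcond [leRHS]big_mkcond/=.
apply: ler_sum => c _; rewrite -ia0 eqxx mul1r.
have [->|ca0] := eqVneq c a0; first by rewrite -ia0 eqxx.
by case: ifP => // _; exact: infl_ge0.
Qed.

(** Deleting a factor amounts to switching it to the constant 1 on its hyperedge; the factors of [B]
    are inactive switches. *)
Lemma gavg_cat n (K B : seq factor) t f : dep (pred1 t) f -> (forall s, `|f s| <= 1) ->
  `|gavg (fprod (K ++ B)) f - gavg (fprod B) f| <=
  RS (fun x l' => cb * (2 * \sum_(a < p) infl n (map fedge (l' ++ B)) (fedge x a) t)) K.
Proof.
move=> df f1.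
have r1 (s s' : conf) : (1 : R) <= expR beta * 1.
  by rewrite mulr1 ltW// expR_gt1.
pose one e : factor := @Factor e (fun=> 1) (fun=> ltr01) r1 (fun _ _ _ => erefl).
pose dq (e : hedge) := codom e.
have ndep (w : conf -> R) e : ~~ true -> fwt (one e) = w by [].
pose swK (x : factor) := @Switch dq x (one (fedge x)) true erefl
   (fun h => match notF h with end) (fun=> @fwt_dep x) (fun=> @fwt_dep (one (fedge x))).
pose swB (x : factor) := @Switch dq x x false erefl
   (fun=> erefl) (fun h => match notF h with end) (fun h => match notF h with end).
have := gavg_switch (@influence_boundP n) (map swK K ++ map swB B) df f1.
rewrite !map_cat -!map_comp.
have -> : map (@sw1 dq \o swK) K ++ map (@sw1 dq \o swB) B = K ++ B.
  by congr (_ ++ _); exact: map_id.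
have -> : fprod (map (@sw2 dq \o swK) K ++ map (@sw2 dq \o swB) B) = fprod B.
  apply/funext => s; rewrite /fprod big_cat/= big_map big1 ?mul1r//.
  by congr (\prod_(_ <- _) _); exact: map_id.
move=> /le_trans; apply; rewrite RS_cat !RS_map/= RS_cst mulr0 addr0.
apply: le_RS => x l _; rewrite ler_wpM2l ?cb_ge0// ler_wpM2l//.
rewrite big_map big_enum/= !map_cat -!map_comp.
by rewrite (eq_map (g := fedge))// (eq_map (f := _ \o swB) (g := fedge)).
Qed.

End influence.

(** * Factorization of Gibbs averages *)

Section multiaffine.
Context {R : realType}.
Variable k : R.
Hypothesis k1 : 1 <= k.

Definition box (ys : seq R) := all (fun y => -1 <= y <= 1) ys.

(* Functions of [M] slots, affine and with bounded ratio in each slot; freezing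
   the slots from the left gives the recursion. *)
Fixpoint maff M (Phi : seq R -> R) : Prop :=
  if M is M'.+1 then
    [/\ forall y : R, -1 <= y <= 1 -> maff M' (fun l => Phi (y :: l)),
        forall (y : R) ys, size ys = M' -> box ys -> -1 <= y <= 1 ->
          Phi (y :: ys) = (1 + y) / 2 * Phi (1 :: ys) + (1 - y) / 2 * Phi (-1 :: ys)
      & forall ys, size ys = M' -> box ys ->
          Phi (1 :: ys) <= k * Phi (-1 :: ys) /\ Phi (-1 :: ys) <= k * Phi (1 :: ys)]
  else 0 < Phi [::].

Lemma maff_gt0 M Phi ys : maff M Phi -> size ys = M -> box ys -> 0 < Phi ys.
Proof.
elim: M Phi ys => [|M ih] Phi [|y ys]//= [mP _ _] [sy] /andP[y1 bys].
exact: (ih _ _ (mP y y1)).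
Qed.

Lemma maff_cst M (c : R) : 0 < c -> maff M (fun=> c).
Proof.
move=> c0; elim: M => //= M ih; split=> // [y ys _ _ _|ys _ _]; first by field.
by split; rewrite ler_peMl// ltW.
Qed.

Lemma maffZ M Phi (c : R) : 0 < c -> maff M Phi -> maff M (fun l => c * Phi l).
Proof.
move=> c0; elim: M Phi => [|M ih] Phi /=; first exact: mulr_gt0.
move=> [mP aP rP]; split=> [y y1|y ys sy bys y1|ys sy bys].
- exact: (ih _ (mP y y1)).
- by rewrite aP//; ring.
- by have [r1 r2] := rP ys sy bys; split; rewrite mulrCA ler_pM2l.
Qed.

Lemma split_box M1 M2 ys : size ys = (M1 + M2)%N -> box ys ->
  [/\ size (take M1 ys) = M1, box (take M1 ys) &
      size (drop M1 ys) = M2 /\ box (drop M1 ys)].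
Proof.
move=> sy; rewrite -{1}(cat_take_drop M1 ys) /box all_cat => /andP[bt bd].
by split=> //; rewrite ?size_drop ?size_take_min sy ?addKn// (minn_idPl (leq_addr _ _)).
Qed.

Lemma maff_cat M1 M2 Phi1 Phi2 : maff M1 Phi1 -> maff M2 Phi2 ->
  maff (M1 + M2) (fun ys => Phi1 (take M1 ys) * Phi2 (drop M1 ys)).
Proof.
move=> m1 m2; elim: M1 Phi1 m1 => [|M1 ih] Phi1 /=.
  move=> p0; rewrite (_ : (fun _ => _) = fun ys => Phi1 [::] * Phi2 ys).
    exact: maffZ.
  by apply/funext => ys; rewrite take0 drop0.
move=> [mP aP rP]; split=> [y y1|y ys sy bys y1|ys sy bys].
- exact: (ih _ (mP y y1)).
- have [st bt _] := split_box sy bys; rewrite aP//; ring.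
- have [st bt [sd bd]] := split_box sy bys.
  have d0 : 0 < Phi2 (drop M1 ys) by exact: (maff_gt0 m2).
  by have [r1 r2] := rP _ st bt; rewrite !mulrA !ler_pM2r.
Qed.

(** Measuring against both values makes the relation symmetric; it is also preserved by a common
    positive factor. *)
Definition relcl (eta P P' : R) := `|P - P'| <= eta * P /\ `|P - P'| <= eta * P'.

Lemma relcl_sym eta P P' : relcl eta P P' -> relcl eta P' P.
Proof. by move=> [h1 h2]; split; rewrite distrC. Qed.

Lemma relclxx (P : R) : 0 < P -> relcl 0 P P.
Proof. by move=> P0; split; rewrite subrr normr0 mul0r. Qed.

Lemma relclZ eta P P' c : 0 < c -> relcl eta P P' -> relcl eta (c * P) (c * P').
Proof.
by move=> c0 [h1 h2]; split; rewrite -mulrBr normrM gtr0_norm// mulrCA ler_pM2l.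
Qed.

(** Readouts of two positive weights that are 1-Lipschitz in logarithmic scale: the logarithm of a
    weight, the logarithm of the mean of the cavity weights for the two values of a spin, and the
    resulting magnetization. *)
Definition glip (g : R -> R -> R) := forall eta1 eta2 P P' Q Q',
  0 < P -> 0 < P' -> 0 < Q -> 0 < Q' -> relcl eta1 P P' -> relcl eta2 Q Q' ->
  `|g P Q - g P' Q'| <= eta1 + eta2.

Lemma ln_relcl eta P P' : 0 < P -> 0 < P' -> relcl eta P P' -> `|ln P - ln P'| <= eta.
Proof.
have h x y : 0 < x -> 0 < y -> relcl eta x y -> ln x - ln y <= eta.
  move=> x0 y0 [h1 h2]; rewrite -ln_div//.
  rewrite (_ : x / y = 1 + (x - y) / y); last by field; rewrite gt_eqF.
  rewrite (le_trans (le_ln1Dx _))//.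
    by rewrite ltr_pdivlMr//; lra.
  by rewrite ler_pdivrMr// (le_trans (ler_norm _)).
move=> P0 P'0 r; rewrite ler_norml h// andbT lerNl opprB h//; exact: relcl_sym.
Qed.

Lemma glip_ln : glip (fun P _ => ln P).
Proof.
move=> e1 e2 P P' Q Q' P0 P'0 Q0 Q'0 r1 [r2 _].
rewrite (le_trans (ln_relcl _ _ r1))// lerDl.
by rewrite -(pmulr_lge0 _ Q0) (le_trans _ r2).
Qed.

Lemma glip_lnavg : glip (fun P Q => ln (2^-1 * (P + Q))).
Proof.
move=> e1 e2 P P' Q Q' P0 P'0 Q0 Q'0 [r1 r1'] [r2 r2'].
have e10 : 0 <= e1 by rewrite -(pmulr_lge0 _ P0) (le_trans _ r1).
have e20 : 0 <= e2 by rewrite -(pmulr_lge0 _ Q0) (le_trans _ r2).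
apply: ln_relcl; [by rewrite mulr_gt0 ?addr_gt0..|].
have E : `|2^-1 * (P + Q) - 2^-1 * (P' + Q')| <= 2^-1 * (`|P - P'| + `|Q - Q'|).
  rewrite -mulrBr normrM gtr0_norm// ler_pM2l// opprD addrACA.
  exact: ler_normD.
by split; rewrite (le_trans E)// mulrCA ler_pM2l//; nra.
Qed.

Lemma glip_tanh : glip (fun P Q => (P - Q) / (P + Q)).
Proof.
have h eta P P' Q : 0 < P -> 0 < P' -> 0 < Q -> relcl eta P P' ->
    `|(P - Q) / (P + Q) - (P' - Q) / (P' + Q)| <= eta.
  move=> P0 P'0 Q0 [r1 r2].
  have -> : (P - Q) / (P + Q) - (P' - Q) / (P' + Q) =
      2 * Q * (P - P') / ((P + Q) * (P' + Q)).
    by field; rewrite !gt_eqF ?addr_gt0.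
  rewrite normrM normfV normrM (gtr0_norm (_ : 0 < 2 * Q)) ?mulr_gt0//.
  rewrite (gtr0_norm (_ : 0 < (P + Q) * (P' + Q))) ?mulr_gt0 ?addr_gt0//.
  rewrite ler_pdivrMr ?mulr_gt0 ?addr_gt0//.
  have e0 : 0 <= eta by rewrite -(pmulr_lge0 _ P0) (le_trans _ r1).
  (* The mean of the two bounds of [relcl] is symmetric in [P] and [P'], as is the denominator. *)
  have d : `|P - P'| <= eta * (P + P') / 2 by lra.
  apply: (@le_trans _ _ (2 * Q * (eta * (P + P') / 2))).
    by rewrite ler_pM2l ?mulr_gt0.
  rewrite -subr_ge0.
  rewrite (_ : _ - _ = eta * (P * P' + Q * Q)); last by field.
  by rewrite mulr_ge0// addr_ge0// mulr_ge0// ltW.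
move=> e1 e2 P P' Q Q' P0 P'0 Q0 Q'0 r1 r2.
rewrite (le_trans (ler_distD ((P' - Q) / (P' + Q)) _ _))// lerD ?h//.
have E (x y : R) : (x - y) / (x + y) = - ((y - x) / (y + x)) by rewrite -mulNr opprB (addrC y).
by rewrite !(E P') -opprD normrN h.
Qed.
End multiaffine.

Section factorization.
Context {R : realType} {V : finType} {p : nat}.
Variable beta : R.
Hypothesis beta0 : 0 < beta.
Local Notation conf := {ffun V -> bool}.

Definition magn (L : seq (@factor R V p beta)) (u : V) : R :=
  gavg (fprod L) (fun s => spin R (s u)).

Definition spins (s : conf) (l : seq V) : seq R := [seq spin R (s u) | u <- l].

Lemma spin_itv b : -1 <= spin R b <= 1.
Proof. by case: b; rewrite /spin; lra. Qed.

Lemma spin_norm b : `|spin R b| <= 1.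
Proof. by rewrite ler_norml spin_itv. Qed.

Lemma box_spins s l : box (spins s l).
Proof. by rewrite /box all_map; apply/allP => u _; exact: spin_itv. Qed.

Lemma magn_itv L u : -1 <= magn L u <= 1.
Proof.
by rewrite -ler_norml; apply: gavg_bounded => [s|s]; [exact: fprod_gt0|exact: spin_norm].
Qed.

Lemma box_magn L l : box (map (magn L) l).
Proof. by rewrite /box all_map; apply/allP => u _; exact: magn_itv. Qed.

(** As [Phi] is affine in its first slot, replacing the spin by its mean costs B (s_u - m_u), with B
    half the difference of [Phi] at 1 and -1. The mean of this is a covariance, controlled by the
    influence of the sites of [l] on [u]; the ratio bound turns |B| into (e^beta - 1)/2 times [Phi]
    at any value of the slot, which makes the error relative to both sides. *)
Lemma factor_step n L M Phi u l : maff (expR beta) M.+1 Phi -> size l = M ->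
  relcl ((expR beta - 1) * \sum_(b <- l) infl beta n (map (@fedge _ _ _ _) L) b u)
    (gavg (fprod L) (fun s => Phi (spin R (s u) :: spins s l)))
    (gavg (fprod L) (fun s => Phi (magn L u :: spins s l))).
Proof.
move=> [mP aP rP] sl; have W0 := fprod_gt0 L.
pose f (s : conf) : R := spin R (s u).
pose B s := (Phi (1 :: spins s l) - Phi (-1 :: spins s l)) / 2.
have ss s : size (spins s l) = M by rewrite size_map.
have bs s := box_spins s l.
have one1 : -1 <= (1 : R) <= 1 by lra.
have mone1 : -1 <= (-1 : R) <= 1 by lra.
have PhiE y s : -1 <= y <= 1 -> Phi (y :: spins s l) =
    (1 + y) / 2 * Phi (1 :: spins s l) + (1 - y) / 2 * Phi (-1 :: spins s l).
  by move=> y1; rewrite aP.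
have dB : dep (mem [set:: l]) B.
  move=> s s' ss'; rewrite /B /spins (_ : map _ l = [seq spin R (s' u) | u <- l])//.
  by apply/eq_in_map => v vl; rewrite ss'// inE.
have df : dep (pred1 u) f by move=> s s' ss'; rewrite /f ss'// inE.
have := cov_bound W0 dB (condavg_osc_seq beta0 (@influence_boundP _ _ _ _ beta0 n) L l df (fun s => spin_norm (s u))).
rewrite (_ : gavg _ (fun s => B s * _) =
  gavg (fprod L) (fun s => Phi (spin R (s u) :: spins s l)) -
  gavg (fprod L) (fun s => Phi (magn L u :: spins s l))); last first.
  rewrite -[X in _ = _ + X]mulN1r -gavgZ -gavgD; apply: eq_gavg => s.
  rewrite -/(magn L u) PhiE ?spin_itv// (PhiE (magn L u)) ?magn_itv// /B /f.
  by field.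
have e1 : 1 <= expR beta by rewrite ltW// expR_gt1.
have Bb s y : -1 <= y <= 1 -> `|B s| <= (expR beta - 1) / 2 * Phi (y :: spins s l).
  move=> y1; have [r1 r2] := rP _ (ss s) (bs s).
  have p1 := maff_gt0 (mP 1 one1) (ss s) (bs s).
  have p2 := maff_gt0 (mP (-1) mone1) (ss s) (bs s).
  rewrite PhiE// /B normrM normfV (gtr0_norm (_ : 0 < 2))//.
  rewrite [leRHS]mulrAC ler_pM2r// ler_norml.
  set P := Phi (1 :: _) in r1 r2 p1 *; set Q := Phi (-1 :: _) in r1 r2 p2 *.
  set e := expR beta in r1 r2 e1 *.
  have [y2 y3] := andP y1.
  set X := (1 + y) / 2 * P + _.
  have [PQ|QP] := leP P Q.
    have XP : P <= X.
      rewrite -subr_ge0 (_ : X - P = (1 - y) / 2 * (Q - P)); last by rewrite /X; field.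
      by rewrite mulr_ge0 ?subr_ge0// divr_ge0// subr_ge0.
    have : (e - 1) * P <= (e - 1) * X by rewrite ler_wpM2l// subr_ge0.
    by move=> ?; apply/andP; split; nra.
  have XQ : Q <= X.
    rewrite -subr_ge0 (_ : X - Q = (1 + y) / 2 * (P - Q)); last by rewrite /X; field.
    by rewrite mulr_ge0 ?subr_ge0 ?(ltW QP)// divr_ge0//; lra.
  have : (e - 1) * Q <= (e - 1) * X by rewrite ler_wpM2l// subr_ge0.
  by move=> ?; apply/andP; split; nra.
set I := \sum_(_ <- l) _ => h.
have I0 : 0 <= I by apply: sumr_ge0 => v _; exact: infl_ge0.
have key (y : conf -> R) : (forall s, -1 <= y s <= 1) ->
    2 * I * gavg (fprod L) (fun s => `|B s|) <=
    (expR beta - 1) * I * gavg (fprod L) (fun s => Phi (y s :: spins s l)).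
  move=> y1; apply: (@le_trans _ _ (2 * I * gavg (fprod L) (fun s => (expR beta - 1) / 2 *
      Phi (y s :: spins s l)))).
    by apply: ler_wpM2l; [rewrite mulr_ge0|apply: le_gavg => // s; exact: Bb].
  by rewrite gavgZ; lra.
by split; rewrite (le_trans h)// key// => s; [exact: spin_itv|exact: magn_itv].
Qed.

Fixpoint pairsum n (E : seq {ffun 'I_p -> V}) (l : seq V) : R :=
  if l is u :: l' then \sum_(b <- l') infl beta n E b u + pairsum n E l' else 0.

Lemma pairsum_ge0 n E l : 0 <= pairsum n E l.
Proof.
elim: l => //= u l ih; rewrite addr_ge0// sumr_ge0// => v _; exact: infl_ge0.
Qed.

(* Spins of distinct sites are replaced by their means one after the other; a
   repeated site contributes [infl b b = 1], so no distinctness is required. *)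
Lemma factorization n L Phi1 Phi2 g l : glip g ->
  maff (expR beta) (size l) Phi1 -> maff (expR beta) (size l) Phi2 ->
  `|g (gavg (fprod L) (fun s => Phi1 (spins s l))) (gavg (fprod L) (fun s => Phi2 (spins s l))) -
    g (Phi1 (map (magn L) l)) (Phi2 (map (magn L) l))| <=
  2 * (expR beta - 1) * pairsum n (map (@fedge _ _ _ _) L) l.
Proof.
move=> gg; elim: l Phi1 Phi2 => [|u l ih] Phi1 Phi2.
  by move=> _ _; rewrite /= !gavg_cst; [rewrite subrr normr0 mulr0|exact: fprod_gt0..].
move=> m1 m2 /=.
have W0 := fprod_gt0 L; have mu := magn_itv L u.
have pos Phi y s : maff (expR beta) (size l).+1 Phi -> -1 <= y <= 1 -> 0 < Phi (y :: spins s l).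
  by move=> m y1; apply: (maff_gt0 m); rewrite /= ?size_map// y1 box_spins.
have gp Phi (y : conf -> R) : maff (expR beta) (size l).+1 Phi -> (forall s, -1 <= y s <= 1) ->
    0 < gavg (fprod L) (fun s => Phi (y s :: spins s l)).
  by move=> m y1; apply: gavg_gt0 => // s; apply: pos.
rewrite mulrDr (le_trans (ler_distD (g (gavg (fprod L) (fun s => Phi1 (magn L u :: spins s l)))
  (gavg (fprod L) (fun s => Phi2 (magn L u :: spins s l)))) _ _))//; apply: lerD.
  rewrite (le_trans (gg _ _ _ _ _ _ _ _ _ _
     (@factor_step n L _ _ u l m1 erefl) (@factor_step n L _ _ u l m2 erefl)))//.
  - by apply: gp => // s; exact: spin_itv.
  - by apply: (gp _ (fun=> magn L u)).
  - by apply: gp => // s; exact: spin_itv.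
  - by apply: (gp _ (fun=> magn L u)).
  - lra.
have [p1 _ _] := m1; have [p2 _ _] := m2.
exact: (ih _ _ (p1 _ mu) (p2 _ mu)).
Qed.
End factorization.

(** * Clause weights and their Lipschitz constants *)

Section clause_weights.
Context {R : realType}.
Variables (beta : R) (p : nat).
Hypothesis beta0 : 0 < beta.
Local Notation sg := {ffun 'I_p -> bool}.

Definition dl (b b' : seq R) : R := \sum_(x <- zip b b') `|x.1 - x.2|.

Definition jprod (js : seq bool) (ys : seq R) : R :=
  \prod_(x <- zip js ys) ((1 + spin R x.1 * x.2) / 2).

Lemma jfactor_itv j (y : R) : -1 <= y <= 1 -> 0 <= (1 + spin R j * y) / 2 <= 1.
Proof. by move=> /andP[? ?]; case: j; rewrite /spin; apply/andP; split; lra. Qed.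

Lemma jprod_cons j js y ys : jprod (j :: js) (y :: ys) = (1 + spin R j * y) / 2 * jprod js ys.
Proof. by rewrite /jprod/= big_cons. Qed.

Lemma jprod_itv js ys : box ys -> 0 <= jprod js ys <= 1.
Proof.
elim: js ys => [|j js ih] [|y ys]/=; rewrite ?/jprod/= ?big_nil ?ler01 ?lexx//.
move=> /andP[y1 /ih]; rewrite -/(jprod (j :: js) (y :: ys)) jprod_cons.
have := jfactor_itv j y1; set a := _ / 2 => /andP[a0 a1] /andP[b0 b1].
by rewrite mulr_ge0//= mulr_ile1.
Qed.

(** Each factor is 1/2-Lipschitz and at most 1. This 1/2 is the one in the contraction condition. *)
Lemma jprod_dist js ys ys' : size ys = size ys' -> box ys -> box ys' ->
  `|jprod js ys - jprod js ys'| <= 2^-1 * dl ys ys'.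
Proof.
elim: js ys ys' => [|j js ih] [|y ys] [|y' ys']//=.
- by rewrite /jprod /dl/= !big_nil subrr normr0 mulr0.
- move=> _ _ _; rewrite /jprod/= !big_nil subrr normr0 mulr_ge0// sumr_ge0//.
- by rewrite /jprod /dl/= !big_nil subrr normr0 mulr0.
move=> [sy] /andP[y1 by1] /andP[y1' by1']; rewrite !jprod_cons /dl/= big_cons/= -/(dl ys ys').
have := ih _ _ sy by1 by1'; have /andP[b0 b1] := jprod_itv js by1.
have := jfactor_itv j y1'.
have -> : (1 + spin R j * y) / 2 = (1 + spin R j * y') / 2 + spin R j * (y - y') / 2 by field.
set a := (1 + spin R j * y') / 2 => /andP[a0 a1] h.
have -> : (a + spin R j * (y - y') / 2) * jprod js ys - a * jprod js ys' =
  spin R j * (y - y') / 2 * jprod js ys + a * (jprod js ys - jprod js ys') by ring.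
rewrite (le_trans (ler_normD _ _))// [leRHS]mulrDr lerD//.
  rewrite !normrM normfV (gtr0_norm (_ : 0 < 2))// [`|jprod _ _|]ger0_norm//.
  rewrite -[leRHS]mulr1 ler_pM// mulrC ler_pM2l//.
  by rewrite -[leRHS]mul1r ler_pM// spin_norm.
by rewrite normrM ger0_norm// (le_trans _ h)// ler_piMl.
Qed.

(** A clause weight some of whose factors are already evaluated, [k] being their product: freezing
    slots from the left stays in this family. *)
Definition cwl (k : R) js ys := 1 + (expR (- beta) - 1) * k * jprod js ys.

Let ebeta := expR (- beta).

Lemma ebeta_itv : 0 < expR (- beta) < 1.
Proof. by rewrite expR_gt0/= expR_lt1 oppr_lt0. Qed.

Lemma cwl_itv k js ys : 0 <= k <= 1 -> box ys -> expR (- beta) <= cwl k js ys <= 1.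
Proof.
move=> /andP[k0 k1] /(jprod_itv js); rewrite /cwl; set P := jprod _ _ => /andP[P0 P1].
have /andP[e0 e1] := ebeta_itv; set e := expR (- beta) in e0 e1 *.
have kP0 : 0 <= k * P by rewrite mulr_ge0.
have kP1 : k * P <= 1 by rewrite mulr_ile1.
by apply/andP; split; rewrite -mulrA; set t := k * P in kP0 kP1 *; nra.
Qed.

Lemma cwl_ratio k js ys ys' : 0 <= k <= 1 -> box ys -> box ys' ->
  cwl k js ys <= expR beta * cwl k js ys'.
Proof.
move=> k1 b b'; have /andP[_ h1] := cwl_itv js k1 b; have /andP[h2 _] := cwl_itv js k1 b'.
rewrite (le_trans h1)//; have := ler_wpM2l (ltW (expR_gt0 beta)) h2.
by rewrite -expRD subrr expR0.
Qed.

Lemma maff_cwl k js : 0 <= k <= 1 -> maff (expR beta) (size js) (cwl k js).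
Proof.
elim: js k => [|j js ih] k k1 /=.
  have /andP[+ _] := cwl_itv [::] k1 (isT : box [::]).
  by apply: lt_le_trans; exact: expR_gt0.
have one1 : -1 <= (1 : R) <= 1 by lra.
have mone1 : -1 <= (-1 : R) <= 1 by lra.
split=> [y y1|y ys sy bys y1|ys sy bys].
- rewrite (_ : (fun l => _) = cwl (k * ((1 + spin R j * y) / 2)) js).
    apply: ih; have /andP[a0 a1] := jfactor_itv j y1; have [k0 k1'] := andP k1.
    by rewrite mulr_ge0//= mulr_ile1.
  by apply/funext => l; rewrite /cwl jprod_cons !mulrA.
- by rewrite /cwl !jprod_cons; field.
- by split; apply: cwl_ratio; rewrite //= ?one1 ?mone1.
Qed.

(** The variation of the weight is at most (1 - e^(-beta))/2 times the distance, and the weight is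
    at least e^(-beta); the quotient is (e^beta - 1)/2. *)
Lemma cwl_relcl k js ys ys' : 0 <= k <= 1 -> size ys = size ys' -> box ys -> box ys' ->
  relcl (2^-1 * (expR beta - 1) * dl ys ys') (cwl k js ys) (cwl k js ys').
Proof.
move=> k01 sy b b'; have /andP[h1 _] := cwl_itv js k01 b; have /andP[h2 _] := cwl_itv js k01 b'.
have d0 : 0 <= dl ys ys' by apply: sumr_ge0.
have /andP[k0 k1] := k01; have /andP[e0 e1] := ebeta_itv.
suff h : `|cwl k js ys - cwl k js ys'| <= 2^-1 * (expR beta - 1) * dl ys ys' * expR (- beta).
  by split; rewrite (le_trans h)// ler_wpM2l// !mulr_ge0// subr_ge0 ltW// expR_gt1.
rewrite /cwl opprD addrACA subrr add0r -mulrBr normrM normrM.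
rewrite ler0_norm; last by rewrite subr_le0 ltW.
rewrite (ger0_norm k0).
have -> : 2^-1 * (expR beta - 1) * dl ys ys' * expR (- beta) =
   (1 - expR (- beta)) * (2^-1 * dl ys ys').
  have E : expR beta * expR (- beta) = 1 by rewrite -expRD subrr expR0.
  transitivity (2^-1 * dl ys ys' * (expR beta * expR (- beta) - expR (- beta))); first by ring.
  by rewrite E; ring.
rewrite opprB ler_pM//; first by rewrite mulr_ge0// subr_ge0 ltW.
  by rewrite ler_piMr// subr_ge0 ltW.
exact: jprod_dist.
Qed.
End clause_weights.

Section readouts.
Context {R : realType}.
Variables (beta : R) (p : nat).
Hypothesis beta0 : 0 < beta.
Local Notation sg := {ffun 'I_p -> bool}.

Definition cw (J : sg) (b : seq R) : R := cwl beta 1 (codom J) b.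
Definition cavw (eps : R) (J : sg) (b : seq R) : R := cw J (rcons b eps).

(** The slots of all clauses form one flat list, of which each clause consumes the next [q] entries;
    integrating over the inputs is then a single [It]. *)
Fixpoint FP q (w : sg -> seq R -> R) (Js : seq sg) (ys : seq R) : R :=
  if Js is J :: Js' then w J (take q ys) * FP q w Js' (drop q ys) else 1.

Definition block_lip q (a : R) (c1 c2 : sg -> seq R -> R) := forall J b b',
  size b = q -> size b' = q -> box b -> box b' -> exists eta1 eta2,
  [/\ relcl eta1 (c1 J b) (c1 J b'), relcl eta2 (c2 J b) (c2 J b')
    & eta1 + eta2 <= a * dl b b'].

Lemma ones01 : 0 <= (1 : R) <= 1. Proof. by rewrite ler01 lexx. Qed.

Lemma expbeta1 : 1 <= expR beta. Proof. by rewrite ltW// expR_gt1. Qed.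

Lemma maff_FP q w Js : (forall J, maff (expR beta) q (w J)) ->
  maff (expR beta) (size Js * q) (FP q w Js).
Proof.
move=> mw; elim: Js => [|J Js ih]; first by rewrite mul0n /= ltr01.
by rewrite mulSn; apply: maff_cat (mw J) ih; exact: expbeta1.
Qed.

Lemma FP_gt0 q w Js ys : (forall J, maff (expR beta) q (w J)) ->
  size ys = (size Js * q)%N -> box ys -> 0 < FP q w Js ys.
Proof. by move=> mw sy bys; apply: (maff_gt0 (maff_FP Js mw)). Qed.

Lemma dl_split q (ys ys' : seq R) : size ys = size ys' ->
  dl ys ys' = dl (take q ys) (take q ys') + dl (drop q ys) (drop q ys').
Proof.
move=> sy; rewrite /dl -big_cat/= -zip_cat ?cat_take_drop//.
by rewrite !size_take_min sy.
Qed.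

Lemma dl_cons (x x' : R) (ys ys' : seq R) : dl (x :: ys) (x' :: ys') = `|x - x'| + dl ys ys'.
Proof. by rewrite /dl/= big_cons. Qed.

Section lip.
Variables (q : nat) (a : R) (c1 c2 : sg -> seq R -> R) (g : R -> R -> R).
Hypotheses (gg : glip g) (m1 : forall J, maff (expR beta) q (c1 J)).
Hypotheses (m2 : forall J, maff (expR beta) q (c2 J)) (bl : block_lip q a c1 c2).

(** [P] and [Q] collect the weights of the blocks already replaced; relative closeness is
    insensitive to such prefactors. *)
Lemma FP_lip_gen Js ys ys' P Q : 0 < P -> 0 < Q ->
  size ys = (size Js * q)%N -> size ys' = (size Js * q)%N -> box ys -> box ys' ->
  `|g (P * FP q c1 Js ys) (Q * FP q c2 Js ys) -
    g (P * FP q c1 Js ys') (Q * FP q c2 Js ys')| <= a * dl ys ys'.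
Proof.
elim: Js ys ys' P Q => [|J Js ih] ys ys' P Q P0 Q0 /=.
  rewrite mul0n => /size0nil -> /size0nil -> _ _; rewrite subrr normr0.
  by rewrite /dl/= big_nil mulr0.
rewrite mulSn => sy sy' b b'.
have [st bt [sd bd]] := split_box sy b; have [st' bt' [sd' bd']] := split_box sy' b'.
have [e1 [e2 [r1 r2 e12]]] := bl J st st' bt bt'.
have p1 := maff_gt0 (m1 J) st bt; have p1' := maff_gt0 (m1 J) st' bt'.
have p2 := maff_gt0 (m2 J) st bt; have p2' := maff_gt0 (m2 J) st' bt'.
have f1 := FP_gt0 m1 sd bd; have f2 := FP_gt0 m2 sd bd.
rewrite !mulrA.
rewrite (le_trans (ler_distD (g (P * c1 J (take q ys') * FP q c1 Js (drop q ys))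
   (Q * c2 J (take q ys') * FP q c2 Js (drop q ys))) _ _))//.
rewrite (dl_split q) ?sy// mulrDr lerD//.
  rewrite (le_trans _ e12)//; apply: gg; [by rewrite !mulr_gt0..| |].
  - by rewrite !(mulrAC _ (c1 J _)); apply: relclZ => //; rewrite mulr_gt0.
  - by rewrite !(mulrAC _ (c2 J _)); apply: relclZ => //; rewrite mulr_gt0.
by apply: ih => //; rewrite mulr_gt0.
Qed.

Lemma FP_lip Js ys ys' :
  size ys = (size Js * q)%N -> size ys' = (size Js * q)%N -> box ys -> box ys' ->
  `|g (FP q c1 Js ys) (FP q c2 Js ys) - g (FP q c1 Js ys') (FP q c2 Js ys')| <= a * dl ys ys'.
Proof.
move=> s s' b b'; have := FP_lip_gen ltr01 ltr01 s s' b b'.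
by rewrite !mul1r.
Qed.

End lip.

Lemma maff_cw J : maff (expR beta) p (cw J).
Proof.
have := maff_cwl beta0 (codom J) ones01.
by rewrite size_codom card_ord.
Qed.

Lemma block_lip_cw : block_lip p (2^-1 * (expR beta - 1)) cw (fun _ _ => 1).
Proof.
move=> J b b' sb sb' bb bb'; exists (2^-1 * (expR beta - 1) * dl b b'), 0; split.
- by apply: cwl_relcl => //; [exact: ones01|rewrite sb sb'].
- exact: relclxx.
- by rewrite addr0.
Qed.

Hypothesis p0 : (0 < p)%N.

Definition lastJ (J : sg) : bool := nth false (codom J) p.-1.

(** The factor of the last spin involves no slot and becomes the constant [k] of [cwl]. *)
Lemma cavwE eps J b : size b = p.-1 ->
  cavw eps J b = cwl beta ((1 + spin R (lastJ J) * eps) / 2) (take p.-1 (codom J)) b.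
Proof.
move=> sb; rewrite /cavw /cw /cwl mulr1.
have -> : codom J = rcons (take p.-1 (codom J)) (lastJ J).
  have sJ : size (codom J) = p by rewrite size_codom card_ord.
  by rewrite /lastJ -take_nth ?sJ ?prednK// take_oversize// sJ.
rewrite -cats1 take_size_cat; last by rewrite size_takel// size_codom card_ord leq_pred.
rewrite cats1 /jprod zip_rcons ?sb ?size_takel ?size_codom ?card_ord ?leq_pred//.
by rewrite big_rcons/=; ring.
Qed.

Lemma eps01 (e j : bool) : 0 <= (1 + spin R j * spin R e) / 2 <= 1.
Proof. by case: e; case: j; rewrite /spin; apply/andP; split; lra. Qed.

Lemma maff_ext M (Phi Psi : seq R -> R) : (forall ys, size ys = M -> Phi ys = Psi ys) ->
  maff (expR beta) M Phi -> maff (expR beta) M Psi.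
Proof.
elim: M Phi Psi => [|M ih] Phi Psi E /=; first by rewrite E.
move=> [mP aP rP]; split=> [y y1|y ys sy b y1|ys sy b].
- by apply: ih (mP y y1) => ys sy; rewrite E//= sy.
- have := aP y ys sy b y1.
  by rewrite (E (y :: ys)) ?(E (1 :: ys)) ?(E (-1 :: ys)) //= sy.
- by have := rP ys sy b; rewrite (E (1 :: ys)) ?(E (-1 :: ys)) //= sy.
Qed.

Lemma maff_cavw e J : maff (expR beta) p.-1 (cavw (spin R e) J).
Proof.
have := maff_cwl beta0 (take p.-1 (codom J)) (eps01 e (lastJ J)).
rewrite size_takel ?size_codom ?card_ord ?leq_pred//.
by apply: maff_ext => ys sy; rewrite cavwE.
Qed.

(** For one of the two values of the last spin its factor vanishes and the weight is constant, so
    only one of the two relative errors is nonzero. Otherwise the bound on their sum would be twice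
    as large. *)
Lemma block_lip_cavw : block_lip p.-1 (2^-1 * (expR beta - 1))
  (cavw (spin R true)) (cavw (spin R false)).
Proof.
move=> J b b' sb sb' bb bb'; rewrite !cavwE//.
have h e := cwl_relcl beta0 (take p.-1 (codom J)) (eps01 e (lastJ J))
  (etrans sb (esym sb')) bb bb'.
have c e : spin R (lastJ J) * spin R e = -1 -> relcl 0
    (cwl beta ((1 + spin R (lastJ J) * spin R e) / 2) (take p.-1 (codom J)) b)
    (cwl beta ((1 + spin R (lastJ J) * spin R e) / 2) (take p.-1 (codom J)) b').
  by move=> ->; rewrite /cwl subrr mul0r mulr0 !mul0r addr0; exact: relclxx.
have [jt|jf] : lastJ J = true \/ lastJ J = false by case: (lastJ J); [left|right].
- exists (2^-1 * (expR beta - 1) * dl b b'), 0; split; rewrite ?addr0//.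
  by apply: c; rewrite jt /spin mul1r.
- exists 0, (2^-1 * (expR beta - 1) * dl b b'); split; rewrite ?add0r//.
  by apply: c; rewrite jf /spin mulr1.
Qed.

Lemma theta_cw J (y : 'I_p -> R) (ys : seq R) : size ys = p ->
  (forall i : 'I_p, y i = nth 0 ys i) -> theta beta J y = ln (cw J ys).
Proof.
move=> sy yE; rewrite /theta /cw /cwl mulr1; congr (ln (1 + _ * _)).
rewrite /jprod (big_nth (false, 0)) size_zip size_codom card_ord sy minnn big_mkord.
apply: eq_bigr => i _; rewrite nth_zip ?size_codom ?card_ord ?sy//= yE.
by rewrite (nth_map i) ?size_enum_ord// nth_ord_enum.
Qed.

Lemma cw_gt0 J b : box b -> 0 < cw J b.
Proof.
move=> bb; have /andP[h _] := cwl_itv beta0 (codom J) ones01 bb.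
by rewrite (lt_le_trans _ h)// expR_gt0.
Qed.

Lemma cw_bounds J b : box b -> expR (- beta) <= cw J b <= 1.
Proof. by move=> bb; exact: (cwl_itv beta0 _ ones01 bb). Qed.

Lemma FP_flatten q w (Js : seq sg) (bs : seq (seq R)) : size Js = size bs ->
  (forall b, b \in bs -> size b = q) ->
  FP q w Js (flatten bs) = \prod_(x <- zip Js bs) w x.1 x.2.
Proof.
elim: Js bs => [|J Js ih] [|b bs]//=; first by rewrite big_nil.
move=> [sJ] sb; rewrite big_cons/= take_size_cat ?drop_size_cat ?sb ?mem_head// ih//.
by move=> c cb; rewrite sb// in_cons cb orbT.
Qed.
End readouts.

(** * Random clause systems *)

Section averages.
Context {R : realType}.
Implicit Types A B : finType.

Lemma eq_avg A (f g : A -> R) : f =1 g -> avg f = avg g.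
Proof. by move=> /funext ->. Qed.

Lemma avgD A (f g : A -> R) : avg (fun x => f x + g x) = avg f + avg g.
Proof. by rewrite /avg big_split mulrDr. Qed.

Lemma avgZ A k (f : A -> R) : avg (fun x => k * f x) = k * avg f.
Proof. by rewrite /avg -mulr_sumr mulrCA. Qed.

Lemma avgN A (f : A -> R) : avg (fun x => - f x) = - avg f.
Proof. by rewrite /avg sumrN mulrN. Qed.

Lemma avgB A (f g : A -> R) : avg (fun x => f x - g x) = avg f - avg g.
Proof. by rewrite avgD avgN. Qed.

Lemma avg_sum A (I : Type) (s : seq I) (P : pred I) (f : I -> A -> R) :
  avg (fun x => \sum_(i <- s | P i) f i x) = \sum_(i <- s | P i) avg (f i).
Proof. by rewrite /avg exchange_big mulr_sumr. Qed.

Lemma le_avg A (f g : A -> R) : (forall x, f x <= g x) -> avg f <= avg g.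
Proof. by move=> fg; rewrite /avg ler_wpM2l ?invr_ge0// ler_sum. Qed.

Lemma avg_ge0 A (f : A -> R) : (forall x, 0 <= f x) -> 0 <= avg f.
Proof. by move=> f0; rewrite mulr_ge0 ?invr_ge0// sumr_ge0. Qed.

Lemma avg_norm A (f : A -> R) : `|avg f| <= avg (fun x => `|f x|).
Proof.
rewrite /avg normrM ger0_norm ?invr_ge0// ler_wpM2l ?invr_ge0//.
exact: ler_norm_sum.
Qed.

Lemma avg_cst A k : (0 < #|A|)%N -> avg (fun _ : A => k : R) = k.
Proof.
by move=> A0; rewrite /avg sumr_const -[k *+ _]mulr_natl mulrA mulVf ?mul1r// pnatr_eq0 -lt0n.
Qed.

Lemma avg_bounded A (f : A -> R) k : (0 < #|A|)%N -> (forall x, `|f x| <= k) -> `|avg f| <= k.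
Proof.
by move=> A0 fk; rewrite (le_trans (avg_norm f))// -[leRHS](avg_cst _ A0) le_avg.
Qed.

Lemma avg_pair A B (f : A * B -> R) : avg f = avg (fun x => avg (fun y => f (x, y))).
Proof.
rewrite /avg card_prod natrM invfM -mulrA; congr (_ * _).
by rewrite -mulr_sumr pair_bigA/=; congr (_ * _); apply: eq_bigr => -[].
Qed.

Lemma avg_prod (I A : finType) (F : I -> A -> R) :
  avg (fun e : {ffun I -> A} => \prod_i F i (e i)) = \prod_i avg (F i).
Proof.
rewrite {1}/avg -(bigA_distr_bigA F) card_ffun natrX -exprVn.
by rewrite -[_ ^+ _]prodr_const -big_split.
Qed.

Section two_coordinates.
Variables (I A : finType).
Hypothesis A0 : (0 < #|A|)%N.

Lemma avg_coord (a : I) (f : A -> R) : avg (fun e : {ffun I -> A} => f (e a)) = avg f.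
Proof.
transitivity (avg (fun e : {ffun I -> A} => \prod_i (if i == a then f (e i) else 1))).
  by apply: eq_avg => e; rewrite (bigD1 a)//= eqxx big1 ?mulr1// => i /negbTE ->.
rewrite (avg_prod (fun i x => if i == a then f x else 1)) (bigD1 a)//= eqxx.
by rewrite big1 ?mulr1// => i /negbTE ->; rewrite avg_cst.
Qed.

Lemma avg_coord2 (a b : I) (f h : A -> R) : b != a ->
  avg (fun e : {ffun I -> A} => f (e a) * h (e b)) = avg f * avg h.
Proof.
move=> ba.
transitivity (avg (fun e : {ffun I -> A} =>
    \prod_i (if i == a then f (e i) else if i == b then h (e i) else 1))).
  apply: eq_avg => e; rewrite (bigD1 a)//= eqxx (bigD1 b)//= (negbTE ba) eqxx.
  by rewrite big1 ?mulr1// => i /andP[/negbTE -> /negbTE ->].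
rewrite (avg_prod (fun i x => if i == a then f x else if i == b then h x else 1)).
rewrite (bigD1 a)//= eqxx (bigD1 b)//= (negbTE ba) eqxx.
by rewrite big1 ?mulr1// => i /andP[/negbTE -> /negbTE ->]; rewrite avg_cst.
Qed.
End two_coordinates.

Lemma avg_delta A (i : A) : avg (fun u => (u == i)%:R) = #|A|%:R^-1 :> R.
Proof.
rewrite /avg (bigD1 i)//= eqxx big1 ?addr0 ?mulr1// => u /negbTE ->.
by [].
Qed.
End averages.

(** * Mean influence in a Poisson system of clauses *)

Section mean_influence.
Context {R : realType} {V : finType} {p : nat}.
Variables (alpha beta : R).
Hypotheses (alpha0 : 0 < alpha) (beta0 : 0 < beta) (V0 : (0 < #|V|)%N).
Local Notation sg := {ffun 'I_p -> bool}.
Local Notation hedge := {ffun 'I_p -> V}.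
Local Notation clause := (sg * hedge)%type.
Local Notation NV := (#|V|%:R : R).
Local Notation cb := (Num.min (4 * beta) 1).

Definition unif (C : finType) (lam : R) : C -> R := fun=> lam / #|C|%:R.

Lemma wsum_unif (C : finType) (lam : R) (phi : C -> R) : wsum (unif lam) phi = lam * avg phi.
Proof. by rewrite /wsum /unif -mulr_sumr /avg mulrA. Qed.

Lemma mass_unif (C : finType) (lam : R) : (0 < #|C|)%N -> mass (@unif C lam) = lam.
Proof.
move=> C0; rewrite -[RHS]mulr1 -(avg_cst 1 C0) -wsum_unif /wsum.
by apply: eq_bigr => c _; rewrite mulr1.
Qed.

Lemma unif_ge0 (C : finType) (lam : R) : 0 <= lam -> forall c : C, 0 <= unif lam c.
Proof. by move=> l0 c; rewrite divr_ge0. Qed.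

(* Growth rate of the mean influence: a site lies in [p * alpha] clauses on
   average, each of which passes on to [p - 1] sites at most the fraction [cb]. *)
Definition kappa : R := cb * p.-1%:R * p%:R * alpha.

Lemma sg_gt0 : (0 < #|{: sg}|)%N.
Proof. by apply/card_gt0P; exists [ffun=> true]. Qed.

Lemma NV0 : 0 < NV. Proof. by rewrite ltr0n. Qed.

Variable nu : clause -> R.
Hypotheses (nu0 : forall c, 0 <= nu c) (nule : forall c, nu c <= unif (alpha * NV) c).

Definition Einfl n i t : R := PP nu (fun G => infl beta n (unzip2 G) i t).

Lemma gr_infl n i t : gr (fun G : seq clause => infl beta n (unzip2 G) i t).
Proof.
by apply: (@gr_bounded _ _ _ 1) => l; rewrite ger0_norm ?infl_ge0 ?infl_le1.
Qed.

Lemma Einfl_ge0 n i t : 0 <= Einfl n i t.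
Proof. by apply: PP_ge0 => //; [exact: gr_infl|move=> l; exact: infl_ge0]. Qed.

Lemma Einfl_le1 n i t : Einfl n i t <= 1.
Proof.
rewrite -[leRHS](PP_cst nu 1); apply: le_PP => //; first exact: gr_infl.
  by apply: (@gr_bounded _ _ _ 1) => l; rewrite normr1.
by move=> l; exact: infl_le1.
Qed.

(** Mecke's formula takes out the first clause of the walk and leaves a process of the same
    intensity. In a uniform clause, position [a] hits [i] with probability 1/N while the site at [b]
    is uniform and independent of it; the total rate of clauses is at most alpha N. *)
Lemma EinflS n i t : i != t -> Einfl n.+1 i t <= kappa * avg (fun u => Einfl n u t).
Proof.
move=> it.
pose H (c : clause) (G : seq clause) := cb * \sum_(a < p) \sum_(b < p | b != a)
  (c.2 a == i)%:R * infl beta n (unzip2 G) (c.2 b) t.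
have gH c : gr (H c).
  apply: grZ; apply: gr_sum => a; apply: gr_sum => b; apply: grZ; exact: gr_infl.
apply: (@le_trans _ _ (PP nu (RS H))).
  apply: le_PP => //; [exact: gr_infl|exact: gr_RS|].
  by move=> l; rewrite /= (negbTE it) ge_min RS_map lexx orbT.
rewrite PP_RS//.
have HE c : PP nu (H c) = cb * \sum_(a < p) \sum_(b < p | b != a)
    (c.2 a == i)%:R * Einfl n (c.2 b) t.
  rewrite PPZ//; last first.
    by apply: gr_sum => a; apply: gr_sum => b; apply: grZ; exact: gr_infl.
  congr (_ * _); rewrite PP_sum//; last first.
    by move=> a; apply: gr_sum => b; apply: grZ; exact: gr_infl.
  apply: eq_bigr => a _; rewrite PP_sum//; last by move=> b; apply: grZ; exact: gr_infl.
  by apply: eq_bigr => b _; rewrite PPZ//; exact: gr_infl.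
apply: (@le_trans _ _ (wsum (unif (alpha * NV)) (fun c : clause => PP nu (H c)))).
  apply: ler_sum => c _; apply: ler_wpM2r => //; rewrite HE mulr_ge0 ?cb_ge0//.
  by do 2!apply: sumr_ge0 => ? _; rewrite mulr_ge0 ?Einfl_ge0.
rewrite wsum_unif; under eq_avg do rewrite HE.
rewrite avgZ avg_sum.
have E a : avg (fun c : clause => \sum_(b < p | b != a) (c.2 a == i)%:R * Einfl n (c.2 b) t) =
    p.-1%:R * (NV^-1 * avg (fun u => Einfl n u t)).
  rewrite avg_sum (eq_bigr (fun=> NV^-1 * avg (fun u => Einfl n u t))).
    by rewrite sumr_const -[LHS]mulr_natl (cardC1 a) card_ord.
  move=> b ba; rewrite avg_pair/= avg_cst ?sg_gt0//.
  rewrite (avg_coord2 V0 (fun u => (u == i)%:R) (fun u => Einfl n u t) ba).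
  by rewrite avg_delta.
under eq_bigr do rewrite E; rewrite sumr_const card_ord -[_ *+ p]mulr_natl.
rewrite le_eqVlt; apply/orP; left; apply/eqP.
by rewrite /kappa; field; rewrite gt_eqF// NV0.
Qed.

Hypothesis kappa1 : kappa < 1.

Lemma kappa_ge0 : 0 <= kappa.
Proof. by rewrite !mulr_ge0 ?cb_ge0// ltW. Qed.

(** The mean influence x satisfies a recursion x' <= 1/N + kappa x, the term 1/N coming from the
    walk that starts at [t]. *)
Lemma avg_Einfl n t : avg (fun u => Einfl n u t) <= NV^-1 / (1 - kappa) + kappa ^+ n.
Proof.
have k1 : 0 < 1 - kappa by rewrite subr_gt0.
have n0 := NV0; have k0 := kappa_ge0.
elim: n => [|n ih].
  rewrite expr0 ler_wpDl ?divr_ge0 ?invr_ge0//; first exact: ltW.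
  by rewrite -[leRHS](avg_cst _ V0) le_avg// => u; exact: Einfl_le1.
apply: (@le_trans _ _ (avg (fun u => (u == t)%:R + kappa * avg (fun u => Einfl n u t)))).
  apply: le_avg => u; case: eqVneq => [->|ut].
    rewrite ler_wpDr ?Einfl_le1// mulr_ge0//.
    by rewrite avg_ge0// => v; exact: Einfl_ge0.
  by rewrite add0r EinflS.
rewrite avgD avg_delta avg_cst// exprS.
rewrite (le_trans (lerD (lexx _) (ler_wpM2l k0 ih)))// mulrDr addrA lerD2r.
rewrite le_eqVlt; apply/orP; left; apply/eqP; field.
by rewrite (gt_eqF n0) gt_eqF.
Qed.

(** The depth is chosen after the number of sites, so that the truncation term kappa^n is O(1/N) as
    well. *)
Lemma Einfl_bound n i t : kappa ^+ n <= NV^-1 ->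
  Einfl n.+1 i t <= (i == t)%:R + (1 / (1 - kappa) + 1) / NV.
Proof.
move=> kn; have k1 : 0 < 1 - kappa by rewrite subr_gt0.
have n0 := NV0; have k0 := kappa_ge0.
have C0 : 0 <= (1 / (1 - kappa) + 1) / NV.
  by rewrite mulr_ge0 ?invr_ge0 ?addr_ge0 ?divr_ge0// ltW.
case: eqVneq => [->|it]; first by rewrite ler_wpDr// Einfl_le1.
rewrite add0r (le_trans (EinflS n it))//.
have a0 : 0 <= avg (fun u => Einfl n u t) by apply: avg_ge0 => u; exact: Einfl_ge0.
rewrite (le_trans (ler_piMl a0 (ltW kappa1)))//.
rewrite (le_trans (avg_Einfl n t))//.
rewrite (le_trans (lerD (lexx _) kn))//.
by rewrite mulrDl !mul1r mulrC.
Qed.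
End mean_influence.

Lemma small_power {R : realType} (k e : R) : 0 <= k < 1 -> 0 < e -> exists n, k ^+ n <= e.
Proof.
move=> /andP[k0 k1] e0; have nk : `|k| < 1 by rewrite ger0_norm.
have /cvgrPdist_le /(_ _ e0)[n _ /(_ n (leqnn n))] := cvg_expr nk.
by rewrite /= sub0r normrN => hn; exists n; rewrite (le_trans (ler_norm _)).
Qed.

(** * Uniform averages over functions as averages over lists *)

Section list_averages.
Context {R : realType}.

Lemma avg_ffunS (A : finType) n (F : seq A -> R) :
  avg (fun e : {ffun 'I_n.+1 -> A} => F (codom e)) =
  avg (fun x => avg (fun e : {ffun 'I_n -> A} => F (x :: codom e))).
Proof.
pose h (x : A * {ffun 'I_n -> A}) : {ffun 'I_n.+1 -> A} :=
  [ffun i => if unlift ord0 i is Some j then x.2 j else x.1].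
pose h' (e : {ffun 'I_n.+1 -> A}) : A * {ffun 'I_n -> A} :=
  (e ord0, [ffun j => e (lift ord0 j)]).
have hK : cancel h h'.
  move=> [x e]; rewrite /h /h'; congr (_, _); first by rewrite ffunE unlift_none.
  by apply/ffunP => j; rewrite !ffunE liftK.
have h'K : cancel h' h.
  move=> e; apply/ffunP => i; rewrite !ffunE/=.
  by case: unliftP => [j ->|->]; rewrite ?ffunE.
rewrite -(avg_pair (fun x : A * {ffun 'I_n -> A} => F (x.1 :: codom x.2))).
rewrite /avg (reindex h); last by exists h'; [move=> ? _; exact: hK|move=> ? _; exact: h'K].
congr (_^-1 * _); first by rewrite (bij_eq_card (Bijective hK h'K)).
apply: eq_bigr => -[x e] _; congr F; rewrite /codom /image_mem enum_ordSl/=.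
congr (_ :: _); first by rewrite ffunE unlift_none.
by rewrite -map_comp; apply: eq_map => j /=; rewrite ffunE liftK.
Qed.

Lemma avg_ffun_It (A : finType) n (F : seq A -> R) :
  avg (fun e : {ffun 'I_n -> A} => F (codom e)) = It (@avg R A) n F.
Proof.
elim: n F => [|n ih] F /=; last first.
  by rewrite avg_ffunS; apply: eq_avg => x; rewrite -ih.
transitivity (avg (fun e : {ffun 'I_0 -> A} => F [::])).
  by apply: eq_avg => e; congr F; apply: size0nil; rewrite size_codom card_ord.
by rewrite avg_cst// card_ffun card_ord expn0.
Qed.

Lemma wsum_unif1 (A : finType) (phi : A -> R) : avg phi = wsum (unif 1) phi.
Proof. by rewrite wsum_unif mul1r. Qed.

Lemma It_avgE (A : finType) n (F : seq A -> R) :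
  It (@avg R A) n F = It (wsum (unif 1)) n F.
Proof. by apply: eq_It => // phi; exact: wsum_unif1. Qed.

Lemma It_unif (A : finType) (lam : R) n (F : seq A -> R) :
  It (wsum (unif lam)) n F = lam ^+ n * It (@avg R A) n F.
Proof.
elim: n F => [|n ih] F /=; first by rewrite mul1r.
rewrite wsum_unif exprS -mulrA -[X in _ = _ * X]avgZ; congr (_ * _); apply: eq_avg => x.
by rewrite ih.
Qed.

Section It_avg_lemmas.
Variable A : finType.
Hypothesis A0 : (0 < #|A|)%N.
Local Notation Ia := (It (@avg R A)).
Let u0 : forall c : A, 0 <= unif (1 : R) c. Proof. exact: unif_ge0 ler01. Qed.

Lemma ItaD n F G : Ia n (fun l => F l + G l) = Ia n F + Ia n G.
Proof. by rewrite !It_avgE psumD. Qed.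
Lemma ItaZ n k F : Ia n (fun l => k * F l) = k * Ia n F.
Proof. by rewrite !It_avgE psumZ. Qed.
Lemma ItaB n F G : Ia n (fun l => F l - G l) = Ia n F - Ia n G.
Proof.
rewrite -[in RHS]mulN1r -ItaZ -ItaD; congr It.
by apply/funext => l; rewrite mulN1r.
Qed.
Lemma Ita_cst n k : Ia n (fun=> k) = k.
Proof. by rewrite It_avgE psum_cst mass_unif// expr1n mul1r. Qed.
Lemma le_Ita n F G : (forall l, size l = n -> F l <= G l) -> Ia n F <= Ia n G.
Proof. by move=> h; rewrite !It_avgE; exact: le_psum. Qed.
Lemma Ita_norm n F : `|Ia n F| <= Ia n (fun l => `|F l|).
Proof. by rewrite !It_avgE; exact: psum_norm. Qed.
Lemma Ita_bound n F B : (forall l, size l = n -> `|F l| <= B) -> `|Ia n F| <= B.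
Proof. by move=> h; rewrite (le_trans (Ita_norm _ _))// -[leRHS](Ita_cst n) le_Ita. Qed.
Lemma Ita_dist n F G H : (forall l, size l = n -> `|F l - G l| <= H l) ->
  `|Ia n F - Ia n G| <= Ia n H.
Proof. by move=> h; rewrite -ItaB (le_trans (Ita_norm _ _))// le_Ita. Qed.
Lemma Ita_sum (I : Type) (s : seq I) (P : pred I) n (F : I -> seq A -> R) :
  Ia n (fun l => \sum_(i <- s | P i) F i l) = \sum_(i <- s | P i) Ia n (F i).
Proof. by rewrite It_avgE psum_sum; apply: eq_bigr => i _; rewrite It_avgE. Qed.
Lemma Ita_avg (B : finType) n (F : B -> seq A -> R) :
  Ia n (fun l => avg (F^~ l)) = avg (fun b => Ia n (F b)).
Proof. by rewrite /avg ItaZ Ita_sum. Qed.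

Lemma Ita_sumf n (f : A -> R) : Ia n (fun l => \sum_(b <- l) f b) = n%:R * avg f.
Proof.
elim: n => [|n ih] /=; first by rewrite big_nil mul0r.
transitivity (avg (fun x => f x + n%:R * avg f)).
  apply: eq_avg => x; rewrite -ih -[X in X + _](Ita_cst n) -ItaD.
  by congr It; apply/funext => l; rewrite big_cons.
by rewrite avgD avg_cst// -natr1 mulrDl mul1r addrC.
Qed.

Fixpoint pairs (h : A -> A -> R) (l : seq A) : R :=
  if l is u :: l' then \sum_(b <- l') h b u + pairs h l' else 0.

Lemma Ita_pairs n (h : A -> A -> R) rho : (forall u, avg (h^~ u) <= rho) -> 0 <= rho ->
  Ia n (pairs h) <= n%:R ^+ 2 * rho.
Proof.
move=> hr r0; elim: n => [|n ih] /=; first by rewrite expr2 mul0r mul0r.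
apply: (@le_trans _ _ (avg (fun _ : A => n%:R * rho + n%:R ^+ 2 * rho))).
  apply: le_avg => u; rewrite ItaD Ita_sumf lerD//.
  by rewrite ler_wpM2l.
rewrite avg_cst// -mulrDl ler_wpM2r// -natr1.
by have := ler0n R n; nra.
Qed.
End It_avg_lemmas.

(** Uniform clauses amount to signs and, independently, one flat list of i.i.d. uniform sites, which
    is the format read by [FP]. *)
Lemma It_pair_flatten (S A : finType) q r (F : seq S -> seq A -> R) :
  It (@avg R (S * {ffun 'I_q -> A})%type) r
    (fun l => F (unzip1 l) (flatten (map (fun x : S * {ffun 'I_q -> A} => codom x.2) l))) =
  It (@avg R S) r (fun Js => It (@avg R A) (r * q) (F Js)).
Proof.
elim: r F => [|r ih] F /=; first by [].
rewrite avg_pair; apply: eq_avg => J.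
under eq_avg do rewrite (ih (fun Js l => F (J :: Js) (codom _ ++ l))).
rewrite -Ita_avg; congr It; apply/funext => Js.
by rewrite mulSn It_add -avg_ffun_It.
Qed.
End list_averages.

Section poisson_expectation.
Context {R : realType}.
Implicit Types (f g : nat -> R) (lam : R).

Definition EPo lam f : R := expR (- lam) * xsum (fun r => lam ^+ r * f r).

Lemma EPo_gb lam f : gbnd f -> gbnd (fun r => lam ^+ r * f r).
Proof. by move=> gf; apply: gbndM gf; exact: gbnd_pow. Qed.

Lemma eq_EPo lam f g : f =1 g -> EPo lam f = EPo lam g.
Proof. by move=> /funext ->. Qed.

Lemma EPoD lam f g : gbnd f -> gbnd g -> EPo lam (fun r => f r + g r) = EPo lam f + EPo lam g.
Proof.
move=> gf gg; rewrite /EPo -mulrDr -xsumD; [|exact: EPo_gb..].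
by congr (_ * _); apply: eq_xsum => r; rewrite mulrDr.
Qed.

Lemma EPoZ lam k f : gbnd f -> EPo lam (fun r => k * f r) = k * EPo lam f.
Proof.
move=> gf; rewrite /EPo [RHS]mulrCA -[in RHS]xsumZ; last exact: EPo_gb.
by congr (_ * _); apply: eq_xsum => r; rewrite mulrCA.
Qed.

Lemma EPoB lam f g : gbnd f -> gbnd g -> EPo lam (fun r => f r - g r) = EPo lam f - EPo lam g.
Proof.
move=> gf gg; rewrite EPoD//; last exact: gbndN.
rewrite -[in RHS]mulN1r -EPoZ//; congr (_ + _); apply: eq_EPo => r.
by rewrite mulN1r.
Qed.

Lemma EPo_cst lam k : EPo lam (fun=> k) = k.
Proof.
rewrite /EPo; under eq_xsum do rewrite mulrC.
rewrite xsumZ; last exact: gbnd_pow.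
by rewrite xsum_expR mulrCA -expRD addNr expR0 mulr1.
Qed.

Lemma EPo_nat lam : EPo lam (fun r => r%:R) = lam.
Proof.
rewrite /EPo (_ : (fun r => _) = (fun r => r%:R * (lam * lam ^+ r.-1))).
  rewrite (@xsum_shift _ (fun r => lam * lam ^+ r)); last by apply: gbndZ; exact: gbnd_pow.
  rewrite xsumZ; last exact: gbnd_pow.
  by rewrite xsum_expR mulrCA -expRD addNr expR0 mulr1.
apply/funext => -[|r]; first by rewrite mulr0 mul0r.
by rewrite /= -exprS mulrC.
Qed.

Lemma le_EPo lam f g : 0 <= lam -> gbnd f -> gbnd g -> (forall r, f r <= g r) ->
  EPo lam f <= EPo lam g.
Proof.
move=> l0 gf gg fg; rewrite ler_wpM2l ?expR_ge0// le_xsum//; [exact: EPo_gb..|].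
by move=> r; rewrite ler_wpM2l ?exprn_ge0.
Qed.

Lemma EPo_ge0 lam f : 0 <= lam -> gbnd f -> (forall r, 0 <= f r) -> 0 <= EPo lam f.
Proof.
by move=> l0 gf f0; rewrite -(EPo_cst lam 0); apply: le_EPo => //; exact: gbnd_cst.
Qed.

Lemma EPo_dist lam f g h : 0 <= lam -> gbnd f -> gbnd g -> gbnd h ->
  (forall r, `|f r - g r| <= h r) -> `|EPo lam f - EPo lam g| <= EPo lam h.
Proof.
move=> l0 gf gg gh fgh; rewrite -EPoB//.
have gfg : gbnd (fun r => f r - g r) by apply: gbndD => //; exact: gbndN.
rewrite ler_norml -[- EPo lam h]mulN1r -EPoZ//; apply/andP; split.
  apply: le_EPo => // [|r]; first exact: gbndZ.
  by have := fgh r; rewrite ler_norml mulN1r => /andP[].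
by apply: le_EPo => // r; rewrite (le_trans (ler_norm _)).
Qed.

Lemma PP_unif (C : finType) lam (F : seq C -> R) : (0 < #|C|)%N ->
  PP (unif lam) F = EPo lam (fun r => It (@avg R C) r F).
Proof.
move=> C0; rewrite /PP /EPo mass_unif//; congr (_ * _); apply: eq_xsum => r.
exact: It_unif.
Qed.

Lemma gbnd_Ita (C : finType) (F : seq C -> R) : (0 < #|C|)%N -> gr F ->
  gbnd (fun r => It (@avg R C) r F).
Proof.
move=> C0 [K FK]; exists K => r; apply: Ita_bound => // l lr.
by rewrite -lr.
Qed.

(** A Poisson number is the size of a Poisson process on a one-point set, so this is an instance of
    [PP_swap]. *)
Lemma EPo_PP (C : finType) (mu : C -> R) lam (F : nat -> seq C -> R) : 0 <= lam ->
  (forall c, 0 <= mu c) -> (exists K : R, forall r l, `|F r l| <= K ^+ (r + size l).+1) ->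
  EPo lam (fun r => PP mu (F r)) = PP mu (fun l => EPo lam (F^~ l)).
Proof.
move=> l0 mu0 [K FK].
pose G (l : seq unit) := F (size l).
have C0 : (0 < #|{: unit}|)%N by rewrite card_unit.
have gG : gr2 G by exists K => l l'; rewrite /G FK.
have u0 := unif_ge0 (C := unit) l0.
have E (H : nat -> R) : EPo lam H = PP (unif lam) (fun l : seq unit => H (size l)).
  rewrite PP_unif//; apply: eq_EPo => r.
  rewrite -[LHS](Ita_cst C0 r); apply: eq_It => // l lr.
  by rewrite lr.
by rewrite E (PP_swap u0 mu0 gG); apply: eq_PP => l; rewrite E.
Qed.
End poisson_expectation.

Section support.
Context {R : realType} {C : finType}.
Variables (nu : C -> R) (P : pred C).
Hypotheses (nu0 : forall c, 0 <= nu c) (nuP : forall c, ~~ P c -> nu c = 0).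

Lemma eq_PP_supp (F G : seq C -> R) : (forall l, all P l -> F l = G l) -> PP nu F = PP nu G.
Proof.
move=> FG; rewrite /PP; congr (_ * _); apply: eq_xsum => r.
elim: r F G FG => [|r ih] F G FG /=; first exact: FG.
rewrite /wsum; apply: eq_bigr => c _; case: (boolP (P c)) => [Pc|/nuP ->].
  by congr (_ * _); apply: ih => l Pl; apply: FG; rewrite /= Pc.
by rewrite !mul0r.
Qed.

Lemma PP_dist_supp (F G H : seq C -> R) : gr F -> gr G -> gr H -> (forall l, 0 <= H l) ->
  (forall l, all P l -> `|F l - G l| <= H l) -> `|PP nu F - PP nu G| <= PP nu H.
Proof.
move=> gF gG gH H0 FGH.
pose G' l := if all P l then G l else F l.
rewrite (@eq_PP_supp G G'); last by move=> l Pl; rewrite /G' Pl.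
apply: PP_dist => //.
  apply: (@gr_le _ _ _ (fun l => `|F l| + `|G l|)); last by apply: grD; exact: gr_norm.
  by move=> l; rewrite /G'; case: ifP => _; rewrite ?lerDl ?lerDr.
move=> l; rewrite /G'; case: ifPn => [/FGH//|_]; by rewrite subrr normr0.
Qed.
End support.

Arguments infl : simpl never.

Section clause_systems.
Context {R : realType} {V : finType} {q : nat}.
Variables (alpha beta : R).
Hypotheses (alpha0 : 0 < alpha) (beta0 : 0 < beta) (V0 : (0 < #|V|)%N).
Local Notation p := q.+1.
Local Notation conf := {ffun V -> bool}.
Local Notation sg := {ffun 'I_p -> bool}.
Local Notation hedge := {ffun 'I_p -> V}.
Local Notation clause := (sg * hedge)%type.
Local Notation open_clause := (sg * {ffun 'I_q -> V})%type.
Local Notation NV := (#|V|%:R : R).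

Definition wl (J : sg) (l : seq V) (s : conf) : R := cw beta J (spins s l).

Lemma wl_gt0 J l s : 0 < wl J l s.
Proof. by apply: cw_gt0 => //; exact: box_spins. Qed.

Lemma wl_ratio J l s t : wl J l s <= expR beta * wl J l t.
Proof. by apply: cwl_ratio => //; [exact: ones01|exact: box_spins..]. Qed.

Lemma wl_dep J l : dep (mem l) (wl J l).
Proof. by move=> s t st; congr cw; apply/eq_in_map => u ul; rewrite st. Qed.

Definition clf (c : clause) : @factor R V p beta :=
  Factor (wl_gt0 c.1 (codom c.2)) (wl_ratio c.1 (codom c.2)) (@wl_dep c.1 (codom c.2)).

Definition sys (G : seq clause) := map clf G.
Definition mag (G : seq clause) (u : V) : R := magn (sys G) u.
(** Products are taken over lists of weight functions rather than of clauses, because processes are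
    later identified only through the weights of their clauses ([PP_position]). *)
Definition wprod (W : seq (conf -> R)) (s : conf) : R := \prod_(w <- W) w s.
Definition cwt (c : clause) : conf -> R := wl c.1 (codom c.2).

Lemma fprod_sys G : fprod (sys G) = wprod (map cwt G).
Proof. by apply/funext => s; rewrite /fprod /wprod !big_map. Qed.

Lemma fedge_sys G : map (@fedge _ _ _ _) (sys G) = unzip2 G.
Proof. by rewrite -map_comp. Qed.

Lemma wprod_cat W W' s : wprod (W ++ W') s = wprod W s * wprod W' s.
Proof. by rewrite /wprod big_cat. Qed.

Lemma wprod_perm (T : Type) (F : (conf -> R) -> T) : perm_inv (fun G => F (wprod (map cwt G))).
Proof.
move=> l l' ll'; congr F; apply/funext => s.
by rewrite /wprod !big_map; exact: perm_big.
Qed.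

Lemma wprod_gt0 G s : 0 < wprod (map cwt G) s.
Proof. by rewrite -fprod_sys fprod_gt0. Qed.

Lemma magE G u : mag G u = gavg (wprod (map cwt G)) (fun s => spin R (s u)).
Proof. by rewrite /mag /magn fprod_sys. Qed.

Lemma mag_perm u : perm_inv (fun G => mag G u).
Proof. by move=> l l' /(wprod_perm (fun W => gavg W (fun s => spin R (s u)))); rewrite !magE. Qed.

Lemma mag_itv G u : -1 <= mag G u <= 1. Proof. exact: magn_itv. Qed.

Lemma mag_norm G u : `|mag G u| <= 1. Proof. by rewrite ler_norml mag_itv. Qed.

Lemma mag_dist2 G G' u : `|mag G u - mag G' u| <= 2.
Proof.
by rewrite (le_trans (ler_normB _ _))//; have := mag_norm G u; have := mag_norm G' u; lra.
Qed.

Variable n : nat.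
Local Notation kap := (@kappa R p alpha beta).
Hypotheses (kappa1 : kap < 1) (kn : kap ^+ n <= NV^-1).
Local Notation inf := (infl beta n.+1).
Local Notation C1 := (1 / (1 - kap) + 1).
Local Notation lam := (alpha * NV).

Lemma C1_ge0 : 0 <= C1.
Proof. by rewrite addr_ge0// divr_ge0// subr_ge0 ltW. Qed.

Lemma lam_ge0 : 0 <= lam. Proof. by rewrite mulr_ge0// ltW. Qed.

(** The bound of [Einfl_bound], kept as a function of the pair for later averaging over either
    site. *)
Definition hit (u v : V) : R := (u == v)%:R + C1 / NV.

Lemma hit_ge0 u v : 0 <= hit u v.
Proof. by rewrite addr_ge0// divr_ge0// C1_ge0. Qed.

Lemma avg_hit v : avg (hit^~ v) = (1 + C1) / NV.
Proof. by rewrite /hit avgD avg_delta avg_cst// [RHS]mulrDl !mul1r. Qed.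

(** Adding the clauses of [K] moves the magnetization of [w] by at most twice the sum of the
    influences on [w] of their sites, the factor min(4 beta, 1) being bounded by 1. Mecke's formula
    for [nu1] isolates one clause, and the remaining superposition is again dominated by the full
    process, so [Einfl_bound] applies. *)
Lemma delta_bound (nu1 nu2 : clause -> R) w :
  (forall c, 0 <= nu1 c) -> (forall c, 0 <= nu2 c) ->
  (forall c, nu1 c + nu2 c <= unif lam c) ->
  PP nu1 (fun K => PP nu2 (fun B => `|mag (K ++ B) w - mag B w|)) <=
  2 * wsum nu1 (fun c => \sum_(a < p) hit (c.2 a) w).
Proof.
move=> n1 n2 n12.
pose H (c : clause) (l B : seq clause) := 2 * \sum_(a < p) inf (unzip2 (l ++ B)) (c.2 a) w.
have H0 c l B : 0 <= H c l B.
  by rewrite mulr_ge0// sumr_ge0// => a _; exact: infl_ge0.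
have H2 c l B : `|H c l B| <= 2 * p%:R.
  rewrite ger0_norm// /H ler_pM2l// (le_trans (ler_sum _ (fun a _ => infl_le1 beta0 n.+1 _ (c.2 a) w)))//.
  by rewrite sumr_const card_ord.
have gH c : gr2 (H c) by exact: gr2_bounded (H2 c).
have gR : gr2 (fun K B => RS (fun c l => H c l B) K).
  apply: (@gr2_size _ _ _ _ (fun m => m%:R * (2 * p%:R))).
    by apply: gbndM; [exact: gbnd_nat|exact: gbnd_cst].
  move=> l l'; rewrite (le_trans (RS_norm _ _))// (le_trans (le_RS (H' := fun _ _ => 2 * p%:R) _))//.
  by rewrite RS_cst ler_wpM2r ?mulr_ge0// ler_nat leq_addr.
have gd : gr2 (fun K B => `|mag (K ++ B) w - mag B w|).
  by apply: (@gr2_bounded _ _ _ _ 2) => K B; rewrite normr_id mag_dist2.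
apply: (@le_trans _ _ (PP nu1 (fun K => PP nu2 (fun B => RS (fun c l => H c l B) K)))).
  apply: le_PP => //; [exact: gr2_PP..|] => K.
  apply: le_PP => //; [exact: (gr2_l K gd)|exact: (gr2_l K gR)|] => B.
  rewrite /mag /magn.
  have := gavg_cat beta0 n.+1 (sys K) (sys B) (t := w) (f := fun s => spin R (s w)) _
    (fun s => spin_norm (s w)).
  rewrite /sys -map_cat => /(_ _)/le_trans; apply.
    by move=> s s' ss'; rewrite ss'// inE.
  rewrite RS_map; apply: le_RS => c l _.
  rewrite /= -map_cat fedge_sys /H ler_piMl//.
    by rewrite mulr_ge0// sumr_ge0// => a _; exact: infl_ge0.
  by rewrite ge_min lexx orbT.
rewrite (PP_swap n1 n2 gR).
have -> : PP nu2 (fun B => PP nu1 (fun K => RS (fun c l => H c l B) K)) =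
    PP nu2 (fun B => \sum_c nu1 c * PP nu1 (fun l => H c l B)).
  apply: eq_PP => B; rewrite PP_RS// => c; exact: (gr2_l B (gr2_sym (gH c))).
rewrite PP_sum//; last first.
  by move=> c; apply: grZ; apply: gr2_PP => //; exact: gr2_sym.
rewrite /wsum mulr_sumr; apply: ler_sum => c _.
rewrite PPZ//; last by apply: gr2_PP => //; exact: gr2_sym.
rewrite [leRHS]mulrCA ler_wpM2l// (PP_swap n2 n1 (gr2_sym (gH c))).
have n12' d : 0 <= nu1 d + nu2 d by rewrite addr_ge0.
pose H' (G : seq clause) : R := 2 * \sum_(a < p) inf (unzip2 G) (c.2 a) w.
have gi a : gr (fun G : seq clause => inf (unzip2 G) (c.2 a) w) by exact: gr_infl.
rewrite -(@PP_add _ _ nu1 nu2 H')//; last 2 first.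
- move=> l l' ll'; congr (_ * _); apply: eq_bigr => a _; apply: infl_perm.
  exact: perm_map.
- by apply: grZ; apply: gr_sum.
rewrite PPZ//; last exact: gr_sum.
rewrite ler_pM2l// PP_sum//; apply: ler_sum => a _.
exact: Einfl_bound.
Qed.

Section cavity.
Variable u : V.

(* Intensities: [nuA] of the clauses through [u], [nuB] of the others. [nuS]
   counts a clause once per position occupied by [u]; by symmetry of the
   positions, it is the law of open clauses completed by [u] in the last place.
   The excess [nuD] of [nuS] over [nuA] has mass O(1/N). *)
Definition touch (c : clause) : bool := u \in codom c.2.
Definition nuA (c : clause) : R := if touch c then unif lam c else 0.
Definition nuB (c : clause) : R := if touch c then 0 else unif lam c.
Definition nuS (c : clause) : R := unif lam c * \sum_(a < p) (c.2 a == u)%:R.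
Definition nuD (c : clause) : R := nuS c - nuA c.

Lemma unif_lam_ge0 (c : clause) : 0 <= unif lam c. Proof. exact/unif_ge0/lam_ge0. Qed.
Lemma nuA_ge0 c : 0 <= nuA c. Proof. by rewrite /nuA; case: ifP => // _; exact: unif_lam_ge0. Qed.
Lemma nuB_ge0 c : 0 <= nuB c. Proof. by rewrite /nuB; case: ifP => // _; exact: unif_lam_ge0. Qed.
Lemma nuS_ge0 c : 0 <= nuS c.
Proof. by rewrite mulr_ge0 ?unif_lam_ge0// sumr_ge0. Qed.

Lemma nuAB c : nuA c + nuB c = unif lam c.
Proof. by rewrite /nuA /nuB; case: ifP; rewrite ?addr0 ?add0r. Qed.

Lemma nuB_le c : nuB c <= unif lam c.
Proof. by rewrite -nuAB lerDr nuA_ge0. Qed.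

Lemma nuA_le c : nuA c <= nuS c.
Proof.
rewrite /nuA; case: ifPn => [/codomP[a ua]|_]; last exact: nuS_ge0.
rewrite /nuS ler_peMr ?unif_lam_ge0// (bigD1 a)//= -ua eqxx lerDl.
exact: sumr_ge0.
Qed.

Lemma nuD_ge0 c : 0 <= nuD c. Proof. by rewrite subr_ge0 nuA_le. Qed.

Lemma nuAD c : nuA c + nuD c = nuS c. Proof. by rewrite addrC subrK. Qed.

(** The excess of a clause is at most the number of ordered pairs of distinct positions occupied by
    [u]; two given positions are both at [u] with probability 1/N^2, and the total rate of clauses
    is alpha N. *)
Lemma mass_nuD : mass nuD <= alpha * p%:R ^+ 2 / NV.
Proof.
apply: (@le_trans _ _ (\sum_(c : clause) unif lam c * \sum_(a < p) \sum_(b < p | b != a)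
    (c.2 a == u)%:R * (c.2 b == u)%:R)).
  apply: ler_sum => c _; rewrite /nuD /nuA /nuS; case: ifPn => [/codomP[a0 ua]|uc]; last first.
    rewrite subr0 big1 ?mulr0; last first.
      by move=> a _; case: eqP => // ca; rewrite /touch -ca codom_f in uc.
    rewrite mulr_ge0 ?unif_lam_ge0//.
    by do 2!apply: sumr_ge0 => ? _; rewrite mulr_ge0.
  rewrite -[X in _ - X]mulr1 -mulrBr ler_wpM2l ?unif_lam_ge0//.
  rewrite (bigD1 a0)//= -ua eqxx addrAC subrr add0r [leRHS](bigD1 a0)//= -ua eqxx.
  under [X in X + _]eq_bigr do rewrite mul1r; rewrite lerDl.
  by do 2!apply: sumr_ge0 => ? _; rewrite mulr_ge0.
change (wsum (unif lam) (fun c : clause => \sum_(a < p) \sum_(b < p | b != a)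
    (c.2 a == u)%:R * (c.2 b == u)%:R) <= alpha * p%:R ^+ 2 / NV).
have N0 := NV0 V0 : 0 < NV.
rewrite wsum_unif avg_sum.
apply: (@le_trans _ _ (lam * \sum_(a < p) \sum_(b < p) (NV^-1 * NV^-1))).
  rewrite ler_wpM2l ?lam_ge0//; apply: ler_sum => a _; rewrite avg_sum big_mkcond.
  apply: ler_sum => b _; case: ifPn => ba; last by rewrite mulr_ge0 ?invr_ge0.
  rewrite avg_pair/= avg_cst ?sg_gt0//.
  rewrite (avg_coord2 V0 (fun v => (v == u)%:R) (fun v => (v == u)%:R) ba).
  by rewrite avg_delta.
rewrite !sumr_const !card_ord -[_ *+ p *+ p]mulr_natl -[_ *+ p]mulr_natl.
rewrite le_eqVlt; apply/orP; left; apply/eqP; field; rewrite gt_eqF//.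
Qed.

Definition C2 : R := 2 * alpha * p%:R * C1 + 2 * alpha * p%:R ^+ 2 * (1 + C1).

Lemma C2_ge0 : 0 <= C2.
Proof.
have := C1_ge0; have a0 := ltW alpha0; rewrite /C2; set c := C1 => h.
by rewrite addr_ge0// !mulr_ge0// addr_ge0.
Qed.

(** Only [w = u] is affected at order 1, since every removed clause contains [u]; the other sites of
    these clauses are uniform and act on [w] only to order 1/N in mean. *)
Lemma cavity_delta w :
  PP nuA (fun K => PP nuB (fun B => `|mag (K ++ B) w - mag B w|)) <=
  2 * alpha * p%:R * (u == w)%:R + C2 / NV.
Proof.
have N0 := NV0 V0 : 0 < NV.
apply: le_trans (delta_bound w nuA_ge0 nuB_ge0 _) _; first by move=> c; rewrite nuAB.
apply: (@le_trans _ _ (2 * wsum nuS (fun c => \sum_(a < p) hit (c.2 a) w))).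
  rewrite ler_pM2l//; apply: ler_sum => c _; rewrite ler_wpM2r ?nuA_le//.
  by apply: sumr_ge0 => a _; exact: hit_ge0.
have -> : wsum nuS (fun c => \sum_(a < p) hit (c.2 a) w) =
    wsum (unif lam) (fun c : clause => \sum_(b < p) \sum_(a < p) (c.2 b == u)%:R * hit (c.2 a) w).
  by apply: eq_bigr => c _; rewrite /nuS -mulrA mulr_suml; under eq_bigr do rewrite mulr_sumr.
rewrite wsum_unif avg_sum.
apply: (@le_trans _ _ (2 * (lam * \sum_(b < p) (NV^-1 * hit u w + p%:R * (NV^-1 * ((1 + C1) / NV)))))).
  rewrite ler_pM2l// ler_wpM2l ?lam_ge0//; apply: ler_sum => b _.
  rewrite avg_sum (bigD1 b)//= lerD//.
    rewrite avg_pair/= avg_cst ?sg_gt0//.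
    rewrite (avg_coord V0 b (fun v => (v == u)%:R * hit v w)) /avg ler_wpM2l ?invr_ge0//.
    by rewrite (bigD1 u)//= eqxx mul1r big1 ?addr0// => v /negbTE ->; rewrite mul0r.
  rewrite -[p%:R * _](_ : \sum_(a < p) (NV^-1 * ((1 + C1) / NV)) = _); last first.
    by rewrite sumr_const card_ord mulr_natl.
  rewrite [leRHS](bigID (fun a => a != b))/= -[leLHS]addr0 lerD//; last first.
    by apply: sumr_ge0 => a _; rewrite !mulr_ge0 ?invr_ge0// addr_ge0// C1_ge0.
  apply: ler_sum => a ab; rewrite avg_pair/= avg_cst ?sg_gt0//.
  rewrite (avg_coord2 V0 (fun v => (v == u)%:R) (fun v => hit v w) ab).
  by rewrite avg_delta avg_hit.
rewrite sumr_const card_ord -[_ *+ p]mulr_natl /hit /C2; set c1 := C1.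
rewrite le_eqVlt; apply/orP; left; apply/eqP; field; rewrite gt_eqF//.
Qed.

End cavity.
End clause_systems.

(** * Cavity equations in a fixed clause system *)

Section cavity_equations.
Context {R : realType} {V : finType} {q : nat}.
Variables (alpha beta : R).
Hypotheses (alpha0 : 0 < alpha) (beta0 : 0 < beta) (V0 : (0 < #|V|)%N).
Local Notation p := q.+1.
Local Notation conf := {ffun V -> bool}.
Local Notation sg := {ffun 'I_p -> bool}.
Local Notation hedge := {ffun 'I_p -> V}.
Local Notation clause := (sg * hedge)%type.
Local Notation open_clause := (sg * {ffun 'I_q -> V})%type.
Local Notation NV := (#|V|%:R : R).
Local Notation lam := (alpha * NV).
Local Notation sys := (@sys R V q beta beta0).
Local Notation mag := (@mag R V q beta beta0).
Local Notation cwt := (@cwt R V q beta).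

(** Flipping the spin of [u] is an involution that leaves every [X b] unchanged. *)
Lemma sum_split_spin (u : V) (X : bool -> conf -> R) :
  (forall b, dep (predC1 u) (X b)) ->
  \sum_(s : conf) X (s u) s = 2^-1 * (\sum_s X true s + \sum_s X false s).
Proof.
move=> dX.
pose flip (s : conf) : conf := [ffun v => if v == u then ~~ s u else s v].
have flipK : involutive flip.
  move=> s; apply/ffunP => v; rewrite !ffunE eqxx negbK.
  by case: eqVneq => // ->.
have E : \sum_(s : conf) X (s u) s = \sum_(s : conf) X (~~ s u) s.
  rewrite (reindex_inj (inv_inj flipK)); apply: eq_bigr => s _ /=.
  rewrite ffunE eqxx; apply: dX => v; rewrite inE => vu.
  by rewrite ffunE (negbTE vu).
apply: (@mulfI _ 2) => //; rewrite mulrA divff// mul1r -big_split/=.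
rewrite mulr_natl mulr2n {2}E -big_split/=; apply: eq_bigr => s _.
by case: (s u) => //=; rewrite addrC.
Qed.

(** The default value [u] of [nth] fills the last position. *)
Definition ins (u : V) (x : open_clause) : clause :=
  (x.1, [ffun i : 'I_p => nth u (codom x.2) i]).

Lemma codom_ins u x : codom (ins u x).2 = rcons (codom x.2) u.
Proof.
apply: (@eq_from_nth _ u); first by rewrite size_rcons !size_codom !card_ord.
move=> i; rewrite size_codom card_ord => ip.
rewrite /codom /image_mem (nth_map (Ordinal ip)) ?size_enum_ord//.
rewrite /= ffunE nth_enum_ord// nth_rcons size_map size_enum_ord.
case: ltngtP => // iq; first by rewrite nth_default// size_map size_enum_ord ltnW.
by rewrite nth_default// size_map size_enum_ord iq.
Qed.

Definition flat (K : seq open_clause) : seq V := flatten (map (fun x : open_clause => codom x.2) K).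

Lemma size_flat K : size (flat K) = (size K * q)%N.
Proof.
elim: K => //= x K ih; rewrite /flat/= size_cat size_codom card_ord mulSn.
by congr (_ + _)%N.
Qed.

Lemma wprod_ins u K s : wprod (map cwt (map (ins u) K)) s =
  FP q (cavw beta (spin R (s u))) (unzip1 K) (spins s (flat K)).
Proof.
elim: K => [|x K ih]; first by rewrite /wprod big_nil.
rewrite /wprod/= big_cons -/(wprod _ _) ih /flat/= /spins map_cat.
have sx : size (map (fun v => spin R (s v)) (codom x.2)) = q.
  by rewrite size_map size_codom card_ord.
rewrite take_size_cat// drop_size_cat//; congr (_ * _).
by rewrite /cwt/= /wl codom_ins /cavw /spins map_rcons.
Qed.

Lemma spins_dep (S : {pred V}) (l : seq V) (s t : conf) : {in S, s =1 t} ->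
  {subset l <= S} -> spins (R := R) s l = spins t l.
Proof. by move=> st lS; apply/eq_in_map => v vl; rewrite st// lS. Qed.

Section avoiding.
Variables (u : V) (B : seq clause).
Hypothesis Bu : all (fun c => ~~ touch u c) B.

Lemma wprod_dep : dep (predC1 u) (wprod (map cwt B)).
Proof.
move=> s t st; rewrite /wprod !big_map.
elim: B Bu => [|c B' ih]; first by rewrite !big_nil.
rewrite /= => /andP[cu /ih]; rewrite !big_cons => ->; congr (_ * _).
rewrite /cwt /wl; congr cw; apply: spins_dep st _ => v vc; rewrite inE.
by apply: contraNneq cu => <-.
Qed.

Variables (K : seq open_clause).
Hypothesis Ku : u \notin flat K.

(** The mean weight of the clauses of [K], completed by [u] with spin [e], in the system without
    them. *)
Definition cav (e : bool) : R :=
  gavg (fprod (sys B)) (fun s => FP q (cavw beta (spin R e)) (unzip1 K) (spins s (flat K))).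

Lemma cavity_sum (f : bool -> R) :
  gavg (fprod (sys B)) (fun s => f (s u) * wprod (map cwt (map (ins u) K)) s) =
  2^-1 * (f true * cav true + f false * cav false).
Proof.
pose X b s := f b * (FP q (cavw beta (spin R b)) (unzip1 K) (spins s (flat K)) *
  wprod (map cwt B) s).
have dX b : dep (predC1 u) (X b).
  move=> s t st; rewrite /X (wprod_dep st) (spins_dep st)// => v vK; rewrite inE.
  by apply: contraNneq Ku => <-.
have := sum_split_spin dX; rewrite /cav /gavg fprod_sys /X -!mulr_sumr => E.
rewrite 2![in RHS]mulrA -mulrDl [in RHS]mulrA; congr (_ / _).
transitivity (\sum_(s : conf) f (s u) * (FP q (cavw beta (spin R (s u))) (unzip1 K) (spins s (flat K)) *
  wprod (map cwt B) s)).
  by apply: eq_bigr => s _; rewrite wprod_ins mulrCA (mulrC (wprod _ _)).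
rewrite E; congr (_ * (_ * _ + _ * _));
  by apply: eq_bigr => s _; rewrite mulrC.
Qed.

(** The exact cavity equation: neither [B] nor the open sites of [K] involve [u], so the sum over
    its spin can be carried out first. Factorization comes only afterwards, in [Rd_factor]. *)
Lemma cavity_mag : mag (map (ins u) K ++ B) u =
  (cav true - cav false) / (cav true + cav false).
Proof.
have W0 := fprod_gt0 (sys B).
have Z0 : \sum_s fprod (sys B) s != 0 by rewrite gt_eqF// sumW_gt0.
have num := cavity_sum (spin R); have den := cavity_sum (fun=> 1).
rewrite magE /gavg map_cat.
have -> : \sum_s wprod (map cwt (map (ins u) K) ++ map cwt B) s * spin R (s u) =
   (\sum_s fprod (sys B) s) * (2^-1 * (cav true - cav false)).
  rewrite (_ : cav true - cav false = spin R true * cav true + spin R false * cav false).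
    rewrite -num /gavg mulrC mulfVK//; apply: eq_bigr => s _.
    by rewrite wprod_cat fprod_sys; ring.
  by rewrite /spin mul1r mulN1r.
have -> : \sum_s wprod (map cwt (map (ins u) K) ++ map cwt B) s =
   (\sum_s fprod (sys B) s) * (2^-1 * (cav true + cav false)).
  rewrite (_ : cav true + cav false = 1 * cav true + 1 * cav false); last by rewrite !mul1r.
  rewrite -den /gavg mulrC mulfVK//; apply: eq_bigr => s _.
  by rewrite wprod_cat fprod_sys; ring.
rewrite -mulf_div divff// mul1r -mulf_div divff ?mul1r//.
Qed.

Lemma cavity_ratio : gavg (fprod (sys B)) (wprod (map cwt (map (ins u) K))) =
  2^-1 * (cav true + cav false).
Proof.
have := cavity_sum (fun=> 1); rewrite !mul1r => <-.
by apply: eq_gavg => s; rewrite mul1r.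
Qed.
End avoiding.

Definition Rd (g : R -> R -> R) (Js : seq sg) (ys : seq R) : R :=
  g (FP q (cavw beta (spin R true)) Js ys) (FP q (cavw beta (spin R false)) Js ys).

Definition gT (P Q : R) : R := (P - Q) / (P + Q).
Definition gL (P Q : R) : R := ln (2^-1 * (P + Q)).

Lemma gT_itv P Q : 0 < P -> 0 < Q -> -1 <= gT P Q <= 1.
Proof.
move=> P0 Q0; rewrite /gT ler_pdivlMr ?addr_gt0// ler_pdivrMr ?addr_gt0//.
by apply/andP; split; lra.
Qed.

Lemma mcav e (J : sg) : maff (expR beta) q (cavw beta (spin R e) J).
Proof. exact: (@maff_cavw R beta q.+1 beta0). Qed.

Lemma Rd_lip g (Js : seq sg) ys ys' : glip g -> size ys = (size Js * q)%N -> size ys' = (size Js * q)%N ->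
  box ys -> box ys' -> `|Rd g Js ys - Rd g Js ys'| <= 2^-1 * (expR beta - 1) * dl ys ys'.
Proof.
move=> gg s s' b b'; apply: FP_lip => //; [exact: mcav..|].
exact: (@block_lip_cavw R beta q.+1 beta0).
Qed.

Lemma RdgT_itv (Js : seq sg) ys : size ys = (size Js * q)%N -> box ys -> -1 <= Rd gT Js ys <= 1.
Proof.
by move=> sy bys; apply: gT_itv; apply: (FP_gt0 (beta := beta)) => // J; exact: mcav.
Qed.

Lemma Rd_factor n g K B : glip g ->
  `|g (cav B K true) (cav B K false) - Rd g (unzip1 K) (map (mag B) (flat K))| <=
  2 * (expR beta - 1) * pairsum beta n (unzip2 B) (flat K).
Proof.
move=> gg; rewrite -(fedge_sys beta0 B).
by apply: factorization => //; rewrite size_flat -(size_map fst K); apply: maff_FP => //;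
  exact: mcav.
Qed.

Lemma sum_pred_ge1 u (l : seq V) : u \in l -> (1 : R) <= \sum_(b <- l) (b == u)%:R.
Proof.
elim: l => // v l ih; rewrite in_cons big_cons => /orP[/eqP ->|/ih h].
  by rewrite eqxx lerDl sumr_ge0.
by rewrite (le_trans h)// lerDr.
Qed.

Lemma FP_cav_itv e (Js : seq sg) ys : size ys = (size Js * q)%N -> box ys ->
  expR (- beta * (size Js)%:R) <= FP q (cavw beta (spin R e)) Js ys <= 1.
Proof.
elim: Js ys => [|J Js ih] ys /=; first by rewrite mulr0 expR0 lexx.
rewrite mulSn => sy b; have [st bt [sd bd]] := split_box sy b.
have /andP[h1 h2] := ih _ sd bd.
have /andP[k1 k2] : expR (- beta) <= cavw beta (spin R e) J (take q ys) <= 1.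
  by apply: cw_bounds => //; rewrite /box all_rcons spin_itv.
rewrite -natr1 mulrDr mulr1 addrC expRD ler_pM ?expR_ge0//=.
by rewrite mulr_ile1//; [exact: le_trans (expR_ge0 _) k1|exact: le_trans (expR_ge0 _) h1].
Qed.

Lemma mag_cavity n u K B : all (fun c => ~~ touch u c) B ->
  `|mag (map (ins u) K ++ B) u - Rd gT (unzip1 K) (map (mag B) (flat K))| <=
  2 * (expR beta - 1) * pairsum beta n (unzip2 B) (flat K) +
  2 * \sum_(b <- flat K) (b == u)%:R.
Proof.
move=> Bu; have e1 : 0 <= expR beta - 1 by rewrite subr_ge0 ltW// expR_gt1.
have P0 := pairsum_ge0 beta0 n (unzip2 B) (flat K).
have [uK|uK] := boolP (u \in flat K); last first.
  rewrite cavity_mag// -/(gT _ _) -[leLHS]addr0 lerD//.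
    exact: (Rd_factor n K B glip_tanh).
  by rewrite mulr_ge0// sumr_ge0.
rewrite ler_wpDl ?mulr_ge0// (@le_trans _ _ 2)//; last first.
  by have := sum_pred_ge1 uK; lra.
have h1 := mag_norm beta0 (map (ins u) K ++ B) u.
have h2 : `|Rd gT (unzip1 K) (map (mag B) (flat K))| <= 1.
  by rewrite ler_norml RdgT_itv//; [rewrite !size_map size_flat|exact: box_magn].
by rewrite (le_trans (ler_normB _ _))//; lra.
Qed.

Lemma ln_between (x k : R) : 0 <= k -> expR (- k) <= x <= 1 -> - k <= ln x <= 0.
Proof.
move=> k0 /andP[h1 h2]; have x0 : 0 < x by rewrite (lt_le_trans _ h1)// expR_gt0.
apply/andP; split; last by rewrite -ln1 ler_ln ?posrE.
by rewrite -ler_expR lnK ?posrE.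
Qed.

Lemma gavg_between (B : seq clause) (f : conf -> R) a b : (forall s, a <= f s <= b) ->
  a <= gavg (fprod (sys B)) f <= b.
Proof.
move=> ab; have W0 := fprod_gt0 (sys B).
rewrite -{1}(gavg_cst W0 a) -(gavg_cst W0 b) !le_gavg// => s; by have /andP[] := ab s.
Qed.

Lemma ln_cavity_itv u K B :
  - (beta * (size K)%:R) <= ln (gavg (fprod (sys B)) (wprod (map cwt (map (ins u) K)))) <= 0.
Proof.
apply: ln_between; first by rewrite mulr_ge0// ltW.
apply: gavg_between => s; rewrite wprod_ins -mulNr -(size_map fst K).
by apply: FP_cav_itv; [rewrite !size_map size_flat|exact: box_spins].
Qed.

(** The same dichotomy as for [mag_cavity], the trivial bound of a logarithm being [beta] per
    clause. *)
Lemma ln_cavity n u K B : all (fun c => ~~ touch u c) B ->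
  `|ln (gavg (fprod (sys B)) (wprod (map cwt (map (ins u) K)))) -
    Rd gL (unzip1 K) (map (mag B) (flat K))| <=
  2 * (expR beta - 1) * pairsum beta n (unzip2 B) (flat K) +
  beta * (size K)%:R * \sum_(b <- flat K) (b == u)%:R.
Proof.
move=> Bu; have e1 : 0 <= expR beta - 1 by rewrite subr_ge0 ltW// expR_gt1.
have P0 := pairsum_ge0 beta0 n (unzip2 B) (flat K).
have bK : 0 <= beta * (size K)%:R by rewrite mulr_ge0// ltW.
have [uK|uK] := boolP (u \in flat K); last first.
  rewrite cavity_ratio// -/(gL _ _) -[leLHS]addr0 lerD//.
    exact: (Rd_factor n K B glip_lnavg).
  by rewrite mulr_ge0// sumr_ge0.
rewrite ler_wpDl ?mulr_ge0// (@le_trans _ _ (beta * (size K)%:R))//; last first.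
  by rewrite ler_peMr// sum_pred_ge1.
have /andP[h1 h2] := ln_cavity_itv u K B.
have FK e : expR (- (beta * (size K)%:R)) <=
    FP q (cavw beta (spin R e)) (unzip1 K) (map (mag B) (flat K)) <= 1.
  rewrite -mulNr -(size_map fst K); apply: FP_cav_itv; last exact: box_magn.
  by rewrite !size_map size_flat.
have /andP[h3 h4] : - (beta * (size K)%:R) <= Rd gL (unzip1 K) (map (mag B) (flat K)) <= 0.
  apply: ln_between => //; have /andP[? ?] := FK true; have /andP[? ?] := FK false.
  by apply/andP; split; lra.
by rewrite ler_norml; apply/andP; split; lra.
Qed.
End cavity_equations.

Section support_bound.
Context {R : realType} {C : finType}.
Variables (nu : C -> R) (P : pred C).
Hypotheses (nu0 : forall c, 0 <= nu c) (nuP : forall c, ~~ P c -> nu c = 0).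

Lemma le_PP_supp (F H : seq C -> R) : gr F -> gr H -> (forall l, 0 <= F l) -> (forall l, 0 <= H l) ->
  (forall l, all P l -> F l <= H l) -> PP nu F <= PP nu H.
Proof.
move=> gF gH F0 H0 FH.
have g0 : gr (fun _ : seq C => 0 : R) by apply: (@gr_bounded _ _ _ 0) => l; rewrite normr0.
have := PP_dist_supp nu0 nuP gF g0 gH H0; rewrite PP_cst subr0 => h.
by rewrite (le_trans (ler_norm _))// h// => l Pl; rewrite subr0 ger0_norm// FH.
Qed.
End support_bound.

(** * Cavity errors averaged over the clause process *)

Section cavity_expectations.
Context {R : realType} {V : finType} {q : nat}.
Variables (alpha beta : R).
Hypotheses (alpha0 : 0 < alpha) (beta0 : 0 < beta) (V0 : (0 < #|V|)%N).
Local Notation p := q.+1.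
Local Notation conf := {ffun V -> bool}.
Local Notation sg := {ffun 'I_p -> bool}.
Local Notation hedge := {ffun 'I_p -> V}.
Local Notation clause := (sg * hedge)%type.
Local Notation open_clause := (sg * {ffun 'I_q -> V})%type.
Local Notation NV := (#|V|%:R : R).
Local Notation lam := (alpha * NV).
Local Notation sys := (@sys R V q beta beta0).
Local Notation mag := (@mag R V q beta beta0).
Local Notation cwt := (@cwt R V q beta).

Lemma open0 : (0 < #|{: open_clause}|)%N.
Proof. by rewrite card_prod muln_gt0 sg_gt0 card_ffun card_ord expn_gt0 V0. Qed.

Lemma clause0 : (0 < #|{: clause}|)%N.
Proof. by rewrite card_prod muln_gt0 sg_gt0 card_ffun card_ord expn_gt0 V0. Qed.

Lemma avg_reindex (A : finType) (h : A -> A) (f : A -> R) : involutive h -> avg f = avg (f \o h).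
Proof. by move=> hK; rewrite /avg (reindex_inj (inv_inj hK)). Qed.

Lemma cwtE (c : clause) s : cwt c s =
  1 + (expR (- beta) - 1) * \prod_(i < p) ((1 + spin R (c.1 i) * spin R (s (c.2 i))) / 2).
Proof.
rewrite /cwt /wl /cw /cwl mulr1; congr (1 + _ * _).
have sJ : size (codom c.1) = p by rewrite size_codom card_ord.
have sS : size (spins (R := R) s (codom c.2)) = p by rewrite size_map size_codom card_ord.
rewrite /jprod (big_nth (false, 0)) size_zip sJ sS minnn big_mkord.
apply: eq_bigr => i _; rewrite nth_zip ?sJ ?sS//=.
rewrite /spins (nth_map (c.2 i)) ?size_codom ?card_ord//.
have cn (T : Type) (x0 : T) (f : {ffun 'I_p -> T}) : nth x0 (codom f) i = f i.
  by rewrite /codom /image_mem (nth_map i) ?size_enum_ord// nth_ord_enum.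
by rewrite !cn.
Qed.

(** Exchanging position [a] with the last one preserves clause weights and the uniform law, so all
    [p] positions contribute equally; the last site is [u] with probability 1/N, whence the rate
    (alpha N) p / N. *)
Lemma wsum_nuS u (phi : (conf -> R) -> R) :
  wsum (nuS alpha u) (phi \o cwt) = wsum (unif (alpha * p%:R)) (phi \o cwt \o ins u).
Proof.
have N0 := NV0 V0 : 0 < NV.
transitivity (lam * \sum_(a < p) avg (fun c : clause => (c.2 a == u)%:R * phi (cwt c))).
  rewrite -avg_sum -wsum_unif; apply: eq_bigr => c _.
  by rewrite /nuS -mulrA mulr_suml.
transitivity (lam * \sum_(a < p) (NV^-1 * avg (fun x : open_clause => phi (cwt (ins u x))))); last first.
  rewrite sumr_const card_ord wsum_unif -[_ *+ p]mulr_natl /=.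
  by field; rewrite gt_eqF.
congr (_ * _); apply: eq_bigr => a _.
pose pi (i : 'I_p) : 'I_p := if i == a then ord_max else if i == ord_max then a else i.
have piK : involutive pi.
  move=> i; rewrite /pi; have [->|ia] := eqVneq i a.
    by rewrite eqxx; case: eqVneq.
  have [->|im] := eqVneq i ord_max; first by rewrite eqxx.
  by rewrite (negbTE ia) (negbTE im).
pose h (c : clause) : clause := ([ffun i : 'I_p => c.1 (pi i)], [ffun i : 'I_p => c.2 (pi i)]).
have hK : involutive h.
  by move=> [J e]; congr (_, _); apply/ffunP => i; rewrite !ffunE piK.
have hW c : cwt (h c) = cwt c.
  apply/funext => s; rewrite !cwtE; congr (1 + _ * _).
  rewrite [RHS](reindex_inj (inv_inj piK)); apply: eq_bigr => i _.
  by rewrite !ffunE.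
rewrite (avg_reindex _ hK).
transitivity (avg (fun c : clause => (c.2 ord_max == u)%:R * phi (cwt c))).
  by apply: eq_avg => c /=; rewrite hW ffunE /pi eqxx.
rewrite !avg_pair -avgZ; apply: eq_avg => J.
pose F (l : seq V) := (nth u l q == u)%:R * phi (wl beta J l).
transitivity (avg (fun e : hedge => F (codom e))).
  apply: eq_avg => e; rewrite /F /cwt/=; congr (_%:R * _); congr (_ == _).
  rewrite (nth_map ord_max) ?size_enum_ord//; congr (e _).
  by apply: val_inj; rewrite /= nth_enum_ord.
rewrite avg_ffun_It.
transitivity (It (@avg R V) (q + 1) F); first by rewrite addn1.
rewrite It_add.
transitivity (It (@avg R V) q (fun l => NV^-1 * phi (wl beta J (rcons l u)))).
  apply: eq_It => // l lq /=.
  rewrite /avg; congr (_ * _); rewrite (bigD1 u)//= /F nth_cat lq ltnn subnn/= eqxx mul1r cats1.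
  rewrite big1 ?addr0// => v /negbTE vu.
  by rewrite nth_cat lq ltnn subnn/= vu mul0r.
rewrite ItaZ// -avg_ffun_It; congr (_ * _); apply: eq_avg => e.
by rewrite /cwt codom_ins.
Qed.

Lemma PP_position u (F : seq (conf -> R) -> R) :
  PP (nuS alpha u) (F \o map cwt) = PP (unif (alpha * p%:R)) (F \o map cwt \o map (ins u)).
Proof.
have -> : F \o map cwt \o map (ins u) = F \o map (cwt \o ins u).
  by apply/funext => l /=; rewrite -map_comp.
by apply: PP_ext => phi; exact: wsum_nuS.
Qed.

Variable n : nat.
Local Notation kap := (@kappa R p alpha beta).
Hypotheses (kappa1 : kap < 1) (kn : kap ^+ n <= NV^-1).
Local Notation C1 := (1 / (1 - kap) + 1).
Local Notation hit := (@hit R V q alpha beta).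

Lemma PP_pairsum (nu : clause -> R) l : (forall c, 0 <= nu c) ->
  (forall c, nu c <= unif lam c) ->
  gr (fun B : seq clause => pairsum beta n.+1 (unzip2 B) l) /\
  PP nu (fun B => pairsum beta n.+1 (unzip2 B) l) <= pairs hit l.
Proof.
move=> nu0 nule; elim: l => [|v l [gl ih]] /=.
  by rewrite PP_cst; split=> //; apply: (@gr_bounded _ _ _ 0) => s; rewrite normr0.
have gi b : gr (fun B : seq clause => infl beta n.+1 (unzip2 B) b v) by exact: gr_infl.
split; first by apply: grD => //; exact: gr_sum.
rewrite PPD ?PP_sum//; last exact: gr_sum.
by rewrite lerD// ler_sum// => b _; exact: (Einfl_bound alpha0 beta0 V0 nu0 nule).
Qed.

Lemma pairs_ge0 l : 0 <= pairs hit l.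
Proof. by elim: l => //= v l ih; rewrite addr_ge0// sumr_ge0// => b _; exact: hit_ge0. Qed.

Lemma size_le_gbnd m : gbnd (fun r : nat => (r * m)%:R ^+ 2 : R).
Proof.
apply: (@gbnd_le _ _ (fun r => (m%:R ^+ 2) * (r%:R * r%:R))).
  by move=> r; rewrite ger0_norm ?exprn_ge0// natrM exprMn mulrC.
by apply: gbndZ; apply: gbndM; exact: gbnd_nat.
Qed.

Lemma pairs_le l : pairs hit l <= (size l)%:R ^+ 2 * (1 + C1).
Proof.
have C11 : 0 <= 1 + C1 by rewrite addr_ge0// C1_ge0.
elim: l => [|v l ih] /=; first by rewrite expr2 !mul0r.
apply: (@le_trans _ _ ((size l)%:R * (1 + C1) + (size l)%:R ^+ 2 * (1 + C1))); last first.
  rewrite -mulrDl ler_wpM2r// -natr1.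
  by have := ler0n R (size l); nra.
rewrite lerD//.
have hh b : hit b v <= 1 + C1.
  rewrite /hit lerD ?lern1 ?leq_b1// ler_pdivrMr ?NV0// ler_peMr ?C1_ge0// ler1n.
  exact: V0.
rewrite -sum1_size natr_sum mulr_suml; apply: ler_sum => b _.
by rewrite [leRHS]mul1r hh.
Qed.

Lemma gr_flat (x : R) (y : nat -> R) u : 0 <= x -> gbnd y -> (forall r, 0 <= y r) ->
  gr (fun K : seq open_clause =>
     x * pairs hit (flat K) + y (size K) * \sum_(b <- flat K) (b == u)%:R).
Proof.
move=> x0 gy y0; have C10 : 0 <= C1 by exact: C1_ge0.
have C11 : 0 <= 1 + C1 by rewrite addr_ge0.
have N0 := NV0 V0 : 0 < NV.
have hb (l : seq V) : \sum_(b <- l) (b == u)%:R <= (size l)%:R :> R.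
  elim: l => [|v l ih]; first by rewrite big_nil.
  by rewrite big_cons/= -natr1 addrC lerD// lern1 leq_b1.
have hp := pairs_le.
apply: (@gr_size _ _ _ (fun r => x * ((r * q)%:R ^+ 2 * (1 + C1)) + y r * (r * q)%:R)).
  apply: gbndD; first by apply: gbndZ; apply: gbndM; [exact: size_le_gbnd|exact: gbnd_cst].
  under eq_fun do rewrite natrM; apply: gbndM => //.
  by apply: gbndM; [exact: gbnd_nat|exact: gbnd_cst].
move=> K; rewrite ger0_norm; last first.
  by rewrite addr_ge0 ?mulr_ge0 ?pairs_ge0 ?sumr_ge0.
by rewrite -size_flat lerD// ?ler_wpM2l.
Qed.

(** The open sites are i.i.d. uniform: each of the at most (rq)^2 pairs and each of the rq possible
    recurrences costs O(1/N) in mean. *)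
Lemma EPo_flat lamb (x : R) (y : nat -> R) u : 0 <= lamb -> 0 <= x -> gbnd y -> (forall r, 0 <= y r) ->
  PP (unif lamb) (fun K : seq open_clause =>
     x * pairs hit (flat K) + y (size K) * \sum_(b <- flat K) (b == u)%:R) <=
  EPo lamb (fun r => x * (r * q)%:R ^+ 2 * (1 + C1) + y r * (r * q)%:R) / NV.
Proof.
move=> l0 x0 gy y0; have N0 := NV0 V0 : 0 < NV.
have C10 : 0 <= C1 by exact: C1_ge0.
have C11 : 0 <= 1 + C1 by rewrite addr_ge0.
have gb : gbnd (fun r => x * (r * q)%:R ^+ 2 * (1 + C1) + y r * (r * q)%:R).
  apply: gbndD; apply: gbndM.
  - by apply: gbndZ; exact: size_le_gbnd.
  - exact: gbnd_cst.
  - by [].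
  - under eq_fun do rewrite natrM; apply: gbndM; [exact: gbnd_nat|exact: gbnd_cst].
have E r : It (@avg R open_clause) r (fun K =>
     x * pairs hit (flat K) + y (size K) * \sum_(b <- flat K) (b == u)%:R) <=
   NV^-1 * (x * (r * q)%:R ^+ 2 * (1 + C1) + y r * (r * q)%:R).
  rewrite (@eq_It _ _ _ (@avg R open_clause) r _ (fun K =>
     x * pairs hit (flat K) + y r * \sum_(b <- flat K) (b == u)%:R))//; last first.
    by move=> l ->.
  rewrite (@It_pair_flatten R sg V q r (fun _ l => x * pairs hit l + y r * \sum_(b <- l) (b == u)%:R)).
  rewrite (@le_trans _ _ (It (@avg R sg) r (fun=> NV^-1 * (x * (r * q)%:R ^+ 2 * (1 + C1) + y r * (r * q)%:R))))//.
    apply: le_Ita.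
    move=> Js _; rewrite ItaD// !ItaZ// Ita_sumf// avg_delta mulrDr lerD//.
      have hI : It (@avg R V) (r * q) (pairs hit) <= (r * q)%:R ^+ 2 * ((1 + C1) / NV).
        by apply: Ita_pairs => //; [move=> v; rewrite avg_hit|rewrite divr_ge0].
      rewrite (le_trans (ler_wpM2l x0 hI))// le_eqVlt; apply/orP; left; apply/eqP.
      by set c := 1 + C1; ring.
    by rewrite le_eqVlt; apply/orP; left; apply/eqP; ring.
  by rewrite Ita_cst ?sg_gt0.
rewrite PP_unif ?open0// mulrC -EPoZ//; apply: le_EPo => //.
- by apply: gbnd_Ita; [exact: open0|exact: gr_flat].
- exact: gbndZ.
Qed.

Section errors.
Variable u : V.
Local Notation nuB := (@nuB R V q alpha u).

Lemma nuB_supp c : ~~ ~~ touch u c -> nuB c = 0.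
Proof. by rewrite negbK /nuB => ->. Qed.

(** [x] weighs the factorization error and [y] the recurrences of [u]. This covers both the
    magnetization and the log-ratio, whose trivial bound grows with the number of clauses. *)
Lemma E_cavity_gen (D : seq open_clause -> seq clause -> R) (x : R) (y : nat -> R) :
  0 <= x -> gbnd y -> (forall r, 0 <= y r) -> gr2 D -> (forall K B, 0 <= D K B) ->
  (forall K B, all (fun c => ~~ touch u c) B -> D K B <=
     x * pairsum beta n.+1 (unzip2 B) (flat K) + y (size K) * \sum_(b <- flat K) (b == u)%:R) ->
  PP (unif (alpha * p%:R)) (fun K => PP nuB (D K)) <=
  EPo (alpha * p%:R) (fun r => x * (r * q)%:R ^+ 2 * (1 + C1) + y r * (r * q)%:R) / NV.
Proof.
move=> x0 gy y0 gD D0 DB.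
have ap0 : 0 <= alpha * p%:R by rewrite mulr_ge0// ltW.
have nB0 c : 0 <= nuB c by exact: nuB_ge0.
have nBle c : nuB c <= unif lam c by exact: nuB_le.
apply: le_trans (EPo_flat u ap0 x0 gy y0).
apply: le_PP => //; [exact: unif_ge0|exact: gr2_PP|exact: gr_flat|] => K.
have [gp hp] := @PP_pairsum nuB (flat K) nB0 nBle.
apply: (@le_trans _ _ (PP nuB (fun B => x * pairsum beta n.+1 (unzip2 B) (flat K) +
   y (size K) * \sum_(b <- flat K) (b == u)%:R))).
  apply: (le_PP_supp nB0 nuB_supp) => //.
  - exact: gr2_l.
  - apply: grD; first exact: grZ.
    by apply: (@gr_bounded _ _ _ `|y (size K) * \sum_(b <- flat K) (b == u)%:R|).
  - by move=> l; rewrite addr_ge0 ?mulr_ge0 ?pairsum_ge0 ?sumr_ge0.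
  - by move=> B; exact: DB.
rewrite PPD//; last 2 first.
- exact: grZ.
- by apply: (@gr_bounded _ _ _ `|y (size K) * \sum_(b <- flat K) (b == u)%:R|).
by rewrite PPZ// PP_cst lerD2r ler_wpM2l.
Qed.
End errors.
End cavity_expectations.

(** * The field of magnetizations and the cavity recursion *)

Section lipschitz_expectation.
Context {R : realType}.

Definition Lp (K : R) (phi : R -> R) := forall x y, `|phi x - phi y| <= K * `|x - y|.

(* An expectation on [-1, 1], seen through Lipschitz functions only. *)
Record lexp := Lexp {
  ez :> (R -> R) -> R ;
  ezD : forall K L phi psi, Lp K phi -> Lp L psi -> ez (fun z => phi z + psi z) = ez phi + ez psi ;
  ezZ : forall K k phi, Lp K phi -> ez (fun z => k * phi z) = k * ez phi ;
  le_ez : forall K L phi psi, Lp K phi -> Lp L psi ->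
    (forall z, -1 <= z <= 1 -> phi z <= psi z) -> ez phi <= ez psi ;
  ez_cst : forall k, ez (fun=> k) = k }.

Definition LpS M (b : R) (Psi : seq R -> R) := forall ys ys', size ys = M -> size ys' = M ->
  `|Psi ys - Psi ys'| <= b * dl ys ys'.

Lemma LpD K L phi psi : Lp K phi -> Lp L psi -> Lp (K + L) (fun z => phi z + psi z).
Proof.
move=> h1 h2 x y; rewrite opprD addrACA (le_trans (ler_normD _ _))// mulrDl.
by rewrite lerD.
Qed.

Lemma LpZ K k phi : Lp K phi -> Lp (`|k| * K) (fun z => k * phi z).
Proof. by move=> h x y; rewrite -mulrBr normrM -mulrA ler_wpM2l. Qed.

Lemma Lp_cst k : Lp 0 (fun=> k).
Proof. by move=> x y; rewrite subrr normr0 mul0r. Qed.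

Lemma Lp_ge0 K phi : Lp K phi -> 0 <= K.
Proof. by move=> h; have := h 1 0; rewrite subr0 normr1 mulr1; apply: le_trans. Qed.

Lemma Lp_sum (I : Type) (s : seq I) (P : pred I) K (phi : I -> R -> R) :
  (forall i, Lp (K i) (phi i)) ->
  Lp (\sum_(i <- s | P i) K i) (fun z => \sum_(i <- s | P i) phi i z).
Proof.
move=> h x y; rewrite -sumrB (le_trans (ler_norm_sum _ _ _))// mulr_suml.
by apply: ler_sum => i _; exact: h.
Qed.

Section ez.
Variable E : lexp.

Lemma ezB K L phi psi : Lp K phi -> Lp L psi -> E (fun z => phi z - psi z) = E phi - E psi.
Proof.
move=> h1 h2; rewrite -mulN1r -(ezZ E _ h2) -(ezD E h1 (LpZ (-1) h2)).
by congr (ez E); apply/funext => z; rewrite mulN1r.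
Qed.

Lemma ez_norm K phi c : Lp K phi -> (forall z, -1 <= z <= 1 -> `|phi z| <= c) -> `|E phi| <= c.
Proof.
move=> h hc; rewrite ler_norml; apply/andP; split.
  rewrite -[leLHS](ez_cst E).
  by apply: le_ez (Lp_cst _) h _ => z /hc; rewrite ler_norml => /andP[].
rewrite -[leRHS](ez_cst E).
by apply: le_ez h (Lp_cst _) _ => z /hc; rewrite ler_norml => /andP[].
Qed.

Lemma ez_dist K L phi psi c : Lp K phi -> Lp L psi ->
  (forall z, -1 <= z <= 1 -> `|phi z - psi z| <= c) -> `|E phi - E psi| <= c.
Proof.
move=> h1 h2 hc; rewrite -(ezB h1 h2); apply: (ez_norm (K := K + L)) => //.
move=> x y; rewrite (_ : _ - _ - _ = (phi x - phi y) - (psi x - psi y)); last by ring.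
by rewrite (le_trans (ler_normB _ _))// mulrDl lerD.
Qed.

Lemma ez_sum (I : Type) (s : seq I) (P : pred I) K (phi : I -> R -> R) :
  (forall i, Lp (K i) (phi i)) ->
  E (fun z => \sum_(i <- s | P i) phi i z) = \sum_(i <- s | P i) E (phi i).
Proof.
move=> h; elim: s => [|i s ih].
  by rewrite big_nil -[RHS](ez_cst E 0); congr (ez E); apply/funext => z; rewrite big_nil.
rewrite big_cons -ih; case: (boolP (P i)) => Pi; last first.
  by congr (ez E); apply/funext => z; rewrite big_cons (negbTE Pi).
rewrite -(ezD E (h i) (Lp_sum s P h)).
by congr (ez E); apply/funext => z; rewrite big_cons Pi.
Qed.

Lemma ez_avg (A : finType) K (phi : A -> R -> R) :
  (forall i, Lp K (phi i)) -> E (fun z => avg (phi^~ z)) = avg (fun i => E (phi i)).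
Proof.
move=> h; rewrite /avg (ezZ E _ (Lp_sum _ _ (fun i => h i))).
by rewrite (ez_sum _ _ (fun i => h i)).
Qed.

Lemma LpS_cons M b Psi y : LpS M.+1 b Psi -> LpS M b (fun ys => Psi (y :: ys)).
Proof.
move=> h ys ys' s s'; rewrite (le_trans (h _ _ _ _))//= ?s ?s'//.
by rewrite dl_cons subrr normr0 add0r.
Qed.

Lemma Lp_Itez M b Psi : 0 <= b -> LpS M.+1 b Psi -> Lp b (fun y => It E M (fun ys => Psi (y :: ys))).
Proof.
move=> b0; elim: M Psi => [|M ih] Psi h x y /=.
  by rewrite (le_trans (h _ _ _ _))//= dl_cons /dl/= big_nil addr0.
have hz z : Lp b (fun y => It E M (fun ys => Psi [:: y, z & ys])).
  apply: (ih (fun ys => Psi (head 0 ys :: z :: behead ys))) => -[|w ys] [|w' ys']//= [s] [s'].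
  by rewrite (le_trans (h _ _ _ _))//= ?s ?s'// !dl_cons subrr normr0 add0r.
have hx w : Lp b (fun z => It E M (fun ys => Psi [:: w, z & ys])).
  by apply: (ih (fun ys => Psi (w :: ys))); exact: LpS_cons.
apply: ez_dist (hx x) (hx y) _ => z _; exact: hz.
Qed.

Lemma Itez_dist M b b' Psi Psi' c : 0 <= b -> 0 <= b' -> LpS M b Psi -> LpS M b' Psi' ->
  (forall ys, size ys = M -> box ys -> `|Psi ys - Psi' ys| <= c) ->
  `|It E M Psi - It E M Psi'| <= c.
Proof.
move=> b0 b0'; elim: M Psi Psi' => [|M ih] Psi Psi' h h' hc /=; first exact: hc.
apply: ez_dist (Lp_Itez b0 h) (Lp_Itez b0' h') _ => z z1.
apply: ih; [exact: LpS_cons|exact: LpS_cons|].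
by move=> ys s bys; apply: hc => /=; rewrite ?s// z1.
Qed.

Lemma Itez_cst M k : It E M (fun=> k) = k.
Proof. by elim: M => //= M ih; rewrite -[RHS](ez_cst E); congr (ez E); apply/funext. Qed.

Lemma LpS_cst M k : LpS M 0 (fun=> k).
Proof. by move=> ys ys' _ _; rewrite subrr normr0 mul0r. Qed.

Lemma Itez_norm M b Psi c : 0 <= b -> LpS M b Psi ->
  (forall ys, size ys = M -> box ys -> `|Psi ys| <= c) -> `|It E M Psi| <= c.
Proof.
move=> b0 h hc; rewrite -[It E M Psi]subr0 -(Itez_cst M 0).
by apply: (Itez_dist b0 (lexx 0) h (@LpS_cst M 0)) => ys s bys; rewrite subr0 hc.
Qed.

Lemma Itez_avg (A : finType) M b (Psi : A -> seq R -> R) : (0 < #|A|)%N -> 0 <= b ->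
  (forall i, LpS M b (Psi i)) -> It E M (fun ys => avg (Psi^~ ys)) = avg (fun i => It E M (Psi i)).
Proof.
move=> A0 b0; elim: M Psi => [//|M ih] Psi h /=.
transitivity (E (fun y => avg (fun i => It E M (fun ys => Psi i (y :: ys))))).
  congr (ez E); apply/funext => y; rewrite (ih (fun i ys => Psi i (y :: ys)))// => i.
  exact: LpS_cons.
by rewrite (ez_avg (K := b))// => i; exact: Lp_Itez.
Qed.

End ez.
End lipschitz_expectation.

Section telescoping.
Context {R : realType} {V : finType} (C : finType).
Hypothesis V0 : (0 < #|V|)%N.
Variables (nu : C -> R) (m : seq C -> V -> R) (E : @lexp R).
Hypotheses (nu0 : forall c, 0 <= nu c) (m1 : forall G u, -1 <= m G u <= 1).
Local Notation NV := (#|V|%:R : R).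

Definition wdist (l : V -> R) (x x' : V -> R) : R := \sum_v l v * `|x v - x' v|.

(** The weights [l] record the dependence on the field site by site; only their sum enters the final
    errors. *)
Definition LpX M (l : V -> R) (b : R) (Psi : (V -> R) -> seq R -> R) :=
  forall x x' ys ys', size ys = M -> size ys' = M ->
  `|Psi x ys - Psi x' ys'| <= wdist l x x' + b * dl ys ys'.

(* The magnetization of a uniform site is an approximate [E]-sample, even for test
   functions that also depend on the whole field. Only the error [A] survives
   in the limit of infinitely many sites. *)
Definition claim (A B : R) := forall (l : V -> R) b Psi, (forall v, 0 <= l v) -> 0 <= b ->
  LpX 1 l b Psi ->
  `|PP nu (fun G => avg (fun u => Psi (m G) [:: m G u])) - PP nu (fun G => E (fun z => Psi (m G) [:: z]))|
  <= A * b + B * (b + \sum_v l v) / NV.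

Lemma wdistxx l x : wdist l x x = 0.
Proof. by rewrite /wdist big1// => v _; rewrite subrr normr0 mulr0. Qed.

Lemma LpX_S M l b Psi x : LpX M l b Psi -> LpS M b (Psi x).
Proof. by move=> h ys ys' s s'; have := h x x _ _ s s'; rewrite wdistxx add0r. Qed.

Lemma dl0 (ys : seq R) : dl ys ys = 0.
Proof. by elim: ys => [|y ys ih]; rewrite /dl/= ?big_nil// big_cons subrr normr0 add0r. Qed.

Lemma LpX_bounded M l b Psi : (forall v, 0 <= l v) -> 0 <= b -> LpX M l b Psi ->
  exists c, forall x ys, (forall v, -1 <= x v <= 1) -> size ys = M -> box ys -> `|Psi x ys| <= c.
Proof.
move=> l0 b0 h; exists (`|Psi (fun=> 0) (nseq M 0)| + (\sum_v l v + b * M%:R)) => x ys x1 sy bys.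
have := h x (fun=> 0) ys (nseq M 0) sy (size_nseq _ _).
have d1 : wdist l x (fun=> 0) <= \sum_v l v.
  apply: ler_sum => v _; rewrite subr0 ler_piMr// ler_norml; exact: x1.
have d2 : dl ys (nseq M 0) <= M%:R.
  elim: ys M sy bys {h} => [|y ys ih] [|M]//=; first by rewrite /dl/= big_nil.
  move=> [sy] /andP[y1 bys]; rewrite dl_cons subr0 -natr1 addrC lerD ?ih//.
  by rewrite ler_norml.
move=> hd; rewrite -[Psi x ys](subrK (Psi (fun=> 0) (nseq M 0))) addrC.
rewrite (le_trans (ler_normD _ _))// lerD2l (le_trans hd)// lerD// ler_wpM2l//.
Qed.

Lemma box_m G l : box (map (m G) l).
Proof. by rewrite /box all_map; apply/allP => u _; exact: m1. Qed.

Lemma gr_sites M l b Psi : (forall v, 0 <= l v) -> 0 <= b -> LpX M l b Psi ->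
  gr (fun G => It (@avg R V) M (fun s => Psi (m G) (map (m G) s))).
Proof.
move=> l0 b0 h; have [c hc] := LpX_bounded l0 b0 h.
apply: (@gr_bounded _ _ _ c) => G; apply: Ita_bound => // s sM.
by apply: hc => //; rewrite ?size_map// box_m.
Qed.

Lemma gr_ez M l b Psi : (forall v, 0 <= l v) -> 0 <= b -> LpX M l b Psi ->
  gr (fun G => It E M (Psi (m G))).
Proof.
move=> l0 b0 h; have [c hc] := LpX_bounded l0 b0 h.
apply: (@gr_bounded _ _ _ c) => G; apply: (Itez_norm E b0 (LpX_S _ h)) => ys sy bys.
exact: hc.
Qed.

(* The slots are replaced one at a time, the replaced ones being integrated
   first. *)
Lemma slot_replacement A B M l b Psi : 0 <= B -> claim A B -> (forall v, 0 <= l v) -> 0 <= b ->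
  LpX M l b Psi ->
  `|PP nu (fun G => It (@avg R V) M (fun s => Psi (m G) (map (m G) s))) -
    PP nu (fun G => It E M (Psi (m G)))|
  <= M%:R * (A * b + B * (b + \sum_v l v + M%:R * b) / NV).
Proof.
move=> B0 cl; elim: M l Psi => [|M ih] l Psi l0 b0 h.
  by rewrite /= subrr normr0 mul0r.
have N0 : 0 < NV by rewrite ltr0n.
have L0 : 0 <= \sum_v l v by exact: sumr_ge0.
(* Averaging a slot over a uniform site turns it into a dependence on the whole field, each site
   receiving the share b/N of its Lipschitz constant: this is why [claim] allows functions of the
   field. *)
pose l1 v := l v + b / NV.
have l10 v : 0 <= l1 v by rewrite addr_ge0// divr_ge0.
have sl1 : \sum_v l1 v = \sum_v l v + b.
  by rewrite big_split/= sumr_const -[_ *+ _]mulr_natr mulfVK// gt_eqF.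
pose Psi1 x ys := avg (fun u => Psi x (x u :: ys)).
have h1 : LpX M l1 b Psi1.
  move=> x x' ys ys' s s'; rewrite /Psi1 -avgB (le_trans (avg_norm _))//.
  apply: (@le_trans _ _ (avg (fun u => wdist l x x' + b * (`|x u - x' u| + dl ys ys')))).
    by apply: le_avg => u; rewrite -dl_cons; apply: h; rewrite /= ?s ?s'.
  rewrite avgD avg_cst// avgZ avgD avg_cst// mulrDr addrA lerD2r.
  rewrite /wdist /l1; under [leRHS]eq_bigr do rewrite mulrDl.
  by rewrite big_split/= lerD2l -mulr_sumr /avg mulrA.
have ih1 := ih _ _ l10 b0 h1.
pose Psi2 (x : V -> R) ys := It E M (fun t => Psi x (head 0 ys :: t)).
have h2 : LpX 1 l b Psi2.
  move=> x x' [|y [|? ?]]// [|y' [|? ?]]// _ _; rewrite dl_cons /dl/= big_nil addr0 /Psi2/=.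
  apply: (Itez_dist E b0 b0); [exact: LpS_cons (LpX_S _ h)|exact: LpS_cons (LpX_S _ h)|].
  move=> t st _; rewrite (le_trans (h _ _ _ _ _ _))/= ?st//.
  by rewrite dl_cons dl0 addr0.
have h2' := cl _ _ _ l0 b0 h2.
rewrite (le_trans (ler_distD (PP nu (fun G => It E M (Psi1 (m G)))) _ _))//.
have e1 : PP nu (fun G => It (@avg R V) M.+1 (fun s => Psi (m G) (map (m G) s))) =
    PP nu (fun G => It (@avg R V) M (fun s => Psi1 (m G) (map (m G) s))).
  by apply: eq_PP => G /=; rewrite -Ita_avg.
have e2 : PP nu (fun G => It E M (Psi1 (m G))) =
    PP nu (fun G => avg (fun u => Psi2 (m G) [:: m G u])).
  apply: eq_PP => G; rewrite /Psi1 /Psi2/= (@Itez_avg _ E V M b (fun u ys => Psi (m G) (m G u :: ys)))//.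
  by move=> u; apply: LpS_cons; exact: (LpX_S _ h).
have e3 : PP nu (fun G => It E M.+1 (Psi (m G))) = PP nu (fun G => E (fun z => Psi2 (m G) [:: z])) by [].
rewrite e1 [X in _ + `|X - _|]e2 e3.
rewrite (le_trans (lerD ih1 h2'))// sl1 -natr1.
have M0 : 0 <= M%:R :> R by [].
rewrite -subr_ge0; set L := \sum_v l v in L0 *.
rewrite (_ : _ - _ = B * (M%:R + 1) * b / NV); last by field; rewrite gt_eqF.
by rewrite !mulr_ge0// ?invr_ge0 ?addr_ge0// ltW.
Qed.
End telescoping.

Section clamping.
Context {R : realType}.

Definition clamp (y : R) : R := Num.max (-1) (Num.min 1 y).

Lemma clamp_itv y : -1 <= clamp y <= 1.
Proof. by rewrite /clamp le_max lexx/= ge_max ge_min lexx/= andbT; lra. Qed.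

Lemma clamp_id y : -1 <= y <= 1 -> clamp y = y.
Proof. by move=> /andP[h1 h2]; rewrite /clamp min_r// max_r. Qed.

Lemma clamp_lip x y : `|clamp x - clamp y| <= `|x - y|.
Proof.
wlog xy : x y / x <= y => [h|].
  by have [/h//|/ltW/h] := leP x y; rewrite distrC (distrC y).
have [h1 h2] : clamp x <= clamp y /\ clamp y - clamp x <= y - x.
  rewrite /clamp; case: (leP 1 x) => x1; case: (leP 1 y) => y1;
  case: (leP (-1 : R) x) => hx; case: (leP (-1 : R) y) => hy;
  case: (leP (-1 : R) 1) => h1; split; lra.
by rewrite distrC (distrC x) !ger0_norm ?subr_ge0.
Qed.

Lemma box_clamp ys : box (map clamp ys).
Proof. by rewrite /box all_map; apply/allP => y _; exact: clamp_itv. Qed.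

Lemma map_clamp_id ys : box ys -> map clamp ys = ys.
Proof. by elim: ys => //= y ys ih /andP[/clamp_id -> /ih ->]. Qed.

Lemma dl_clamp ys ys' : dl (map clamp ys) (map clamp ys') <= dl ys ys'.
Proof.
elim: ys ys' => [|y ys ih] [|y' ys']; rewrite /dl/= ?big_nil//.
by rewrite !big_cons lerD ?clamp_lip//; exact: ih.
Qed.
End clamping.

(** * From the magnetization of a site to the cavity recursion, in stages *)

Section recursion.
Context {R : realType} {V : finType} {q : nat}.
Variables (alpha beta : R).
Hypotheses (alpha0 : 0 < alpha) (beta0 : 0 < beta) (V0 : (0 < #|V|)%N).
Local Notation p := q.+1.
Local Notation conf := {ffun V -> bool}.
Local Notation sg := {ffun 'I_p -> bool}.
Local Notation hedge := {ffun 'I_p -> V}.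
Local Notation clause := (sg * hedge)%type.
Local Notation open_clause := (sg * {ffun 'I_q -> V})%type.
Local Notation NV := (#|V|%:R : R).
Local Notation lam := (alpha * NV).
Local Notation mag := (@mag R V q beta beta0).
Local Notation cwt := (@cwt R V q beta).
Local Notation nuA := (@nuA R V q alpha).
Local Notation nuB := (@nuB R V q alpha).
Local Notation nuS := (@nuS R V q alpha).
Local Notation nuD := (@nuD R V q alpha).
Local Notation kap := (@kappa R p alpha beta).
Local Notation ap := (alpha * p%:R).
Variable n : nat.
Hypotheses (kappa1 : kap < 1) (kn : kap ^+ n <= NV^-1).
Local Notation C1 := (1 / (1 - kap) + 1).
Local Notation C2 := (@C2 R q alpha beta).
Local Notation aa := (2^-1 * (expR beta - 1)).

(* Clamping makes the readouts Lipschitz everywhere; without it the quotient and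
   the logarithm would take junk values off the cube. *)
Definition cavT (Js : seq sg) (ys : seq R) : R := Rd beta gT Js (map clamp ys).
Definition cavL (Js : seq sg) (ys : seq R) : R := Rd beta gL Js (map clamp ys).

Lemma cavT_itv (Js : seq sg) ys : size ys = (size Js * q)%N -> -1 <= cavT Js ys <= 1.
Proof. by move=> sy; apply: RdgT_itv; [|rewrite size_map|exact: box_clamp]. Qed.

Lemma Rd_clamp_lip g (Js : seq sg) : glip g ->
  LpS (size Js * q) aa (fun ys => Rd beta g Js (map clamp ys)).
Proof.
move=> gg ys ys' s s'.
rewrite (le_trans (Rd_lip beta0 gg _ _ (box_clamp ys) (box_clamp ys')))// ?size_map//.
apply: ler_wpM2l; last exact: dl_clamp.
by rewrite mulr_ge0// subr_ge0 ltW// expR_gt1.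
Qed.

Lemma aa_ge0 : 0 <= aa.
Proof. by rewrite mulr_ge0// subr_ge0 ltW// expR_gt1. Qed.

(** Moments of the number of cavity inputs. By [slots1E], [aa * slots1] is the left-hand side of the
    contraction condition. *)
Definition slots1 : R := EPo ap (fun r => (r * q)%:R).
Definition slots2 : R := EPo ap (fun r => (r * q)%:R ^+ 2).
Definition C3 : R :=
  EPo ap (fun r => 2 * (expR beta - 1) * (r * q)%:R ^+ 2 * (1 + C1) + 2 * (r * q)%:R).
Definition shiftC : R := 2 * ap + C2.

Lemma ap_ge0 : 0 <= ap. Proof. by rewrite mulr_ge0// ltW. Qed.

Lemma gbnd_rq : gbnd (fun r : nat => (r * q)%:R : R).
Proof. by under eq_fun do rewrite natrM; apply: gbndM; [exact: gbnd_nat|exact: gbnd_cst]. Qed.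

Lemma slots1E : slots1 = ap * q%:R.
Proof.
rewrite /slots1; under eq_EPo do rewrite natrM mulrC.
by rewrite EPoZ ?EPo_nat 1?mulrC//; exact: gbnd_nat.
Qed.

Lemma shiftC_ge0 : 0 <= shiftC.
Proof. by rewrite addr_ge0 ?C2_ge0// mulr_ge0// ap_ge0. Qed.

Section one_function.
Variables (l : V -> R) (b : R) (Psi : (V -> R) -> seq R -> R).
Hypotheses (l0 : forall v, 0 <= l v) (b0 : 0 <= b) (hPsi : LpX 1 l b Psi).

Lemma Psi1 x x' y y' : `|Psi x [:: y] - Psi x' [:: y']| <= wdist l x x' + b * `|y - y'|.
Proof. by rewrite (le_trans (hPsi _ _ _ _))//= dl_cons /dl/= big_nil addr0. Qed.

Section site.
Variable u : V.

(** Stages of the comparison: the field is first evaluated without the clauses at [u]; these clauses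
    are then counted once per position and rewritten as open clauses; the magnetization of [u] is
    replaced by the cavity formula; finally the field is evaluated in the full system again. *)
Let S0 := PP (unif lam) (fun G : seq clause => Psi (mag G) [:: mag G u]).
Let S1 := PP (nuA u) (fun K => PP (nuB u) (fun B => Psi (mag B) [:: mag (K ++ B) u])).
Let S2 := PP (nuS u) (fun K => PP (nuB u) (fun B => Psi (mag B) [:: mag (K ++ B) u])).
Let S4 := PP (unif ap) (fun K : seq open_clause => PP (nuB u)
   (fun B => Psi (mag B) [:: cavT (unzip1 K) (map (mag B) (flat K))])).
Let S5 := PP (unif ap) (fun K : seq open_clause => PP (unif lam)
   (fun G : seq clause => Psi (mag G) [:: cavT (unzip1 K) (map (mag G) (flat K))])).

Lemma nA0 c : 0 <= nuA u c. Proof. exact: nuA_ge0. Qed.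
Lemma nB0 c : 0 <= nuB u c. Proof. exact: nuB_ge0. Qed.
Lemma nD0 c : 0 <= nuD u c. Proof. exact: nuD_ge0. Qed.
Lemma un0 (c : open_clause) : 0 <= unif ap c. Proof. exact/unif_ge0/ap_ge0. Qed.
Lemma unl0 (c : clause) : 0 <= unif lam c. Proof. exact/unif_ge0/lam_ge0. Qed.

Lemma unifAB (F : seq clause -> R) : perm_inv F -> gr F ->
  PP (unif lam) F = PP (nuA u) (fun K => PP (nuB u) (fun B => F (K ++ B))).
Proof.
move=> pF gF; rewrite -PP_add//; [|exact: nA0|exact: nB0].
by congr PP; apply/funext => c; rewrite nuAB.
Qed.

Lemma Psi_bnd : exists c, forall G G' G'', `|Psi (mag G) [:: mag (G' : seq clause) u]| <= c /\
  forall Js s, size s = (size Js * q)%N -> `|Psi (mag G) [:: cavT Js (map (mag G'') s)]| <= c.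
Proof.
have [c hc] := LpX_bounded l0 b0 hPsi; exists c => G G' G''; split.
  by apply: hc => // [v|]; [exact: mag_itv|rewrite /= mag_itv].
move=> Js s sJ; apply: hc => //= [v|]; first exact: mag_itv.
rewrite andbT cavT_itv// size_map sJ//.
Qed.

Let du w := 2 * ap * (u == w)%:R + C2 / NV.

Lemma du_bound w : PP (nuA u) (fun K => PP (nuB u) (fun B => `|mag (K ++ B) w - mag B w|)) <= du w.
Proof.
by have := cavity_delta alpha0 beta0 V0 kappa1 kn u w; rewrite /du mulrA.
Qed.

Lemma gr2_dmag w : gr2 (fun K B => `|mag (K ++ B) w - mag B w|).
Proof. by apply: (@gr2_bounded _ _ _ _ 2) => K B; rewrite normr_id mag_dist2. Qed.

Lemma gr2D (C D : Type) (F G : seq C -> seq D -> R) : gr2 F -> gr2 G ->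
  gr2 (fun K B => F K B + G K B).
Proof.
move=> [K hF] [L hG]; exists (K + L) => s t.
have K0 : 0 <= K by rewrite (le_trans _ (hF [::] [::])).
have L0 : 0 <= L by rewrite (le_trans _ (hG [::] [::])).
rewrite (le_trans (ler_normD _ _))// (le_trans (lerD (hF s t) (hG s t)))//.
elim: (size s + size t)%N => [|r ih]; first by rewrite !expr1.
rewrite [in leRHS]exprS (le_trans _ (ler_wpM2l _ ih)) ?addr_ge0//.
rewrite exprS [L ^+ r.+2]exprS mulrDr !mulrDl.
by rewrite addrACA lerD// ?lerDl ?lerDr mulr_ge0 ?exprn_ge0.
Qed.

Lemma gr2Z (C D : Type) k (F : seq C -> seq D -> R) : gr2 F -> gr2 (fun K B => k * F K B).
Proof.
move=> [K hF]; have K0 : 0 <= K by rewrite (le_trans _ (hF [::] [::])).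
exists ((1 + `|k|) * K) => s t; rewrite normrM exprMn ler_pM//.
by rewrite exprS (@le_trans _ _ (1 + `|k|)) ?lerDr// ler_peMr ?addr_ge0// exprn_ege1// lerDl.
Qed.

Lemma gr2_sum (C D I : Type) (s : seq I) (F : I -> seq C -> seq D -> R) :
  (forall i, gr2 (F i)) -> gr2 (fun K B => \sum_(i <- s) F i K B).
Proof.
move=> gF; elim: s => [|i s ih].
  apply: (@gr2_bounded _ _ _ _ 0) => K B; rewrite big_nil normr0//.
rewrite (_ : (fun K B => _) = fun K B => F i K B + \sum_(j <- s) F j K B).
  exact: gr2D.
by apply/funext => K; apply/funext => B; rewrite big_cons.
Qed.

Lemma wdist_AB : PP (nuA u) (fun K => PP (nuB u) (fun B => wdist l (mag (K ++ B)) (mag B))) <=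
  \sum_w l w * du w.
Proof.
rewrite (_ : PP (nuA u) _ = \sum_w l w * PP (nuA u) (fun K => PP (nuB u)
   (fun B => `|mag (K ++ B) w - mag B w|))).
  by apply: ler_sum => w _; rewrite ler_wpM2l// du_bound.
have g2 w := gr2_dmag w.
transitivity (PP (nuA u) (fun K => \sum_w l w * PP (nuB u) (fun B => `|mag (K ++ B) w - mag B w|))).
  apply: eq_PP => K; rewrite PP_sum; last 2 first.
  - exact: nB0.
  - by move=> w; apply: grZ; exact: (gr2_l K (g2 w)).
  by apply: eq_bigr => w _; rewrite PPZ//; [exact: nB0|exact: (gr2_l K (g2 w))].
rewrite PP_sum; last 2 first.
- exact: nA0.
- by move=> w; apply: grZ; apply: gr2_PP => //; exact: nB0.
by apply: eq_bigr => w _; rewrite PPZ//; [exact: nA0|apply: gr2_PP => //; exact: nB0].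
Qed.

Lemma gr2_wdist : gr2 (fun K B => wdist l (mag (K ++ B)) (mag B)).
Proof. by apply: gr2_sum => w; apply: gr2Z; exact: gr2_dmag. Qed.

(** The magnetization of [u] still sees all the clauses; only the field, the first argument of
    [Psi], loses those at [u]. *)
Lemma drop_environment : `|S0 - S1| <= \sum_w l w * du w.
Proof.
have [c hc] := Psi_bnd.
rewrite /S0 unifAB; last 2 first.
- move=> G G' GG'; rewrite (_ : mag G = mag G')//; apply/funext => v; exact: mag_perm.
- by apply: (@gr_bounded _ _ _ c) => G; have [h _] := hc G G G.
have gF : gr2 (fun K B : seq clause => Psi (mag (K ++ B)) [:: mag (K ++ B) u]).
  by apply: (@gr2_bounded _ _ _ _ c) => K B; have [h _] := hc (K ++ B) (K ++ B) B.
have gG : gr2 (fun K B : seq clause => Psi (mag B) [:: mag (K ++ B) u]).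
  by apply: (@gr2_bounded _ _ _ _ c) => K B; have [h _] := hc B (K ++ B) B.
apply: le_trans wdist_AB; have gw := gr2_wdist.
have pB c' := nB0 c'; have pA c' := nA0 c'.
apply: PP_dist => //; [exact: gr2_PP..|] => K.
apply: PP_dist => //; [exact: (gr2_l K gF)|exact: (gr2_l K gG)|exact: (gr2_l K gw)|] => B.
by rewrite (le_trans (Psi1 _ _ _ _))// subrr normr0 mulr0 addr0.
Qed.

(** [nuS] is [nuA] plus the excess process [nuD]. Nothing changes if the latter is empty; otherwise
    the change is at most 2b, hence at most 2b times its size, whose mean is [mass_nuD]. *)
Lemma overlap_error : `|S1 - S2| <= b * (2 * alpha * p%:R ^+ 2 / NV).
Proof.
have [c hc] := Psi_bnd; have pB c' := nB0 c'; have pA c' := nA0 c'; have pD c' := nD0 c'.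
have gG : gr2 (fun K B : seq clause => Psi (mag B) [:: mag (K ++ B) u]).
  by apply: (@gr2_bounded _ _ _ _ c) => K B; have [h _] := hc B (K ++ B) B.
pose H (K : seq clause) := PP (nuB u) (fun B => Psi (mag B) [:: mag (K ++ B) u]).
have Hc K : `|H K| <= c.
  by apply: PP_bounded => // B; have [h _] := hc B (K ++ B) B.
have gH : gr H by exact: gr_bounded Hc.
have pH : perm_inv H.
  move=> K K' KK'; apply: eq_PP => B; congr (Psi _ [:: _]).
  by apply: mag_perm; rewrite perm_cat2r.
have E2 : S2 = PP (nuA u) (fun K => PP (nuD u) (fun D => H (K ++ D))).
  rewrite -PP_add//; congr PP; apply/funext => c'.
  by rewrite nuAD.
have E1 : S1 = PP (nuA u) (fun K => PP (nuD u) (fun _ => H K)).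
  by apply: eq_PP => K; rewrite PP_cst.
rewrite E1 E2.
have gs : gr2 (fun (K D : seq clause) => 2 * b * (size D)%:R).
  apply: (@gr2_size _ _ _ _ (fun r => 2 * b * r%:R)); first by apply: gbndZ; exact: gbnd_nat.
  by move=> K D; rewrite ger0_norm ?mulr_ge0// ler_wpM2l ?mulr_ge0// ler_nat leq_addl.
have g1 : gr2 (fun K (D : seq clause) => H K) by apply: (gr2_bounded (k := c)) => K D; exact: Hc.
have g2 : gr2 (fun K D => H (K ++ D)) by exact: gr2_cat.
apply: (@le_trans _ _ (PP (nuA u) (fun K => PP (nuD u) (fun D => 2 * b * (size D)%:R)))).
  apply: PP_dist => //; [exact: (gr2_PP pD g1)|exact: (gr2_PP pD g2)|exact: (gr2_PP pD gs)|] => K.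
  apply: PP_dist => //; [exact: (gr2_l K g1)|exact: (gr2_l K g2)|exact: (gr2_l K gs)|].
  case=> [|d D]; first by rewrite cats0 subrr normr0 mulr0.
  apply: (@le_trans _ _ (2 * b)); last by rewrite ler_peMr ?mulr_ge0// ler1n.
  rewrite -[leRHS](PP_cst (nuB u)); apply: PP_dist => //.
  - exact: (gr2_l K gG).
  - exact: (gr2_l (K ++ d :: D) gG).
  - by apply: (@gr_bounded _ _ _ `|2 * b|).
  move=> B; rewrite (le_trans (Psi1 _ _ _ _))// wdistxx add0r mulrC.
  by rewrite ler_wpM2r// mag_dist2.
rewrite PP_cst PPZ//; last by apply: (@gr_size _ _ _ (fun r => r%:R)) => //; [exact: gbnd_nat|move=> D; rewrite normr_nat].
rewrite PP_size//.
have := mass_nuD alpha0 V0 u (q := q); set M := mass _ => hM.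
rewrite (le_trans (ler_wpM2l (mulr_ge0 (ler0n R 2) b0) hM))//.
by rewrite le_eqVlt; apply/orP; left; apply/eqP; ring.
Qed.

Let S3 := PP (unif ap) (fun K : seq open_clause => PP (nuB u)
   (fun B => Psi (mag B) [:: mag (map (ins u) K ++ B) u])).

Lemma position_form : S2 = S3.
Proof.
pose F (W : seq (conf -> R)) : R := PP (nuB u) (fun B => Psi (mag B)
  [:: gavg (wprod (W ++ map cwt B)) (fun s => spin R (s u))]).
transitivity (PP (nuS u) (F \o map cwt)).
  by apply: eq_PP => K; apply: eq_PP => B /=; rewrite magE map_cat.
rewrite PP_position//; apply: eq_PP => K; apply: eq_PP => B /=.
by rewrite magE map_cat.
Qed.

Lemma cavity_error : `|S3 - S4| <= b * (C3 / NV).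
Proof.
have [c hc] := Psi_bnd; have pB c' := nB0 c'; have po c' := un0 c'.
have ub K : size (flat K) = (size (@unzip1 sg {ffun 'I_q -> V} K) * q)%N.
  by rewrite size_flat size_map.
have gF : gr2 (fun K B => Psi (mag B) [:: mag (map (ins u) K ++ B) u]).
  by apply: (@gr2_bounded _ _ _ _ c) => K B; have [h _] := hc B (map (ins u) K ++ B) B.
have gG : gr2 (fun K B => Psi (mag B) [:: cavT (unzip1 K) (map (mag B) (flat K))]).
  by apply: (@gr2_bounded _ _ _ _ c) => K B; have [_ h] := hc B B B; apply: h.
pose D K B := `|mag (map (ins u) K ++ B) u - Rd beta gT (unzip1 K) (map (mag B) (flat K))|.
have D2 K B : `|D K B| <= 2.
  rewrite /D normr_id (le_trans (ler_normB _ _))//.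
  have := mag_norm beta0 (map (ins u) K ++ B) u.
  have h : `|Rd beta gT (unzip1 K) (map (mag B) (flat K))| <= 1.
    by rewrite ler_norml RdgT_itv//; [rewrite size_map|exact: box_magn].
  by move=> ?; lra.
have gD : gr2 D by exact: gr2_bounded D2.
apply: (@le_trans _ _ (PP (unif ap) (fun K => PP (nuB u) (fun B => b * D K B)))).
  have gbD := gr2Z b gD.
  apply: PP_dist => //; [exact: gr2_PP..|] => K.
  apply: PP_dist => //; [exact: (gr2_l K gF)|exact: (gr2_l K gG)|exact: (gr2_l K gbD)|] => B.
  rewrite (le_trans (Psi1 _ _ _ _))// wdistxx add0r /cavT map_clamp_id//.
  exact: box_magn.
rewrite (_ : PP _ _ = b * PP (unif ap) (fun K => PP (nuB u) (D K))); last first.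
  rewrite -PPZ//; last exact: gr2_PP.
  by apply: eq_PP => K; rewrite PPZ//; exact: (gr2_l K gD).
rewrite ler_wpM2l// /C3.
have e0 : 0 <= 2 * (expR beta - 1) by rewrite mulr_ge0// subr_ge0 ltW// expR_gt1.
apply: (E_cavity_gen alpha0 beta0 V0 kappa1 kn (u := u) (y := fun=> 2)) => //.
- exact: gbnd_cst.
- by move=> K B; exact: normr_ge0.
- move=> K B Bu; exact: mag_cavity.
Qed.

Lemma sum_flat_avg (f : V -> R) :
  PP (unif ap) (fun K : seq open_clause => \sum_(s <- flat K) f s) = slots1 * avg f.
Proof.
rewrite PP_unif ?open0// /slots1 [RHS]mulrC -EPoZ; last exact: gbnd_rq.
apply: eq_EPo => r.
rewrite (@It_pair_flatten R sg V q r (fun _ l => \sum_(s <- l) f s)).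
transitivity (It (@avg R sg) r (fun _ => (r * q)%:R * avg f)).
  by apply: eq_It => // Js _; rewrite Ita_sumf.
by rewrite Ita_cst ?sg_gt0// mulrC.
Qed.

(** Putting the clauses at [u] back moves both the first argument of [Psi] and the cavity inputs; as
    the latter sit at uniform sites, they see only the average of [du]. *)
Lemma restore_environment : `|S4 - S5| <= \sum_w l w * du w + b * aa * (slots1 * avg du).
Proof.
have [c hc] := Psi_bnd; have pB c' := nB0 c'; have po c' := un0 c'; have pA c' := nA0 c'.
have pu c' := unl0 c'.
have ub K : size (flat K) = (size (@unzip1 sg {ffun 'I_q -> V} K) * q)%N.
  by rewrite size_flat size_map.
have a0 := aa_ge0.
have du0 w : 0 <= du w.
  by rewrite (le_trans _ (du_bound w))// PP_ge0//; [apply: gr2_PP => //; exact: gr2_dmag|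
    move=> K; apply: PP_ge0 => //; exact: (gr2_l K (gr2_dmag w))].
have sum0 (s : seq V) : 0 <= \sum_(w <- s) du w by exact: sumr_ge0.
have sl0 : 0 <= \sum_w l w * du w by apply: sumr_ge0 => w _; rewrite mulr_ge0.
have ba0 : 0 <= b * aa by rewrite mulr_ge0.
have gd : gbnd (fun r : nat => \sum_w l w * du w + b * aa * ((r * q)%:R * \sum_w du w)).
  apply: gbndD; first exact: gbnd_cst.
  by apply: gbndZ; apply: gbndM; [exact: gbnd_rq|exact: gbnd_cst].
have gH : gr (fun K : seq open_clause => \sum_w l w * du w + b * aa * \sum_(s <- flat K) du s).
  apply: (gr_size gd) => K; rewrite ger0_norm; last first.
    by rewrite addr_ge0// mulr_ge0.
  rewrite lerD2l ler_wpM2l// -size_flat.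
  elim: (flat K) => [|s t ih]; first by rewrite big_nil mul0r.
  rewrite big_cons/= -natr1 mulrDl mul1r addrC lerD//.
  by rewrite (bigD1 s)//= lerDl sumr_ge0.
have gF : gr2 (fun K B => Psi (mag B) [:: cavT (unzip1 K) (map (mag B) (flat K))]).
  by apply: (@gr2_bounded _ _ _ _ c) => K B; have [_ h] := hc B B B; apply: h.
rewrite (_ : \sum_w l w * du w + _ = PP (unif ap) (fun K : seq open_clause =>
    \sum_w l w * du w + b * aa * \sum_(s <- flat K) du s)); last first.
  have gs : gr (fun K : seq open_clause => \sum_(s <- flat K) du s).
    apply: (@gr_size _ _ _ (fun r => (r * q)%:R * \sum_w du w)).
      by apply: gbndM; [exact: gbnd_rq|exact: gbnd_cst].
    move=> K; rewrite ger0_norm// -size_flat.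
    elim: (flat K) => [|s t ih]; first by rewrite big_nil mul0r.
    rewrite big_cons/= -natr1 mulrDl mul1r addrC lerD//.
    by rewrite (bigD1 s)//= lerDl sumr_ge0.
  rewrite PPD//; [|by apply: (@gr_bounded _ _ _ `|\sum_w l w * du w|)|exact: grZ].
  by rewrite PP_cst PPZ// sum_flat_avg.
apply: PP_dist => //; [exact: gr2_PP|exact: gr2_PP|] => K.
have gFK := gr2_l K gF.
rewrite unifAB//; last first.
  move=> G G' GG'; rewrite (_ : mag G = mag G')//; apply/funext => v; exact: mag_perm.
rewrite -(PP_cst (nuA u) (PP (nuB u) _)).
have gF' : gr2 (fun A B => Psi (mag (A ++ B)) [:: cavT (unzip1 K) (map (mag (A ++ B)) (flat K))]).
  exact: (gr2_cat gFK).
have gF0 : gr2 (fun A B : seq clause => Psi (mag B) [:: cavT (unzip1 K) (map (mag B) (flat K))]).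
  by apply: (@gr2_bounded _ _ _ _ c) => A B; have [_ h] := hc B B B; apply: h.
pose X s (A B : seq clause) := `|mag (A ++ B) s - mag B s|.
have gX : gr2 (fun A B => wdist l (mag (A ++ B)) (mag B) + b * aa * \sum_(s <- flat K) X s A B).
  apply: gr2D; first exact: gr2_wdist.
  by apply: gr2Z; apply: gr2_sum => s; exact: gr2_dmag.
apply: (@le_trans _ _ (PP (nuA u) (fun A => PP (nuB u) (fun B =>
   wdist l (mag (A ++ B)) (mag B) + b * aa * \sum_(s <- flat K) X s A B)))).
  rewrite distrC; apply: PP_dist => //; [exact: gr2_PP| |exact: gr2_PP|].
    exact: (gr2_PP pB gF0).
  move=> A; apply: PP_dist => //; [exact: (gr2_l A gF')|exact: (gr2_l A gX)|] => B.
  rewrite (le_trans (Psi1 _ _ _ _))// lerD2l -mulrA ler_wpM2l//.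
  have h := @Rd_clamp_lip gT (unzip1 K) glip_tanh.
  rewrite (le_trans (h _ _ _ _))// ?size_map ?size_flat ?size_map//.
  rewrite ler_wpM2l// /X; elim: (flat K) => [|s t ih]; first by rewrite /dl/= big_nil big_nil.
  by rewrite dl_cons big_cons lerD2l.
rewrite (_ : PP (nuA u) _ = PP (nuA u) (fun A => PP (nuB u) (fun B => wdist l (mag (A ++ B)) (mag B))) +
   b * aa * \sum_(s <- flat K) PP (nuA u) (fun A => PP (nuB u) (X s A))); last first.
  have gXs s : gr2 (X s) by exact: gr2_dmag.
  rewrite -PP_sum//; last by move=> s; exact: gr2_PP.
  rewrite -PPZ//; last by apply: gr_sum => s; exact: gr2_PP.
  rewrite -PPD//; last 2 first.
  - by apply: gr2_PP => //; exact: gr2_wdist.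
  - by apply: grZ; apply: gr_sum => s; exact: gr2_PP.
  apply: eq_PP => A; rewrite PPD//; last 2 first.
  - exact: (gr2_l A gr2_wdist).
  - by apply: grZ; apply: gr_sum => s; exact: (gr2_l A (gXs s)).
  rewrite PPZ//; last by apply: gr_sum => s; exact: (gr2_l A (gXs s)).
  congr (_ + _ * _); rewrite PP_sum// => s; exact: (gr2_l A (gXs s)).
rewrite lerD ?wdist_AB// ler_wpM2l//; apply: ler_sum => s _; exact: du_bound.
Qed.

Lemma avg_du_l : avg du = shiftC / NV.
Proof.
rewrite /du avgD avgZ avg_cst//.
rewrite (_ : avg _ = NV^-1); first by rewrite /shiftC [RHS]mulrDl.
by rewrite -(avg_delta u); apply: eq_avg => v; rewrite eq_sym.
Qed.

End site.
End one_function.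
End recursion.

Section PP_averages.
Context {R : realType} {C : finType}.
Variable nu : C -> R.
Hypothesis nu0 : forall c, 0 <= nu c.

Lemma gr_avg (A : finType) (F : A -> seq C -> R) : (forall a, gr (F a)) -> gr (fun l => avg (F^~ l)).
Proof. by move=> gF; rewrite /avg; apply: grZ; exact: gr_sum. Qed.

Lemma PP_avg (A : finType) (F : A -> seq C -> R) : (forall a, gr (F a)) ->
  PP nu (fun l => avg (F^~ l)) = avg (fun a => PP nu (F a)).
Proof. by move=> gF; rewrite /avg PPZ ?PP_sum//; exact: gr_sum. Qed.

Lemma gr_Ita (A : finType) n (F : seq A -> seq C -> R) : (forall a, gr (F a)) ->
  gr (fun l => It (@avg R A) n (F^~ l)).
Proof.
elim: n F => [|n ih] F gF /=; first exact: gF.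
by apply: gr_avg => a; apply: (ih (fun s => F (a :: s))).
Qed.

Lemma PP_Ita (A : finType) n (F : seq A -> seq C -> R) : (forall a, gr (F a)) ->
  PP nu (fun l => It (@avg R A) n (F^~ l)) = It (@avg R A) n (fun s => PP nu (F s)).
Proof.
elim: n F => [//|n ih] F gF /=.
rewrite (PP_avg (F := fun a l => It (@avg R A) n (fun s => F (a :: s) l))).
  by apply: eq_avg => a; rewrite (ih (fun s => F (a :: s))).
by move=> a; apply: (@gr_Ita A n (fun s => F (a :: s))).
Qed.
End PP_averages.

(** * Iteration of the cavity recursion *)

Section claims.
Context {R : realType} {q : nat}.
Variables (alpha beta : R).
Hypotheses (alpha0 : 0 < alpha) (beta0 : 0 < beta).
Local Notation p := q.+1.
Local Notation sg := {ffun 'I_p -> bool}.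
Local Notation kap := (@kappa R p alpha beta).
Local Notation ap := (alpha * p%:R).
Local Notation aa := (2^-1 * (expR beta - 1)).
Local Notation Q1 := (@slots1 R q alpha).
Local Notation Q2 := (@slots2 R q alpha).
Local Notation C3 := (@C3 R q alpha beta).
Local Notation D1 := (@shiftC R q alpha beta).
Local Notation RdT := (@cavT R q beta).
Hypothesis kappa1 : kap < 1.
Variable E : @lexp R.

Definition fixed_lexp := forall K phi, Lp K phi ->
  E phi = EPo ap (fun r => It (@avg R sg) r (fun Js => It E (r * q) (fun ys => phi (RdT Js ys)))).

(** One step adds the O(1/N) errors of the comparison stages and multiplies [B] by a constant made
    of moments of the number of inputs. *)
Definition Bstep (B : R) : R :=
  2 * D1 + 2 * alpha * p%:R ^+ 2 + C3 + aa * Q1 * D1 + B * (Q1 * (1 + aa) + Q2 * aa).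

Lemma slots1_ge0 : 0 <= Q1. Proof. by rewrite slots1E !mulr_ge0// ltW. Qed.

Lemma slots2_ge0 : 0 <= Q2.
Proof.
apply: EPo_ge0; [exact: ap_ge0|exact: size_le_gbnd|by move=> r; exact: exprn_ge0].
Qed.

Lemma C1_pos : 0 <= 1 / (1 - kap) + 1.
Proof. by rewrite addr_ge0// divr_ge0// subr_ge0 ltW. Qed.

Lemma C3_ge0 : 0 <= C3.
Proof.
have C10 := C1_pos; have e0 : 0 <= expR beta - 1 by rewrite subr_ge0 ltW// expR_gt1.
apply: EPo_ge0; first exact: ap_ge0.
  apply: gbndD; last by apply: gbndZ; exact: gbnd_rq.
  by apply: gbndM; [apply: gbndZ; exact: size_le_gbnd|exact: gbnd_cst].
move=> r; rewrite addr_ge0// ?mulr_ge0//.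
by rewrite addr_ge0.
Qed.

Lemma Bstep_ge0 B : 0 <= B -> 0 <= Bstep B.
Proof.
move=> B0; have h1 := slots1_ge0; have h2 := slots2_ge0; have h3 := C3_ge0.
have h4 : 0 <= D1 by exact: shiftC_ge0.
have h5 : 0 <= aa by exact: aa_ge0.
have a0 := ltW alpha0.
have x1 : 0 <= aa * Q1 * D1 by rewrite mulr_ge0// mulr_ge0.
have x2 : 0 <= B * (Q1 * (1 + aa) + Q2 * aa).
  by rewrite mulr_ge0// addr_ge0// mulr_ge0// addr_ge0.
have x3 : 0 <= 2 * alpha * p%:R ^+ 2 by rewrite mulr_ge0 ?exprn_ge0// mulr_ge0.
by rewrite /Bstep; lra.
Qed.

Section one_size.
Variables (V : finType) (n : nat).
Hypotheses (V0 : (0 < #|V|)%N) (kn : kap ^+ n <= #|V|%:R^-1).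
Local Notation NV := (#|V|%:R : R).
Local Notation lam := (alpha * NV).
Local Notation mag := (@mag R V q beta beta0).
Local Notation clause := (sg * {ffun 'I_p -> V})%type.
Local Notation open_clause := (sg * {ffun 'I_q -> V})%type.
Local Notation claimV := (@claim R V clause (unif lam) mag E).

(** Before any use of the recursion both arguments lie in [-1, 1], at distance at most 2. *)
Lemma claim_base : claimV 2 0.
Proof.
move=> l b Psi l0 b0 h; rewrite !mul0r addr0.
have N0 : 0 < NV by exact: NV0.
have ul c : 0 <= unif lam c :> R by exact/unif_ge0/lam_ge0.
have m1 := @mag_itv R V q beta beta0.
have g1 : gr (fun G : seq clause => avg (fun u => Psi (mag G) [:: mag G u])) := gr_sites V0 m1 l0 b0 h.
have g2 : gr (fun G : seq clause => E (fun z => Psi (mag G) [:: z])) := gr_ez E m1 l0 b0 h.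
rewrite -[leRHS](PP_cst (unif lam : clause -> R)); apply: PP_dist => //.
  by apply: (@gr_bounded _ _ _ `|2 * b|).
move=> G; rewrite -(avg_cst (E _) V0) -avgB; apply: avg_bounded => // u.
have hz x : Lp b (fun z => Psi x [:: z]).
  by move=> y y'; rewrite (le_trans (h _ _ _ _ _ _))// wdistxx add0r dl_cons /dl/= big_nil addr0.
rewrite -(ez_cst E (Psi _ _)); apply: ez_dist (Lp_cst _) (hz _) _ => z z1.
rewrite (le_trans (h _ _ _ _ _ _))// wdistxx add0r dl_cons /dl/= big_nil addr0 mulrC.
rewrite ler_wpM2r// (le_trans (ler_normB _ _))//.
have := mag_norm beta0 G u; move: z1; rewrite -ler_norml => ? ?; lra.
Qed.

(* One use of the cavity equation multiplies the surviving error by the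
   contraction factor of T. *)
Lemma claim_step A B : 0 <= A -> 0 <= B -> fixed_lexp -> claimV A B ->
  claimV (aa * Q1 * A) (Bstep B).
Proof.
move=> A0 B0 fixE cl l b Psi l0 b0 h.
have N0 : 0 < NV by exact: NV0.
have ul c : 0 <= unif lam c :> R by exact/unif_ge0/lam_ge0.
have uo (c : open_clause) : 0 <= unif ap c by exact/unif_ge0/ap_ge0.
have m1 := @mag_itv R V q beta beta0.
have a0 : 0 <= aa by exact: aa_ge0.
have L0 : 0 <= \sum_v l v by exact: sumr_ge0.
have [c hc] := LpX_bounded l0 b0 h.
have hPhi (Js : seq sg) : LpX (size Js * q) l (b * aa) (fun x ys => Psi x [:: RdT Js ys]).
  move=> x x' ys ys' s s'; rewrite (le_trans (h _ _ _ _ _ _))// lerD2l -mulrA.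
  rewrite ler_wpM2l// dl_cons /dl/= big_nil addr0.
  exact: (@Rd_clamp_lip R q beta beta0 gT Js glip_tanh).
pose S5 := PP (unif ap) (fun K : seq open_clause => PP (unif lam)
   (fun G : seq clause => Psi (mag G) [:: RdT (unzip1 K) (map (mag G) (flat K))])).
pose du (u w : V) := 2 * ap * (u == w)%:R + @C2 R q alpha beta / NV : R.
have step1 u : `|PP (unif lam) (fun G : seq clause => Psi (mag G) [:: mag G u]) - S5| <=
    2 * (\sum_w l w * du u w) + b * (2 * alpha * p%:R ^+ 2 / NV) + b * (C3 / NV) +
    b * aa * (Q1 * (D1 / NV)).
  have h1 := drop_environment (q := q) alpha0 beta0 V0 kappa1 kn l0 b0 h u.
  have h2 := overlap_error (q := q) alpha0 beta0 V0 l0 b0 h u.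
  have h3 := cavity_error (q := q) alpha0 beta0 V0 kappa1 kn l0 b0 h u.
  have h4 := restore_environment (q := q) alpha0 beta0 V0 kappa1 kn l0 b0 h u.
  rewrite (@avg_du_l R V q alpha beta V0 u) in h4.
  have h23 := @position_form R V q alpha beta beta0 V0 Psi u.
  rewrite h23 in h2.
  move: h1 h2 h3 h4; rewrite -/S5 /du.
  set s0 := PP (unif lam) _; set s1 := PP (nuA alpha u) _; set s3 := PP (unif ap) _.
  set s4 := PP (unif ap) (fun K => PP (nuB alpha u) _) => h1 h2 h3 h4.
  rewrite (le_trans (ler_distD s1 _ _))// (le_trans (lerD (lexx _) (ler_distD s3 _ _)))//.
  rewrite (le_trans (lerD (lexx _) (lerD (lexx _) (ler_distD s4 _ _))))//.
  by lra.
have gu u : gr (fun G : seq clause => Psi (mag G) [:: mag G u]).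
  apply: (@gr_bounded _ _ _ c) => G; apply: hc => //=.
  by rewrite /= m1.
have hz x : Lp b (fun z => Psi x [:: z]).
  by move=> y y'; rewrite (le_trans (h _ _ _ _ _ _))// wdistxx add0r dl_cons /dl/= big_nil addr0.
pose T1 r Js := PP (unif lam) (fun G : seq clause =>
   It (@avg R V) (r * q) (fun s => Psi (mag G) [:: RdT Js (map (mag G) s)])).
pose T2 r Js := PP (unif lam) (fun G : seq clause =>
   It E (r * q) (fun ys => Psi (mag G) [:: RdT Js ys])).
have RdT1 (Js : seq sg) ys : size ys = (size Js * q)%N -> box [:: RdT Js ys].
  by move=> sy; rewrite /box/= andbT cavT_itv.
have g1 r Js : size Js = r -> gr (fun G : seq clause =>
   It (@avg R V) (r * q) (fun s => Psi (mag G) [:: RdT Js (map (mag G) s)])).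
  move=> sJ; apply: (@gr_bounded _ _ _ c) => G; apply: Ita_bound => // s ss.
  by apply: hc => //; apply: RdT1; rewrite size_map ss sJ.
have g2 r Js : size Js = r -> forall G, `|It E (r * q) (fun ys => Psi (mag G) [:: RdT Js ys])| <= c.
  move=> sJ G; subst r; apply: (Itez_norm E (mulr_ge0 b0 a0) (LpX_S (mag G) (hPhi Js))) => ys sy _.
  by apply: hc => //; exact: RdT1.
have E5 : S5 = EPo ap (fun r => It (@avg R sg) r (T1 r)).
  rewrite /S5 PP_unif ?open0//; apply: eq_EPo => r.
  rewrite (@It_pair_flatten R sg V q r (fun Js s => PP (unif lam) (fun G : seq clause =>
     Psi (mag G) [:: RdT Js (map (mag G) s)]))).
  apply: eq_It => // Js sJ; rewrite /T1.
  (* Off the lists of the right size [F] is set to 0, since [PP_Ita] requires the growth condition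
     for every list. *)
  pose F s G := if size s == (r * q)%N then Psi (mag G) [:: RdT Js (map (mag G) s)] else 0.
  transitivity (It (@avg R V) (r * q) (fun s => PP (unif lam) (F s))).
    by apply: eq_It => // s ss; apply: eq_PP => G; rewrite /F ss eqxx.
  rewrite -PP_Ita//; last first.
    move=> s; rewrite /F; case: eqP => ss; last by apply: (@gr_bounded _ _ _ 0) => G; rewrite normr0.
    apply: (@gr_bounded _ _ _ c) => G.
    by apply: hc => //; apply: RdT1; rewrite size_map ss sJ.
  by apply: eq_PP => G; apply: eq_It => // s ss; rewrite /F ss eqxx.
pose S8 := PP (unif lam) (fun G : seq clause => E (fun z => Psi (mag G) [:: z])).
(* The fixed-point equation is applied with the field held fixed, for each clause list [G]; then the
   Poisson sum is exchanged with the process. *)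
have E8 : S8 = EPo ap (fun r => It (@avg R sg) r (T2 r)).
  pose F r (G : seq clause) := It (@avg R sg) r (fun Js => It E (r * q) (fun ys => Psi (mag G) [:: RdT Js ys])).
  have -> : S8 = PP (unif lam) (fun G => EPo ap (F^~ G)).
    by apply: eq_PP => G; rewrite (fixE b _ (hz (mag G))).
  have c0 : 0 <= c by rewrite (le_trans _ (g2 0%N [::] erefl [::])).
  rewrite -EPo_PP//; last 2 first.
  - exact: ap_ge0.
  - exists (1 + c) => r G; apply: (@le_trans _ _ c).
      by apply: Ita_bound => [|Js sJ]; [exact: sg_gt0|exact: g2].
    by rewrite exprS (@le_trans _ _ (1 + c)) ?lerDr// ler_peMr ?addr_ge0// exprn_ege1// lerDl.
  apply: eq_EPo => r.
  pose F' Js G := if size Js == r then It E (r * q) (fun ys => Psi (mag G) [:: RdT Js ys]) else 0.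
  transitivity (PP (unif lam) (fun G : seq clause => It (@avg R sg) r (fun Js => F' Js G))).
    by apply: eq_PP => G; apply: eq_It => // Js sJ; rewrite /F' sJ eqxx.
  rewrite PP_Ita//; last first.
    move=> Js; rewrite /F'; case: eqP => sJ; last by apply: (@gr_bounded _ _ _ 0) => G; rewrite normr0.
    by apply: (@gr_bounded _ _ _ c) => G; exact: g2.
  by apply: eq_It => // Js sJ; apply: eq_PP => G; rewrite /F' sJ eqxx.
(* At fixed number and signs of the clauses, what remains is to compare [r * q] magnetizations of
   uniform sites with as many samples of [E], which the previous claim controls. *)
have TT r Js : size Js = r -> `|T1 r Js - T2 r Js| <=
    (r * q)%:R * (A * (b * aa) + B * (b * aa + \sum_v l v + (r * q)%:R * (b * aa)) / NV).
  move=> sJ; subst r.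
  exact: (slot_replacement V0 B0 cl l0 (mulr_ge0 b0 a0) (hPhi Js)).
pose k1 := A * (b * aa) + B * (b * aa + \sum_v l v) / NV.
pose k2 := B * (b * aa) / NV.
have errE : EPo ap (fun r => (r * q)%:R * (A * (b * aa) + B * (b * aa + \sum_v l v + (r * q)%:R * (b * aa)) / NV)) =
    k1 * Q1 + k2 * Q2.
  rewrite /slots1 /slots2 -EPoZ; last exact: gbnd_rq.
  rewrite -EPoZ; last exact: size_le_gbnd.
  rewrite -EPoD; last 2 first.
  - by apply: gbndZ; exact: gbnd_rq.
  - by apply: gbndZ; exact: size_le_gbnd.
  by apply: eq_EPo => r; rewrite /k1 /k2; field; rewrite gt_eqF.
have gbe : gbnd (fun r => (r * q)%:R * (A * (b * aa) + B * (b * aa + \sum_v l v + (r * q)%:R * (b * aa)) / NV)).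
  apply: gbndM; first exact: gbnd_rq.
  rewrite (_ : (fun r => _) = (fun r => k1 + k2 * (r * q)%:R)).
    by apply: gbndD; [exact: gbnd_cst|apply: gbndZ; exact: gbnd_rq].
  by apply/funext => r; rewrite /k1 /k2; field; rewrite gt_eqF.
have bT1 r : `|It (@avg R sg) r (T1 r)| <= c.
  apply: Ita_bound => [|Js sJ]; first exact: sg_gt0.
  apply: PP_bounded => // G; apply: Ita_bound => // s ss.
  by apply: hc => //; apply: RdT1; rewrite size_map ss sJ.
have bT2 r : `|It (@avg R sg) r (T2 r)| <= c.
  apply: Ita_bound => [|Js sJ]; first exact: sg_gt0.
  by apply: PP_bounded => // G; exact: g2.
have step2 : `|S5 - S8| <= k1 * Q1 + k2 * Q2.
  rewrite E5 E8 -errE; apply: EPo_dist => //.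
  - exact: ap_ge0.
  - by apply: (gbnd_le bT1); exact: gbnd_cst.
  - by apply: (gbnd_le bT2); exact: gbnd_cst.
  move=> r; rewrite -[leRHS](@Ita_cst R sg sg_gt0 r); apply: Ita_dist => Js sJ.
  exact: TT.
rewrite (PP_avg (ul _) (F := fun u G => Psi (mag G) [:: mag G u]))//.
rewrite -/S8 (le_trans (ler_distD S5 _ _))//.
have step3 : `|avg (fun u => PP (unif lam) (fun G : seq clause => Psi (mag G) [:: mag G u])) - S5| <=
  2 * ((\sum_w l w) * (D1 / NV)) + b * (2 * alpha * p%:R ^+ 2 / NV) + b * (C3 / NV) +
    b * aa * (Q1 * (D1 / NV)).
  rewrite -(avg_cst S5 V0) -avgB (le_trans (avg_norm _))//.
  apply: (le_trans (le_avg step1)); rewrite !avgD !avg_cst// avgZ !lerD2r ler_pM2l//.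
  rewrite avg_sum mulr_suml; apply: ler_sum => w _; rewrite avgZ ler_wpM2l//.
  by rewrite /du avgD avgZ avg_cst// avg_delta /shiftC [leRHS]mulrDl.
rewrite (le_trans (lerD step3 step2))// /Bstep /k1 /k2.
have h1 := slots1_ge0; have h2 := slots2_ge0; have h3 := C3_ge0.
have h4 : 0 <= D1 by exact: shiftC_ge0.
have a1 := ltW alpha0.
rewrite -subr_ge0; set L := \sum_v l v in L0 *.
move: h1 h2 h3 h4 a0 N0; set x1 := Q1; set x2 := Q2; set x3 := C3; set x4 := D1.
set a := aa; set N := NV; set pp := p%:R => h1 h2 h3 h4 a0 N0.
have pp0 : 0 <= pp by [].
rewrite (_ : _ - _ = (2 * x4 * b + 2 * alpha * pp ^+ 2 * L + x3 * L + a * x1 * x4 * L +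
   B * (x1 * b + x1 * a * L + x2 * a * L)) / N); last by field; rewrite gt_eqF.
by clearbody x1 x2 x3 x4 a L pp; rewrite divr_ge0 ?(ltW N0)//; do ?[apply: addr_ge0|apply: mulr_ge0|apply: exprn_ge0].
Qed.
End one_size.

(** [B] depends on [L] but not on the number of sites, so the limit in N can be taken before the one
    in [L]. *)
Lemma claims_hold (L : nat) : fixed_lexp -> exists2 B : R, 0 <= B &
  forall (V : finType) (n : nat), (0 < #|V|)%N -> kap ^+ n <= #|V|%:R^-1 ->
  @claim R V (sg * {ffun 'I_p -> V})%type (unif (alpha * #|V|%:R)) (@mag R V q beta beta0) E
    (2 * (aa * Q1) ^+ L) B.
Proof.
move=> fixE; have x0 : 0 <= aa * Q1 by rewrite mulr_ge0 ?slots1_ge0//; exact: aa_ge0.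
elim: L => [|L [B B0 ih]].
  by exists 0 => // V n V0 _; rewrite expr0 mulr1; exact: claim_base.
exists (Bstep B); first exact: Bstep_ge0.
move=> V n V0 kn; rewrite exprS mulrCA; apply: (@claim_step V n) => //.
  by rewrite mulr_ge0// exprn_ge0.
exact: (ih V n).
Qed.
End claims.

Lemma le_Itez {R : realType} (E : @lexp R) M b b' Psi Psi' : 0 <= b -> 0 <= b' -> LpS M b Psi ->
  LpS M b' Psi' -> (forall ys, size ys = M -> box ys -> Psi ys <= Psi' ys) ->
  It E M Psi <= It E M Psi'.
Proof.
move=> b0 b0'; elim: M Psi Psi' => [|M ih] Psi Psi' h h' hc /=; first exact: hc.
apply: le_ez (Lp_Itez E b0 h) (Lp_Itez E b0' h') _ => z z1.
apply: ih; [exact: LpS_cons|exact: LpS_cons|].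
by move=> ys s bys; apply: hc => /=; rewrite ?s// z1.
Qed.

Lemma ItezB {R : realType} (E : @lexp R) M b b' Psi Psi' : 0 <= b -> 0 <= b' -> LpS M b Psi ->
  LpS M b' Psi' -> It E M (fun ys => Psi ys - Psi' ys) = It E M Psi - It E M Psi'.
Proof.
move=> b0 b0'; elim: M Psi Psi' => [//|M ih] Psi Psi' h h' /=.
rewrite -(ezB E (Lp_Itez E b0 h) (Lp_Itez E b0' h')); congr (ez E); apply/funext => z.
by rewrite (ih (fun ys => Psi (z :: ys)) (fun ys => Psi' (z :: ys)))//; exact: LpS_cons.
Qed.

Lemma dl_cat {R : realType} (x x' ys ys' : seq R) : size x = size x' ->
  dl (x ++ ys) (x' ++ ys') = dl x x' + dl ys ys'.
Proof. by move=> s; rewrite /dl zip_cat// big_cat. Qed.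

(** * Measures on [-1, 1] and the fixed point of T *)

Section measure_expectation.
Context {R : realType}.
Variable mu : probability R R.

Lemma Lp_continuous K (phi : R -> R) : Lp K phi -> continuous phi.
Proof.
move=> h x; apply/cvgrPdist_lt => e e0; have K0 := Lp_ge0 h.
have e1 : 0 < e / (K + 1) by rewrite divr_gt0// ltr_wpDl.
near=> y; rewrite (le_lt_trans (h x y))//.
apply: (@le_lt_trans _ _ ((K + 1) * `|x - y|)).
  by rewrite ler_wpM2r// lerDl.
rewrite mulrC -ltr_pdivlMr; last by rewrite ltr_wpDl.
near: y; exact: (nbhsx_ballx x _ e1).
Unshelve. all: by end_near. Qed.

Lemma Lp_clamp K (phi : R -> R) : Lp K phi -> Lp K (phi \o clamp).
Proof.
by move=> h x y /=; rewrite (le_trans (h _ _))// ler_wpM2l ?clamp_lip// (Lp_ge0 h).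
Qed.

Lemma Lp_bounded K (phi : R -> R) z : Lp K phi -> -1 <= z <= 1 -> `|phi z| <= `|phi 0| + K.
Proof.
move=> h; rewrite -ler_norml => z1; rewrite -[phi z](subrK (phi 0)).
rewrite (le_trans (ler_normD _ _))// addrC lerD2l (le_trans (h _ _))// subr0.
by rewrite ler_piMr// (Lp_ge0 h).
Qed.

Lemma Lp_measurable K (phi : R -> R) : Lp K phi -> measurable_fun setT phi.
Proof. by move=> /Lp_continuous/continuous_measurable_fun. Qed.

Lemma Lp_integrable K (phi : R -> R) : Lp K phi -> mu.-integrable setT (EFin \o (phi \o clamp)).
Proof.
move=> h; apply: measurable_bounded_integrable => //.
- by rewrite (le_lt_trans (probability_le1 _ _))// ltry.
- exact: (Lp_measurable (Lp_clamp h)).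
exists (`|phi 0| + K); split=> [|x hx y _ /=]; first by rewrite num_real.
by rewrite (le_trans (Lp_bounded h (clamp_itv y)))// ltW.
Qed.

(* The clamp is invisible to measures carried by [-1, 1] and makes all Lipschitz
   functions integrable. *)
Definition mexp (phi : R -> R) : R := \int[mu]_x phi (clamp x).

Lemma mexpD K L phi psi : Lp K phi -> Lp L psi -> mexp (fun z => phi z + psi z) = mexp phi + mexp psi.
Proof. by move=> h1 h2; rewrite /mexp RintegralD//; [exact: (Lp_integrable h1)|exact: (Lp_integrable h2)]. Qed.

Lemma mexpZ K k phi : Lp K phi -> mexp (fun z => k * phi z) = k * mexp phi.
Proof. by move=> h; rewrite /mexp RintegralZl//; exact: (Lp_integrable h). Qed.

Lemma le_mexp K L phi psi : Lp K phi -> Lp L psi ->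
  (forall z, -1 <= z <= 1 -> phi z <= psi z) -> mexp phi <= mexp psi.
Proof.
move=> h1 h2 h; apply: le_Rintegral => //; [exact: (Lp_integrable h1)|exact: (Lp_integrable h2)|].
by move=> x _; apply: h; exact: clamp_itv.
Qed.

Lemma mexp_cst k : mexp (fun=> k) = k.
Proof.
rewrite /mexp Rintegral_cst// -[RHS]mulr1; congr (_ * _).
by rewrite (_ : _ setT = 1%E)//; exact: probability_setT.
Qed.

Definition mlexp := Lexp mexpD mexpZ le_mexp mexp_cst.

Lemma mexpE K phi : Lp K phi -> (\int[mu]_x (phi (clamp x))%:E = (mexp phi)%:E)%E.
Proof.
move=> h; rewrite /mexp /Rintegral fineK//.
by apply: integrable_fin_num => //; exact: (Lp_integrable h).
Qed.

End measure_expectation.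

(** * Integrals against powers of a law as iterated expectations *)

Section integration_of_powers.
Context {R : realType}.

Lemma integral_prod_prob d1 d2 (T1 : measurableType d1) (T2 : measurableType d2)
  (P1 : probability T1 R) (P2 : probability T2 R) (f : T1 * T2 -> \bar R) :
  measurable_fun setT f -> (forall x, 0 <= f x)%E ->
  (\int[prod_prob P1 P2]_z f z = \int[P1]_x \int[P2]_y f (x, y))%E.
Proof. by move=> mf f0; exact: fubini_tonelli1. Qed.

Lemma integral_iidS d (T : measurableType d) (P : probability T R) n (f : n.+1.-tuple T -> \bar R) :
  measurable_fun setT f -> (forall x, 0 <= f x)%E ->
  (\int[iid P n.+1]_z f z = \int[P]_x \int[iid P n]_t f (cons_pair (x, t)))%E.
Proof.
move=> mf f0; rewrite [LHS]ge0_integral_distribution// integral_prod_prob//.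
  by apply: measurableT_comp.
by move=> x; exact: f0.
Qed.

Lemma measurable_iidS d (T : measurableType d) (P : probability T R) n (f : n.+1.-tuple T -> \bar R) :
  measurable_fun setT f -> (forall x, 0 <= f x)%E ->
  measurable_fun setT (fun x => \int[iid P n]_t f (cons_pair (x, t)))%E.
Proof.
move=> mf f0; apply: (measurable_fun_fubini_tonelli_F (fun z => f (cons_pair z))) => //.
by apply: measurableT_comp.
Qed.

Lemma measurable_section d (T : measurableType d) n (f : n.+1.-tuple T -> \bar R) x :
  measurable_fun setT f -> measurable_fun setT (fun t => f (cons_pair (x, t))).
Proof.
move=> mf; apply: (measurableT_comp mf).
by apply: measurable_cons => //; exact: measurable_id.
Qed.

Lemma integral_iid0 d (T : measurableType d) (P : probability T R) (f : 0.-tuple T -> \bar R) :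
  measurable_fun setT f -> (\int[iid P 0]_z f z = f [tuple])%E.
Proof. by move=> mf; rewrite /= integral_dirac// diracT mul1e. Qed.

Variable zeta : Pr11 R.
Local Notation E := (mlexp zeta).

Lemma Pr11_integral (f : R -> \bar R) : measurable_fun setT f -> (forall x, 0 <= f x)%E ->
  (\int[zeta]_x f x = \int[zeta]_(x in `[(-1)%R, 1%R]) f x)%E.
Proof.
move=> mf f0; rewrite (@ge0_negligible_integral _ R _ zeta setT (~` `[(-1)%R, 1%R]%classic : set R))//.
- by rewrite setTD setCK.
- exact: measurableC.
- transitivity (1 - Pr11_prob zeta `[(-1)%R, 1%R]%classic)%E; first exact: probability_setC.
  by rewrite Pr11_carried subee.
Qed.

Lemma Pr11_integral_eq (f g : R -> \bar R) : measurable_fun setT f -> (forall x, 0 <= f x)%E ->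
  measurable_fun setT g -> (forall x, 0 <= g x)%E ->
  (forall x, -1 <= x <= 1 -> f x = g x) -> (\int[zeta]_x f x = \int[zeta]_x g x)%E.
Proof.
move=> mf f0 mg g0 fg; rewrite Pr11_integral// [RHS]Pr11_integral//.
by apply: eq_integral => x; rewrite inE/= in_itv/= => /fg.
Qed.

(** [F] is compared with [Psi] on the cube only, which has full measure. Nonnegativity gives access
    to Tonelli's theorem; signed functions are split into positive and negative parts afterwards. *)
Lemma integral_iid_real n b Psi (F : n.-tuple R -> \bar R) : 0 <= b -> LpS n b Psi ->
  (forall ys, size ys = n -> box ys -> 0 <= Psi ys) ->
  measurable_fun setT F -> (forall x, 0 <= F x)%E ->
  (forall z : n.-tuple R, box z -> F z = (Psi z)%:E) ->
  (\int[iid zeta n]_z F z = (It E n Psi)%:E)%E.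
Proof.
move=> b0; elim: n Psi F => [|n ih] Psi F h Psi0 mF F0 FE.
  by rewrite integral_iid0//= FE.
rewrite integral_iidS//.
have hl : Lp b (fun y => It E n (fun ys => Psi (y :: ys))) by exact: (Lp_Itez E b0 h).
rewrite (Pr11_integral_eq (g := fun x => (It E n (fun ys => Psi (clamp x :: ys)))%:E)).
- by rewrite (mexpE zeta hl).
- exact: measurable_iidS.
- by move=> x; apply: integral_ge0.
- by apply/measurable_EFinP; exact: (Lp_measurable (Lp_clamp hl)).
- move=> x; rewrite lee_fin -(Itez_cst E n 0).
  apply: (le_Itez E (lexx 0) b0 (@LpS_cst _ n 0) (LpS_cons _ h)) => ys s bys.
  by apply: Psi0; rewrite /= ?s// bys clamp_itv.
move=> x x1; rewrite clamp_id//; apply: (ih (fun ys => Psi (x :: ys))).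
- exact: LpS_cons.
- by move=> ys s bys; apply: Psi0 => /=; rewrite ?s// x1.
- exact: measurable_section.
- by [].
by move=> z bz; rewrite FE//= x1.
Qed.

Definition box2 (r m : nat) (z : r.-tuple (m.-tuple R)) := all (fun t : m.-tuple R => box t) z.

Lemma integral_iid_iid r m b Psi (F : r.-tuple (m.-tuple R) -> \bar R) : 0 <= b ->
  LpS (r * m) b Psi -> (forall ys, size ys = (r * m)%N -> box ys -> 0 <= Psi ys) ->
  measurable_fun setT F -> (forall x, 0 <= F x)%E ->
  (forall z, box2 z -> F z = (Psi (flatten (map val z)))%:E) ->
  (\int[iid (iid zeta m) r]_z F z = (It E (r * m) Psi)%:E)%E.
Proof.
move=> b0; elim: r Psi F => [|r ih] Psi F h Psi0 mF F0 FE.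
  by rewrite integral_iid0//= FE.
rewrite integral_iidS// mulSn It_add.
have hx (x : seq R) : size x = m -> LpS (r * m) b (fun ys => Psi (x ++ ys)).
  move=> sx ys ys' s s'; rewrite (le_trans (h _ _ _ _))//= ?size_cat ?sx ?s ?s' ?mulSn//.
  by rewrite ler_wpM2l// dl_cat// dl0 add0r.
apply: (integral_iid_real b0).
- move=> x x' s s'; apply: (Itez_dist E b0 b0 (hx _ s) (hx _ s')) => ys sy _.
  rewrite (le_trans (h _ _ _ _))//= ?size_cat ?s ?s' ?sy ?mulSn//.
  by rewrite dl_cat ?s ?s'// dl0 addr0.
- move=> x s bx; rewrite -(Itez_cst E (r * m) 0).
  apply: (le_Itez E (lexx 0) b0 (@LpS_cst _ _ 0) (hx _ s)) => ys sy bys.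
  by apply: Psi0; rewrite ?size_cat ?s ?sy ?mulSn// /box all_cat; apply/andP.
- exact: measurable_iidS.
- by move=> x; apply: integral_ge0.
move=> x bx; apply: (ih (fun ys => Psi (x ++ ys))).
- by apply: hx; rewrite size_tuple.
- move=> ys s bys; apply: Psi0; first by rewrite size_cat size_tuple s mulSn.
  by rewrite /box all_cat; apply/andP.
- exact: measurable_section.
- by [].
by move=> z bz; rewrite FE//; apply/andP.
Qed.
End integration_of_powers.

Section signed_integrals.
Context {R : realType}.

Lemma Rintegral_signed d (T : measurableType d) (mu : {measure set T -> \bar R}) (F : T -> R) a b :
  (\int[mu]_x (Num.max (F x) 0)%:E = a%:E)%E -> (\int[mu]_x (Num.max (- F x) 0)%:E = b%:E)%E ->
  \int[mu]_x F x = a - b.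
Proof.
move=> ha hb; rewrite /Rintegral integralE.
rewrite (_ : (\int[mu]_x _)%E = a%:E); last first.
  by rewrite -ha; apply: eq_integral => x _; rewrite funeposE EFin_max.
rewrite (_ : (\int[mu]_x _)%E = b%:E)//.
by rewrite -hb; apply: eq_integral => x _; rewrite funenegE -EFinN EFin_max.
Qed.

Lemma maxN0 (x : R) : Num.max x 0 - Num.max (- x) 0 = x.
Proof. by case: (leP x 0) => h1; case: (leP (- x) 0) => h2; lra. Qed.

Lemma max0_lip (x y : R) : `|Num.max x 0 - Num.max y 0| <= `|x - y|.
Proof.
wlog xy : x y / x <= y => [h|].
  by have [/h//|/ltW/h] := leP x y; rewrite distrC (distrC y).
rewrite distrC [leRHS]distrC.
have [h1 h2] : Num.max x 0 <= Num.max y 0 /\ Num.max y 0 - Num.max x 0 <= y - x.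
  by case: (leP x 0) => h1; case: (leP y 0) => h2; split; lra.
by rewrite !ger0_norm ?subr_ge0.
Qed.

Lemma LpS_max n b (Psi : seq R -> R) : LpS n b Psi -> LpS n b (fun ys => Num.max (Psi ys) 0).
Proof. by move=> h ys ys' s s'; rewrite (le_trans (max0_lip _ _))// h. Qed.

Lemma LpS_N n b (Psi : seq R -> R) : LpS n b Psi -> LpS n b (fun ys => - Psi ys).
Proof. by move=> h ys ys' s s'; rewrite opprK addrC distrC h. Qed.

Variable zeta : Pr11 R.
Local Notation E := (mlexp zeta).

Lemma It_maxN0 n b Psi : 0 <= b -> LpS n b Psi ->
  It E n (fun ys => Num.max (Psi ys) 0) - It E n (fun ys => Num.max (- Psi ys) 0) = It E n Psi.
Proof.
move=> b0 h; rewrite -(ItezB E b0 b0 (LpS_max h) (LpS_max (LpS_N h))).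
by apply: eq_It => // ys _; rewrite maxN0.
Qed.

Lemma measurable_pos d (T : measurableType d) (F : T -> R) : measurable_fun setT F ->
  measurable_fun setT (fun x => (Num.max (F x) 0)%:E).
Proof. by move=> mF; apply/measurable_EFinP; apply: measurable_maxr. Qed.

Lemma measurable_neg d (T : measurableType d) (F : T -> R) : measurable_fun setT F ->
  measurable_fun setT (fun x => (Num.max (- F x) 0)%:E).
Proof. by move=> mF; apply: measurable_pos; apply: measurableT_comp. Qed.

Lemma Rintegral_iid n b Psi (F : n.-tuple R -> R) : 0 <= b -> LpS n b Psi ->
  measurable_fun setT F -> (forall z : n.-tuple R, box z -> F z = Psi z) ->
  \int[iid zeta n]_z F z = It E n Psi.
Proof.
move=> b0 h mF FE; rewrite -(It_maxN0 b0 h); apply: Rintegral_signed.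
- apply: (integral_iid_real zeta b0 (LpS_max h)) => [ys _ _||x|z bz].
  + by rewrite le_max lexx orbT.
  + exact: measurable_pos.
  + by rewrite lee_fin le_max lexx orbT.
  + by rewrite FE.
- apply: (integral_iid_real zeta b0 (LpS_max (LpS_N h))) => [ys _ _||x|z bz].
  + by rewrite le_max lexx orbT.
  + exact: measurable_neg.
  + by rewrite lee_fin le_max lexx orbT.
  + by rewrite FE.
Qed.

Lemma Rintegral_iid_iid r m b Psi (F : r.-tuple (m.-tuple R) -> R) : 0 <= b ->
  LpS (r * m) b Psi -> measurable_fun setT F ->
  (forall z, box2 z -> F z = Psi (flatten (map val z))) ->
  \int[iid (iid zeta m) r]_z F z = It E (r * m) Psi.
Proof.
move=> b0 h mF FE; rewrite -(It_maxN0 b0 h); apply: Rintegral_signed.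
- apply: (integral_iid_iid zeta b0 (LpS_max h)) => [ys _ _||x|z bz].
  + by rewrite le_max lexx orbT.
  + exact: measurable_pos.
  + by rewrite lee_fin le_max lexx orbT.
  + by rewrite FE.
- apply: (integral_iid_iid zeta b0 (LpS_max (LpS_N h))) => [ys _ _||x|z bz].
  + by rewrite le_max lexx orbT.
  + exact: measurable_neg.
  + by rewrite lee_fin le_max lexx orbT.
  + by rewrite FE.
Qed.
End signed_integrals.

Section poisson_integrals.
Context {R : realType}.
Variable lam : R.
Hypothesis lam0 : 0 < lam.

Let pmf_ge0 k : 0 <= poisson_pmf lam k. Proof. exact: poisson_pmf_ge0. Qed.
Let w k : {nonneg R} := NngNum (pmf_ge0 k).

(** Written as a series of weighted Dirac masses, the law integrates nonnegative functions term by
    term. *)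
Lemma poisson_mseries (A : set nat) :
  poisson lam A = mseries (fun k => mscale (w k) \d_k : {measure set nat -> \bar R}) 0 A.
Proof.
transitivity (\esum_(k in A) (poisson_pmf lam k)%:E)%E.
  transitivity (poisson_prob lam 0%N A) => //.
  by rewrite /poisson_prob lam0.
rewrite (esum_mkcond A) /mseries nneseries_esumT; last first.
  by move=> n; rewrite /mscale mule_ge0// lee_fin.
apply: eq_esum => k _; transitivity ((poisson_pmf lam k)%:E * ((k \in A)%:R)%:E)%E => //.
by case: ifP => _; rewrite ?mule1 ?mule0.
Qed.

Lemma integral_poisson (f : nat -> \bar R) : (forall r, 0 <= f r)%E ->
  (\int[poisson lam]_r f r = \sum_(0 <= r <oo) (poisson_pmf lam r)%:E * f r)%E.
Proof.
move=> f0; rewrite (@eq_measure_integral _ _ _ _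
  (mseries (fun k => mscale (w k) \d_k : {measure set nat -> \bar R}) 0)); last first.
  by move=> A _ _; exact: poisson_mseries.
rewrite ge0_integral_measure_series//; apply: eq_eseriesr => r _.
by rewrite ge0_integral_mscale// integral_dirac// diracT mul1e.
Qed.

Lemma eseries_EPo (f : nat -> R) : gbnd f ->
  (\sum_(0 <= r <oo) (poisson_pmf lam r)%:E * (f r)%:E = (EPo lam f)%:E)%E.
Proof.
move=> gf; have gg := EPo_gb lam gf.
rewrite /EPo -xsumZ// /xsum -EFin_lim; last by apply: is_cvg_xser; exact: gbndZ.
congr (limn _); apply/funext => n /=.
rewrite sumEFin; congr EFin; rewrite /xser /series/=; apply: eq_bigr => r _.
by rewrite /poisson_pmf lam0; ring.
Qed.

Lemma gbnd_max f : gbnd f -> gbnd (fun r => Num.max (f r) 0 : R).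
Proof.
move=> [K hK]; exists K => r; rewrite (le_trans _ (hK r))//.
by have := max0_lip (f r) 0; rewrite maxxx !subr0.
Qed.

Lemma Rintegral_poisson (f : nat -> R) : gbnd f -> \int[poisson lam]_r f r = EPo lam f.
Proof.
move=> gf; have gN := gbndN gf.
rewrite (@Rintegral_signed _ _ _ _ _ (EPo lam (fun r => Num.max (f r) 0))
  (EPo lam (fun r => Num.max (- f r) 0))).
- by rewrite -EPoB; [apply: eq_EPo => r; rewrite maxN0|exact: gbnd_max..].
- rewrite integral_poisson; last by move=> r; rewrite lee_fin le_max lexx orbT.
  by apply: eseries_EPo; exact: gbnd_max.
- rewrite integral_poisson; last by move=> r; rewrite lee_fin le_max lexx orbT.
  by apply: eseries_EPo; exact: (gbnd_max gN).
Qed.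
End poisson_integrals.

(** * The map T on test functions *)

Section law_of_cavity.
Context {R : realType} {q : nat}.
Variables (alpha beta : R).
Hypotheses (alpha0 : 0 < alpha) (beta0 : 0 < beta).
Local Notation p := q.+1.
Local Notation sg := {ffun 'I_p -> bool}.
Local Notation ap := (alpha * p%:R).
Local Notation aa := (2^-1 * (expR beta - 1)).
Local Notation RdT := (@cavT R q beta).
Local Notation RdL := (@cavL R q beta).

Lemma expR_cavity r (J : {ffun 'I_r -> sg}) (z : r.-tuple (q.-tuple R)) (e : bool) : box2 z ->
  expR (cavity_field (p := p) beta J z (spin R e)) =
  FP q (cavw beta (spin R e)) (codom J) (flatten (map val z)).
Proof.
move=> bz; rewrite FP_flatten; last 2 first.
- by rewrite size_codom card_ord size_map size_tuple.
- by move=> b /mapP[t _ ->]; rewrite size_tuple.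
rewrite (_ : map val z = map (fun k => val (tnth z k)) (enum 'I_r)); last first.
  by rewrite -[in LHS](map_tnth_enum z) -map_comp.
rewrite codomE zip_map big_map big_enum/= /cavity_field expR_sum.
apply: eq_bigr => k _; rewrite (@theta_cw R beta p _ _ (rcons (tnth z k) (spin R e)))//.
  rewrite lnK// posrE cw_gt0// /box all_rcons spin_itv/=.
  by move/allP : bz; apply; exact: mem_tnth.
by rewrite size_rcons size_tuple.
Qed.

Lemma T_funE r (J : {ffun 'I_r -> sg}) (z : r.-tuple (q.-tuple R)) : box2 z ->
  T_fun (p := p) beta J z = RdT (codom J) (flatten (map val z)).
Proof.
move=> bz; rewrite /T_fun !avg_bool !expR_cavity// /cavT map_clamp_id; last first.
  move: bz; rewrite /box2 /box => /allP bz; apply/allP => y /flattenP[s /mapP[t tz ->] yt].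
  by have /allP := bz _ tz; apply.
by rewrite /Rd /gT /spin mul1r mulN1r -mulf_div divff// mul1r.
Qed.

Lemma ln_cavityE r (J : {ffun 'I_r -> sg}) (z : r.-tuple (q.-tuple R)) : box2 z ->
  ln (avg (fun eps : bool => expR (cavity_field (p := p) beta J z (spin R eps)))) =
  RdL (codom J) (flatten (map val z)).
Proof.
move=> bz; rewrite avg_bool !expR_cavity// /cavL map_clamp_id//.
move: bz; rewrite /box2 /box => /allP bz; apply/allP => y /flattenP[s /mapP[t tz ->] yt].
by have /allP := bz _ tz; apply.
Qed.

(** The action of T on expectations, identified with T on laws in [mexp_T]; it makes sense for
    functionals not yet known to be integrals. *)
Definition TE (E : @lexp R) (phi : R -> R) : R :=
  EPo ap (fun r => It (@avg R sg) r (fun Js => It E (r * q) (fun ys => phi (RdT Js ys)))).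

Lemma cavT_LpS K phi (Js : seq sg) : Lp K phi -> LpS (size Js * q) (K * aa) (fun ys => phi (RdT Js ys)).
Proof.
move=> h ys ys' s s'; rewrite (le_trans (h _ _))// -mulrA ler_wpM2l ?(Lp_ge0 h)//.
exact: (@Rd_clamp_lip R q beta beta0 gT Js glip_tanh).
Qed.

Lemma Kaa_ge0 K (phi : R -> R) : Lp K phi -> 0 <= K * aa.
Proof. by move=> h; rewrite mulr_ge0 ?(Lp_ge0 h)//; exact: aa_ge0. Qed.

Lemma TE_bnd (E : @lexp R) K phi r : Lp K phi ->
  `|It (@avg R sg) r (fun Js => It E (r * q) (fun ys => phi (RdT Js ys)))| <= `|phi 0| + K.
Proof.
move=> h; apply: Ita_bound => [|Js sJ]; first exact: sg_gt0.
subst r; apply: (Itez_norm E (Kaa_ge0 h) (cavT_LpS (Js := Js) h)) => ys sy _.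
exact: (Lp_bounded h (cavT_itv beta0 sy)).
Qed.

Lemma TE_gbnd (E : @lexp R) K phi : Lp K phi ->
  gbnd (fun r => It (@avg R sg) r (fun Js => It E (r * q) (fun ys => phi (RdT Js ys)))).
Proof. by move=> h; apply: (gbnd_le (fun r => TE_bnd E r h)); exact: gbnd_cst. Qed.

Lemma TEB (E : @lexp R) K L phi psi : Lp K phi -> Lp L psi ->
  TE E (fun z => phi z - psi z) = TE E phi - TE E psi.
Proof.
move=> h1 h2; rewrite /TE -EPoB; [|exact: (TE_gbnd E h1)|exact: (TE_gbnd E h2)].
apply: eq_EPo => r; rewrite -ItaB; apply: eq_It => // Js sJ; subst r.
by rewrite -(ItezB E (Kaa_ge0 h1) (Kaa_ge0 h2) (cavT_LpS (Js := Js) h1) (cavT_LpS (Js := Js) h2)).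
Qed.

Lemma TE_cst (E : @lexp R) k : TE E (fun=> k) = k.
Proof.
rewrite /TE -[RHS](EPo_cst ap); apply: eq_EPo => r.
rewrite -[RHS](Ita_cst (@sg_gt0 p) r k); apply: eq_It => // Js _; exact: Itez_cst.
Qed.

Variable zeta : Pr11 R.
Local Notation E := (mlexp zeta).

Section measurable_T_instance.
Variables (r : nat) (J : {ffun 'I_r -> sg}).
HB.instance Definition _ := isMeasurableFun.Build _ _ _ _ (@T_fun R beta p r J)
  (@measurable_T_fun R beta p r J).
End measurable_T_instance.

(** The law is rewritten as a countable sum of scaled image measures, over which integrals of
    nonnegative functions distribute. *)
Lemma integral_law_T (f : R -> \bar R) : measurable_fun setT f -> (forall x, 0 <= f x)%E ->
  (\int[law_T alpha beta p zeta]_x f x = \sum_(0 <= r <oo) (poisson_pmf ap r)%:E *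
    ((#|{ffun 'I_r -> sg}|%:R^-1)%:E *
     \sum_(J : {ffun 'I_r -> sg}) \int[iid (iid zeta q) r]_z f (T_fun (p := p) beta J z)))%E.
Proof.
move=> mf f0.
have ap0 : 0 < ap by rewrite mulr_gt0.
pose J0 r : {ffun 'I_r -> sg} := [ffun=> [ffun=> true]].
pose mu r k : {measure set R -> \bar R} := distribution (iid (iid zeta q) r)
   (T_fun (p := p) beta (nth (J0 r) (enum {ffun 'I_r -> sg}) k)).
have w0 r : 0 <= poisson_pmf ap r * #|{ffun 'I_r -> sg}|%:R^-1.
  by rewrite mulr_ge0// poisson_pmf_ge0.
pose nu r : {measure set R -> \bar R} := mscale (NngNum (w0 r)) (msum (mu r) #|{ffun 'I_r -> sg}|).
have sumJ r (F : {ffun 'I_r -> sg} -> \bar R) :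
    (\sum_(k < #|{ffun 'I_r -> sg}|) F (nth (J0 r) (enum {ffun 'I_r -> sg}) k) = \sum_J F J)%E.
  rewrite -(big_mkord xpredT (fun k => F (nth (J0 r) (enum {ffun 'I_r -> sg}) k))).
  by rewrite cardE -(big_nth (J0 r) xpredT F) big_enum.
rewrite (@eq_measure_integral _ _ _ _ (mseries nu 0)); last first.
  move=> A mA _; transitivity (\int[poisson ap]_r law_T_fun beta p zeta r A)%E => //.
  rewrite integral_poisson//; last first.
    by move=> r; rewrite mule_ge0// ?lee_fin ?invr_ge0// sume_ge0.
  apply: eq_eseriesr => r _; rewrite /law_T_fun muleA -EFinM.
  congr (_ * _)%E; rewrite -sumJ.
  by [].
rewrite ge0_integral_measure_series//; apply: eq_eseriesr => r _.
rewrite ge0_integral_mscale// ge0_integral_measure_sum// muleA -EFinM; congr (_ * _)%E.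
rewrite -sumJ; apply: eq_bigr => k _.
by rewrite ge0_integral_distribution.
Qed.

Lemma mexp_T_ge0 K psi : Lp K psi -> (forall z, -1 <= z <= 1 -> 0 <= psi z) ->
  mexp (T_map alpha beta p zeta) psi = TE E psi.
Proof.
move=> h psi0; apply: EFin_inj.
rewrite -(mexpE (T_map alpha beta p zeta) h) [LHS]integral_law_T; last 2 first.
- by apply/measurable_EFinP; exact: (Lp_measurable (Lp_clamp h)).
- by move=> x; rewrite lee_fin psi0// clamp_itv.
rewrite /TE -(eseries_EPo _ (TE_gbnd E h)); last by rewrite mulr_gt0.
apply: eq_eseriesr => r _; congr (_ * _)%E.
rewrite -avg_ffun_It /avg EFinM; congr (_ * _)%E.
rewrite -sumEFin; apply: eq_bigr => J _.
have sJ : size (codom J) = r by rewrite size_codom card_ord.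
have := cavT_LpS (Js := codom J) h; rewrite sJ => hl.
apply: (integral_iid_iid zeta (Kaa_ge0 h) hl).
- by move=> ys sy _; apply: psi0; apply: (cavT_itv beta0); rewrite sJ.
- apply/measurable_EFinP; apply: (measurableT_comp (Lp_measurable (Lp_clamp h))).
  exact: (@measurable_T_fun R beta p r J).
- by move=> x; rewrite lee_fin psi0// clamp_itv.
move=> z bz; rewrite /= clamp_id; last exact: (@T_fun_itv R beta p r J z).
by rewrite T_funE.
Qed.

(** Adding a constant makes the test function nonnegative on [-1, 1], and both sides preserve
    constants. *)
Lemma mexp_T K phi : Lp K phi -> mexp (T_map alpha beta p zeta) phi = TE E phi.
Proof.
move=> h; pose c : R := `|phi 0| + K.
have hc : Lp (K + 0) (fun z => phi z + c) by apply: LpD h (Lp_cst c).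
have e1 : phi = (fun z => (phi z + c) - c) by apply/funext => z; rewrite addrK.
rewrite [in LHS]e1 [in RHS]e1 (TEB E hc (Lp_cst c)) TE_cst.
have eB := ezB (mlexp (T_map alpha beta p zeta)) hc (Lp_cst c).
transitivity (mexp (T_map alpha beta p zeta) (fun z => phi z + c) - c).
  by rewrite -[X in _ = _ - X](mexp_cst (T_map alpha beta p zeta) c); exact: eB.
congr (_ - _); apply: (mexp_T_ge0 hc) => z z1.
by have := Lp_bounded h z1; rewrite ler_norml -/c => /andP[]; lra.
Qed.
End law_of_cavity.

(** * Ramps, distribution functions and the measure of a Lipschitz expectation *)

Section ramps.
Context {R : realType}.

Definition ramp (x : R) (k : nat) (y : R) : R := Num.max 0 (Num.min 1 (1 - k.+1%:R * (y - x))).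

Lemma ramp01 x k y : 0 <= ramp x k y <= 1.
Proof. by rewrite /ramp le_max lexx/= ge_max ler01 ge_min lexx. Qed.

Lemma ramp1 x k y : y <= x -> ramp x k y = 1.
Proof.
move=> yx; have h : 0 <= k.+1%:R * (x - y) by rewrite mulr_ge0// subr_ge0.
by rewrite /ramp min_l ?max_r// -(opprB x y) mulrN opprK lerDl.
Qed.

Lemma ramp0 x k y : x + k.+1%:R^-1 <= y -> ramp x k y = 0.
Proof.
move=> xy; apply/eqP; rewrite eq_le; apply/andP; split; last by rewrite /ramp le_max lexx.
rewrite /ramp ge_max lexx/= ge_min; apply/orP; right.
have := ler_wpM2l (ler0n R k.+1) xy; rewrite mulrDr mulfV ?pnatr_eq0//.
by rewrite mulrBr; lra.
Qed.

Lemma ramp_lip2 x x' k y y' : `|ramp x k y - ramp x' k y'| <= k.+1%:R * `|(y - x) - (y' - x')|.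
Proof.
have mm (a b : R) : `|Num.max 0 (Num.min 1 (1 - a)) - Num.max 0 (Num.min 1 (1 - b))| <= `|a - b|.
  wlog ab : a b / a <= b => [h|].
    by have [/h//|/ltW/h] := leP a b; rewrite distrC (distrC b).
  rewrite [leRHS]distrC.
  have [h1 h2] : Num.max 0 (Num.min 1 (1 - b)) <= Num.max 0 (Num.min 1 (1 - a)) /\
     Num.max 0 (Num.min 1 (1 - a)) - Num.max 0 (Num.min 1 (1 - b)) <= b - a.
    case: (leP 1 (1 - a)) => h1; case: (leP 1 (1 - b)) => h2;
    case: (leP 0 (1 - a)) => h3; case: (leP 0 (1 - b)) => h4;
    case: (leP (0 : R) 1) => h5; split; lra.
  by rewrite !ger0_norm ?subr_ge0.
by rewrite (le_trans (mm _ _))// -mulrBr normrM normr_nat.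
Qed.

Lemma Lp_ramp x k : Lp k.+1%:R (ramp x k).
Proof.
move=> y y'; rewrite (le_trans (ramp_lip2 _ _ _ _ _))// (_ : y - x - (y' - x) = y - y')//.
by ring.
Qed.

Lemma le_ramp x x' k y : x <= x' -> ramp x k y <= ramp x' k y.
Proof.
move=> xx'; rewrite /ramp ge_max le_max lexx/= le_max; apply/orP; right.
rewrite le_min; apply/andP; split; first by rewrite ge_min lexx.
by rewrite ge_min; apply/orP; right; rewrite lerD2l lerN2 ler_wpM2l// lerD2l lerN2.
Qed.

(** The second ramp starts to decrease only where the first has reached 0. *)
Lemma ramp_ramp x k j y : ramp x k y <= ramp (x + k.+1%:R^-1) j y.
Proof.
have [/ramp1 ->|/ltW/ramp0 ->] := leP y (x + k.+1%:R^-1).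
  by have /andP[] := ramp01 x k y.
by have /andP[] := ramp01 (x + k.+1%:R^-1) j y.
Qed.

(* Piecewise linear interpolation of [phi] on the first [n] cells of the grid of
   mesh [1 / (k + 1)] starting at -1. *)
Fixpoint interp (phi : R -> R) (k n : nat) (y : R) : R :=
  let x i := -1 + i%:R / k.+1%:R in
  if n is m.+1 then interp phi k m y + (phi (x m.+1) - phi (x m)) * (1 - ramp (x m) k y)
  else phi (-1).

(** Beyond the last node the interpolation is constant; this second part supplies the value to which
    the next cell adds its increment. *)
Lemma interpP K phi k n y : Lp K phi -> -1 <= y ->
  (y <= -1 + n%:R / k.+1%:R -> `|phi y - interp phi k n y| <= 2 * K / k.+1%:R) /\
  (-1 + n%:R / k.+1%:R <= y -> interp phi k n y = phi (-1 + n%:R / k.+1%:R)).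
Proof.
move=> h y1; have K0 := Lp_ge0 h; have h0 : 0 <= 2 * K / k.+1%:R by rewrite divr_ge0// mulr_ge0.
elim: n => [|n [ih1 ih2]] /=.
  rewrite mul0r addr0; split=> [y2|//]; rewrite (_ : y = -1) ?subrr ?normr0//.
  by apply/eqP; rewrite eq_le y2.
pose x (i : nat) : R := -1 + i%:R / k.+1%:R; rewrite -/(x n) in ih1 ih2 *; rewrite -/(x n.+1).
have xS : x n.+1 = x n + k.+1%:R^-1 by rewrite /x -natr1 mulrDl mul1r addrA.
have k0 : 0 < k.+1%:R^-1 :> R by rewrite invr_gt0.
clearbody x; move: k0 xS; set c := k.+1%:R^-1 => k0 xS.
have [yx|/ltW xy] := leP y (x n).
  rewrite ramp1// subrr mulr0 addr0; split=> [_|]; first exact: ih1.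
  by rewrite xS => ?; exfalso; lra.
rewrite (ih2 xy); split=> [yx|yx]; last by rewrite ramp0 -?xS// subr0 mulr1; ring.
have /andP[r0 r1] := ramp01 (x n) k y.
set t := ramp _ _ _ in r0 r1 *.
rewrite (_ : _ - _ = (phi y - phi (x n)) - (phi (x n.+1) - phi (x n)) * (1 - t)); last by ring.
rewrite (le_trans (ler_normB _ _))// normrM.
have e1 : `|phi y - phi (x n)| <= K / k.+1%:R.
  by rewrite (le_trans (h _ _))// ler_wpM2l// ger0_norm ?subr_ge0//; rewrite xS in yx; rewrite lerBlDl.
have e2 : `|phi (x n.+1) - phi (x n)| <= K / k.+1%:R.
  rewrite (le_trans (h _ _))// ler_wpM2l// xS addrAC subrr add0r ger0_norm//.
  exact: ltW.
have e3 : `|1 - t| <= 1 by rewrite ler_norml; apply/andP; split; lra.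
have := ler_pM (normr_ge0 _) (normr_ge0 _) e2 e3; rewrite mulr1 => e4.
by rewrite (le_trans (lerD e1 e4))// -[leRHS]mulrA mulr2n mulrDl mul1r.
Qed.

Lemma Lp_interp phi k n : exists L, Lp L (interp phi k n).
Proof.
elim: n => [|n [L ih]] /=; first by exists 0; exact: Lp_cst.
eexists; apply: (LpD ih); apply: LpZ.
by apply: (LpD (Lp_cst 1)) => x y; rewrite opprK addrC distrC; exact: Lp_ramp.
Qed.

Definition cdfm (P : probability R R) (x : R) : R := fine (P `]-oo, x]%classic).

Lemma cdfmE (P : probability R R) x : P `]-oo, x]%classic = (cdfm P x)%:E.
Proof. by rewrite fineK// fin_num_measure. Qed.

Lemma ramp_cdfm (zeta : Pr11 R) x k :
  cdfm zeta x <= mexp zeta (ramp x k) <= cdfm zeta (x + k.+1%:R^-1).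
Proof.
have mr := Lp_measurable (Lp_ramp x k).
have r0 y : 0 <= ramp x k y by have /andP[] := ramp01 x k y.
have e : (mexp zeta (ramp x k))%:E = (\int[zeta]_y (ramp x k y)%:E)%E.
  rewrite -(mexpE zeta (Lp_ramp x k)); apply: Pr11_integral_eq.
  - by apply/measurable_EFinP; exact: (Lp_measurable (Lp_clamp (Lp_ramp x k))).
  - by move=> y; rewrite lee_fin r0.
  - exact/measurable_EFinP.
  - by move=> y; rewrite lee_fin r0.
  by move=> y y1; rewrite clamp_id.
have ind (z : R) : (cdfm zeta z)%:E = (\int[zeta]_y (\1_(`]-oo, z]%classic) y)%:E)%E.
  by rewrite integral_indic// setIT -cdfmE.
rewrite -!lee_fin e !ind; apply/andP; split; apply: ge0_le_integral => //.
- by apply/measurable_EFinP.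
- exact/measurable_EFinP.
- move=> y _; rewrite lee_fin indicE mem_setE in_itv/=.
  by have [yx|_] := leP y x; [rewrite ramp1|exact: r0].
- by move=> y _; rewrite lee_fin r0.
- exact/measurable_EFinP.
- by apply/measurable_EFinP.
move=> y _; rewrite lee_fin indicE mem_setE in_itv/=.
have [yx|/ltW xy] := leP y (x + k.+1%:R^-1); last by rewrite ramp0.
by have /andP[] := ramp01 x k y.
Qed.
End ramps.

Section lexp_measure.
Context {R : realType}.
Variable I : @lexp R.

(* The ramps at [x] decrease to the indicator function of ]-oo, x]. *)
Definition lcdf (x : R) : R := inf (range (fun k => I (ramp x k))).

Lemma has_inf_lcdf x : has_inf (range (fun k => I (ramp x k))).
Proof.
split; first by exists (I (ramp x 0)), 0%N.
exists 0 => _ [k _ <-]; rewrite -[leLHS](ez_cst I); apply: le_ez (Lp_cst 0) (Lp_ramp x k) _ => y _.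
by have /andP[] := ramp01 x k y.
Qed.

Lemma lcdf_le x k : lcdf x <= I (ramp x k).
Proof. by apply: ge_inf; [case: (has_inf_lcdf x)|exists k]. Qed.

Lemma lcdf_lb x c : (forall k, c <= I (ramp x k)) -> c <= lcdf x.
Proof.
move=> h; apply: lb_le_inf; first by case: (has_inf_lcdf x).
by move=> _ [k _ <-]; exact: h.
Qed.

Lemma lcdf_ge x k : I (ramp x k) <= lcdf (x + k.+1%:R^-1).
Proof.
apply: lcdf_lb => j; apply: le_ez (Lp_ramp _ _) (Lp_ramp _ _) _ => y _; exact: ramp_ramp.
Qed.

Lemma lcdf_nd : nondecreasing lcdf.
Proof.
move=> x y xy; apply: lcdf_lb => k; apply: le_trans (lcdf_le x k) _.
by apply: le_ez (Lp_ramp _ _) (Lp_ramp _ _) _ => z _; exact: le_ramp.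
Qed.

Lemma lcdf_ge0 x : 0 <= lcdf x.
Proof.
apply: lcdf_lb => k; rewrite -[leLHS](ez_cst I); apply: le_ez (Lp_cst 0) (Lp_ramp x k) _ => y _.
by have /andP[] := ramp01 x k y.
Qed.

Lemma lcdf_le1 x : lcdf x <= 1.
Proof.
apply: (le_trans (lcdf_le x 0)); rewrite -[leRHS](ez_cst I).
apply: le_ez (Lp_ramp x 0) (Lp_cst 1) _ => y _.
by have /andP[] := ramp01 x 0 y.
Qed.

(** An infimum of functions continuous in [x] is upper semicontinuous, which for a nondecreasing
    function is right continuity. *)
Lemma lcdf_rc : right_continuous lcdf.
Proof.
move=> x; apply/cvgrPdist_lt => e e0.
have e2 : 0 < e / 2 by rewrite divr_gt0.
have [_ [k _ <-] hk] := inf_adherent e2 (has_inf_lcdf x).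
have d0 : 0 < e / 2 / k.+1%:R by rewrite divr_gt0.
near=> y.
have xy : x < y by near: y; exact: nbhs_right_gt.
have yd : y < x + e / 2 / k.+1%:R.
  by near: y; apply: nbhs_right_lt; rewrite ltrDl.
rewrite distrC ger0_norm ?subr_ge0 ?lcdf_nd ?ltW//.
have h1 := lcdf_le y k.
have h2 : `|I (ramp y k) - I (ramp x k)| <= k.+1%:R * `|x - y|.
  apply: ez_dist (Lp_ramp _ _) (Lp_ramp _ _) _ => z _.
  by rewrite (le_trans (ramp_lip2 _ _ _ _ _))// (_ : z - y - (z - x) = x - y)//; ring.
have h3 : k.+1%:R * `|x - y| < e / 2.
  rewrite mulrC -ltr_pdivlMr// distrC ger0_norm ?subr_ge0 ?ltW//.
  by rewrite ltrBlDl.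
have h4 := le_lt_trans (ler_norm _) (le_lt_trans h2 h3).
move: hk; rewrite -/(lcdf x) => hk.
rewrite ltrBlDl (le_lt_trans h1)//; lra.
Unshelve. all: by end_near. Qed.

HB.instance Definition _ := isCumulative.Build R _ R lcdf lcdf_nd lcdf_rc.

(** The bound is -2 so that the ramp of width 1, the one with [k = 0], already vanishes on
    [-1, 1]. *)
Lemma lcdf_lo x : x <= -2 -> lcdf x = 0.
Proof.
move=> x2; apply/eqP; rewrite eq_le lcdf_ge0 andbT (le_trans (lcdf_le x 0))//.
rewrite -[leRHS](ez_cst I); apply: le_ez (Lp_ramp x 0) (Lp_cst 0) _ => y /andP[y1 _].
by rewrite ramp0// invr1; lra.
Qed.

Lemma lcdf_hi x : 1 <= x -> lcdf x = 1.
Proof.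
move=> x1; apply/eqP; rewrite eq_le lcdf_le1/=; apply: lcdf_lb => k.
rewrite -[leLHS](ez_cst I); apply: le_ez (Lp_cst 1) (Lp_ramp x k) _ => y /andP[_ y1].
by rewrite ramp1// (le_trans y1).
Qed.

Lemma lcdf_Ny : lcdf @ -oo --> (0 : R).
Proof.
apply/cvgrPdist_lt => e e0; near=> x.
have hx : x <= -2 by near: x; apply: nbhs_ninfty_le; rewrite ?num_real.
by rewrite lcdf_lo ?subrr ?normr0.
Unshelve. all: by end_near. Qed.

Lemma lcdf_y : lcdf @ +oo --> (1 : R).
Proof.
apply/cvgrPdist_lt => e e0; near=> x.
have hx : 1 <= x by near: x; apply: nbhs_pinfty_ge; rewrite ?num_real.
by rewrite lcdf_hi ?subrr ?normr0.
Unshelve. all: by end_near. Qed.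

HB.instance Definition _ := isCumulativeBounded.Build R 0 1 lcdf lcdf_Ny lcdf_y.

Let mu : probability (measurableTypeR R) R := lebesgue_stieltjes_measure lcdf.

Lemma mu_cdf x : mu `]-oo, x]%classic = (lcdf x)%:E.
Proof. by have := cdf_lebesgue_stieltjes_id lcdf x; rewrite /cdf /=. Qed.

(** Pushing the Stieltjes measure through the clamp makes it carried by [-1, 1] by construction,
    without changing its distribution function there. *)
Let clampf : measurableTypeR R -> R := clamp.

Let measurable_clampf : measurable_fun setT clampf.
Proof. by apply: (@Lp_measurable _ 1) => x y; rewrite mul1r; exact: clamp_lip. Qed.

HB.instance Definition _ := isMeasurableFun.Build _ _ _ _ clampf measurable_clampf.

Let zeta_prob : probability R R := distribution mu clampf.

Let zeta_carried : zeta_prob `[(-1)%R, 1%R]%classic = 1%E.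
Proof.
transitivity (mu setT); last exact: probability_setT.
congr (mu _); apply/seteqP; split => // x _ /=; rewrite in_itv/=; exact: clamp_itv.
Qed.

Definition lexp_prob : Pr11 R := MkPr11 zeta_carried.

Lemma cdfm_lexp_prob x : -1 <= x <= 1 -> cdfm lexp_prob x = lcdf x.
Proof.
move=> /andP[x1]; rewrite le_eqVlt => /orP[/eqP ->|x2]; apply: EFin_inj; rewrite -cdfmE.
  rewrite lcdf_hi//; transitivity (mu setT); last exact: probability_setT.
  congr (mu _); apply/seteqP; split => // y _ /=; rewrite in_itv/=.
  by have /andP[] := clamp_itv y.
rewrite -mu_cdf; congr (mu _); apply/seteqP; split => y /=; rewrite !in_itv/= /clampf /clamp.
  by rewrite ge_max => /andP[_]; rewrite ge_min leNgt x2.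
by move=> yx; rewrite ge_max x1/= ge_min yx orbT.
Qed.

(** At a grid point, both expectations of the ramp lie between the values of [lcdf] at this point
    and the next. Weighted by the increments of [phi], at most K/(k + 1), these gaps telescope to at
    most K/(k + 1); with the two interpolation errors 2K/(k + 1) this makes 5K/(k + 1). *)
Lemma mexp_lexp_prob K phi : Lp K phi -> mexp lexp_prob phi = I phi.
Proof.
move=> h; have K0 := Lp_ge0 h.
have key k : `|I phi - mexp lexp_prob phi| <= 5 * K / k.+1%:R.
  set E := mlexp lexp_prob; rewrite -[mexp _ _]/(E phi).
  pose x (i : nat) : R := -1 + i%:R / k.+1%:R; pose m := (2 * k.+1)%N.
  have k0 : k.+1%:R != 0 :> R by rewrite pnatr_eq0.
  have xm : x m = 1.
    by rewrite /x /m natrM mulfK//; lra.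
  have xS i : x i.+1 = x i + k.+1%:R^-1 by rewrite /x -natr1 mulrDl mul1r addrA.
  have xle i : (i <= m)%N -> -1 <= x i <= 1.
    move=> im; rewrite /x lerDl divr_ge0//= -[leRHS]xm /x lerD2l ler_pM2r ?invr_gt0//.
    by rewrite ler_nat.
  have [L hL] := Lp_interp phi k m.
  have hi : forall z, -1 <= z <= 1 -> `|phi z - interp phi k m z| <= 2 * K / k.+1%:R.
    move=> z /andP[z1 z2]; have [h1 _] := interpP k m h z1.
    by apply: h1; rewrite -/(x m) xm.
  have i1 := ez_dist I h hL hi; have i2 := ez_dist E h hL hi.
  have i3g n : (n <= m)%N ->
      `|I (interp phi k n) - E (interp phi k n)| <= K / k.+1%:R * (lcdf (x n) - lcdf (x 0)).
    elim: n => [|n ih] nm.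
      have e0 (E' : @lexp R) : E' (interp phi k 0) = phi (-1) by exact: (ez_cst E').
      by rewrite !e0 !subrr normr0 mulr0.
    have [L' hL'] := Lp_interp phi k n.
    have hr : Lp (0 + k.+1%:R) (fun y => 1 - ramp (x n) k y).
      by apply: (LpD (Lp_cst 1)) => y y'; rewrite opprK addrC distrC; exact: Lp_ramp.
    set d := phi (x n.+1) - phi (x n).
    have e (E' : @lexp R) : E' (interp phi k n.+1) = E' (interp phi k n) + d * (1 - E' (ramp (x n) k)).
      rewrite /= (ezD E' hL' (LpZ d hr)) (ezZ E' d hr); congr (_ + _ * _).
      have := ezB E' (Lp_cst 1) (Lp_ramp (x n) k); rewrite ez_cst; apply.
    rewrite !e.
    have d1 : `|d| <= K / k.+1%:R.
      by rewrite (le_trans (h _ _))// ler_wpM2l// xS addrAC subrr add0r ger0_norm.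
    have xn := xle n (ltnW nm); have xn1 := xle n.+1 nm.
    have s1 : lcdf (x n) <= I (ramp (x n) k) <= lcdf (x n.+1).
      by rewrite xS lcdf_le lcdf_ge.
    have s2 : lcdf (x n) <= E (ramp (x n) k) <= lcdf (x n.+1).
      rewrite -(cdfm_lexp_prob xn) -(cdfm_lexp_prob xn1) xS; exact: ramp_cdfm.
    have s3 : `|E (ramp (x n) k) - I (ramp (x n) k)| <= lcdf (x n.+1) - lcdf (x n).
      move/andP: s1 => [? ?]; move/andP: s2 => [? ?]; rewrite ler_norml; apply/andP; split; lra.
    have {}ih := ih (ltnW nm).
    set u := I (interp _ _ _) in ih *; set v := E (interp _ _ _) in ih *.
    rewrite (_ : _ - _ = (u - v) + d * (E (ramp (x n) k) - I (ramp (x n) k))); last by ring.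
    rewrite (le_trans (ler_normD _ _))//.
    rewrite (_ : lcdf (x n.+1) - lcdf (x 0) = (lcdf (x n) - lcdf (x 0)) + (lcdf (x n.+1) - lcdf (x n))); last by ring.
    by rewrite [leRHS]mulrDr lerD// normrM ler_pM.
  have i4 : K / k.+1%:R * (lcdf (x m) - lcdf (x 0)) <= K / k.+1%:R.
    rewrite ler_piMr ?divr_ge0// xm lcdf_hi//; have := lcdf_ge0 (x 0); lra.
  have i5 := le_trans (i3g m (leqnn m)) i4.
  rewrite (le_trans (ler_distD (I (interp phi k m)) _ _))//.
  rewrite (le_trans (lerD (lexx _) (ler_distD (E (interp phi k m)) _ _)))//.
  rewrite [in X in _ + (_ + X)]distrC (le_trans (lerD i1 (lerD i5 i2)))//.
  rewrite -!mulrA; set c := K / _; lra.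
apply/esym/eqP; rewrite -subr_eq0 -normr_le0; apply/ler_addgt0Pr => e e0; rewrite add0r.
have [k hk] : exists k : nat, 5 * K / e < k.+1%:R.
  by exists (Num.bound (5 * K / e)); rewrite (lt_le_trans (archi_boundP _))// ?divr_ge0 ?mulr_ge0 ?(ltW e0)// ler_nat.
apply: (le_trans (key k)); rewrite ler_pdivrMr// [leRHS]mulrC -ler_pdivrMr//; exact: ltW.
Qed.
End lexp_measure.

Section determination.
Context {R : realType}.

(** The ramps compare the distribution functions up to a shift by 1/(k + 1), which right continuity
    removes. *)
Lemma cdfm_le (xi zeta : Pr11 R) : (forall x k, mexp xi (ramp x k) = mexp zeta (ramp x k)) ->
  forall x, cdfm xi x <= cdfm zeta x.
Proof.
move=> h x; have hc k : cdfm xi x <= cdfm zeta (x + k.+1%:R^-1).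
  have /andP[h1 _] := ramp_cdfm xi x k; have /andP[_ h2] := ramp_cdfm zeta x k.
  by rewrite (le_trans h1)// h.
have idm : measurable_fun setT (idfun : R -> R) by exact: measurable_id.
pose X : {RV Pr11_prob zeta >-> R} := HB.pack (idfun : R -> R) (isMeasurableFun.Build _ _ _ _ (idfun : R -> R) idm).
have rc : right_continuous (fun z => cdfm zeta z).
  move=> a; apply: fine_cvg; rewrite -cdfmE.
  exact: (@cdf_right_continuous _ _ _ (Pr11_prob zeta) X a).
have cv : (fun k : nat => cdfm zeta (x + k.+1%:R^-1)) @ \oo --> cdfm zeta x.
  have := rc x; move/cvg_at_rightP; apply; split=> [n|]; first by rewrite ltrDl.
  rewrite -[X in _ --> X]addr0; apply: cvgD; first exact: cvg_cst.
  exact: cvg_harmonic.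
rewrite -(cvg_lim _ cv)//; apply: limr_ge; first by apply/cvg_ex; eexists; exact: cv.
exact: nearW.
Qed.

Lemma measure_eq_Lp (xi zeta : Pr11 R) : (forall x k, mexp xi (ramp x k) = mexp zeta (ramp x k)) ->
  measure_eq xi zeta.
Proof.
move=> h A mA.
have e x : cdfm xi x = cdfm zeta x by apply/eqP; rewrite eq_le !cdfm_le.
have ray (P : probability R R) x : P `]x, +oo[%classic = (1 - cdfm P x)%:E.
  rewrite EFinB -cdfmE -(probability_setC P) ?setCitvl//.
apply: (@measure_unique _ R _ (@RGenOInfty.G R) (fun n => `]- n%:R, +oo[%classic) _ _ _ _ (Pr11_prob xi) (Pr11_prob zeta)) => //.
- exact: RGenOInfty.measurableE.
- move=> _ _ [x ->] [y ->]; exists (Num.max x y).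
  by apply/seteqP; split => z /=; rewrite !in_itv/= !andbT gt_max => /andP.
- by move=> n; exists (- n%:R).
- apply/seteqP; split => // x _; exists (Num.bound x) => //=.
  by rewrite in_itv/= andbT ltrNl unstable.ltrNbound.
- by move=> _ [x ->]; rewrite [LHS]ray [RHS]ray e.
- by move=> n; rewrite [ltLHS]ray ltry.
Qed.
End determination.

Section geometric_cauchy.
Context {R : realType}.
Variables (u : nat -> R) (C rho : R).
Hypotheses (rho0 : 0 <= rho) (rho1 : rho < 1).
Hypothesis hu : forall n, `|u n.+1 - u n| <= C * rho ^+ n.

Lemma geometric_is_cvg : cvgn u.
Proof.
rewrite (_ : u = fun n => u 0%N + series (telescope u) n); last first.
  by apply/funext => n; exact: eq_sum_telescope.
apply: is_cvgD; first exact: is_cvg_cst.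
apply: normed_cvg; apply: (@series_le_cvg _ _ (geometric C rho)) => /=.
- by move=> n; exact: normr_ge0.
- by move=> n; rewrite (le_trans _ (hu n)).
- by move=> n; rewrite /telescope; exact: hu.
by apply: is_cvg_geometric_series; rewrite ger0_norm.
Qed.

Lemma geometric_lim n : `|limn u - u n| <= C * rho ^+ n / (1 - rho).
Proof.
have r1 : 0 < 1 - rho by rewrite subr_gt0.
have C0 : 0 <= C by have := le_trans (normr_ge0 _) (hu 0); rewrite expr0 mulr1.
have h m : `|u (n + m)%N - u n| <= C * rho ^+ n / (1 - rho) * (1 - rho ^+ m).
  elim: m => [|m ih]; first by rewrite addn0 subrr normr0 expr0 subrr mulr0.
  rewrite addnS (le_trans (ler_distD (u (n + m)%N) _ _))//.
  rewrite (le_trans (lerD (hu _) ih))// exprD exprS le_eqVlt; apply/orP; left; apply/eqP.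
  by field; rewrite gt_eqF.
have cu := geometric_is_cvg.
have cv : `|u m - u n| @[m --> \oo] --> `|limn u - u n|.
  by apply: cvg_norm; apply: cvgB => //; exact: cvg_cst.
rewrite -(cvg_lim _ cv)//; apply: limr_le; first by apply/cvg_ex; eexists; exact: cv.
near=> m; have nm : (n <= m)%N by near: m; exact: nbhs_infty_ge.
rewrite -(subnKC nm) (le_trans (h _))// ler_piMr//; last by rewrite gerBl exprn_ge0.
by apply: divr_ge0; [apply: mulr_ge0 => //; exact: exprn_ge0|exact: ltW].
Unshelve. all: by end_near. Qed.
End geometric_cauchy.

(** * Contraction, existence and uniqueness of the fixed point *)

Section fixed_point.
Context {R : realType} {q : nat}.
Variables (alpha beta : R).
Hypotheses (alpha0 : 0 < alpha) (beta0 : 0 < beta).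
Local Notation p := q.+1.
Local Notation sg := {ffun 'I_p -> bool}.
Local Notation ap := (alpha * p%:R).
Local Notation aa := (2^-1 * (expR beta - 1)).
Local Notation Q1 := (@slots1 R q alpha).
Local Notation RdT := (@cavT R q beta).
Local Notation TE := (@TE R q alpha beta).

(** This is the dual form of a bound on the Kantorovich distance. *)
Definition close (D : R) (E E' : @lexp R) := forall K phi, Lp K phi -> `|E phi - E' phi| <= K * D.

(** Both expectations are within K of the value of the test function at 0. *)
Lemma close2 E E' : close 2 E E'.
Proof.
move=> K phi h.
have e (F : @lexp R) : `|F phi - phi 0| <= K.
  rewrite -(ez_cst F (phi 0)); apply: (ez_dist F h (Lp_cst _)) => z z1.
  rewrite (le_trans (h _ _))// subr0 ler_piMr ?(Lp_ge0 h)//.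
  by rewrite ler_norml.
by rewrite (le_trans (ler_distD (phi 0) _ _))// [X in _ + X]distrC mulrDr !mulr1 lerD.
Qed.

Lemma It_close D E E' n b Psi : 0 <= b -> close D E E' -> LpS n b Psi ->
  `|It E n Psi - It E' n Psi| <= n%:R * (b * D).
Proof.
move=> b0 h; elim: n Psi => [|n ih] Psi hP /=; first by rewrite subrr normr0 mul0r.
rewrite (le_trans (ler_distD (E (fun z => It E' n (fun ys => Psi (z :: ys)))) _ _))//.
rewrite -natr1 mulrDl mul1r lerD//; last exact: (h b _ (Lp_Itez E' b0 hP)).
apply: ez_dist (Lp_Itez E b0 hP) (Lp_Itez E' b0 hP) _ => z _.
by apply: ih; exact: LpS_cons.
Qed.

(** The slots are exchanged one at a time, each at cost K aa D; their mean number is [Q1]. *)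
Lemma TE_close D E E' K phi : close D E E' -> Lp K phi ->
  `|TE E phi - TE E' phi| <= K * (aa * Q1 * D).
Proof.
move=> h hp; have K0 := Lp_ge0 hp.
have -> : K * (aa * Q1 * D) = EPo ap (fun r => (K * aa * D) * (r * q)%:R).
  by rewrite EPoZ; [rewrite -/Q1; ring|exact: gbnd_rq].
apply: EPo_dist; [exact: ap_ge0|exact: (TE_gbnd beta0 E hp)|exact: (TE_gbnd beta0 E' hp)| |].
  by apply: gbndZ; exact: gbnd_rq.
move=> r; rewrite -[leRHS](Ita_cst (@sg_gt0 p) r); apply: Ita_dist => Js sJ; subst r.
rewrite mulrC; apply: It_close => //; first exact: (Kaa_ge0 beta0 hp).
exact: (cavT_LpS beta0 hp).
Qed.

Lemma carried0 : (\d_(0 : R) : probability R R) `[(-1)%R, 1%R]%classic = 1%E.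
Proof. by rewrite /= /dirac indicE mem_set//= in_itv/= lerN10 ler01. Qed.

Definition T_iter n : Pr11 R := iter n (T_map alpha beta p) (MkPr11 carried0).
Local Notation u phi := (fun n => mexp (T_iter n) phi).

Hypothesis hQ : aa * Q1 < 1.

Lemma contraction_ge0 : 0 <= aa * Q1.
Proof. by rewrite mulr_ge0 ?aa_ge0// slots1_ge0. Qed.

Lemma T_iter_close n : close (2 * (aa * Q1) ^+ n) (mlexp (T_iter n.+1)) (mlexp (T_iter n)).
Proof.
elim: n => [|n ih]; first by rewrite expr0 mulr1; exact: close2.
move=> K phi h; have := TE_close ih h.
rewrite -(mexp_T alpha0 beta0 (T_iter n.+1) h) -(mexp_T alpha0 beta0 (T_iter n) h).
by rewrite [aa * Q1 * (2 * _)]mulrCA -exprS.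
Qed.

Lemma mexp_T_iter_cvg K phi : Lp K phi -> cvgn (u phi).
Proof.
move=> h; apply: (@geometric_is_cvg _ _ (K * 2) (aa * Q1)) => //; first exact: contraction_ge0.
by move=> n; rewrite -mulrA; exact: T_iter_close.
Qed.

Let I phi : R := limn (u phi).

Let ID K L phi psi : Lp K phi -> Lp L psi -> I (fun z => phi z + psi z) = I phi + I psi.
Proof.
move=> h1 h2; rewrite /I -limD; [|exact: (mexp_T_iter_cvg h1)|exact: (mexp_T_iter_cvg h2)].
by congr (limn _); apply/funext => n; exact: (ezD (mlexp (T_iter n)) h1 h2).
Qed.

Let IZ K k phi : Lp K phi -> I (fun z => k * phi z) = k * I phi.
Proof.
move=> h; rewrite /I; have := mexp_T_iter_cvg h => cu; apply: cvg_lim => //.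
rewrite (_ : (fun n => _) = (fun n => k * mexp (T_iter n) phi)).
  by apply: cvgM; [exact: cvg_cst|exact: cu].
by apply/funext => n; exact: (ezZ (mlexp (T_iter n)) k h).
Qed.

Let le_I K L phi psi : Lp K phi -> Lp L psi ->
  (forall z, -1 <= z <= 1 -> phi z <= psi z) -> I phi <= I psi.
Proof.
move=> h1 h2 h; apply: ler_lim; [exact: (mexp_T_iter_cvg h1)|exact: (mexp_T_iter_cvg h2)|].
by apply: nearW => n; exact: (le_ez (mlexp (T_iter n)) h1 h2 h).
Qed.

Let I_cst k : I (fun=> k) = k.
Proof.
rewrite /I (_ : (fun n => _) = (fun=> k)); first exact: lim_cst.
by apply/funext => n; exact: mexp_cst.
Qed.

Definition lim_lexp := Lexp ID IZ le_I I_cst.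

Lemma lim_lexp_close n : close (2 * (aa * Q1) ^+ n / (1 - aa * Q1)) lim_lexp (mlexp (T_iter n)).
Proof.
move=> K phi h; have hm m : `|mexp (T_iter m.+1) phi - mexp (T_iter m) phi| <= K * 2 * (aa * Q1) ^+ m.
  by rewrite -mulrA; exact: T_iter_close.
have -> : K * (2 * (aa * Q1) ^+ n / (1 - aa * Q1)) = K * 2 * (aa * Q1) ^+ n / (1 - aa * Q1) by rewrite !mulrA.
exact: (geometric_lim (u := u phi) contraction_ge0 hQ hm n).
Qed.

Definition fixed_measure : Pr11 R := lexp_prob lim_lexp.

Lemma fixed_measure_close n : close (2 * (aa * Q1) ^+ n / (1 - aa * Q1)) (mlexp fixed_measure) (mlexp (T_iter n)).
Proof.
move=> K phi h; have := @lim_lexp_close n K phi h.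
by rewrite -[ez lim_lexp phi](mexp_lexp_prob lim_lexp h).
Qed.

Lemma pow_cvg0 (c : R) : c * (aa * Q1) ^+ n @[n --> \oo] --> (0 : R).
Proof.
rewrite -[X in _ --> X](mulr0 c); apply: cvgM; first exact: cvg_cst.
apply: cvg_expr.
by rewrite ger0_norm// contraction_ge0.
Qed.

Lemma le_pow0 (x c : R) : (forall n, x <= c * (aa * Q1) ^+ n) -> x <= 0.
Proof.
move=> h; rewrite -(cvg_lim _ (pow_cvg0 c))//; apply: limr_ge.
  by apply/cvg_ex; eexists; exact: pow_cvg0.
exact: nearW.
Qed.

(** Both sides are geometrically close to the iterate n + 1: the left one as its limit, the right
    one by contraction from the iterate n. As n is arbitrary, they agree. *)
Lemma fixed_measure_TE K phi : Lp K phi -> mexp fixed_measure phi = TE (mlexp fixed_measure) phi.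
Proof.
move=> h; apply/eqP; rewrite -subr_eq0 -normr_le0.
apply: (@le_pow0 _ (K * 4 / (1 - aa * Q1))) => n.
have r1 : 0 < 1 - aa * Q1 by rewrite subr_gt0.
have h1 := @fixed_measure_close n.+1 K phi h.
have h2 := TE_close (@fixed_measure_close n) h.
rewrite (le_trans (ler_distD (mexp (T_iter n.+1) phi) _ _))//.
have e : mexp (T_iter n.+1) phi = TE (mlexp (T_iter n)) phi by exact: (mexp_T alpha0 beta0 (T_iter n) h).
rewrite {2}e [X in _ + X]distrC (le_trans (lerD h1 h2))//.
rewrite (_ : _ + _ = K * 4 / (1 - aa * Q1) * (aa * Q1) ^+ n * (aa * Q1)).
  rewrite ler_piMr ?(ltW hQ)// !mulr_ge0 ?invr_ge0 ?(ltW r1) ?(Lp_ge0 h)//.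
  by rewrite exprn_ge0// contraction_ge0.
by rewrite exprS; move: r1; set x := aa * Q1 => r1; field; rewrite gt_eqF.
Qed.

Lemma T_fixed : measure_eq (T_map alpha beta p fixed_measure) fixed_measure.
Proof.
apply: measure_eq_Lp => x k.
rewrite (mexp_T alpha0 beta0 fixed_measure (Lp_ramp x k)).
by rewrite (fixed_measure_TE (Lp_ramp x k)).
Qed.

Lemma measure_eq_mexp (xi zeta : Pr11 R) phi : measure_eq xi zeta -> mexp xi phi = mexp zeta phi.
Proof.
by move=> h; rewrite /mexp /Rintegral; congr fine; apply: eq_measure_integral => A mA _; exact: h.
Qed.

Lemma T_unique (xi : Pr11 R) : measure_eq (T_map alpha beta p xi) xi -> measure_eq xi fixed_measure.
Proof.
move=> hx; have hc n : close (2 * (aa * Q1) ^+ n) (mlexp xi) (mlexp fixed_measure).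
  elim: n => [|n ih]; first by rewrite expr0 mulr1; exact: close2.
  move=> K phi h; have := TE_close ih h.
  rewrite -(mexp_T alpha0 beta0 xi h) -(fixed_measure_TE h) (measure_eq_mexp _ hx).
  by rewrite [aa * Q1 * (2 * _)]mulrCA -exprS.
apply: measure_eq_Lp => x k; apply/eqP; rewrite -subr_eq0 -normr_le0.
apply: (@le_pow0 _ (k.+1%:R * 2)) => n; rewrite -mulrA; exact: (hc n _ _ (Lp_ramp x k)).
Qed.
End fixed_point.

(** * Increments of the free energy *)

Section readout.
Context {R : realType} {V : finType} {q : nat}.
Variables (alpha beta : R).
Hypotheses (alpha0 : 0 < alpha) (beta0 : 0 < beta) (V0 : (0 < #|V|)%N).
Local Notation p := q.+1.
Local Notation sg := {ffun 'I_p -> bool}.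
Local Notation clause := (sg * {ffun 'I_p -> V})%type.
Local Notation NV := (#|V|%:R : R).
Local Notation lam := (alpha * NV).
Local Notation mag := (@mag R V q beta beta0).
Variable E : @lexp R.
Variables (A B : R).
Hypothesis B0 : 0 <= B.
Hypothesis cl : @claim R V clause (unif lam) mag E A B.

Variables (nu1 nu2 : clause -> R) (d : V -> R).
Hypotheses (n1 : forall c, 0 <= nu1 c) (n2 : forall c, 0 <= nu2 c).
Hypothesis n12 : forall c, nu1 c + nu2 c = unif lam c.
Hypothesis hd : forall w, PP nu1 (fun K => PP nu2 (fun G => `|mag (K ++ G) w - mag G w|)) <= d w.

Definition mflat m (K : seq (sg * {ffun 'I_m -> V})) : seq V :=
  flatten (map (fun x : sg * {ffun 'I_m -> V} => codom x.2) K).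

Section one_readout.
Variables (k : nat) (b c : R) (g : seq R -> R).
Hypotheses (b0 : 0 <= b) (hg : LpS k b g) (gc : forall ys, size ys = k -> box ys -> `|g ys| <= c).

(** The claim concerns the full process, while the readout takes place in the one of intensity
    [nu2]; putting back [nu1] moves each magnetization by at most [d] in mean. *)
Lemma mag_shift (s : seq V) : size s = k ->
  `|PP nu2 (fun G => g (map (mag G) s)) - PP (unif lam) (fun G => g (map (mag G) s))| <=
  b * \sum_(v <- s) d v.
Proof.
move=> sk; have gb G : `|g (map (mag G) s)| <= c.
  by apply: gc; [rewrite size_map|apply: box_m => u; exact: mag_itv].
have pmag : perm_inv (fun G => g (map (mag G) s)).
  by move=> G G' GG'; congr g; apply/eq_map => v; exact: mag_perm.
have -> : PP (unif lam) (fun G => g (map (mag G) s)) =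
    PP nu1 (fun K => PP nu2 (fun G => g (map (mag (K ++ G)) s))).
  rewrite -(@PP_add _ _ nu1 nu2 (fun G => g (map (mag G) s)))//; last exact: gr_bounded gb.
  by congr PP; apply/funext => x; rewrite n12.
rewrite -(PP_cst nu1 (PP nu2 _)) distrC.
have gd v : gr2 (fun K G => `|mag (K ++ G) v - mag G v|).
  by apply: (@gr2_bounded _ _ _ _ 2) => K G; rewrite normr_id mag_dist2.
have gs : gr2 (fun K G => b * \sum_(v <- s) `|mag (K ++ G) v - mag G v|).
  by apply: gr2Z; apply: gr2_sum.
have g1 : gr2 (fun K G : seq clause => g (map (mag (K ++ G)) s)) by exact: (gr2_bounded (k := c)).
have g2 : gr2 (fun K G : seq clause => g (map (mag G) s)) by exact: (gr2_bounded (k := c)).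
apply: (@le_trans _ _ (PP nu1 (fun K => PP nu2 (fun G => b * \sum_(v <- s) `|mag (K ++ G) v - mag G v|)))).
  apply: PP_dist => //; [exact: (gr2_PP n2 g1)|exact: (gr2_PP n2 g2)|exact: (gr2_PP n2 gs)|] => K.
  apply: PP_dist => //; [exact: (gr2_l K g1)|exact: (gr2_l K g2)|exact: (gr2_l K gs)|] => G.
  rewrite (le_trans (hg _ _))// ?size_map// ler_wpM2l//.
  elim: {sk gb pmag g1 g2 gs} s => [|v s ih]; first by rewrite /dl/= !big_nil.
  by rewrite dl_cons big_cons lerD2l.
rewrite (_ : PP nu1 _ = b * \sum_(v <- s) PP nu1 (fun K => PP nu2 (fun G => `|mag (K ++ G) v - mag G v|))).
  by rewrite ler_wpM2l// ler_sum.
rewrite -PP_sum//; last by move=> v; exact: (gr2_PP n2 (gd v)).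
rewrite -PPZ//; last by apply: gr_sum => v; exact: (gr2_PP n2 (gd v)).
apply: eq_PP => K; rewrite PPZ//; last by apply: gr_sum => v; exact: (gr2_l K (gd v)).
by rewrite PP_sum// => v; exact: (gr2_l K (gd v)).
Qed.

Lemma readout_one :
  `|It (@avg R V) k (fun s => PP nu2 (fun G => g (map (mag G) s))) - It E k g| <=
  b * (k%:R * avg d) + k%:R * (A * b + B * (b + k%:R * b) / NV).
Proof.
pose F s G := if size s == k then g (map (mag G) s) else 0.
have Fc s G : `|F s G| <= `|c|.
  rewrite /F; case: eqP => [sk|_]; last by rewrite normr0.
  rewrite (le_trans _ (ler_norm c))//.
  by apply: gc; [rewrite size_map|apply: box_m => u; exact: mag_itv].
have ul (x : clause) : 0 <= unif lam x by rewrite -n12 addr_ge0.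
rewrite (le_trans (ler_distD (It (@avg R V) k (fun s => PP (unif lam) (fun G => g (map (mag G) s)))) _ _))//.
apply: lerD.
  rewrite -Ita_sumf// -ItaZ; apply: Ita_dist => s sk; exact: mag_shift.
have -> : It (@avg R V) k (fun s => PP (unif lam) (fun G => g (map (mag G) s))) =
    PP (unif lam) (fun G => It (@avg R V) k (fun s => g (map (mag G) s))).
  transitivity (It (@avg R V) k (fun s => PP (unif lam) (F s))).
    by apply: eq_It => // s sk; apply: eq_PP => G; rewrite /F sk eqxx.
  rewrite -PP_Ita//; last by move=> s; exact: gr_bounded (Fc s).
  by apply: eq_PP => G; apply: eq_It => // s sk; rewrite /F sk eqxx.
rewrite -(PP_cst (unif lam : clause -> R) (It E k g)).
(* The readout does not depend on the rest of the field, hence zero weights. *)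
have hX : LpX k (fun _ : V => 0) b (fun _ ys => g ys).
  move=> x x' ys ys' s s'; rewrite /wdist big1 ?add0r ?hg// => v _; exact: mul0r.
have := slot_replacement V0 B0 cl (fun _ => lexx 0) b0 hX.
by rewrite big1// addr0.
Qed.
End one_readout.

(** Used with [m = q] for the clauses of a new site, whose last place is taken, and with [m = p] for
    extra clauses among old sites. *)
Lemma readout_limit m rho b (g : seq sg -> seq R -> R) (c : nat -> R) : 0 <= rho -> 0 <= b ->
  gbnd c ->
  (forall Js, LpS (size Js * m) b (g Js)) ->
  (forall Js ys, size ys = (size Js * m)%N -> box ys -> `|g Js ys| <= c (size Js)) ->
  `|PP (unif rho) (fun K => PP nu2 (fun G => g (unzip1 K) (map (mag G) (@mflat m K)))) -
    EPo rho (fun r => It (@avg R sg) r (fun Js => It E (r * m) (g Js)))| <=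
  EPo rho (fun r => b * ((r * m)%:R * avg d) + (r * m)%:R * (A * b + B * (b + (r * m)%:R * b) / NV)).
Proof.
move=> r0 b0 gc hg gcb.
have oc0 : (0 < #|{: sg * {ffun 'I_m -> V}}|)%N.
  by rewrite card_prod muln_gt0 sg_gt0 card_ffun card_ord expn_gt0 V0.
rewrite PP_unif//.
have e r : It (@avg R (sg * {ffun 'I_m -> V})%type) r
      (fun K => PP nu2 (fun G => g (unzip1 K) (map (mag G) (@mflat m K)))) =
    It (@avg R sg) r (fun Js => It (@avg R V) (r * m) (fun s => PP nu2 (fun G => g Js (map (mag G) s)))).
  exact: (@It_pair_flatten R sg V m r (fun Js s => PP nu2 (fun G => g Js (map (mag G) s)))).
rewrite (eq_EPo _ e).
have grm : gbnd (fun r : nat => (r * m)%:R : R).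
  by under eq_fun do rewrite natrM; apply: gbndM; [exact: gbnd_nat|exact: gbnd_cst].
have gcn : gbnd (fun r => `|c r|) by exact: gbnd_norm.
apply: EPo_dist => //.
- apply: (gbnd_le _ gcn) => r; apply: Ita_bound => [|Js sJ]; first exact: sg_gt0.
  apply: Ita_bound => // s ss; apply: PP_bounded => // G.
  rewrite (le_trans _ (ler_norm _))// -sJ; apply: gcb; first by rewrite size_map ss sJ.
  by apply: box_m => u; exact: mag_itv.
- apply: (gbnd_le _ gcn) => r; apply: Ita_bound => [|Js sJ]; first exact: sg_gt0.
  subst r; apply: (Itez_norm E b0 (hg Js)) => ys sy bys.
  by rewrite (le_trans (gcb _ _ sy bys))// ler_norm.
- apply: gbndD; first by apply: gbndZ; apply: gbndM => //; exact: gbnd_cst.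
  apply: gbndM => //; apply: gbndD; first exact: gbnd_cst.
  apply: gbndM; last exact: gbnd_cst.
  apply: gbndZ; apply: gbndD; first exact: gbnd_cst.
  by apply: gbndM => //; exact: gbnd_cst.
move=> r; rewrite -[leRHS](@Ita_cst R sg (@sg_gt0 p) r); apply: Ita_dist => Js sJ; subst r.
by apply: readout_one => //; exact: gcb.
Qed.
End readout.

(** * The gain from the clauses of a new site *)

Section log_ratio.
Context {R : realType} {V : finType} {q : nat}.
Variables (alpha beta : R).
Hypotheses (alpha0 : 0 < alpha) (beta0 : 0 < beta) (V0 : (0 < #|V|)%N).
Local Notation p := q.+1.
Local Notation conf := {ffun V -> bool}.
Local Notation sg := {ffun 'I_p -> bool}.
Local Notation clause := (sg * {ffun 'I_p -> V})%type.
Local Notation open_clause := (sg * {ffun 'I_q -> V})%type.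
Local Notation NV := (#|V|%:R : R).
Local Notation lam := (alpha * NV).
Local Notation mag := (@mag R V q beta beta0).
Local Notation cwt := (@cwt R V q beta).
Local Notation w := (fun G : seq clause => wprod (map cwt G)).

Definition lnpart (G : seq clause) : R := ln (\sum_s w G s).
(** The logarithm of the ratio of the partition functions with and without [K], by [lnpart_cat]. *)
Definition lnratio (K G : seq clause) : R := ln (gavg (w G) (w K)).

Lemma w_gt0 G s : 0 < w G s. Proof. exact: wprod_gt0. Qed.

Lemma w_itv G s : expR (- (beta * (size G)%:R)) <= w G s <= 1.
Proof.
elim: G => [|c G ih] /=; first by rewrite mulr0 oppr0 expR0 /wprod big_nil lexx.
rewrite /wprod big_cons -/(wprod _ _).
have /andP[h1 h2] := ih; have /andP[k1 k2] : expR (- beta) <= cwt c s <= 1.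
  by apply: cw_bounds => //; exact: box_spins.
rewrite -natr1 mulrDr mulr1 opprD addrC expRD ler_pM ?expR_ge0//=.
by rewrite mulr_ile1//; [exact: le_trans (expR_ge0 _) k1|exact: le_trans (expR_ge0 _) h1].
Qed.

Lemma gavg_w_gt0 G K : 0 < gavg (w G) (w K).
Proof. by apply: gavg_gt0 => s; exact: w_gt0. Qed.

Lemma lnpart_cat K G : lnpart (K ++ G) = lnpart G + lnratio K G.
Proof.
rewrite /lnpart /lnratio -lnM ?posrE ?sumW_gt0 ?gavg_w_gt0//; last by move=> s; exact: w_gt0.
congr ln; rewrite /gavg mulrC mulfVK; last first.
  by rewrite gt_eqF// sumW_gt0// => s; exact: w_gt0.
by apply: eq_bigr => s _; rewrite map_cat wprod_cat mulrC.
Qed.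

Lemma lnratio_cat_itv K D G : - (beta * (size D)%:R) <= lnratio (K ++ D) G - lnratio K G <= 0.
Proof.
have W0 s := w_gt0 G s; have bD : 0 <= beta * (size D)%:R by rewrite mulr_ge0// ltW.
rewrite /lnratio -ln_div ?posrE ?gavg_w_gt0//; apply: ln_between => //.
rewrite ler_pdivlMr ?gavg_w_gt0// ler_pdivrMr ?gavg_w_gt0// mul1r -gavgZ.
apply/andP; split; apply: le_gavg => // s; rewrite map_cat wprod_cat;
  have /andP[h1 h2] := w_itv D s.
- by rewrite mulrC ler_wpM2l// ltW// w_gt0.
- by rewrite ler_piMr// ltW// w_gt0.
Qed.

Lemma lnratio0 G : lnratio [::] G = 0.
Proof.
rewrite /lnratio (_ : gavg _ _ = 1) ?ln1// -[RHS](gavg_cst (w_gt0 G)).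
by apply: eq_gavg => s; rewrite /wprod big_nil.
Qed.

Lemma lnratio_itv K G : - (beta * (size K)%:R) <= lnratio K G <= 0.
Proof. by have := lnratio_cat_itv [::] K G; rewrite lnratio0 subr0. Qed.

Lemma lnratio_norm K G : `|lnratio K G| <= beta * (size K)%:R.
Proof.
have /andP[h1 h2] := lnratio_itv K G.
by rewrite ler_norml h1 (le_trans h2)// mulr_ge0// ltW.
Qed.

Lemma gr2_beta (T : Type) (F : seq T -> seq clause -> R) :
  (forall K G, `|F K G| <= beta * (size K)%:R) -> gr2 F.
Proof.
move=> h; apply: (@gr2_size _ _ _ _ (fun r => beta * r%:R)); first by apply: gbndZ; exact: gbnd_nat.
by move=> K G; rewrite (le_trans (h K G))// ler_wpM2l ?ler_nat ?leq_addr// ltW.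
Qed.

Lemma lnratio_perml G : perm_inv (fun K => lnratio K G).
Proof. exact: (wprod_perm beta (fun W => ln (gavg (w G) W))). Qed.

Variable n : nat.
Local Notation kap := (@kappa R p alpha beta).
Hypotheses (kappa1 : kap < 1) (kn : kap ^+ n <= NV^-1).
Local Notation C1 := (1 / (1 - kap) + 1).
Local Notation aa := (2^-1 * (expR beta - 1)).
Local Notation ap := (alpha * p%:R).
Local Notation RdL := (@cavL R q beta).
Local Notation Q1 := (@slots1 R q alpha).
Local Notation Q2 := (@slots2 R q alpha).
Local Notation D1 := (@shiftC R q alpha beta).

Lemma cavL_bound (Js : seq sg) ys : size ys = (size Js * q)%N -> `|RdL Js ys| <= beta * (size Js)%:R.
Proof.
move=> sy; have bJ : 0 <= beta * (size Js)%:R by rewrite mulr_ge0// ltW.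
have FK e : expR (- (beta * (size Js)%:R)) <= FP q (cavw beta (spin R e)) Js (map clamp ys) <= 1.
  by rewrite -mulNr; apply: FP_cav_itv; [|rewrite size_map|exact: box_clamp].
have /andP[h3 h4] : - (beta * (size Js)%:R) <= RdL Js ys <= 0.
  apply: ln_between => //; have /andP[? ?] := FK true; have /andP[? ?] := FK false.
  by apply/andP; split; lra.
by rewrite ler_norml h3 (le_trans h4).
Qed.

Variable E : @lexp R.
Variables (A B : R).
Hypotheses (A0 : 0 <= A) (B0 : 0 <= B).
Hypothesis cl : @claim R V clause (unif lam) mag E A B.

Definition C4 : R := EPo ap (fun r => 2 * (expR beta - 1) * (r * q)%:R ^+ 2 * (1 + C1) +
  beta * r%:R * (r * q)%:R).
Definition CX : R := beta * (alpha * p%:R ^+ 2) + C4 + aa * D1 * Q1 + B * aa * (Q1 + Q2).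

Variable u : V.
Local Notation nuA := (@nuA R V q alpha u).
Local Notation nuB := (@nuB R V q alpha u).
Local Notation nuS := (@nuS R V q alpha u).
Local Notation nuD := (@nuD R V q alpha u).

Let pA c : 0 <= nuA c. Proof. exact: nuA_ge0. Qed.
Let pB c : 0 <= nuB c. Proof. exact: nuB_ge0. Qed.
Let pD c : 0 <= nuD c. Proof. exact: nuD_ge0. Qed.

(** The stages parallel those of the recursion: clauses at [u], the same counted once per position,
    open clauses, cavity formula, samples of [E]. *)
Let T0 := PP nuA (fun K => PP nuB (lnratio K)).
Let T1 := PP nuS (fun K => PP nuB (lnratio K)).
Let T2 := PP (unif ap) (fun K : seq open_clause => PP nuB (lnratio (map (ins u) K))).
Let T3 := PP (unif ap) (fun K : seq open_clause => PP nuB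
  (fun G => RdL (unzip1 K) (map (mag G) (mflat K)))).
Let T4 := EPo ap (fun r => It (@avg R sg) r (fun Js => It E (r * q) (RdL Js))).

(** Unlike the quantity in [overlap_error], the log-ratio is unbounded, but appending [D] changes it
    by at most [beta] per clause. *)
Lemma lnratio_overlap : `|T0 - T1| <= beta * (alpha * p%:R ^+ 2 / NV).
Proof.
have bb := ltW beta0.
pose H K := PP nuB (lnratio K).
have gl : gr2 (fun K G => lnratio K G) by apply: gr2_beta; exact: lnratio_norm.
have gH : gr H by exact: (gr2_PP pB gl).
have pH : perm_inv H by move=> K K' KK'; apply: eq_PP => G; exact: (lnratio_perml G KK').
have e1 : T1 = PP nuA (fun K => PP nuD (fun D => H (K ++ D))).
  by rewrite -(PP_add pA pD pH gH) /T1; congr PP; apply/funext => c; rewrite nuAD.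
have e0 : T0 = PP nuA (fun K => PP nuD (fun _ => H K)).
  by apply: eq_PP => K; rewrite PP_cst.
rewrite e0 e1.
have gs : gr2 (fun (K D : seq clause) => beta * (size D)%:R).
  apply: (@gr2_size _ _ _ _ (fun r => beta * r%:R)); first by apply: gbndZ; exact: gbnd_nat.
  by move=> K D; rewrite ger0_norm ?mulr_ge0// ler_wpM2l// ler_nat leq_addl.
have [k hk] := gH.
have g1 : gr2 (fun K (D : seq clause) => H K).
  have [a ga ha] := gr_lift gH; exists (1 + `|k|) => K D.
  rewrite (le_trans (hk K))// (@le_trans _ _ ((1 + `|k|) ^+ (size K).+1))//.
    rewrite lerXn2r ?nnegrE ?addr_ge0 ?(le_trans _ (hk [::]))//.
    by rewrite (le_trans (ler_norm _))// lerDr.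
  by apply: ler_weXn2l; rewrite ?lerDl// ltnS leq_addr.
have g2 : gr2 (fun K D => H (K ++ D)) by exact: gr2_cat.
apply: (@le_trans _ _ (PP nuA (fun K => PP nuD (fun D => beta * (size D)%:R)))).
  apply: PP_dist => //; [exact: (gr2_PP pD g1)|exact: (gr2_PP pD g2)|exact: (gr2_PP pD gs)|] => K.
  apply: PP_dist => //; [exact: (gr2_l K g1)|exact: (gr2_l K g2)|exact: (gr2_l K gs)|] => D.
  rewrite -[leRHS](PP_cst nuB); apply: PP_dist => //.
  - exact: (gr2_l K gl).
  - exact: (gr2_l (K ++ D) gl).
  - by apply: (@gr_bounded _ _ _ `|beta * (size D)%:R|).
  move=> G; have /andP[h1 h2] := lnratio_cat_itv K D G.
  by rewrite distrC ler_norml h1 (le_trans h2)// mulr_ge0.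
rewrite PP_cst PPZ//; last by apply: (@gr_size _ _ _ (fun r => r%:R)) => //; [exact: gbnd_nat|move=> D; rewrite normr_nat].
by rewrite PP_size// ler_wpM2l// mass_nuD.
Qed.

Lemma lnratio_position : T1 = T2.
Proof. exact: (PP_position alpha beta V0 u (fun W => PP nuB (fun G => ln (gavg (w G) (wprod W))))). Qed.

Lemma lnratio_cavity : `|T2 - T3| <= C4 / NV.
Proof.
have po (c : open_clause) : 0 <= unif ap c by exact/unif_ge0/ap_ge0.
pose D (K : seq open_clause) (G : seq clause) := `|lnratio (map (ins u) K) G - RdL (unzip1 K) (map (mag G) (mflat K))|.
have g1 : gr2 (fun (K : seq open_clause) (G : seq clause) => lnratio (map (ins u) K) G).
  by apply: gr2_beta => K G; rewrite (le_trans (lnratio_norm _ _))// size_map.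
have g2 : gr2 (fun (K : seq open_clause) (G : seq clause) => RdL (unzip1 K) (map (mag G) (mflat K))).
  apply: gr2_beta => K G; rewrite -(size_map fst K); apply: cavL_bound.
  by rewrite !size_map; exact: size_flat.
have gD : gr2 D.
  have [k hk] := gr2D g1 (gr2Z (-1) g2); exists k => K G; rewrite /D normr_id.
  by have := hk K G; rewrite mulN1r.
apply: (@le_trans _ _ (PP (unif ap) (fun K => PP nuB (D K)))).
  apply: PP_dist => //; [exact: gr2_PP..|] => K.
  by apply: PP_dist => //; [exact: (gr2_l K g1)|exact: (gr2_l K g2)|exact: (gr2_l K gD)].
apply: (E_cavity_gen alpha0 beta0 V0 kappa1 kn (u := u) (x := 2 * (expR beta - 1)) (y := fun r => beta * r%:R)) => //.
- by rewrite mulr_ge0// subr_ge0 ltW// expR_gt1.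
- by apply: gbndZ; exact: gbnd_nat.
- by move=> r; rewrite mulr_ge0// ltW.
- by move=> K G; exact: normr_ge0.
move=> K G Gu; have := ln_cavity beta0 n.+1 K Gu.
by rewrite fprod_sys /D /cavL map_clamp_id//; exact: box_magn.
Qed.

Lemma lnratio_readout : `|T3 - T4| <= A * aa * Q1 + (aa * D1 * Q1 + B * aa * (Q1 + Q2)) / NV.
Proof.
have N0 : 0 < NV by exact: NV0.
pose du (v : V) : R := 2 * ap * (u == v)%:R + @C2 R q alpha beta / NV.
have hdu v : PP nuA (fun K => PP nuB (fun G => `|mag (K ++ G) v - mag G v|)) <= du v.
  by have := cavity_delta alpha0 beta0 V0 kappa1 kn u v; rewrite /du mulrA.
have nAB c : nuA c + nuB c = unif lam c by exact: nuAB.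
have h := @readout_limit R V q alpha beta beta0 V0 E A B B0 cl nuA nuB du pA pB nAB hdu q ap aa
  RdL (fun r => beta * r%:R) (ap_ge0 alpha0) (aa_ge0 beta0) (gbndZ beta gbnd_nat).
apply: (le_trans (h _ _)).
- by move=> Js; exact: (@Rd_clamp_lip R q beta beta0 (@gL R) Js glip_lnavg).
- by move=> Js ys sy _; exact: cavL_bound.
have e0 : avg du = D1 / NV by exact: (@avg_du_l R V q alpha beta V0 u).
rewrite e0; pose k1 := aa * (D1 / NV) + A * aa + B * aa / NV; pose k2 := B * aa / NV.
have -> : EPo ap (fun r => aa * ((r * q)%:R * (D1 / NV)) +
    (r * q)%:R * (A * aa + B * (aa + (r * q)%:R * aa) / NV)) = k1 * Q1 + k2 * Q2.
  rewrite -(EPoZ ap k1 (@gbnd_rq R q)) -(EPoZ ap k2 (@size_le_gbnd R q)) -EPoD; last 2 first.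
  - by apply: gbndZ; exact: gbnd_rq.
  - by apply: gbndZ; exact: size_le_gbnd.
  by apply: eq_EPo => r; rewrite /k1 /k2; field; rewrite gt_eqF.
by rewrite /k1 /k2 le_eqVlt; apply/orP; left; apply/eqP; field; rewrite gt_eqF.
Qed.

Lemma site_term : `|T0 - T4| <= A * aa * Q1 + CX / NV.
Proof.
rewrite (le_trans (ler_distD T1 _ _))// (le_trans (lerD lnratio_overlap (ler_distD T3 _ _)))//.
rewrite lnratio_position (le_trans (lerD (lexx _) (lerD lnratio_cavity lnratio_readout)))//.
by rewrite le_eqVlt; apply/orP; left; apply/eqP; rewrite /CX; field; rewrite gt_eqF// NV0.
Qed.
End log_ratio.

(** * The gain from extra clauses among old sites *)

Section clause_readout.
Context {R : realType} {q : nat}.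
Variable beta : R.
Hypothesis beta0 : 0 < beta.
Local Notation p := q.+1.
Local Notation sg := {ffun 'I_p -> bool}.
Local Notation aa := (2^-1 * (expR beta - 1)).

Definition clauseL (Js : seq sg) (ys : seq R) : R := ln (FP p (@cw R beta p) Js (map clamp ys)).

Lemma clauseL_LpS (Js : seq sg) : LpS (size Js * p) aa (clauseL Js).
Proof.
move=> ys ys' s s'.
have m1 (J : sg) : maff (expR beta) p (fun _ => 1 : R) by apply: maff_cst => //; exact: expbeta1.
have h := FP_lip glip_ln (maff_cw beta0) m1 (block_lip_cw beta0).
rewrite (le_trans (h _ _ _ _ _ (box_clamp ys) (box_clamp ys')))// ?size_map//.
by rewrite ler_wpM2l ?dl_clamp//; exact: aa_ge0.
Qed.

Lemma FP_cw_itv (Js : seq sg) ys : size ys = (size Js * p)%N -> box ys ->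
  expR (- (beta * (size Js)%:R)) <= FP p (@cw R beta p) Js ys <= 1.
Proof.
elim: Js ys => [|J Js ih] ys /=; first by rewrite mulr0 oppr0 expR0 lexx.
rewrite mulSn => sy b; have [st bt [sd bd]] := split_box sy b.
have /andP[h1 h2] := ih _ sd bd.
have /andP[k1 k2] : expR (- beta) <= cw beta J (take p ys) <= 1 by apply: cw_bounds.
rewrite -natr1 mulrDr mulr1 opprD addrC expRD ler_pM ?expR_ge0//=.
by rewrite mulr_ile1//; [exact: le_trans (expR_ge0 _) k1|exact: le_trans (expR_ge0 _) h1].
Qed.

Lemma clauseL_bound (Js : seq sg) ys : size ys = (size Js * p)%N -> `|clauseL Js ys| <= beta * (size Js)%:R.
Proof.
move=> sy; have bJ : 0 <= beta * (size Js)%:R by rewrite mulr_ge0// ltW.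
have /andP[h3 h4] : - (beta * (size Js)%:R) <= clauseL Js ys <= 0.
  by apply: ln_between => //; apply: FP_cw_itv; [rewrite size_map|exact: box_clamp].
by rewrite ler_norml h3 (le_trans h4).
Qed.

Variable E : @lexp R.

Definition theta_mean_value : R := avg (fun J : sg => It E p (fun ys => ln (cw beta J (map clamp ys)))).

Lemma Itez_addl k n b Psi : 0 <= b -> LpS n b Psi -> It E n (fun ys => k + Psi ys) = k + It E n Psi.
Proof.
move=> b0 h; have := ItezB E (lexx 0) b0 (@LpS_cst R n k) (LpS_N h).
have := ItezB E (lexx 0) b0 (@LpS_cst R n 0) h; rewrite !Itez_cst !sub0r => e1 e2.
transitivity (It E n (fun ys => k - - Psi ys)); first by apply: eq_It => // ys _; rewrite opprK.
rewrite e2 (_ : It E n (fun ys => - Psi ys) = - It E n Psi) ?opprK//.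
by rewrite -e1; apply: eq_It => // ys _; rewrite sub0r.
Qed.

Lemma clauseL_cons J Js l l' : size l = p -> size l' = (size Js * p)%N ->
  clauseL (J :: Js) (l ++ l') = ln (cw beta J (map clamp l)) + clauseL Js l'.
Proof.
move=> sl sl'; rewrite /clauseL /= map_cat take_size_cat ?drop_size_cat ?size_map//.
rewrite lnM// posrE; first by apply: cw_gt0 => //; exact: box_clamp.
have /andP[+ _] := @FP_cw_itv Js (map clamp l') (etrans (size_map _ _) sl') (box_clamp _).
by apply: lt_le_trans; exact: expR_gt0.
Qed.

(** The logarithm of a product of clause weights is a sum, so its mean is proportional to the number
    of clauses: this is why the second term of the functional involves a single theta. *)
Lemma It_clauseL r : It (@avg R sg) r (fun Js => It E (r * p) (clauseL Js)) = r%:R * theta_mean_value.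
Proof.
have a0 : 0 <= aa by exact: aa_ge0.
elim: r => [|r ih]; first by rewrite mul0r /= /clauseL /= ln1.
change (avg (fun J : sg => It (@avg R sg) r (fun Js : seq sg => It E (r.+1 * p) (clauseL (J :: Js)))) =
  r.+1%:R * theta_mean_value).
transitivity (avg (fun J : sg => It (@avg R sg) r (fun Js : seq sg =>
   It E p (fun ys => ln (cw beta J (map clamp ys))) + It E (r * p) (clauseL Js)))).
  apply: eq_avg => J; apply: eq_It => // Js sJ.
  rewrite [(r.+1 * p)%N]mulSn It_add.
  have hJ : LpS p aa (fun ys => ln (cw beta J (map clamp ys))).
    have := @clauseL_LpS [:: J]; rewrite [size _]/= mul1n => hJ ys ys' s s'; have := hJ ys ys' s s'.
    by rewrite /clauseL /= !mulr1 !take_oversize ?size_map ?s ?s'.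
  rewrite addrC -(Itez_addl _ a0 hJ); apply: eq_It => // l sl.
  have hF : LpS (r * p) aa (clauseL Js) by have := @clauseL_LpS Js; rewrite sJ.
  rewrite addrC -(Itez_addl _ a0 hF); apply: eq_It => // l' sl'.
  by rewrite clauseL_cons// sl' sJ.
rewrite -natr1 mulrDl mul1r addrC -ih /theta_mean_value.
transitivity (avg (fun J : sg => It E p (fun ys => ln (cw beta J (map clamp ys))) +
   It (@avg R sg) r (fun Js => It E (r * p) (clauseL Js)))); last by rewrite avgD avg_cst// sg_gt0.
apply: eq_avg => J; rewrite ItaD Ita_cst//; exact: sg_gt0.
Qed.
End clause_readout.

Section clause_term.
Context {R : realType} {V : finType} {q : nat}.
Variables (alpha beta : R).
Hypotheses (alpha0 : 0 < alpha) (beta0 : 0 < beta) (V0 : (0 < #|V|)%N).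
Local Notation p := q.+1.
Local Notation conf := {ffun V -> bool}.
Local Notation sg := {ffun 'I_p -> bool}.
Local Notation clause := (sg * {ffun 'I_p -> V})%type.
Local Notation NV := (#|V|%:R : R).
Local Notation lam := (alpha * NV).
Local Notation mag := (@mag R V q beta beta0).
Local Notation cwt := (@cwt R V q beta).
Local Notation lrat := (@lnratio R V q beta).
Local Notation RdF := (@clauseL R q beta).
Variable n : nat.
Local Notation kap := (@kappa R p alpha beta).
Hypotheses (kappa1 : kap < 1) (kn : kap ^+ n <= NV^-1).
Local Notation C1 := (1 / (1 - kap) + 1).
Local Notation aa := (2^-1 * (expR beta - 1)).
Variable E : @lexp R.
Variables (A B : R).
Hypotheses (A0 : 0 <= A) (B0 : 0 <= B).
Hypothesis cl : @claim R V clause (unif lam) mag E A B.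
Variables (del lam2 : R).
Hypotheses (del0 : 0 <= del) (lam20 : 0 <= lam2) (dl2 : del + lam2 = lam).

Lemma wprod_FP (K : seq clause) s : wprod (map cwt K) s =
  FP p (@cw R beta p) (unzip1 K) (spins s (mflat K)).
Proof.
elim: K => [|x K ih]; first by rewrite /wprod big_nil.
rewrite /wprod/= big_cons -/(wprod _ _) ih /mflat/= /spins map_cat.
have sx : size (map (fun v => spin R (s v)) (codom x.2)) = p.
  by rewrite size_map size_codom card_ord.
by rewrite take_size_cat// drop_size_cat.
Qed.

Lemma size_mflat m (K : seq (sg * {ffun 'I_m -> V})) : size (mflat K) = (size K * m)%N.
Proof.
elim: K => //= x K ih; rewrite /mflat/= size_cat size_codom card_ord mulSn.
by congr (_ + _)%N.
Qed.

(** All [p] sites of an extra clause are old sites, so [factorization] applies with no cavity step;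
    its second weight is the constant 1, as a logarithm reads one weight only. *)
Lemma lnratio_clauseL (K G : seq clause) :
  `|lrat K G - RdF (unzip1 K) (map (mag G) (mflat K))| <=
  2 * (expR beta - 1) * pairsum beta n.+1 (unzip2 G) (mflat K).
Proof.
have gm : maff (expR beta) (size (mflat K)) (FP p (@cw R beta p) (unzip1 K)).
  by rewrite size_mflat -(size_map fst K); apply: maff_FP => // J; exact: maff_cw.
have g1 : maff (expR beta) (size (mflat K)) (fun _ => 1 : R).
  apply: maff_cst => //; exact: expbeta1.
have := factorization beta0 n.+1 (sys beta0 G) glip_ln gm g1.
rewrite fedge_sys fprod_sys /clauseL map_clamp_id; last exact: box_magn.
by rewrite /lnratio; under eq_gavg do rewrite -wprod_FP.
Qed.

Definition P2 : R := EPo del (fun r => (r * p)%:R ^+ 2).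

Let ud (c : clause) : 0 <= unif del c. Proof. exact: unif_ge0. Qed.
Let u2 (c : clause) : 0 <= unif lam2 c. Proof. exact: unif_ge0. Qed.

Lemma unif_split (c : clause) : unif del c + unif lam2 c = unif lam c.
Proof. by rewrite /unif -dl2 mulrDl. Qed.

Let C10 : 0 <= C1. Proof. exact: C1_ge0. Qed.
Let e10 : 0 <= expR beta - 1. Proof. by rewrite subr_ge0 ltW// expR_gt1. Qed.

Let Y0 := PP (unif del) (fun K : seq clause => PP (unif lam2) (lrat K)).
Let Y1 := PP (unif del) (fun K : seq clause => PP (unif lam2)
  (fun G => RdF (unzip1 K) (map (mag G) (mflat K)))).

Lemma gr_pairs : gr (fun K : seq clause => pairs (@hit R V q alpha beta) (mflat K)).
Proof.
apply: (@gr_size _ _ _ (fun r => (r * p)%:R ^+ 2 * (1 + C1))).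
  by apply: gbndM; [exact: size_le_gbnd|exact: gbnd_cst].
move=> K; rewrite ger0_norm ?pairs_ge0// -size_mflat; exact: pairs_le.
Qed.

Lemma clause_factor_error : `|Y0 - Y1| <= 2 * (expR beta - 1) * (1 + C1) * P2 / NV.
Proof.
have N0 : 0 < NV by exact: NV0.
have g1 : gr2 (fun K G : seq clause => lrat K G) by apply: (gr2_beta beta0) => K G; exact: lnratio_norm.
have g2 : gr2 (fun K G : seq clause => RdF (unzip1 K) (map (mag G) (mflat K))).
  apply: (gr2_beta beta0) => K G; rewrite -[size K](size_map fst); apply: clauseL_bound => //.
  by rewrite !size_map size_mflat.
apply: (@le_trans _ _ (PP (unif del) (fun K : seq clause =>
    2 * (expR beta - 1) * pairs (@hit R V q alpha beta) (mflat K)))).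
  apply: PP_dist => //; [exact: (gr2_PP u2 g1)|exact: (gr2_PP u2 g2)|by apply: grZ; exact: gr_pairs|].
  move=> K.
  have nule (c : clause) : unif lam2 c <= unif lam c by rewrite -unif_split lerDr.
  have [gp hp] := PP_pairsum alpha0 beta0 V0 kappa1 kn (mflat K) u2 nule.
  apply: (@le_trans _ _ (PP (unif lam2) (fun G : seq clause =>
     2 * (expR beta - 1) * pairsum beta n.+1 (unzip2 G) (mflat K)))).
    apply: PP_dist => //; [exact: (gr2_l K g1)|exact: (gr2_l K g2)|exact: grZ|] => G.
    exact: lnratio_clauseL.
  by rewrite PPZ// ler_wpM2l// mulr_ge0.
rewrite PPZ//; last exact: gr_pairs.
apply: (@le_trans _ _ (2 * (expR beta - 1) * EPo del (fun r => (1 + C1) / NV * (r * p)%:R ^+ 2))); last first.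
  rewrite EPoZ; last exact: size_le_gbnd.
  by rewrite -/P2 le_eqVlt; apply/orP; left; apply/eqP; set c := 1 + C1; ring.
rewrite ler_wpM2l ?mulr_ge0// PP_unif ?clause0//.
apply: le_EPo => //.
- by apply: gbnd_Ita; [exact: clause0|exact: gr_pairs].
- by apply: gbndZ; exact: size_le_gbnd.
move=> r; rewrite (@It_pair_flatten R sg V p r (fun _ l => pairs (@hit R V q alpha beta) l)).
rewrite -[leRHS](@Ita_cst R sg (@sg_gt0 p) r); apply: le_Ita => Js _.
rewrite [leRHS]mulrC; apply: Ita_pairs => //; first by move=> v; rewrite avg_hit.
by rewrite divr_ge0// addr_ge0.
Qed.

Lemma del_shift w : PP (unif del) (fun K => PP (unif lam2) (fun G => `|mag (K ++ G) w - mag G w|)) <=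
  2 * (del * (p%:R * ((1 + C1) / NV))).
Proof.
apply: le_trans (delta_bound alpha0 beta0 V0 kappa1 kn w ud u2 _) _.
  by move=> c; rewrite unif_split.
rewrite ler_pM2l// wsum_unif ler_wpM2l// avg_sum.
rewrite (eq_bigr (fun=> (1 + C1) / NV)); first by rewrite sumr_const card_ord mulr_natl.
move=> a _; rewrite avg_pair/= avg_cst ?sg_gt0//.
by rewrite (avg_coord V0 a (fun v => @hit R V q alpha beta v w)) avg_hit.
Qed.

Definition CY : R := 2 * (expR beta - 1) * (1 + C1) * P2 +
  aa * (2 * (del * (p%:R * (1 + C1)))) * (del * p%:R) + B * aa * (del * p%:R + P2).

Lemma clause_term : `|Y0 - del * @theta_mean_value R q beta E| <= A * aa * (del * p%:R) + CY / NV.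
Proof.
have N0 : 0 < NV by exact: NV0.
rewrite (le_trans (ler_distD Y1 _ _))// (le_trans (lerD clause_factor_error (lexx _)))//.
have e2 : del * @theta_mean_value R q beta E = EPo del (fun r => It (@avg R sg) r (fun Js => It E (r * p) (RdF Js))).
  rewrite (eq_EPo _ (It_clauseL beta0 E)); under eq_EPo do rewrite mulrC.
  by rewrite EPoZ; [rewrite EPo_nat mulrC|exact: gbnd_nat].
have h := @readout_limit R V q alpha beta beta0 V0 E A B B0 cl (unif del) (unif lam2)
  (fun=> 2 * (del * (p%:R * ((1 + C1) / NV)))) ud u2 unif_split del_shift p del aa
  RdF (fun r => beta * r%:R) del0 (aa_ge0 beta0) (gbndZ beta gbnd_nat)
  (fun Js => @clauseL_LpS R q beta beta0 Js) (fun Js ys sy _ => clauseL_bound beta0 sy).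
rewrite -/Y1 -e2 in h; rewrite (le_trans (lerD (lexx _) h))//.
have grp : gbnd (fun r : nat => (r * p)%:R : R).
  by under eq_fun do rewrite natrM; apply: gbndM; [exact: gbnd_nat|exact: gbnd_cst].
have P1E : EPo del (fun r => (r * p)%:R) = del * p%:R.
  by under eq_EPo do rewrite natrM mulrC; rewrite EPoZ ?EPo_nat 1?mulrC//; exact: gbnd_nat.
rewrite avg_cst//; set x := 2 * (del * _).
pose k1 := aa * x + A * aa + B * aa / NV; pose k2 := B * aa / NV.
rewrite (_ : EPo del (fun r => aa * _ + _) = k1 * (del * p%:R) + k2 * P2).
  rewrite /k1 /k2 /CY /x; set c := 1 + C1.
  by rewrite le_eqVlt; apply/orP; left; apply/eqP; field; rewrite gt_eqF.
rewrite -P1E /P2 -(EPoZ del k1 grp) -(EPoZ del k2 (@size_le_gbnd R p)) -EPoD; last 2 first.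
- exact: gbndZ.
- by apply: gbndZ; exact: size_le_gbnd.
by apply: eq_EPo => r; rewrite /k1 /k2; field; rewrite gt_eqF.
Qed.
End clause_term.

Section free_energy_of_systems.
Context {R : realType} {V : finType} {q : nat}.
Variable beta : R.
Hypothesis beta0 : 0 < beta.
Local Notation p := q.+1.
Local Notation conf := {ffun V -> bool}.
Local Notation sg := {ffun 'I_p -> bool}.
Local Notation clause := (sg * {ffun 'I_p -> V})%type.
Local Notation lnZ := (@lnpart R V q beta).

Lemma lnpart_perm : perm_inv lnZ.
Proof. exact: (wprod_perm beta (fun W => ln (\sum_s W s))). Qed.

Lemma lnpart_gr : gr lnZ.
Proof.
apply: (@gr_size _ _ _ (fun r => `|lnZ [::]| + beta * r%:R)).
  by apply: gbndD; [exact: gbnd_cst|apply: gbndZ; exact: gbnd_nat].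
move=> G; have := lnpart_cat beta0 G [::]; rewrite cats0 => ->.
by rewrite (le_trans (ler_normD _ _))// lerD2l lnratio_norm.
Qed.

Definition mean_lnpart (lam : R) : R := PP (unif lam : clause -> R) lnZ.

Lemma lnpart_superpose (nu1 nu2 : clause -> R) : (forall c, 0 <= nu1 c) -> (forall c, 0 <= nu2 c) ->
  PP (fun c => nu1 c + nu2 c) lnZ =
  PP nu2 lnZ + PP nu1 (fun K => PP nu2 (@lnratio R V q beta K)).
Proof.
move=> n1 n2; rewrite (PP_add n1 n2 lnpart_perm lnpart_gr).
have gl : gr2 (@lnratio R V q beta) by apply: (gr2_beta beta0); exact: lnratio_norm.
rewrite -[X in X + _](PP_cst nu1) -PPD//; last 2 first.
- by apply: (@gr_bounded _ _ _ `|PP nu2 lnZ|).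
- exact: gr2_PP.
apply: eq_PP => K; rewrite -PPD//; last 2 first.
- exact: lnpart_gr.
- exact: (gr2_l K gl).
by apply: eq_PP => G; rewrite lnpart_cat.
Qed.
End free_energy_of_systems.

(** Bernoulli's inequality with a second-order remainder; with x = 1/(N + 1) it gives the rate of
    extra clauses up to O(1/N). *)
Lemma pow_bounds {R : realType} q (x : R) : 0 <= x <= 1 ->
  1 - (1 - x) ^+ q <= q%:R * x /\ q%:R * x - q%:R ^+ 2 * x ^+ 2 <= 1 - (1 - x) ^+ q.
Proof.
move=> /andP[x0 x1]; elim: q => [|q [ih1 ih2]].
  by rewrite expr0 expr2 !mul0r subrr subr0.
have q0 := ler0n R q; have y0 : 0 <= 1 - x by rewrite subr_ge0.
rewrite exprSr -natr1; move: ih1 ih2; set y := (1 - x) ^+ q; set n := q%:R in q0 *.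
move=> h1 h2; split; first by have := ler_wpM2r y0 (_ : 1 - n * x <= y); nra.
have h3 : y <= 1 - n * x + n ^+ 2 * x ^+ 2 by lra.
have := ler_wpM2r y0 h3.
have h4 : 0 <= n ^+ 2 * x ^+ 2 * x by rewrite !mulr_ge0// exprn_ge0.
have h5 : 0 <= n * x ^+ 2 by rewrite mulr_ge0// exprn_ge0.
have h6 : 0 <= x ^+ 2 by rewrite exprn_ge0.
rewrite !expr2 in h4 h5 h6 *; lra.
Qed.

(** * From N to N + 1 sites *)

Section adding_a_site.
Context {R : realType} {q : nat}.
Variables (alpha beta : R) (M : nat).
Hypotheses (alpha0 : 0 < alpha) (beta0 : 0 < beta).
Local Notation p := q.+1.
Local Notation N := M.+1.
Local Notation sg := {ffun 'I_p -> bool}.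
Local Notation clauseN := (sg * {ffun 'I_p -> 'I_N})%type.
Local Notation clauseS := (sg * {ffun 'I_p -> 'I_N.+1})%type.
Local Notation u := (ord0 : 'I_N.+1).

Definition relab (c : clauseN) : clauseS := (c.1, [ffun i => lift u (c.2 i)]).

Definition tailc (s : {ffun 'I_N.+1 -> bool}) : {ffun 'I_N -> bool} := [ffun v => s (lift u v)].

Lemma cwt_relab c s : cwt beta (relab c) s = cwt beta c (tailc s).
Proof.
by rewrite !cwtE; congr (1 + _ * _); apply: eq_bigr => i _; rewrite /relab /= !ffunE.
Qed.

Lemma sum_tailc (F : {ffun 'I_N -> bool} -> R) : \sum_s F (tailc s) = 2 * \sum_t F t.
Proof.
pose h (x : bool * {ffun 'I_N -> bool}) : {ffun 'I_N.+1 -> bool} :=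
  [ffun w => if unlift u w is Some v then x.2 v else x.1].
pose h' (s : {ffun 'I_N.+1 -> bool}) := (s u, tailc s).
have hK : cancel h h'.
  move=> [b t]; rewrite /h' /h ffunE unlift_none; congr (_, _).
  by apply/ffunP => v; rewrite !ffunE liftK.
have h'K : cancel h' h.
  move=> s; apply/ffunP => w; rewrite /h ffunE; case: unliftP => [v ->|->] //=.
  by rewrite ffunE.
rewrite (reindex h); last by exists h' => x _; [exact: hK|exact: h'K].
rewrite (eq_bigr (fun x => F x.2)); last first.
  by move=> x _; congr F; have := hK x; rewrite /h' => /(congr1 snd).
rewrite -(pair_big xpredT xpredT (fun _ t => F t))/= sumr_const card_bool.
by rewrite mulr_natl.
Qed.

(** The new site, [ord0], appears in no relabelled clause: its free spin doubles the partition
    function. *)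
Lemma lnpart_relab G : lnpart beta (map relab G) = ln 2 + lnpart beta G.
Proof.
rewrite /lnpart -lnM ?posrE ?sumW_gt0//; last by move=> s; exact: wprod_gt0.
congr ln; rewrite -sum_tailc; apply: eq_bigr => s _.
by rewrite /wprod !big_map; apply: eq_bigr => c _; rewrite cwt_relab.
Qed.

(* Total rate of the clauses on [N + 1] sites that avoid the new site. *)
Definition thinned_rate : R := alpha * N.+1%:R * (N%:R / N.+1%:R) ^+ p.

Lemma thinned_rate_ge0 : 0 <= thinned_rate.
Proof. by rewrite mulr_ge0 ?exprn_ge0 ?divr_ge0// mulr_ge0// ltW. Qed.

Lemma relab_inj : injective relab.
Proof.
move=> [J e] [J' e'] [-> /ffunP h]; congr (_, _); apply/ffunP => i.
by have := h i; rewrite !ffunE => /lift_inj.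
Qed.

(** The thinned rate is such that a clause on N sites has the same intensity as its image among the
    clauses on N + 1 sites. *)
Lemma unif_relab d : \sum_(c | relab c == d) unif thinned_rate c = @nuB R 'I_N.+1 q alpha u d.
Proof.
rewrite /nuB; case: ifPn => [/codomP[i ui]|ud].
  rewrite big_pred0// => c; apply/eqP => cd; move: ui; rewrite -cd /relab/= ffunE.
  by move/eqP; rewrite (negbTE (neq_lift _ _)).
have [c cd] : exists c, relab c = d.
  exists (d.1, [ffun i => odflt ord0 (unlift u (d.2 i))]).
  rewrite [RHS]surjective_pairing; congr (_, _); apply/ffunP => i; rewrite !ffunE.
  case: unliftP => //= di; move: ud; rewrite /touch -di.
  by rewrite codom_f.
rewrite (big_pred1 c); last by move=> c'; rewrite -cd (inj_eq relab_inj).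
rewrite /unif !card_prod !card_ffun !card_ord !card_bool /thinned_rate !natrM !natrX.
by rewrite expr_div_n; field; rewrite !expf_neq0.
Qed.

Lemma mean_lnpart_relab : PP (@nuB R 'I_N.+1 q alpha u) (lnpart beta) =
  ln 2 + mean_lnpart (V := 'I_N) (q := q) beta thinned_rate.
Proof.
have un c : 0 <= unif thinned_rate c :> R by exact/unif_ge0/thinned_rate_ge0.
rewrite (_ : @nuB _ _ _ _ _ = fun d => \sum_(c | relab c == d) unif thinned_rate c); last first.
  by apply/funext => d; rewrite unif_relab.
rewrite -PP_map /mean_lnpart -[X in X + _](PP_cst (unif thinned_rate : clauseN -> R)) -PPD//.
- by apply: eq_PP => G; exact: lnpart_relab.
- by apply: (@gr_bounded _ _ _ `|ln 2|).
- exact: lnpart_gr.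
Qed.

Definition site_gain : R := PP (@nuA R 'I_N.+1 q alpha u) (fun K => PP (@nuB R 'I_N.+1 q alpha u) (lnratio beta K)).
Definition extra_rate : R := alpha * N%:R - thinned_rate.
Definition clause_gain : R := PP (unif extra_rate) (fun K : seq clauseN => PP (unif thinned_rate) (lnratio beta K)).

Local Notation x := (N.+1%:R^-1 : R).

Lemma x_itv : 0 <= x <= 1.
Proof. by rewrite invr_ge0 ler0n/= invf_le1// ler1n. Qed.

Lemma extra_rateE : extra_rate = alpha * (N%:R * (1 - (1 - x) ^+ q)).
Proof.
have s0 : N.+1%:R != 0 :> R by rewrite pnatr_eq0.
have e : 1 - x = N%:R / N.+1%:R by rewrite -{1}(divff s0) -[X in _ - X]mul1r -mulrBl -natr1 addrK.
rewrite /extra_rate /thinned_rate e exprS; set y := (_ / _) ^+ q.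
move: s0; set z := N.+1%:R => s0; by field.
Qed.

Lemma extra_rate_ge0 : 0 <= extra_rate.
Proof.
have /andP[x0 x1] := x_itv; have a0 := ltW alpha0.
by rewrite extra_rateE !mulr_ge0// subr_ge0 exprn_ile1 ?subr_ge0// gerBl.
Qed.

Lemma extra_rate_le : extra_rate <= alpha * q%:R.
Proof.
have /andP[x0 x1] := x_itv; have [h _] := pow_bounds q x_itv.
rewrite extra_rateE ler_pM2l// (le_trans (ler_wpM2l _ h))// mulrCA ler_piMr//.
by rewrite ler_pdivrMr// mul1r ler_nat.
Qed.

Lemma extra_rate_dist : `|extra_rate - alpha * q%:R| <= alpha * (q%:R + q%:R ^+ 2) * x.
Proof.
have /andP[x0 x1] := x_itv; have [_ h] := pow_bounds q x_itv.
have hN : N%:R = x^-1 - 1 :> R by rewrite invrK -[N.+1%:R]natr1 addrK.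
rewrite distrC ger0_norm ?subr_ge0 ?extra_rate_le// extra_rateE -mulrBr -mulrA ler_pM2l//.
have Nx1 : N%:R * x <= 1 by rewrite ler_pdivrMr// mul1r ler_nat.
have Nx : N%:R * x = 1 - x by rewrite hN mulrBl mulVf ?mul1r// invr_neq0// pnatr_eq0.
have h1 := ler_wpM2l (ler0n R N) h.
have e1 : N%:R * (q%:R * x - q%:R ^+ 2 * x ^+ 2) = q%:R * (1 - x) - q%:R ^+ 2 * x * (1 - x).
  by rewrite -Nx; ring.
rewrite e1 in h1.
have h2 : 0 <= q%:R ^+ 2 * x * x by rewrite !mulr_ge0// exprn_ge0.
rewrite lerBlDr -lerBlDl (le_trans _ h1)// -subr_ge0 (_ : _ - _ = q%:R ^+ 2 * x * x)//; ring.
Qed.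

Lemma mean_lnpart_S : mean_lnpart (V := 'I_N.+1) (q := q) beta (alpha * N.+1%:R) =
  site_gain + ln 2 + mean_lnpart (V := 'I_N) (q := q) beta thinned_rate.
Proof.
rewrite -addrA -mean_lnpart_relab addrC /mean_lnpart /site_gain.
rewrite -(lnpart_superpose beta0); last 2 first.
- by move=> c; apply: nuA_ge0.
- by move=> c; apply: nuB_ge0.
by congr PP; apply/funext => c; rewrite nuAB card_ord.
Qed.

Lemma mean_lnpart_split : mean_lnpart (V := 'I_N) (q := q) beta (alpha * N%:R) =
  mean_lnpart (V := 'I_N) (q := q) beta thinned_rate + clause_gain.
Proof.
rewrite /mean_lnpart /clause_gain -(lnpart_superpose beta0); last 2 first.
- by move=> c; apply/unif_ge0/extra_rate_ge0.
- by move=> c; apply/unif_ge0/thinned_rate_ge0.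
by congr PP; apply/funext => c; rewrite /unif -mulrDl subrK.
Qed.

(** Both systems contain the same intermediate one, N sites with the thinned rate: the larger adds
    the clauses at the new site and its free spin, the smaller adds the extra clauses. *)
Lemma increment : mean_lnpart (V := 'I_N.+1) (q := q) beta (alpha * N.+1%:R) -
  mean_lnpart (V := 'I_N) (q := q) beta (alpha * N%:R) = site_gain + ln 2 - clause_gain.
Proof. by rewrite mean_lnpart_S mean_lnpart_split; ring. Qed.
End adding_a_site.

Lemma EPo_shift {R : realType} (lam : R) f : gbnd f ->
  EPo lam (fun r => r%:R * f r.-1) = lam * EPo lam f.
Proof.
move=> gf; rewrite /EPo (_ : (fun r => _) = (fun r => r%:R * (lam * (lam ^+ r.-1 * f r.-1)))).
  rewrite (@xsum_shift _ (fun r => lam * (lam ^+ r * f r))); last by apply: gbndZ; exact: EPo_gb.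
  by rewrite xsumZ; [rewrite mulrCA|exact: EPo_gb].
apply/funext => -[|r]; first by rewrite !mul0r mulr0.
by rewrite /= exprS; ring.
Qed.

Lemma EPo_sq {R : realType} (lam : R) : EPo lam (fun r => r%:R ^+ 2) = lam ^+ 2 + lam.
Proof.
rewrite (@eq_EPo _ _ _ (fun r => r%:R * (r.-1%:R + 1))); last first.
  by move=> [|r]; rewrite ?mul0r ?expr2 ?mul0r//= natr1.
rewrite (@EPo_shift _ _ (fun r => r%:R + 1)); last by apply: gbndD; [exact: gbnd_nat|exact: gbnd_cst].
rewrite EPoD; [|exact: gbnd_nat|exact: gbnd_cst].
by rewrite EPo_nat EPo_cst mulrDr mulr1.
Qed.

(** * Limit of the increments and of the free energy *)

Section limit.
Context {R : realType} {q : nat}.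
Variables (alpha beta : R).
Hypotheses (alpha0 : 0 < alpha) (beta0 : 0 < beta).
Local Notation p := q.+1.
Local Notation sg := {ffun 'I_p -> bool}.
Local Notation kap := (@kappa R p alpha beta).
Local Notation ap := (alpha * p%:R).
Local Notation aa := (2^-1 * (expR beta - 1)).
Local Notation Q1 := (@slots1 R q alpha).
Local Notation C1 := (1 / (1 - kap) + 1).
Variable E : @lexp R.
Hypotheses (kappa1 : kap < 1) (hQ : aa * Q1 < 1).
Hypothesis fixE : @fixed_lexp R q alpha beta E.
Local Notation theta_bar := (@theta_mean_value R q beta E).

Definition rs_site : R :=
  EPo ap (fun r => It (@avg R sg) r (fun Js => It E (r * q) (cavL beta Js))).
Definition rs_value : R := rs_site + ln 2 - alpha * q%:R * theta_bar.

Let aq : R := alpha * q%:R.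
Let P2b : R := p%:R ^+ 2 * (aq ^+ 2 + aq).

Lemma P2E del : @P2 R q del = p%:R ^+ 2 * (del ^+ 2 + del).
Proof.
rewrite /P2 -EPo_sq -EPoZ; last first.
  rewrite (_ : (fun r => _) = (fun r => (r * 1)%:R ^+ 2)); first exact: size_le_gbnd.
  by apply/funext => r; rewrite muln1.
by apply: eq_EPo => r; rewrite natrM; ring.
Qed.

(** A bound on [CY] uniform over the rates of extra clauses, which vary with the number of sites. *)
Let CYb (B : R) : R := 2 * (expR beta - 1) * (1 + C1) * P2b +
  aa * (2 * (aq * (p%:R * (1 + C1)))) * (aq * p%:R) + B * aa * (aq * p%:R + P2b).

Let C10 : 0 <= C1. Proof. by rewrite addr_ge0// divr_ge0// subr_ge0 ltW. Qed.
Let e10 : 0 <= expR beta - 1. Proof. by rewrite subr_ge0 ltW// expR_gt1. Qed.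
Let aa0 : 0 <= aa. Proof. exact: aa_ge0. Qed.

Lemma CY_le B del : 0 <= B -> 0 <= del <= aq -> @CY R q alpha beta B del <= CYb B.
Proof.
move=> B0 /andP[d0 d1]; have aq0 : 0 <= aq by exact: le_trans d1.
have C11 : 0 <= 1 + C1 by rewrite addr_ge0.
have hP : @P2 R q del <= P2b.
  by rewrite P2E ler_wpM2l// lerD// lerXn2r.
have hp : del * p%:R <= aq * p%:R by rewrite ler_wpM2r.
have h3 : del * (p%:R * (1 + C1)) <= aq * (p%:R * (1 + C1)) by rewrite ler_wpM2r// mulr_ge0.
rewrite /CY /CYb lerD ?lerD//.
- by rewrite ler_wpM2l// !mulr_ge0.
- apply: ler_pM => //.
  + by rewrite !mulr_ge0.
  + by rewrite mulr_ge0.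
  + by rewrite ler_wpM2l// ler_wpM2l.
- by rewrite ler_wpM2l ?mulr_ge0// lerD.
Qed.

Lemma pow_small (e : R) : 0 < e -> exists L : nat, (aa * Q1) ^+ L <= e.
Proof.
move=> e0; apply: small_power => //; rewrite hQ andbT.
by rewrite mulr_ge0// slots1_ge0.
Qed.

(** [L], and with it [C], is fixed before [M]: only the first error survives as [M] grows. *)
Lemma increment_bound L : exists2 C : R, 0 <= C & forall M,
  `|site_gain (q := q) alpha beta M + ln 2 - clause_gain (q := q) alpha beta M - rs_value| <=
  2 * (aa * Q1) ^+ L * (aa * Q1 + aa * (aq * p%:R)) + C / M.+1%:R.
Proof.
have [B B0 hB] := claims_hold alpha0 beta0 kappa1 L fixE.
have aq0 : 0 <= aq by rewrite mulr_ge0// ltW.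
pose D := `|theta_bar| * (alpha * (q%:R + q%:R ^+ 2)).
have D0 : 0 <= D by rewrite !mulr_ge0 ?(ltW alpha0)// addr_ge0// exprn_ge0.
exists (`|@CX R q alpha beta B| + `|CYb B| + D); first by rewrite !addr_ge0.
move=> M; set A := 2 * (aa * Q1) ^+ L.
have A0 : 0 <= A by rewrite mulr_ge0// exprn_ge0// mulr_ge0// slots1_ge0.
(* The depth of the influence walks depends on the number of sites but does not enter the
   constants. *)
have sp k : exists n, kap ^+ n <= (#|'I_k.+1|%:R)^-1.
  by apply: small_power; rewrite ?kappa1 ?kappa_ge0 ?ltW// invr_gt0 card_ord.
have [n1 hn1] := sp M.+1; have [n2 hn2] := sp M.
have c1 : (0 < #|'I_M.+2|)%N by rewrite card_ord.
have c2 : (0 < #|'I_M.+1|)%N by rewrite card_ord.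
have hX := site_term alpha0 c1 kappa1 hn1 B0 (hB _ n1 c1 hn1) (ord0 : 'I_M.+2).
have d0 := extra_rate_ge0 (q := q) M alpha0; have d1 := extra_rate_le (q := q) M alpha0.
have d2 := extra_rate_dist (q := q) M alpha0.
have sum2 : extra_rate (q := q) alpha M + thinned_rate (q := q) alpha M = alpha * #|'I_M.+1|%:R.
  by rewrite subrK card_ord.
have hY := clause_term alpha0 c2 kappa1 hn2 B0 (hB _ n2 c2 hn2) d0 (thinned_rate_ge0 M alpha0) sum2.
rewrite -/(site_gain _ _ _) -/rs_site -/A !card_ord in hX; rewrite -/(clause_gain _ _ _) -/A !card_ord in hY.
set x := site_gain _ _ _ in hX *; set y := clause_gain _ _ _ in hY *; set del := extra_rate _ _ in d0 d1 d2 hY.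
have N0 : 0 < M.+1%:R :> R by [].
have hX' : `|x - rs_site| <= A * aa * Q1 + `|@CX R q alpha beta B| / M.+1%:R.
  rewrite (le_trans hX)// lerD2l (@le_trans _ _ (`|@CX R q alpha beta B| / M.+2%:R))//.
    by rewrite ler_pM2r ?invr_gt0// ler_norm.
  by rewrite ler_wpM2l// lef_pV2 ?posrE// ler_nat.
have hY' : `|y - del * theta_bar| <= A * aa * (aq * p%:R) + `|CYb B| / M.+1%:R.
  have AA0 : 0 <= A * aa by exact: mulr_ge0.
  rewrite (le_trans hY)// lerD//; first by rewrite ler_wpM2l// ler_wpM2r.
  rewrite ler_pM2r ?invr_gt0// (le_trans _ (ler_norm _))//; apply: CY_le => //.
  by rewrite d0 d1.
have hD : `|del * theta_bar - aq * theta_bar| <= D / M.+1%:R.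
  rewrite -mulrBl normrM mulrC /D -!mulrA ler_wpM2l//.
  rewrite (le_trans d2)// -mulrA ler_wpM2l ?(ltW alpha0)// ler_wpM2l ?addr_ge0 ?exprn_ge0//.
  by rewrite lef_pV2 ?posrE// ler_nat.
rewrite (_ : x + ln 2 - y - rs_value = (x - rs_site) - ((y - del * theta_bar) + (del * theta_bar - aq * theta_bar))); last first.
  by rewrite /rs_value /aq; ring.
rewrite (le_trans (ler_normB _ _))// (le_trans (lerD (lexx _) (ler_normD _ _)))//.
rewrite (le_trans (lerD hX' (lerD hY' hD)))//.
by rewrite le_eqVlt; apply/orP; left; apply/eqP; field; rewrite nat1r pnatr_eq0.
Qed.

Lemma increment_cvg :
  (fun M => site_gain (q := q) alpha beta M + ln 2 - clause_gain (q := q) alpha beta M) @ \oo --> rs_value.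
Proof.
apply/cvgrPdist_le => e e0.
pose K0 := aa * Q1 + aa * (aq * p%:R).
have aq0 : 0 <= aq by rewrite mulr_ge0// ltW.
have K00 : 0 <= K0 by rewrite addr_ge0// mulr_ge0// ?slots1_ge0// mulr_ge0.
have [L hL] : exists L : nat, (aa * Q1) ^+ L <= e / 2 / (2 * (K0 + 1)).
  by apply: pow_small; rewrite !divr_gt0// mulr_gt0// ltr_wpDl.
have [C C0 hC] := increment_bound L.
have [k hk] : exists k : nat, C / (e / 2) < k.+1%:R.
  exists (Num.bound (C / (e / 2))); rewrite (lt_le_trans (archi_boundP _))// ?ler_nat//.
  by rewrite divr_ge0// divr_ge0// ltW.
near=> M; rewrite distrC (le_trans (hC M))//.
have kM : (k <= M)%N by near: M; exact: nbhs_infty_ge.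
have h1 : 2 * (aa * Q1) ^+ L * K0 <= e / 2.
  have := ler_wpM2r K00 (ler_wpM2l (ler0n R 2) hL); move/le_trans; apply.
  rewrite [leLHS](_ : _ = e / 2 * (K0 / (K0 + 1))); last first.
    by field; rewrite gt_eqF// ltr_wpDl.
  rewrite ler_piMr ?divr_ge0 ?(ltW e0)// ler_pdivrMr ?ltr_wpDl// mul1r lerDl//.
have h2 : C / M.+1%:R <= e / 2.
  rewrite ler_pdivrMr// -ler_pdivrMl ?divr_gt0// mulrC (le_trans (ltW hk))//.
  by rewrite ler_nat.
by rewrite (le_trans (lerD h1 h2))// -splitr.
Unshelve. all: by end_near. Qed.

Lemma mean_lnpart_cvg : (fun M => M.+1%:R^-1 * mean_lnpart (V := 'I_M.+1) (q := q) beta (alpha * M.+1%:R)) @ \oo --> rs_value.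
Proof.
pose a M := mean_lnpart (V := 'I_M.+1) (q := q) beta (alpha * M.+1%:R).
(* [d 0] is the whole first term, so that the partial sums of [d] are exactly the values of [a]. *)
pose d n := if n is m.+1 then a m.+1 - a m else a 0%N.
have dcv : d n @[n --> \oo] --> rs_value.
  rewrite -cvg_shiftS /=; have := increment_cvg.
  rewrite (_ : (fun M => site_gain _ _ M + _ - _) = (fun n => d n.+1))//.
  by apply/funext => M; rewrite /d /a increment.
have := cesaro dcv; apply: cvg_trans; apply: near_eq_cvg; apply: nearW => M.
rewrite /arithmetic_mean /=; congr (_ * _).
have : forall m, series d m.+1 = a m.
  elim=> [|m ih]; first by rewrite /series/= big_nat1.
  by rewrite seriesSr ih /d addrC subrK.
by move=> ->.
Qed.
End limit.

Lemma It_pair {R : realType} (S T : finType) r (F : seq S -> seq T -> R) :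
  It (@avg R (S * T)%type) r (fun l => F (unzip1 l) (unzip2 l)) =
  It (@avg R S) r (fun a => It (@avg R T) r (F a)).
Proof.
elim: r F => [//|r ih] F /=; rewrite avg_pair; apply: eq_avg => x.
transitivity (avg (fun y => It (@avg R S) r (fun a => It (@avg R T) r (fun b => F (x :: a) (y :: b))))).
  by apply: eq_avg => y; exact: (ih (fun a b => F (x :: a) (y :: b))).
by rewrite -Ita_avg.
Qed.

(** * Translation into the free energy and the functional as defined *)

Section bridge.
Context {R : realType} {q : nat}.
Variables (alpha beta : R).
Hypotheses (alpha0 : 0 < alpha) (beta0 : 0 < beta).
Local Notation p := q.+1.
Local Notation sg := {ffun 'I_p -> bool}.
Local Notation ap := (alpha * p%:R).
Local Notation aa := (2^-1 * (expR beta - 1)).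

Lemma partitionE N r (J : {ffun 'I_r -> sg}) (idx : {ffun 'I_r -> {ffun 'I_p -> 'I_N}}) :
  ln (partition_function beta J idx) = lnpart beta (zip (codom J) (codom idx)).
Proof.
rewrite /partition_function /lnpart; congr ln; apply: eq_bigr => s _.
rewrite /minus_H expR_sum /wprod big_map !codomE zip_map big_map big_enum/=.
apply: eq_bigr => k _.
transitivity (expR (ln (cwt beta (J k, idx k) s))); first by rewrite cwtE.
by rewrite lnK// posrE; exact: wl_gt0.
Qed.

Lemma free_energyE M :
  free_energy alpha beta p M.+1 = M.+1%:R^-1 * mean_lnpart (V := 'I_M.+1) (q := q) beta (alpha * M.+1%:R).
Proof.
have c0 : (0 < #|{: sg * {ffun 'I_p -> 'I_M.+1}}|)%N.
  by rewrite card_prod muln_gt0 sg_gt0 card_ffun !card_ord expn_gt0.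
rewrite /free_energy; congr (_ * _); rewrite /mean_lnpart PP_unif//.
have e r : avg (fun J : {ffun 'I_r -> sg} => avg (fun idx : {ffun 'I_r -> {ffun 'I_p -> 'I_M.+1}} =>
      ln (partition_function beta J idx))) =
    It (@avg R (sg * {ffun 'I_p -> 'I_M.+1})%type) r (lnpart beta).
  transitivity (It (@avg R sg) r (fun a => It (@avg R {ffun 'I_p -> 'I_M.+1}) r
     (fun b => lnpart beta (zip a b)))).
    rewrite -avg_ffun_It; apply: eq_avg => J; rewrite -avg_ffun_It; apply: eq_avg => idx.
    exact: partitionE.
  rewrite -(It_pair r (fun a b => lnpart beta (zip a b))).
  by apply: eq_It => // l _; rewrite zip_unzip.
under [X in \int[_]_x X x]eq_fun do rewrite e.
rewrite Rintegral_poisson//; first by rewrite mulr_gt0.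
by apply: gbnd_Ita => //; exact: lnpart_gr.
Qed.

Variable zeta : Pr11 R.
Local Notation E := (mlexp zeta).

Lemma theta_mean (J : sg) :
  \int[iid zeta p]_z theta beta J (tnth z) = It E p (fun ys => ln (cw beta J (map clamp ys))).
Proof.
have h : LpS p aa (fun ys => ln (cw beta J (map clamp ys))).
  have := @clauseL_LpS R q beta beta0 [:: J]; rewrite [size _]/= mul1n => hJ ys ys' s s'.
  have := hJ ys ys' s s'.
  by rewrite /clauseL /= !mulr1 !take_oversize ?size_map ?s ?s'.
apply: (Rintegral_iid zeta (aa_ge0 beta0) h).
  apply: measurableT_comp; first exact: measurable_ln.
  apply: measurable_funD => //; apply: measurable_funM => //.
  apply: measurable_prod => i _; apply: measurable_funM => //; apply: measurable_funD => //.
  by apply: measurable_funM => //; exact: measurable_tnth.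
move=> z bz; rewrite map_clamp_id// (@theta_cw R beta p _ _ z) ?size_tuple// => i.
by rewrite (tnth_nth 0).
Qed.

Lemma RS_functionalE : RS_functional alpha beta p zeta = rs_value (q := q) alpha beta E.
Proof.
have ap0 : 0 < ap by rewrite mulr_gt0.
rewrite /RS_functional /rs_value /theta_mean_value [_ * alpha]mulrC [rs_site _ _ _ + _]addrC; congr (_ + _ - _ * _); last first.
  by apply: eq_avg => J; exact: theta_mean.
have e r : avg (fun J : {ffun 'I_r -> sg} => \int[iid (iid zeta p.-1) r]_z
      ln (avg (fun eps : bool => expR (cavity_field beta J z (spin R eps))))) =
    It (@avg R sg) r (fun Js => It E (r * q) (cavL beta Js)).
  rewrite -avg_ffun_It; apply: eq_avg => J.
  have sJ : size (codom J) = r by rewrite size_codom card_ord.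
  have := @Rd_clamp_lip R q beta beta0 (@gL R) (codom J) glip_lnavg; rewrite sJ => h.
  apply: (Rintegral_iid_iid zeta (aa_ge0 beta0) h).
    apply: measurableT_comp; first exact: measurable_ln.
    under eq_fun do rewrite avg_bool.
    apply: measurable_funM => //; apply: measurable_funD;
      by apply: measurableT_comp => //; exact: (@measurable_cavity_field R beta p r J).
  by move=> z bz; exact: ln_cavityE.
under [X in \int[_]_x X x]eq_fun do rewrite e.
rewrite Rintegral_poisson//.
apply: (gbnd_le (b := fun r => beta * r%:R)); last by apply: gbndZ; exact: gbnd_nat.
move=> r; apply: Ita_bound => [|Js sJ]; first exact: sg_gt0.
subst r; apply: (Itez_norm E (aa_ge0 beta0) (@Rd_clamp_lip R q beta beta0 (@gL R) Js glip_lnavg)) => ys sy _.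
exact: cavL_bound.
Qed.
End bridge.

Theorem theorem2 (R : realType) (p : nat) (alpha beta : R)
    (hp : (2 <= p)%N) (halpha : 0 < alpha) (hbeta : 0 < beta)
    (hstar : 2^-1 * (expR beta - 1) * p.-1%:R * p%:R * alpha < 1) :
  exists zeta : Pr11 R,
    [/\ measure_eq (T_map alpha beta p zeta) zeta,
        forall xi : Pr11 R,
          measure_eq (T_map alpha beta p xi) xi -> measure_eq xi zeta
      & Num.min (4 * beta) 1 * p.-1%:R * p%:R * alpha < 1 ->
        free_energy alpha beta p N @[N --> \oo] -->
          RS_functional alpha beta p zeta].
Proof.
case: p hp hstar => [//|q] _ hstar.
(* The first condition, read as a bound on the contraction factor of T. *)
have hQ : 2^-1 * (expR beta - 1) * @slots1 R q alpha < 1.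
  by rewrite slots1E (_ : _ * _ = 2^-1 * (expR beta - 1) * q%:R * q.+1%:R * alpha)//; ring.
exists (fixed_measure halpha hbeta hQ); split.
- exact: T_fixed.
- by move=> xi; exact: T_unique.
(* The sequence is shifted to start at N = 1, where the increments start. *)
move=> kappa1; rewrite -cvg_shiftS RS_functionalE//.
under eq_fun do rewrite free_energyE//.
apply: mean_lnpart_cvg => //.
by move=> K phi h; exact: (fixed_measure_TE halpha hbeta hQ h).
Qed.
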